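(* The full opacity decision problem and the weak opacity decision problem are decidable, with non-primitive recursive complexity, for timed automata with a single clock and without $\varepsilon$-transitions.
   Context: A timed automaton (TA) is a tuple $\mathcal{A}=(\Sigma,L,\ell_0,L_{priv},L_f,X,I,E)$ where $\Sigma$ is a finite set of actions, $L$ a finite set of locations, $\ell_0\in L$ the initial location, $L_{priv}\subseteq L$ the set of private locations, $L_f\subseteq L$ the set of final locations, $X$ a finite set of clocks, $I$ assigns to each location an invariant, and $E$ is a finite set of edges $(\ell,g,a,R,\ell')$ with $\ell,\ell'\in L$, $a\in\Sigma\cup\{\varepsilon\}$ (where $\varepsilon$ is an unobservable action; edges labelled $\varepsilon$ are $\varepsilon$-transitions), $R\subseteq X$ the set of clocks to reset, and $g$ a guard. Invariants and guards are conjunctions of constraints $x\bowtie d$ with $x\in X$, $d\in\mathbb{Z}$, ${\bowtie}\in\{<,\le,=,\ge,>\}$. A clock valuation is a map $\mu:X\to\mathbb{R}_{\ge0}$; a configuration is a pair $(\ell,\mu)$ with $\mu\models I(\ell)$; the initial configuration is $(\ell_0,\mathbf{0})$. A delay $d\ge0$ leads from $(\ell,\mu)$ to $(\ell,\mu+d)$ provided $\mu+d'\models I(\ell)$ for all $d'\in[0,d]$; an edge $(\ell,g,a,R,\ell')$ leads from $(\ell,\mu)$ to $(\ell',\mu')$ if $\mu\models g$, $\mu'$ is $\mu$ with the clocks of $R$ set to $0$, and $\mu'\models I(\ell')$. A run is a finite sequence $(\ell_0,\mu_0),(d_0,e_0),(\ell_1,\mu_1),\dots,(\ell_n,\mu_n)$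 starting in the initial configuration, where each step is a delay $d_i$ followed by taking edge $e_i$, with $\ell_n\in L_f$ and $\ell_i\notin L_f$ for $i<n$. A timed word is a finite sequence of pairs $(a,t)\in\Sigma\times\mathbb{R}_{\ge0}$ with non-decreasing timestamps. The trace of a run is the timed word consisting, in order, of the pairs $(a_i,\sum_{j\le i}d_j)$ for the edges $e_i$ whose action $a_i$ is not $\varepsilon$. A run is private if it visits some location of $L_{priv}$ and public otherwise; $\mathrm{PrivTr}(\mathcal{A})$ and $\mathrm{PubTr}(\mathcal{A})$ denote the sets of traces of private, resp. public, runs. $\mathcal{A}$ is weakly opaque if $\mathrm{PrivTr}(\mathcal{A})\subseteq\mathrm{PubTr}(\mathcal{A})$ and fully opaque if $\mathrm{PrivTr}(\mathcal{A})=\mathrm{PubTr}(\mathcal{A})$. The weak (resp. full) opacity decision problem asks, given a TA, whether it is weakly (resp. fully) opaque. *)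

(* Defs.v *)
From Corelib Require Import BinNums.
From HB Require Import structures.
From mathcomp Require Import all_boot all_order all_algebra.
From mathcomp Require Import all_classical all_reals.
Set Implicit Arguments.
Unset Strict Implicit.
Unset Printing Implicit Defensive.
Import Order.TTheory GRing.Theory Num.Theory.
Local Open Scope classical_set_scope.
Local Open Scope ring_scope.

Inductive cmp := CLt | CLe | CEq | CGe | CGt.

Definition nat_of_cmp (c : cmp) : nat :=
  match c with
  | CLt => 0 | CLe => 1 | CEq => 2 | CGe => 3 | CGt => 4
  end%N.

Definition cmp_of_nat (n : nat) : cmp := nth CLt [:: CLt; CLe; CEq; CGe; CGt] n.

Lemma nat_of_cmpK : cancel nat_of_cmp cmp_of_nat.
Proof. by case. Qed.

HB.instance Definition _ := Equality.copy cmp (can_type nat_of_cmpK).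

(** A constraint [(x, c, d)] is [x c d]; a list of constraints is their
    conjunction. *)
Definition constraint (X : finType) : Type := (X * cmp * int)%type.
Definition guard (X : finType) : Type := seq (constraint X).

(** The action [None] is the unobservable action epsilon. *)
Record edge (Sigma L X : finType) := Edge {
  src : L;
  grd : guard X;
  act : option Sigma;
  rst : {set X};
  tgt : L
}.

Definition edge_tuple (Sigma L X : finType) (e : edge Sigma L X) :
    L * seq (X * cmp * int) * option Sigma * {set X} * L :=
  (src e, grd e, act e, rst e, tgt e).

Definition tuple_edge (Sigma L X : finType)
    (t : L * seq (X * cmp * int) * option Sigma * {set X} * L) :
    edge Sigma L X :=
  let: (l, g, a, r, l') := t in Edge l g a r l'.

Lemma edge_tupleK (Sigma L X : finType) :
  cancel (@edge_tuple Sigma L X) (@tuple_edge Sigma L X).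
Proof. by case. Qed.

HB.instance Definition _ (Sigma L X : finType) :=
  Equality.copy (edge Sigma L X) (can_type (@edge_tupleK Sigma L X)).

Record timed_automaton := TimedAutomaton {
  action : finType;
  location : finType;
  init : location;
  priv : {set location};
  final : {set location};
  clock : finType;
  loc_invariant : location -> guard clock;
  edges : seq (edge action location clock)
}.

Definition one_clock (A : timed_automaton) : Prop := #|clock A| = 1%N.

Definition epsilon_free (A : timed_automaton) : Prop :=
  forall e, e \in edges A -> act e <> None.

Section Semantics.
Variables (R : realType) (A : timed_automaton).

(** Nonnegativity is not built into the type: every valuation reachable from
    the zero valuation by nonnegative delays and resets is nonnegative. *)
Definition valuation := {ffun clock A -> R}.

Definition sat_constraint (mu : valuation) (k : constraint (clock A)) : bool :=
  let: (x, c, d) := k in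
  match c with
  | CLt => mu x < d%:~R
  | CLe => mu x <= d%:~R
  | CEq => mu x == d%:~R
  | CGe => mu x >= d%:~R
  | CGt => mu x > d%:~R
  end.

Definition sat (mu : valuation) (g : guard (clock A)) : bool :=
  all (sat_constraint mu) g.

Definition delay (mu : valuation) (d : R) : valuation := [ffun x => mu x + d].

Definition reset (mu : valuation) (r : {set clock A}) : valuation :=
  [ffun x => if x \in r then 0 else mu x].

Definition config : Type := (location A * valuation)%type.

Definition init_config : config := (init A, [ffun=> 0]).

Definition aedge : Type := edge (action A) (location A) (clock A).

Definition step (c : config) (d : R) (e : aedge) (c' : config) : Prop :=
  [/\ 0 <= d,
      forall d' : R, 0 <= d' <= d -> sat (delay c.2 d') (loc_invariant c.1),
      e \in edges A /\ src e = c.1,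
      sat (delay c.2 d) (grd e)
    & c' = (tgt e, reset (delay c.2 d) (rst e)) /\ sat c'.2 (loc_invariant c'.1)].

(** [run_from c r]: [r] lists the successive delays, edges and configurations
    reached after [c], the first final location being that of the last
    configuration. *)
Inductive run_from : config -> seq (R * aedge * config) -> Prop :=
| run_stop c :
    c.1 \in final A -> run_from c [::]
| run_step c d e c' r :
    c.1 \notin final A -> step c d e c' -> run_from c' r ->
    run_from c ((d, e, c') :: r).

(** The first conjunct says that [init_config] is a configuration. *)
Definition is_run (r : seq (R * aedge * config)) : Prop :=
  sat init_config.2 (loc_invariant init_config.1) /\ run_from init_config r.

Definition visits_private (r : seq (R * aedge * config)) : bool :=
  has (fun c : config => c.1 \in priv A) (init_config :: [seq s.2 | s <- r]).

Fixpoint trace_from (t : R) (r : seq (R * aedge * config)) :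
    seq (action A * R) :=
  if r is (d, e, _) :: r' then
    if act e is Some a then (a, t + d) :: trace_from (t + d) r'
    else trace_from (t + d) r'
  else [::].

Definition trace (r : seq (R * aedge * config)) : seq (action A * R) :=
  trace_from 0 r.

Definition PrivTr : set (seq (action A * R)) :=
  [set w | exists r, [/\ is_run r, visits_private r & trace r = w]].

Definition PubTr : set (seq (action A * R)) :=
  [set w | exists r, [/\ is_run r, ~~ visits_private r & trace r = w]].

Definition weakly_opaque : Prop := PrivTr `<=` PubTr.

Definition fully_opaque : Prop := PrivTr = PubTr.

End Semantics.

(** A tape cell is blank ([None]), an input bit, or a working symbol. *)
Definition cell (W : finType) : finType := option (bool + W)%type.

Inductive move := MoveLeft | Stay | MoveRight.

(** [(l, a, r)]: head on [a], [l] to its left (nearest cell first), [r] to its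
    right; all cells beyond [l] and [r] are blank. *)
Definition tape (W : finType) : Type := (seq (cell W) * cell W * seq (cell W))%type.

Definition head_cell (W : finType) (t : tape W) : cell W := t.1.2.

Definition update_tape (W : finType) (t : tape W) (u : cell W * move) : tape W :=
  let: (l, _, r) := t in
  let: (a, m) := u in
  match m with
  | MoveLeft => (behead l, head None l, a :: r)
  | Stay => (l, a, r)
  | MoveRight => (a :: l, head None r, behead r)
  end.

(** There are [ntapes.+1] tapes. [verdict q = None] when [q] is not a halting
    state; [Some true] accepts and [Some false] rejects. *)
Record machine := Machine {
  state : finType;
  work : finType;
  ntapes : nat;
  start : state;
  verdict : state -> option bool;
  delta : state -> {ffun 'I_ntapes.+1 -> cell work} ->
          state * ('I_ntapes.+1 -> cell work * move)
}.

Definition mconfig (M : machine) : Type :=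
  (state M * ('I_(ntapes M).+1 -> tape (work M)))%type.

Definition mstep (M : machine) (c : mconfig M) : mconfig M :=
  if verdict c.1 is Some _ then c
  else let: (q, u) := delta c.1 [ffun i => head_cell (c.2 i)] in
       (q, fun i => update_tape (c.2 i) (u i)).

(** The input word is on tape [0], with the head on its first bit. *)
Definition minit (M : machine) (w : seq bool) : mconfig M :=
  let s := [seq Some (inl b) | b <- w] in
  (start M, fun i => if i == ord0 then ([::], head None s, behead s)
                     else ([::], None, [::])).

(** [M] halts on [w] in at most [t] steps with verdict [b]. *)
Definition halts_within (M : machine) (w : seq bool) (t : nat) (b : bool) : Prop :=
  verdict (iter t (@mstep M) (minit M w)).1 = Some b.

Inductive primrec : forall n : nat, (n.-tuple nat -> nat) -> Prop :=
| primrec_zero n : primrec (fun _ : n.-tuple nat => 0%N)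
| primrec_succ : primrec (fun v : 1.-tuple nat => (thead v).+1)
| primrec_proj n (i : 'I_n) : primrec (fun v : n.-tuple nat => tnth v i)
| primrec_comp m n (f : m.-tuple nat -> nat) (g : 'I_m -> n.-tuple nat -> nat) :
    primrec f -> (forall i, primrec (g i)) ->
    primrec (fun v : n.-tuple nat => f [tuple g i v | i < m])
| primrec_rec n (f : n.-tuple nat -> nat) (g : n.+2.-tuple nat -> nat) :
    primrec f -> primrec g ->
    primrec (fun v : n.+1.-tuple nat =>
      iteri (thead v)
        (fun k r => g [tuple of k :: r :: [tuple of behead v]])
        (f [tuple of behead v])).

Definition primrec1 (f : nat -> nat) : Prop :=
  exists2 F : 1.-tuple nat -> nat, primrec F & forall n, f n = F [tuple n].

Record problem := Problem {
  instance : Type;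
  code : instance -> seq bool;
  holds : instance -> Prop
}.

Definition subproblem (P : problem) (C : instance P -> Prop) : problem :=
  {| instance := {i : instance P | C i};
     code := fun i => code (sval i);
     holds := fun i => holds (sval i) |}.

Arguments subproblem : clear implicits.

Definition decidable_problem (P : problem) : Prop :=
  exists M : machine, forall i : instance P,
    exists t b, halts_within M (code i) t b /\ (b <-> holds i).

(** Decidable in time bounded by a primitive recursive function of the length
    of the encoded instance. *)
Definition primrec_time (P : problem) : Prop :=
  exists (M : machine) (f : nat -> nat), primrec1 f /\
    forall i : instance P,
      exists b, halts_within M (code i) (f (size (code i))) b /\ (b <-> holds i).

Definition decidable_non_primrec (P : problem) : Prop :=
  decidable_problem P /\ ~ primrec_time P.

(** Self-delimiting binary notation: least significant digit first, each digit
    preceded by [true], and a final [false]. *)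
Fixpoint code_pos (p : positive) : seq bool :=
  match p with
  | xH => [:: true; true; false]
  | xO q => [:: true, false & code_pos q]
  | xI q => [:: true, true & code_pos q]
  end.

Definition code_nat (n : nat) : seq bool :=
  if bin_of_nat n is Npos p then code_pos p else [:: false].

Definition code_int (z : int) : seq bool := (z < 0) :: code_nat `|z|%N.

Definition code_fin (T : finType) (x : T) : seq bool := code_nat (enum_rank x).

Definition code_seq (T : Type) (f : T -> seq bool) (s : seq T) : seq bool :=
  code_nat (size s) ++ flatten [seq f x | x <- s].

Definition code_set (T : finType) (B : {set T}) : seq bool :=
  code_seq (@code_fin T) (enum B).

Definition code_constraint (X : finType) (k : constraint X) : seq bool :=
  let: (x, c, d) := k in code_fin x ++ code_nat (nat_of_cmp c) ++ code_int d.

Definition code_guard (X : finType) (g : guard X) : seq bool :=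
  code_seq (@code_constraint X) g.

Definition code_action (Sigma : finType) (a : option Sigma) : seq bool :=
  code_nat (if a is Some b then (enum_rank b).+1 else 0%N).

Definition code_edge (Sigma L X : finType) (e : edge Sigma L X) : seq bool :=
  code_fin (src e) ++ code_guard (grd e) ++ code_action (act e) ++
  code_set (rst e) ++ code_fin (tgt e).

Definition code_ta (A : timed_automaton) : seq bool :=
  code_nat #|action A| ++ code_nat #|location A| ++ code_nat #|clock A| ++
  code_fin (init A) ++ code_set (priv A) ++ code_set (final A) ++
  flatten [seq code_guard (loc_invariant l) | l <- enum (location A)] ++
  code_seq (@code_edge _ _ _) (edges A).

Definition weak_opacity_problem (R : realType) : problem :=
  {| instance := timed_automaton; code := code_ta; holds := weakly_opaque R |}.

Definition full_opacity_problem (R : realType) : problem :=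
  {| instance := timed_automaton; code := code_ta; holds := fully_opaque R |}.

(* Main.v *)
(** Without silent transitions a run is determined by its timed word and its
    edges, and with one clock a configuration is a location and a real number.

    Decidability.  The private run to be matched and all the public runs on the
    same word form a finite set of configurations, which is represented by the
    word of its classes: the configurations are sorted by fractional part, and
    integer parts are capped above the constants.  Letting time pass rotates
    this word.  A smaller set of public runs is less likely to match, so by
    Higman's lemma the representations from which no unmatched private run is
    reachable are the upward closure of a finite set.  A machine searches for
    either a finite closed set of this kind or a path to an unmatched run.

    Lower bound.  The gadget has a trivial private part, and its public part
    accepts the words that do not encode an accepting run of a counter program.
    A unit of time holds one token per unit of the counters, and a single clock
    can check that no token is lost from one unit to the next, but not that no
    token is created.  So the counters may be incremented spuriously.  This is
    repaired by a budget: the program draws its increments from a reserve, a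
    stack of Ackermann functions unfolds the reserve from the time [x] at the
    start, and folding it back at the end takes at least time [x], with equality
    only if no token was created.  Hence the gadget for [x] is opaque if and only
    if a given primitive recursive function vanishes at [x].  A decision
    procedure with a primitive recursive time bound is then refuted by
    diagonalisation, because the codes of the gadgets of a program are obtained
    from one template by filling in [x]. *)
From Corelib Require Import BinNums.
From HB Require Import structures.
From mathcomp Require Import all_boot all_order all_algebra.
From mathcomp Require Import all_classical all_reals.
From mathcomp Require Import zify ring lra.
Require Import Defs.
Set Implicit Arguments.
Unset Strict Implicit.
Unset Printing Implicit Defensive.

(** * Primitive recursive functions on coded data *)

(** Both halves rest on one compilation of primitive recursive functions into counter programs. For
    decidability such a program searches through numbers read as certificates, and only the
    verification of a certificate has to be primitive recursive; Higman's lemma enters solely in the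
    proof that a certificate exists. For the lower bound the same programs are simulated by gadgets.
    The obstacle there is that a spurious token could falsify a run without leaving a trace. The
    remedy is a potential, essentially the number of tokens that the stack would unfold to: it is at
    least [ack k x + x] after loading, never falls, rises strictly with every spurious token, and is
    at most [ack k x + x] if unloading succeeds. The level [k] majorises the cost of the program and
    does not depend on [x]. The private part of a gadget accepts every word that the public part
    could accept, so weak and full opacity coincide on gadgets. The diagonal argument uses no fast
    growing function of its own: the Ackermann functions only supply the space for the
    simulation. *)

Definition cp a b := 'C((a + b).+1, 2) + b.

(** One step of the Cantor enumeration, along a diagonal [a + b] and then to the start of the next
    one. Decoding by counting steps needs no square root, and it is literally what [unpair_com]
    executes. *)
Definition nxt (p : nat * nat) :=
  if p.1 is a.+1 then (a, p.2.+1) else (p.2.+1, 0).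

Definition unp x := iter x nxt (0, 0).

Lemma cp_nxt p : cp (nxt p).1 (nxt p).2 = (cp p.1 p.2).+1.
Proof.
case: p => [[|a] b]; rewrite /cp /=; last by rewrite !addnS addSn.
by rewrite !addn0 add0n binS bin1; lia.
Qed.

Lemma cp_unp x : cp (unp x).1 (unp x).2 = x.
Proof. by elim: x => // x IH; rewrite [unp _]/(nxt (unp x)) cp_nxt IH. Qed.

Lemma leq_cp a b : a + b <= cp a b.
Proof. by rewrite /cp binS bin1; lia. Qed.

Lemma unp_cp a b : unp (cp a b) = (a, b).
Proof.
move E: (cp a b) => n; elim: n a b E => [|n IH] a b E.
  by have := leq_cp a b; rewrite E leqn0 addn_eq0 => /andP[/eqP-> /eqP->].
have [q eq_q] : exists q, (a, b) = nxt q.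
  case: b E => [|b] E; last by exists (a.+1, b).
  by case: a E => [|a] // E; exists (0, a).
have := cp_nxt q; rewrite -eq_q /= E => -[/esym/IH]; rewrite /unp /= => ->.
by rewrite eq_q; case: (q).
Qed.

(** Primitive recursion on unary functions only: pairing and plain iteration replace tuples and
    recursion with parameters. The small number of cases pays off in [pr_implements], where each of
    them is compiled. *)
Inductive pr : (nat -> nat) -> Prop :=
| pr_zero : pr (fun=> 0)
| pr_succ : pr S
| pr_id : pr id
| pr_fst : pr (fun x => (unp x).1)
| pr_snd : pr (fun x => (unp x).2)
| pr_pair f g : pr f -> pr g -> pr (fun x => cp (f x) (g x))
| pr_comp f g : pr f -> pr g -> pr (fun x => f (g x))
| pr_iter f : pr f -> pr (fun x => iter (unp x).1 f (unp x).2).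

Lemma pr_const c : pr (fun=> c).
Proof. by elim: c => [|c IH]; [exact: pr_zero | exact: (pr_comp pr_succ IH)]. Qed.

(** * Data types coded by numbers *)

Class coded (T : Type) := Coded { enc : T -> nat; enc_inj : injective enc }.

#[global] Instance coded_nat : coded nat := @Coded nat id (@inj_id nat).

#[global] Instance coded_bool : coded bool.
Proof. by exists nat_of_bool => -[] []. Defined.

#[global] Instance coded_prod T U (cT : coded T) (cU : coded U) : coded (T * U).
Proof.
exists (fun p => cp (enc p.1) (enc p.2)) => -[a b] [c d] /= /(congr1 unp).
by rewrite !unp_cp => -[e1 e2]; congr (_, _); [exact: enc_inj e1 | exact: enc_inj e2].
Defined.

Fixpoint enc_seq T (cT : coded T) (s : seq T) : nat :=
  if s is a :: s' then (cp (enc a) (enc_seq cT s')).+1 else 0.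

#[global] Instance coded_seq T (cT : coded T) : coded (seq T).
Proof.
exists (enc_seq cT); elim=> [|a s IH] [|b t] //= [/(congr1 unp)].
by rewrite !unp_cp => -[e1 e2]; congr (_ :: _); [exact: enc_inj e1 | exact: IH e2].
Defined.

Definition surj_code T (cT : coded T) := forall n, exists x : T, enc x = n.

Lemma surj_nat : surj_code coded_nat.
Proof. by move=> n; exists n. Qed.

Lemma surj_prod T U (cT : coded T) (cU : coded U) :
  surj_code cT -> surj_code cU -> surj_code (coded_prod cT cU).
Proof.
move=> sT sU n; have [x xE] := sT (unp n).1; have [y yE] := sU (unp n).2.
by exists (x, y); rewrite /= xE yE cp_unp.
Qed.

Lemma surj_seq T (cT : coded T) : surj_code cT -> surj_code (coded_seq cT).
Proof.
move=> sT; elim/ltn_ind=> -[|n] IH; first by exists [::].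
have [x xE] := sT (unp n).1; have := leq_cp (unp n).1 (unp n).2.
rewrite cp_unp => le_n; have [|s sE] := IH (unp n).2; first by lia.
by exists (x :: s); move: sE; rewrite /= xE => ->; rewrite cp_unp.
Qed.

Definition prf T U (cT : coded T) (cU : coded U) (f : T -> U) :=
  exists2 F, pr F & forall x, F (enc x) = enc (f x).
Arguments prf {T U cT cU} f.

Section Toolkit.
Context {G : Type} {cG : coded G}.

Lemma prf_ext T (cT : coded T) (f g : G -> T) : f =1 g -> prf f -> prf g.
Proof. by move=> fg [F pF FE]; exists F => // x; rewrite FE fg. Qed.

Lemma prf_id : prf (fun x : G => x).
Proof. by exists id => //; exact: pr_id. Qed.

Lemma prf_const T (cT : coded T) (c : T) : prf (fun _ : G => c).
Proof. by exists (fun=> enc c) => //; exact: pr_const. Qed.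

Lemma prf_comp T U (cT : coded T) (cU : coded U) (f : T -> U) (g : G -> T) :
  prf f -> prf g -> prf (fun x => f (g x)).
Proof.
move=> [F pF FE] [H pH HE]; exists (fun x => F (H x)); first exact: pr_comp.
by move=> x; rewrite HE FE.
Qed.

Lemma prf_fst T U (cT : coded T) (cU : coded U) (f : G -> T * U) :
  prf f -> prf (fun x => (f x).1).
Proof.
move=> [F pF FE]; exists (fun x => (unp (F x)).1); first exact: pr_comp pr_fst pF.
by move=> x; rewrite FE /= unp_cp.
Qed.

Lemma prf_snd T U (cT : coded T) (cU : coded U) (f : G -> T * U) :
  prf f -> prf (fun x => (f x).2).
Proof.
move=> [F pF FE]; exists (fun x => (unp (F x)).2); first exact: pr_comp pr_snd pF.
by move=> x; rewrite FE /= unp_cp.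
Qed.

Lemma prf_pair T U (cT : coded T) (cU : coded U) (f : G -> T) (g : G -> U) :
  prf f -> prf g -> prf (fun x => (f x, g x)).
Proof.
move=> [F pF FE] [H pH HE]; exists (fun x => cp (F x) (H x)); first exact: pr_pair.
by move=> x; rewrite FE HE.
Qed.

Lemma prf_S (f : G -> nat) : prf f -> prf (fun x => (f x).+1).
Proof. by move=> [F pF FE]; exists (fun x => (F x).+1) => [|x]; [exact: pr_comp pr_succ pF | rewrite FE]. Qed.

Lemma prf_natb (b : G -> bool) : prf b -> prf (fun x => nat_of_bool (b x)).
Proof. by case=> F pF FE; exists F. Qed.

End Toolkit.

Ltac prf_base :=
  lazymatch goal with
  | |- prf (fun x => x) => exact: prf_id
  | |- prf (fun _ => ?c) => exact: prf_const
  | |- prf (fun x => fst (@?f x)) => apply: (@prf_fst _ _ _ _ _ _ f)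
  | |- prf (fun x => snd (@?f x)) => apply: (@prf_snd _ _ _ _ _ _ f)
  | |- prf fst => apply: (@prf_fst _ _ _ _ _ _ (fun x => x))
  | |- prf snd => apply: (@prf_snd _ _ _ _ _ _ (fun x => x))
  | |- prf (fun x => (@?f x, @?g x)) => apply: (@prf_pair _ _ _ _ _ _ f g)
  end.

Section Iteration.
Context {G : Type} {cG : coded G}.

(** [pr_iter] iterates a function without parameters; here the parameter [x] travels unchanged as
    the first component of the iterated pair. *)
Lemma prf_iter T (cT : coded T) (n : G -> nat) (f : G -> T -> T) (b : G -> T) :
  prf n -> prf (fun p => f p.1 p.2) -> prf b -> prf (fun x => iter (n x) (f x) (b x)).
Proof.
move=> [N pN NE] [F pF FE] [B pB BE].
pose st y := cp (unp y).1 (F y).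
have pst : pr st by apply: pr_pair => //; exact: pr_fst.
exists (fun x => (unp (iter (unp (cp (N x) (cp x (B x)))).1 st (unp (cp (N x) (cp x (B x)))).2)).2).
  apply: (pr_comp pr_snd); apply: (pr_comp (pr_iter pst)).
  by apply: pr_pair => //; apply: pr_pair => //; exact: pr_id.
move=> x; rewrite unp_cp NE BE /= -/(iter _ _ _).
have E m : iter m st (cp (enc x) (enc (b x))) = cp (enc x) (enc (iter m (f x) (b x))).
  elim: m => //= m ->; rewrite /st unp_cp.
  by have := FE (x, iter m (f x) (b x)) => /= ->.
by rewrite E unp_cp.
Qed.

Lemma prf_if T (cT : coded T) (b : G -> bool) (f g : G -> T) :
  prf b -> prf f -> prf g -> prf (fun x => if b x then f x else g x).
Proof.
move=> pb pf pg; apply: (@prf_ext _ _ _ _ (fun x => iter (b x) (fun=> f x) (g x))).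
  by move=> x; case: (b x).
apply: prf_iter => //.
by apply: (prf_comp pf); apply: prf_fst; exact: prf_id.
Qed.

Lemma prf_pred (f : G -> nat) : prf f -> prf (fun x => (f x).-1).
Proof.
move=> pf; apply: (@prf_ext _ _ _ _ (fun x => (iter (f x) (fun p => (p.2, p.2.+1)) (0, 0)).1)).
  move=> x; suff -> : iter (f x) (fun p : nat * nat => (p.2, p.2.+1)) (0, 0) = ((f x).-1, f x) by [].
  by elim: (f x) => //= m ->.
apply: prf_fst; apply: prf_iter => //; last exact: prf_const.
by apply: prf_pair; [|apply: prf_S]; apply: prf_snd; apply: prf_snd; exact: prf_id.
Qed.

End Iteration.

Section Arith.
Context {G : Type} {cG : coded G}.
Implicit Types f g : G -> nat.

Lemma prf_add f g : prf f -> prf g -> prf (fun x => f x + g x).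
Proof.
move=> pf pg; apply: (@prf_ext _ _ _ _ (fun x => iter (f x) S (g x))).
  by move=> x; elim: (f x) => //= m ->.
by apply: prf_iter => //; apply: prf_S; apply: prf_snd; exact: prf_id.
Qed.

Lemma prf_sub f g : prf f -> prf g -> prf (fun x => f x - g x).
Proof.
move=> pf pg; apply: (@prf_ext _ _ _ _ (fun x => iter (g x) predn (f x))).
  by move=> x; elim: (g x) => [|m] /=; [rewrite subn0|move=> ->; rewrite subnS].
by apply: prf_iter => //; apply: prf_pred; apply: prf_snd; exact: prf_id.
Qed.

Lemma prf_not (b : G -> bool) : prf b -> prf (fun x => ~~ b x).
Proof. by move=> pb; apply: (prf_if pb); exact: prf_const. Qed.

Lemma prf_and (b c : G -> bool) : prf b -> prf c -> prf (fun x => b x && c x).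
Proof. by move=> pb pc; apply: (prf_if pb) => //; exact: prf_const. Qed.

Lemma prf_or (b c : G -> bool) : prf b -> prf c -> prf (fun x => b x || c x).
Proof. by move=> pb pc; apply: (prf_if pb) => //; exact: prf_const. Qed.

Lemma prf_eq0 f : prf f -> prf (fun x => f x == 0).
Proof.
move=> pf; apply: (@prf_ext _ _ _ _ (fun x => iter (f x) (fun=> false) true)).
  by move=> x; case: (f x).
by apply: prf_iter => //; exact: prf_const.
Qed.

Lemma prf_leq f g : prf f -> prf g -> prf (fun x => f x <= g x).
Proof. by move=> pf pg; apply: prf_eq0; apply: prf_sub. Qed.

Lemma prf_eqn f g : prf f -> prf g -> prf (fun x => f x == g x).
Proof.
move=> pf pg; apply: (@prf_ext _ _ _ _ (fun x => (f x <= g x) && (g x <= f x))).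
  by move=> x; rewrite -eqn_leq.
by apply: prf_and; apply: prf_leq.
Qed.

End Arith.

Section Parity.
Context {G : Type} {cG : coded G}.
Implicit Types f g : G -> nat.

Lemma prf_odd f : prf f -> prf (fun x => odd (f x)).
Proof.
move=> pf; apply: (@prf_ext _ _ _ _ (fun x => iter (f x) negb false)).
  by move=> x; elim: (f x) => //= m ->.
apply: prf_iter => //; last exact: prf_const.
by apply: prf_not; apply: prf_snd; exact: prf_id.
Qed.

Lemma prf_half f : prf f -> prf (fun x => (f x)./2).
Proof.
move=> pf; apply: (@prf_ext _ _ _ _
  (fun x => (iter (f x) (fun p => (p.2, p.1.+1)) (0, 0)).1)).
  move=> x; suff -> : iter (f x) (fun p : nat * nat => (p.2, p.1.+1)) (0, 0) = ((f x)./2, uphalf (f x)) by [].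
  by elim: (f x) => //= m ->.
apply: prf_fst; apply: prf_iter => //; last exact: prf_const.
apply: prf_pair; [|apply: prf_S]; [apply: prf_snd|apply: prf_fst]; apply: prf_snd; exact: prf_id.
Qed.

Lemma prf_eq (T : eqType) (cT : coded T) (f g : G -> T) :
  prf f -> prf g -> prf (fun x => f x == g x).
Proof.
move=> [F pF FE] [H pH HE].
have pfn : prf (fun x => enc (f x) : nat) by exists F.
have pgn : prf (fun x => enc (g x) : nat) by exists H.
apply: prf_ext (prf_eqn pfn pgn) => x.
by apply/eqP/eqP => [e|->] //; exact: enc_inj e.
Qed.

End Parity.

Section Lists.
Context {G : Type} {cG : coded G} {A : Type} {cA : coded A}.

Lemma prf_cons (f : G -> A) (l : G -> seq A) :
  prf f -> prf l -> prf (fun x => f x :: l x).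
Proof.
move=> [F pF FE] [L pL LE]; exists (fun x => (cp (F x) (L x)).+1).
  by apply: (pr_comp pr_succ); exact: pr_pair.
by move=> x; rewrite FE LE.
Qed.

(** The code of a nonempty list is the successor of the code of the pair of its head and tail. The
    case distinction is therefore a zero test, and the predecessor is what the first branch
    expects. *)
Lemma prf_case T (cT : coded T) (l : G -> seq A) (f : G -> A -> seq A -> T) (b : G -> T) :
  prf l -> prf (fun p : G * (A * seq A) => f p.1 p.2.1 p.2.2) -> prf b ->
  prf (fun x => if l x is a :: l' then f x a l' else b x).
Proof.
move=> [L pL LE] [F pF FE] [B pB BE].
have [P pP PE] : @prf nat nat _ _ (fun x => x.-1) by apply: prf_pred; exact: prf_id.
pose X (x : nat) : nat := if L x == 0 then B x else F (cp x (P (L x))).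
have [Y pY YE] : @prf nat nat _ _ X.
  apply: prf_if; [apply: prf_eq0; by exists L|by exists B|].
  exists (fun x => F (cp x (P (L x)))) => //; apply: (pr_comp pF).
  by apply: pr_pair; [exact: pr_id | exact: pr_comp].
exists Y => // x; rewrite (YE (enc x)) /X LE /=.
case: (l x) => [|a s] /=; first exact: BE.
by have /= -> := PE (cp (enc a) (enc_seq cA s)).+1; exact: (FE (x, (a, s))).
Qed.

End Lists.

Section Folds.
Context {G : Type} {cG : coded G} {A : Type} {cA : coded A}.

Lemma leq_size_enc (s : seq A) : size s <= enc s.
Proof.
elim: s => //= a s IH; rewrite ltnS; apply: leq_trans IH _.
exact: leq_trans (leq_addl _ _) (leq_cp _ _).
Qed.

(** The length of the list is not yet available as a primitive recursive function. The loop runs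
    [enc (l x)] times instead, which is enough by [leq_size_enc], and idles once the list is
    empty. *)
Lemma prf_foldl T (cT : coded T) (l : G -> seq A) (f : G -> T -> A -> T) (b : G -> T) :
  prf l -> prf (fun p : G * (T * A) => f p.1 p.2.1 p.2.2) -> prf b ->
  prf (fun x => foldl (f x) (b x) (l x)).
Proof.
move=> pl pf pb.
pose st (x : G) (p : T * seq A) := if p.2 is a :: s then (f x p.1 a, s) else p.
apply: (@prf_ext _ _ _ _ (fun x => (iter (enc (l x)) (st x) (b x, l x)).1)).
  move=> x; have := leq_size_enc (l x); move: (enc _) => m.
  elim: m (b x) (l x) => [|m IH] y [|a s] // le_m; rewrite iterSr /st.
    by rewrite (IH y [::]).
  by rewrite (IH (f x y a) s).
apply: prf_fst; apply: prf_iter; last by apply: prf_pair.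
  by case: pl => L pL LE; exists L.
rewrite /st; apply: prf_case; first by apply: prf_snd; apply: prf_snd; exact: prf_id.
  apply: prf_pair; last by apply: prf_snd; apply: prf_snd; exact: prf_id.
  have pg : prf (fun p : (G * (T * seq A)) * (A * seq A) => (p.1.1, (p.1.2.1, p.2.1))).
    by repeat prf_base.
  exact: (prf_comp pf pg).
by apply: prf_snd; exact: prf_id.
Qed.

End Folds.

Lemma prf_rev G (cG : coded G) A (cA : coded A) (l : G -> seq A) :
  prf l -> prf (fun x => rev (l x)).
Proof.
move=> pl; apply: (@prf_ext _ _ _ _ (fun x => foldl (fun s a => a :: s) [::] (l x))).
  move=> x; rewrite /rev; elim: (l x) [::] => //= a s IH t; exact: IH.
apply: prf_foldl => //; last exact: prf_const.
by apply: prf_cons; repeat prf_base.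
Qed.

Section Foldr.
Context {G : Type} {cG : coded G} {A : Type} {cA : coded A}.

Lemma prf_foldr T (cT : coded T) (l : G -> seq A) (f : G -> A -> T -> T) (b : G -> T) :
  prf l -> prf (fun p : G * (A * T) => f p.1 p.2.1 p.2.2) -> prf b ->
  prf (fun x => foldr (f x) (b x) (l x)).
Proof.
move=> pl pf pb; apply: (@prf_ext _ _ _ _ (fun x => foldl (fun z a => f x a z) (b x) (rev (l x)))).
  by move=> x; rewrite foldl_rev.
apply: prf_foldl => //; first exact: prf_rev.
have pg : prf (fun p : G * (T * A) => (p.1, (p.2.2, p.2.1))) by repeat prf_base.
exact: (prf_comp pf pg).
Qed.

End Foldr.

Section ListOps.
Context {G : Type} {cG : coded G} {A : Type} {cA : coded A}.

Lemma prf_cat (k l : G -> seq A) : prf k -> prf l -> prf (fun x => k x ++ l x).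
Proof.
move=> pk pl; apply: (@prf_ext _ _ _ _ (fun x => foldr (fun a s => a :: s) (l x) (k x))).
  by move=> x; elim: (k x) => //= a s ->.
by apply: prf_foldr => //; apply: prf_cons; repeat prf_base.
Qed.

Lemma prf_map B (cB : coded B) (l : G -> seq A) (f : G -> A -> B) :
  prf l -> prf (fun p => f p.1 p.2) -> prf (fun x => [seq f x a | a <- l x]).
Proof.
move=> pl pf; apply: (@prf_ext _ _ _ _ (fun x => foldr (fun a s => f x a :: s) [::] (l x))).
  by move=> x; elim: (l x) => //= a s ->.
apply: prf_foldr => //; last exact: prf_const.
apply: prf_cons; last by repeat prf_base.
have pg : prf (fun p : G * (A * seq B) => (p.1, p.2.1)) by repeat prf_base.
exact: (prf_comp pf pg).
Qed.

Lemma prf_filter (l : G -> seq A) (f : G -> A -> bool) :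
  prf l -> prf (fun p => f p.1 p.2) -> prf (fun x => [seq a <- l x | f x a]).
Proof.
move=> pl pf; apply: (@prf_ext _ _ _ _
  (fun x => foldr (fun a s => if f x a then a :: s else s) [::] (l x))).
  by move=> x; elim: (l x) => //= a s ->.
apply: prf_foldr => //; last exact: prf_const.
apply: prf_if; last by repeat prf_base.
  have pg : prf (fun p : G * (A * seq A) => (p.1, p.2.1)) by repeat prf_base.
  exact: (prf_comp pf pg).
by apply: prf_cons; repeat prf_base.
Qed.

Lemma prf_all (l : G -> seq A) (f : G -> A -> bool) :
  prf l -> prf (fun p => f p.1 p.2) -> prf (fun x => all (f x) (l x)).
Proof.
move=> pl pf; apply: (@prf_ext _ _ _ _ (fun x => foldr (fun a b => f x a && b) true (l x))).
  by move=> x; elim: (l x) => //= a s ->.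
apply: prf_foldr => //; last exact: prf_const.
apply: prf_and; last by repeat prf_base.
have pg : prf (fun p : G * (A * bool) => (p.1, p.2.1)) by repeat prf_base.
exact: (prf_comp pf pg).
Qed.

Lemma prf_has (l : G -> seq A) (f : G -> A -> bool) :
  prf l -> prf (fun p => f p.1 p.2) -> prf (fun x => has (f x) (l x)).
Proof.
move=> pl pf; apply: (@prf_ext _ _ _ _ (fun x => ~~ all (fun a => ~~ f x a) (l x))).
  by move=> x; rewrite -has_predC; apply: eq_has => a /=; rewrite negbK.
by apply: prf_not; apply: prf_all => //; exact: prf_not.
Qed.

Lemma prf_size (l : G -> seq A) : prf l -> prf (fun x => size (l x)).
Proof.
move=> pl; apply: (@prf_ext _ _ _ _ (fun x => foldr (fun _ n => n.+1) 0 (l x))).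
  by move=> x; elim: (l x) => //= a s ->.
by apply: prf_foldr => //; [apply: prf_S; repeat prf_base | exact: prf_const].
Qed.

Lemma prf_behead (l : G -> seq A) : prf l -> prf (fun x => behead (l x)).
Proof.
move=> pl; apply: (@prf_ext _ _ _ _ (fun x => if l x is _ :: s then s else [::])).
  by move=> x; case: (l x).
by apply: (prf_case pl); [repeat prf_base | exact: prf_const].
Qed.

Lemma prf_head (l : G -> seq A) (d : A) : prf l -> prf (fun x => head d (l x)).
Proof.
move=> pl; apply: (@prf_ext _ _ _ _ (fun x => if l x is a :: _ then a else d)).
  by move=> x; case: (l x).
by apply: (prf_case pl); [repeat prf_base | exact: prf_const].
Qed.

End ListOps.

Section ListOps2.
Context {G : Type} {cG : coded G} {A : Type} {cA : coded A}.

Lemma prf_nth (l : G -> seq A) (n : G -> nat) (d : A) :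
  prf l -> prf n -> prf (fun x => nth d (l x) (n x)).
Proof.
move=> pl pn; apply: (@prf_ext _ _ _ _ (fun x => head d (iter (n x) behead (l x)))).
  move=> x; suff -> : iter (n x) behead (l x) = drop (n x) (l x) by rewrite -nth0 nth_drop addn0.
  by elim: (n x) (l x) => [|m IH] s; rewrite ?drop0 // iterSr IH; case: s.
apply: prf_head; apply: prf_iter => //; apply: prf_behead; repeat prf_base.
Qed.

Lemma prf_last (l : G -> seq A) (d : A) : prf l -> prf (fun x => last d (l x)).
Proof.
move=> pl; apply: (@prf_ext _ _ _ _ (fun x => head d (rev (l x)))).
  by move=> x; elim/last_ind: (l x) => // s a _; rewrite rev_rcons last_rcons.
by apply: prf_head; exact: prf_rev.
Qed.

Lemma prf_flatten (l : G -> seq (seq A)) : prf l -> prf (fun x => flatten (l x)).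
Proof.
move=> pl; apply: prf_foldr => //; last exact: prf_const.
by apply: prf_cat; repeat prf_base.
Qed.

Lemma prf_zip B (cB : coded B) (l : G -> seq A) (m : G -> seq B) :
  prf l -> prf m -> prf (fun x => zip (l x) (m x)).
Proof.
move=> pl pm; apply: (@prf_ext _ _ _ _ (fun x => rev (foldl (fun acc a =>
    if acc.1 is b :: m' then (m', (a, b) :: acc.2) else acc) (m x, [::]) (l x)).2)).
  move=> x; set F := (fun acc a => _).
  suff H s : forall t r, (foldl F (t, r) s).2 = rev (zip s t) ++ r.
    by rewrite H cats0 revK.
  elim: s => [|a s IH] [|b t] r //=; last by rewrite IH rev_cons cat_rcons.
  by rewrite /F /= -/F; move: (IH [::] r) => /= ->; case: (s).
apply: prf_rev; apply: prf_snd; apply: prf_foldl => //; last first.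
  by apply: prf_pair => //; exact: prf_const.
apply: prf_case; [by repeat prf_base | | by repeat prf_base].
by apply: prf_pair; last apply: prf_cons; repeat prf_base.
Qed.

End ListOps2.

Section ListOps3.
Context {G : Type} {cG : coded G}.

Lemma prf_iota (n : G -> nat) : prf n -> prf (fun x => iota 0 (n x)).
Proof.
move=> pn; apply: (@prf_ext _ _ _ _ (fun x => iter (n x) (fun l => 0 :: [seq i.+1 | i <- l]) [::])).
  by move=> x; elim: (n x) => //= m ->; rewrite -(addn0 1) iotaDl.
apply: prf_iter => //; last exact: prf_const.
apply: prf_cons; first exact: prf_const.
by apply: prf_map; [|apply: prf_S]; repeat prf_base.
Qed.

Lemma prf_mem (A : eqType) (cA : coded A) (f : G -> A) (l : G -> seq A) :
  prf f -> prf l -> prf (fun x => f x \in l x).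
Proof.
move=> pf pl; apply: (@prf_ext _ _ _ _ (fun x => has (fun a => a == f x) (l x))).
  by move=> x; rewrite has_pred1.
apply: prf_has => //; apply: prf_eq; first by repeat prf_base.
by apply: (prf_comp pf); repeat prf_base.
Qed.

End ListOps3.

(** A hook that is redefined for the functions at hand. *)
Ltac prf_extra := fail.

Ltac prf_step :=
  lazymatch goal with
  | |- prf (fun x => iter (@?n x) (fun y => @?f x y) (@?b x)) => apply: (@prf_iter _ _ _ _ n f b)
  | |- prf (fun x => foldr (fun a b => @?f x a b) (@?b x) (@?l x)) => apply: (@prf_foldr _ _ _ _ _ _ l f b)
  | |- prf (fun x => foldl (fun a b => @?f x a b) (@?b x) (@?l x)) => apply: (@prf_foldl _ _ _ _ _ _ l f b)
  | |- prf (fun x => if _ then _ else _) => apply: prf_if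
  | |- prf (fun x => map (fun a => @?f x a) (@?l x)) => apply: (@prf_map _ _ _ _ _ _ l f)
  | |- prf (fun x => seq.filter (fun a => @?f x a) (@?l x)) => apply: (@prf_filter _ _ _ _ l f)
  | |- prf (fun x => all (fun a => @?f x a) (@?l x)) => apply: (@prf_all _ _ _ _ l f)
  | |- prf (fun x => has (fun a => @?f x a) (@?l x)) => apply: (@prf_has _ _ _ _ l f)
  | |- prf (fun x => cons (@?f x) (@?l x)) => apply: (@prf_cons _ _ _ _ f l)
  | |- prf (fun x => cat (@?f x) (@?l x)) => apply: (@prf_cat _ _ _ _ f l)
  | |- prf (fun x => zip (@?f x) (@?l x)) => eapply (@prf_zip _ _ _ _ _ _ f l)
  | |- prf (fun x => nth ?d (@?l x) (@?n x)) => apply: (@prf_nth _ _ _ _ l n d)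
  | |- prf (fun x => head ?d (@?l x)) => apply: (@prf_head _ _ _ _ l d)
  | |- prf (fun x => last ?d (@?l x)) => apply: (@prf_last _ _ _ _ l d)
  | |- prf (fun x => behead (@?l x)) => apply: (@prf_behead _ _ _ _ l)
  | |- prf (fun x => rev (@?l x)) => apply: (@prf_rev _ _ _ _ l)
  | |- prf (fun x => flatten (@?l x)) => apply: (@prf_flatten _ _ _ _ l)
  | |- prf (fun x => size (@?l x)) => apply: (@prf_size _ _ _ _ l)
  | |- prf (fun x => iota 0 (@?n x)) => apply: (@prf_iota _ _ n)
  | |- prf (fun x => negb (@?b x)) => apply: (@prf_not _ _ b)
  | |- prf (fun x => andb (@?b x) (@?c x)) => apply: (@prf_and _ _ b c)
  | |- prf (fun x => orb (@?b x) (@?c x)) => apply: (@prf_or _ _ b c)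
  | |- prf (fun x => nat_of_bool (@?b x)) => apply: (@prf_natb _ _ b)
  | |- prf (fun x => S (@?n x)) => apply: (@prf_S _ _ n)
  | |- prf (fun x => predn (@?n x)) => apply: (@prf_pred _ _ n)
  | |- prf (fun x => addn (@?m x) (@?n x)) => apply: (@prf_add _ _ m n)
  | |- prf (fun x => subn (@?m x) (@?n x)) => apply: (@prf_sub _ _ m n)
  | |- prf (fun x => leq (@?m x) (@?n x)) => apply: (@prf_leq _ _ m n)
  | |- prf (fun x => odd (@?n x)) => apply: (@prf_odd _ _ n)
  | |- prf (fun x => half (@?n x)) => apply: (@prf_half _ _ n)
  | |- prf (fun x => in_mem (@?f x) (mem (@?l x))) => apply: (@prf_mem _ _ _ _ f l)
  | |- prf (fun x => eq_op (@?f x) (@?g x)) => apply: (@prf_eq _ _ _ _ f g)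
  end.

Ltac prf_eta :=
  lazymatch goal with
  | |- prf (fun _ => _) => fail
  | |- @prf ?T ?U ?cT ?cU ?f => change (@prf T U cT cU (fun x => f x))
  end.

Ltac prf_hyp := match goal with
  | H : prf ?h |- prf (fun x => ?h (@?g x)) => apply: (@prf_comp _ _ _ _ _ _ h g H)
  end.

Ltac prf_auto := cbv beta;
  repeat first [prf_base | assumption | prf_hyp | prf_extra | prf_step | prf_eta].

(** * Counter programs and Ackermann bounds *)

(** The Ackermann-Péter function. This form is the one that the gadget unfolds: one copy of level
    [k'.+1] on [n] becomes [n.+1] copies of level [k'] on [1]. *)
Fixpoint ack (k n : nat) : nat :=
  if k is k'.+1 then iter n.+1 (ack k') 1 else n.+1.

Lemma ackSS k n : ack k.+1 n.+1 = ack k (ack k.+1 n). Proof. by []. Qed.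

Lemma ltn_ack k n : n < ack k n.
Proof.
elim: k n => // k IH; elim=> [|n IHn]; first exact: (leq_trans _ (IH 1)).
rewrite ackSS; exact: leq_ltn_trans IHn (IH _).
Qed.

Lemma ack_ltS k n : ack k n < ack k n.+1.
Proof. by case: k => // k; rewrite ackSS ltn_ack. Qed.

Lemma ack_lt k m n : (ack k m < ack k n) = (m < n).
Proof.
have ack_mono i j : i <= j -> ack k i <= ack k j.
  move=> /subnK <-; elim: (j - i) => // d IH.
  by rewrite addSn (leq_trans IH) // ltnW // ack_ltS.
apply/idP/idP => [|mn]; last exact: leq_trans (ack_ltS k m) (ack_mono _ _ mn).
by rewrite !ltnNge; apply: contra; exact: ack_mono.
Qed.

Lemma ack_le k m n : (ack k m <= ack k n) = (m <= n).
Proof. by rewrite leqNgt ack_lt -leqNgt. Qed.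

Lemma ack_leS k n : ack k n.+1 <= ack k.+1 n.
Proof.
elim: n => // n IH; rewrite ackSS ack_le; apply: leq_trans IH.
exact: leq_ltn_trans (ltn_ack k n.+1) _ || exact: ltn_ack.
Qed.

Lemma ack_mon k l n : k <= l -> ack k n <= ack l n.
Proof.
move=> /subnK <-; elim: (l - k) => // d IH; rewrite addSn (leq_trans IH) //.
exact: leq_trans (ltnW (ack_ltS _ _)) (ack_leS _ _).
Qed.

Lemma ack_mon2 k l m n : k <= l -> m <= n -> ack k m <= ack l n.
Proof. by move=> kl mn; rewrite (leq_trans (ack_mon _ kl)) // ack_le. Qed.

(** With [M] the larger of the two levels, [ack M (ack M.+1 n) = ack M.+1 n.+1 <= ack M.+2 n]. *)
Lemma ack_comp k l n : ack k (ack l n) <= ack (maxn k l).+2 n.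
Proof.
apply: leq_trans (ack_leS _ _); rewrite ackSS.
apply: ack_mon2; first exact: leq_maxl.
by apply: ack_mon; rewrite leqW // leq_maxr.
Qed.

Lemma ack2 n : ack 2 n = n.*2 + 3.
Proof.
have ack1 m : ack 1 m = m + 2 by elim: m => // m IH; rewrite ackSS IH.
by elim: n => // n IH; rewrite ackSS IH ack1; lia.
Qed.

Lemma ack_sq n : n * n + n.*2 <= ack 3 n.
Proof. by elim: n => // n IH; rewrite ackSS ack2; lia. Qed.

Lemma iter_ack k m x : iter m (ack k) x <= ack k.+1 (m + x).
Proof.
apply: (@leq_trans (iter m (ack k) (ack k.+1 x))).
  elim: m => [|m IH]; first exact: ltnW (ltn_ack k.+1 x).
  by rewrite !iterS ack_le.
by rewrite leq_eqVlt; apply/orP; left; apply/eqP; elim: m => // m IH; rewrite iterS IH.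
Qed.

(** The costs of compiled programs are majorised in this sense, and the level obtained becomes the
    parameter [k] of the gadget. *)
Definition maj (f : nat -> nat) := exists k, forall n, f n <= ack k n.

(** Together with the closure properties below, this reduces every cost estimate to sums, products,
    compositions and iterates of [ack k]. *)
Lemma maj_le f g : maj g -> (forall n, f n <= g n) -> maj f.
Proof. by move=> [k Hk] fg; exists k => n; exact: leq_trans (fg n) (Hk n). Qed.

Lemma maj_id : maj id. Proof. by exists 0 => n /=. Qed.

Lemma maj_comp f g : maj f -> maj g -> maj (fun n => f (g n)).
Proof.
move=> [k Hk] [l Hl]; exists (maxn k l).+2 => n.
by apply: leq_trans (ack_comp k l n); rewrite (leq_trans (Hk _)) // ack_le.
Qed.

Lemma maj_add f g : maj f -> maj g -> maj (fun n => f n + g n).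
Proof.
move=> [k Hk] [l Hl]; apply: (@maj_le _ (fun n => ack 2 (ack (maxn k l) n))).
  by apply: maj_comp; [exists 2 | exists (maxn k l)].
move=> n; rewrite ack2 -addnn.
have := leq_trans (Hk n) (ack_mon n (leq_maxl k l)).
have := leq_trans (Hl n) (ack_mon n (leq_maxr k l)); lia.
Qed.

Lemma maj_const c : maj (fun=> c).
Proof.
elim: c => [|c IH]; first by exists 0.
by apply: maj_comp IH; exists 0.
Qed.

Lemma maj_sq : maj (fun n => n * n).
Proof. by exists 3 => n; apply: leq_trans (ack_sq n); exact: leq_addr. Qed.

Lemma maj_iter k : maj (fun n => iter n (ack k) n).
Proof.
apply: (@maj_le _ (fun n => ack k.+1 (n + n))); last by move=> n; exact: iter_ack.
by apply: (@maj_comp (ack k.+1)); [exists k.+1 | exact: maj_add maj_id maj_id].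
Qed.

(** * Counter programs and the number of their increments *)

Inductive com :=
| Skip
| Inc of nat
| Seq of com & com
| Loop of nat & com
| If of nat & com & com.

Definition upd (s : nat -> nat) r v := fun x => if x == r then v else s x.

(** [Loop r c] decrements [r] before each execution of [c] and stops when [r]
    is zero; [If r c d] decrements [r] before executing [c].  The last argument
    of [exec] counts increments. *)
Inductive exec : com -> (nat -> nat) -> (nat -> nat) -> nat -> Prop :=
| exec_skip s : exec Skip s s 0
| exec_inc r s : exec (Inc r) s (upd s r (s r).+1) 1
| exec_seq c d s1 s2 s3 t u :
    exec c s1 s2 t -> exec d s2 s3 u -> exec (Seq c d) s1 s3 (t + u)
| exec_loop0 r c s : s r = 0 -> exec (Loop r c) s s 0
| exec_loopS r c n s1 s2 s3 t u : s1 r = n.+1 -> exec c (upd s1 r n) s2 t ->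
    exec (Loop r c) s2 s3 u -> exec (Loop r c) s1 s3 (t + u)
| exec_ifS r c d n s1 s2 t : s1 r = n.+1 -> exec c (upd s1 r n) s2 t ->
    exec (If r c d) s1 s2 t
| exec_if0 r c d s1 s2 t : s1 r = 0 -> exec d s1 s2 t ->
    exec (If r c d) s1 s2 t.

Lemma exec_eq c s s1 s2 t t' : exec c s s1 t -> s1 =1 s2 -> t = t' -> exec c s s2 t'.
Proof. by move=> H /funext <- <-. Qed.

Ltac upd_lia :=
  let z := fresh "z" in
  move=> z; rewrite /upd; repeat (case: eqP => ?; try subst); try congruence; try lia.

Definition runs c s s' B := exists2 t, t <= B & exec c s s' t.

Lemma runs_seq c d s1 s2 s3 B C :
  runs c s1 s2 B -> runs d s2 s3 C -> runs (Seq c d) s1 s3 (B + C).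
Proof.
by move=> [t tB e] [u uC e']; exists (t + u); [exact: leq_add | exact: exec_seq e e'].
Qed.

Lemma runs_le c s s1 s2 B C : runs c s s1 B -> s1 =1 s2 -> B <= C -> runs c s s2 C.
Proof. by move=> [t tB e] /funext <- BC; exists t => //; exact: leq_trans tB BC. Qed.

Lemma runs_inc r s : runs (Inc r) s (upd s r (s r).+1) 1.
Proof. by exists 1 => //; exact: exec_inc. Qed.

Lemma runs_skip s : runs Skip s s 0.
Proof. by exists 0 => //; exact: exec_skip. Qed.

(** [F n] is the state at the loop head when [r] holds [n]. *)
Lemma runs_loop r c s (F : nat -> nat -> nat) (B : nat -> nat) :
  (forall n, n <= s r -> F n r = n) ->
  (forall n, n < s r -> runs c (upd (F n.+1) r n) (F n) (B n)) ->
  F (s r) =1 s ->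
  runs (Loop r c) s (F 0) (\sum_(n < s r) B n).
Proof.
move=> Fr Fc Fs.
suff H m : m <= s r -> runs (Loop r c) (F m) (F 0) (\sum_(n < m) B n).
  by have := H _ (leqnn _); rewrite (funext Fs).
elim: m => [|m IH] lem.
  by exists 0 => //; apply: exec_loop0; exact: Fr.
have [u uB eu] := IH (ltnW lem); have [t tB et] := Fc m lem.
exists (t + u); first by rewrite big_ord_recr /= addnC leq_add.
exact: exec_loopS (Fr _ lem) et eu.
Qed.

Lemma runs_loopc r c s (F : nat -> nat -> nat) b :
  (forall n, n <= s r -> F n r = n) ->
  (forall n, n < s r -> runs c (upd (F n.+1) r n) (F n) b) ->
  F (s r) =1 s ->
  runs (Loop r c) s (F 0) (s r * b).
Proof.
move=> Fr Fc Fs; have := runs_loop Fr Fc Fs.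
by rewrite sum_nat_const card_ord.
Qed.

Lemma runs_move r a s : a <> r ->
  runs (Loop r (Inc a)) s (upd (upd s a (s a + s r)) r 0) (s r).
Proof.
move=> ar.
have := @runs_loopc r (Inc a) s (fun n => upd (upd s a (s a + s r - n)) r n) 1.
rewrite muln1 subn0; apply=> [n|n|]; last by upd_lia.
- by rewrite /upd eqxx.
- by move=> ns; apply: runs_le (runs_inc _ _) _ _ => //; upd_lia.
Qed.

Lemma runs_copy r a b s : a <> r -> b <> r -> a <> b ->
  runs (Loop r (Seq (Inc a) (Inc b))) s
    (upd (upd (upd s a (s a + s r)) b (s b + s r)) r 0) (s r * 2).
Proof.
move=> ar br ab.
have := @runs_loopc r (Seq (Inc a) (Inc b)) s
  (fun n => upd (upd (upd s a (s a + s r - n)) b (s b + s r - n)) r n) 2.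
rewrite !subn0; apply=> [n|n|]; last by upd_lia.
- by rewrite /upd eqxx.
- move=> ns; apply: runs_le (runs_seq (runs_inc _ _) (runs_inc _ _)) _ _ => //; upd_lia.
Qed.

Lemma runs_clear r s : runs (Loop r Skip) s (upd s r 0) 0.
Proof.
have := @runs_loopc r Skip s (fun n => upd s r n) 0.
rewrite muln0; apply=> [n|n|]; last by upd_lia.
- by rewrite /upd eqxx.
- by move=> ns; apply: runs_le (runs_skip _) _ _ => //; upd_lia.
Qed.

Lemma maj_mul f g : maj f -> maj g -> maj (fun n => f n * g n).
Proof.
move=> mf mg; apply: (@maj_le _ (fun n => (f n + g n) * (f n + g n))).
  exact: maj_comp maj_sq (maj_add mf mg).
by move=> n; rewrite leq_mul ?leq_addr ?leq_addl.
Qed.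

Ltac upd_at := rewrite /upd; repeat (case: eqP => ?; try congruence; try lia).

Lemma updE s r v : upd s r v r = v.
Proof. by rewrite /upd eqxx. Qed.

Lemma updN s r v x : x <> r -> upd s r v x = s x.
Proof. by rewrite /upd; case: eqP. Qed.

Lemma runs_seqA c1 c2 c3 s s' B :
  runs (Seq (Seq c1 c2) c3) s s' B -> runs (Seq c1 (Seq c2 c3)) s s' B.
Proof.
case=> t tB H; exists t => //; inversion H; subst; clear H.
match goal with X : exec (Seq _ _) _ _ _ |- _ => inversion X; subst end.
by rewrite -addnA; econstructor; [|econstructor]; eassumption.
Qed.

(** The value [cp a c] is [c] plus the sum of the numbers up to [a + c]. The first two loops leave
    [a + c] in [u] and [c] in [r]; each turn of the last loop adds to [r] the content that [u] had
    before the turn, and [v] serves to restore [u]. *)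
Definition pair_com r b u v :=
  Seq (Loop r (Inc u)) (Seq (Loop b (Seq (Inc u) (Inc r)))
    (Loop u (Seq (Inc r) (Seq (Loop u (Seq (Inc r) (Inc v))) (Loop v (Inc u)))))).

Definition pair_cost n := n + n * 2 + n * (1 + n * 3).

Lemma runs_pair r b u v s : uniq [:: r; b; u; v] -> s u = 0 -> s v = 0 ->
  runs (pair_com r b u v) s (upd (upd s r (cp (s r) (s b))) b 0) (pair_cost (s r + s b)).
Proof.
rewrite /= !inE !negb_or => /and4P[/and3P[/eqP rb /eqP ru /eqP rv] /andP[/eqP bu /eqP bv] /eqP uv _] su sv.
set a := s r; set c := s b; set N := a + c.
pose s1 := upd (upd (upd s u N) r c) b 0.
have R1 : runs (Seq (Loop r (Inc u)) (Loop b (Seq (Inc u) (Inc r)))) s s1 (N + N * 2).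
  apply: runs_le (runs_seq (runs_move _ _) (runs_copy _ _ _ _)) _ _ => //; try congruence.
    by rewrite /s1 /a /c /N /a /c; upd_lia.
  by rewrite /upd; do ![case: eqP => ?; try congruence]; rewrite /N /a /c; lia.
pose F n := upd (upd s1 r ('C(N.+1, 2) - 'C(n.+1, 2) + c)) u n.
have R2 : runs (Loop u (Seq (Inc r) (Seq (Loop u (Seq (Inc r) (Inc v))) (Loop v (Inc u))))) s1 (F 0) (N * (1 + N * 3)).
  have s1u : s1 u = N by rewrite /s1 /upd; do ![case: eqP => ?; try congruence].
  rewrite -{1}s1u; apply: runs_loopc => [n _|n|]; rewrite ?s1u.
  - by rewrite /F updE.
  - move=> nN; have leC : 'C(n.+2, 2) <= 'C(N.+1, 2) by exact: leq_bin2l.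
    have CS : 'C(n.+2, 2) = 'C(n.+1, 2) + n.+1 by rewrite binS bin1.
    apply: runs_le (runs_seq (runs_inc _ _) (runs_seq (runs_copy _ _ _ _) (runs_move _ _))) _ _; try congruence.
      by rewrite /F /s1; upd_lia.
    by rewrite /F /s1 /upd; do ![case: eqP => ?; try congruence]; lia.
  - by rewrite /F subnn add0n /s1; upd_lia.
apply: runs_le (runs_seqA (runs_seq R1 R2)) _ _ => //.
by rewrite /F /s1 /cp -/a -/c -/N (_ : 'C(1, 2) = 0) // subn0; upd_lia.
Qed.

(** The body performs [nxt] on the pair held in [a] and [b], once for each unit of [r]. *)
Definition unpair_com r a b :=
  Loop r (If a (Inc b) (Seq (Loop b (Inc a)) (Inc a))).

Lemma unp_le x : (unp x).1 <= x /\ (unp x).2 <= x.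
Proof. by have := leq_cp (unp x).1 (unp x).2; rewrite cp_unp; lia. Qed.

Lemma runs_unpair r a b s : uniq [:: r; a; b] -> s a = 0 -> s b = 0 ->
  runs (unpair_com r a b) s
    (upd (upd (upd s a (unp (s r)).1) b (unp (s r)).2) r 0) (s r * (s r).+1).
Proof.
rewrite /= !inE !negb_or => /and3P[/andP[/eqP ra /eqP rb] /eqP ab _] sa sb.
set x := s r.
pose F n := upd (upd (upd s a (unp (x - n)).1) b (unp (x - n)).2) r n.
have := @runs_loopc r (If a (Inc b) (Seq (Loop b (Inc a)) (Inc a))) s F x.+1.
rewrite -/x /F subn0; apply=> [n _|n nx|]; first by rewrite updE.
  have -> : x - n = (x - n.+1).+1 by lia.
  rewrite [unp _.+1]/(nxt (unp (x - n.+1))); have [_] := unp_le (x - n.+1).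
  case: (unp (x - n.+1)) => -[|p] q /= qx; rewrite /nxt /=.
    suff: runs (Seq (Loop b (Inc a)) (Inc a)) (upd (upd (upd (upd s a 0) b q) r n.+1) r n)
             (upd (upd (upd s a q.+1) b 0) r n) x.+1.
      by case=> t tB e; exists t => //; apply: exec_if0 => //; upd_at.
    apply: runs_le (runs_seq (runs_move _ _) (runs_inc _ _)) _ _; try congruence.
      by upd_lia.
    by upd_at; lia.
  exists 1 => //; apply: (@exec_ifS _ _ _ p); first by upd_at.
  by apply: exec_eq (exec_inc _ _) _ _ => //; upd_lia.
by rewrite subnn /=; upd_lia.
Qed.

Definition implements c r base f (B : nat -> nat) :=
  forall s, (forall j, base <= j -> s j = 0) ->
    runs c s (upd s r (f (s r))) (B (s r)).

(** The registers from [base] on are scratch, zero before and after. *)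
Lemma pr_implements f : pr f -> exists2 B, maj (fun n => B n + f n) &
  forall r base, r < base -> exists c, implements c r base f B.
Proof.
have mfst : maj (fun x => (unp x).1) by apply: maj_le maj_id _ => x; case: (unp_le x).
have msnd : maj (fun x => (unp x).2) by apply: maj_le maj_id _ => x; case: (unp_le x).
have mS : maj S by exists 0.
have mB f0 B : maj (fun n => B n + f0 n) -> maj B /\ maj f0.
  by move=> m; split; apply: maj_le m _ => n; rewrite ?leq_addr ?leq_addl.
elim=> {f}.
- exists (fun=> 0); first exact: maj_const.
  by move=> r base _; exists (Loop r Skip) => s _; exact: runs_clear.
- exists (fun=> 1); first exact: maj_add (maj_const 1) mS.
  by move=> r base _; exists (Inc r) => s _; exact: runs_inc.
- exists (fun=> 0); first exact: maj_add (maj_const 0) maj_id.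
  by move=> r base _; exists Skip => s _; apply: runs_le (runs_skip _) _ _ => //; upd_lia.
- exists (fun x => x * x.+1 + x).
    by apply: maj_add => //; apply: maj_add maj_id; apply: maj_mul maj_id mS.
  move=> r base rb; exists (Seq (unpair_com r base base.+1) (Seq (Loop base.+1 Skip) (Loop base (Inc r)))).
  move=> s s0; have [u1 u2] := unp_le (s r).
  apply: runs_le (runs_seq (runs_unpair _ _ _) (runs_seq (runs_clear _ _) (runs_move _ _))) _ _.
  + by rewrite /= !inE; lia.
  + exact: s0.
  + by apply: s0; lia.
  + lia.
  + by upd_lia; rewrite s0 //; lia.
  + by upd_at; lia.
- exists (fun x => x * x.+1 + x).
    by apply: maj_add => //; apply: maj_add maj_id; apply: maj_mul maj_id mS.
  move=> r base rb; exists (Seq (unpair_com r base base.+1) (Seq (Loop base Skip) (Loop base.+1 (Inc r)))).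
  move=> s s0; have [u1 u2] := unp_le (s r).
  apply: runs_le (runs_seq (runs_unpair _ _ _) (runs_seq (runs_clear _ _) (runs_move _ _))) _ _.
  + by rewrite /= !inE; lia.
  + exact: s0.
  + by apply: s0; lia.
  + lia.
  + by upd_lia; rewrite s0 //; lia.
  + by upd_at; lia.
(* Pairing: the argument is copied to [base], then [f] is computed in [r] and [g] in [base], with
   the scratch registers starting one place later. *)
- move=> f g _ [Bf mf Hf] _ [Bg mg Hg].
  have [mBf mf'] := mB _ _ mf; have [mBg mg'] := mB _ _ mg.
  have mcost : maj pair_cost.
    apply: maj_add; first by apply: maj_add maj_id (maj_mul maj_id (maj_const 2)).
    apply: maj_mul maj_id _; apply: maj_add (maj_const 1) _; exact: maj_mul maj_id (maj_const 3).
  exists (fun x => x * 2 + x + Bf x + Bg x + pair_cost (f x + g x)).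
    have mfg := maj_add mf' mg'.
    apply: maj_add; last first.
      apply: (@maj_le _ (fun x => (f x + g x).+1 * (f x + g x) + (f x + g x))).
        by apply: maj_add => //; apply: maj_mul => //; exact: maj_comp mS mfg.
      move=> x; rewrite /cp; apply: leq_add; last exact: leq_addl.
      by rewrite -bin2_leq_sq || (rewrite bin2 /=; lia).
    apply: maj_add; last exact: maj_comp mcost mfg.
    by repeat apply: maj_add => //; [apply: maj_mul maj_id (maj_const 2) | exact: maj_id].
  move=> r base rb; have [cf Hcf] := Hf r base.+1 (leqW rb).
  have [cg Hcg] := Hg base base.+1 (ltnSn _).
  exists (Seq (Loop r (Seq (Inc base) (Inc base.+1))) (Seq (Loop base.+1 (Inc r))
    (Seq cf (Seq cg (pair_com r base base.+1 base.+2))))) => s s0.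
  have sb : s base = 0 by exact: s0. have sb1 : s base.+1 = 0 by apply: s0; lia.
  have sb2 : s base.+2 = 0 by apply: s0; lia.
  pose s1 := upd s base (s r).
  have R1 : runs (Seq (Loop r (Seq (Inc base) (Inc base.+1))) (Loop base.+1 (Inc r))) s s1 (s r * 2 + s r).
    apply: runs_le (runs_seq (runs_copy _ _ _ _) (runs_move _ _)) _ _; try lia.
      by rewrite /s1; upd_lia.
    by upd_at; lia.
  have R2 : runs cf s1 (upd s1 r (f (s r))) (Bf (s r)).
    have E : s1 r = s r by rewrite /s1; upd_at.
    by have := Hcf s1; rewrite E; apply=> j jb; rewrite /s1; upd_at; apply: s0; lia.
  have R3 : runs cg (upd s1 r (f (s r))) (upd (upd s1 r (f (s r))) base (g (s r))) (Bg (s r)).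
    have E : upd s1 r (f (s r)) base = s r by rewrite /s1; upd_at.
    by have := Hcg (upd s1 r (f (s r))); rewrite E; apply=> j jb; rewrite /s1; upd_at; apply: s0; lia.
  have R4 := @runs_pair r base base.+1 base.+2 (upd (upd s1 r (f (s r))) base (g (s r))).
  apply: runs_le (runs_seqA (runs_seq R1 (runs_seq R2 (runs_seq R3 (R4 _ _ _))))) _ _.
  + by rewrite /= !inE; lia.
  + by rewrite /s1 /upd; do ![case: eqP => ?; try lia].
  + by rewrite /s1 /upd; do ![case: eqP => ?; try lia].
  + by rewrite /s1; upd_lia.
  + by rewrite /upd; do ![case: eqP => ?; try lia].
- move=> f g _ [Bf mf Hf] _ [Bg mg Hg].
  have [mBf mf'] := mB _ _ mf; have [mBg mg'] := mB _ _ mg.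
  exists (fun x => Bg x + Bf (g x)).
    by apply: maj_add; [apply: maj_add => //|]; apply: (maj_comp _ mg').
  move=> r base rb; have [cf Hcf] := Hf r base rb; have [cg Hcg] := Hg r base rb.
  exists (Seq cg cf) => s s0.
  have := Hcf (upd s r (g (s r))); rewrite updE => R.
  apply: runs_le (runs_seq (Hcg s s0) (R _)) _ _ => //; last by upd_lia.
  by move=> j jb; rewrite updN; [exact: s0 | lia].
- move=> g _ [Bg mg Hg].
  have [k Hk] := mg.
  have gk j y : iter j g y <= iter j (ack k) y.
    elim: j => //= j IH; apply: leq_trans (leq_trans (leq_addl (Bg _) _) (Hk _)) _.
    by rewrite ack_le.
  have ik i j y z : i <= j -> y <= z -> iter i (ack k) y <= iter j (ack k) z.
    move=> /subnK <- yz; elim: (j - i) => [|d IH].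
      by elim: i => //= i; rewrite ack_le.
    by rewrite addSn iterS (leq_trans IH) // ltnW // ltn_ack.
  (* There are at most [x] turns and the first argument is at most [x], so all intermediate values
     stay below the [x]-fold iterate of [ack k] on [x]. One further [ack k] bounds the cost of a
     single turn. *)
  exists (fun x => x * x.+1 + x + x * ack k (iter x (ack k) x)).
    have mi := maj_iter k.
    apply: maj_add; last first.
      apply: maj_le mi _ => x; apply: leq_trans (gk _ _) _; apply: ik; by case: (unp_le x).
    apply: maj_add; first by apply: maj_add maj_id; exact: maj_mul maj_id mS.
    by apply: maj_mul maj_id _; apply: maj_comp mi; exists k.
  move=> r base rb; have [cg Hcg] := Hg r base.+1 (leqW rb).
  exists (Seq (unpair_com r base base.+1) (Seq (Loop base.+1 (Inc r)) (Loop base cg))) => s s0.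
  have [u1 u2] := unp_le (s r).
  set x := s r; pose m := (unp x).1; pose y := (unp x).2.
  pose s1 := upd (upd s base m) r y.
  have s1b : s1 base = m by rewrite /s1; upd_at.
  have R1 : runs (Seq (unpair_com r base base.+1) (Loop base.+1 (Inc r))) s s1 (x * x.+1 + x).
    have sb1 : s base.+1 = 0 by apply: s0; lia.
    apply: runs_le (runs_seq (runs_unpair _ _ _) (runs_move _ _)) _ _.
    + by rewrite /= !inE; lia.
    + exact: s0.
    + exact: sb1.
    + lia.
    + by rewrite /s1 /m /y; upd_lia.
    + by upd_at; lia.
  pose F n := upd (upd s1 r (iter (m - n) g y)) base n.
  have R2 : runs (Loop base cg) s1 (F 0) (m * ack k (iter x (ack k) x)).
    rewrite -s1b; apply: runs_loopc => [n _|n|]; rewrite ?s1b.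
    - by rewrite /F updE.
    - move=> nm; have := Hcg (upd (F n.+1) base n).
      have -> : upd (F n.+1) base n r = iter (m - n.+1) g y by rewrite /F; upd_at.
      have eqm : m - n = (m - n.+1).+1 by lia.
      case=> [j jb|t tB e]; first by rewrite /F /s1; upd_at; apply: s0; lia.
      exists t; last by apply: exec_eq e _ _ => //; rewrite /F eqm /=; upd_lia.
      apply: leq_trans tB _; apply: leq_trans (leq_addr (g (iter (m - n.+1) g y)) _) _.
      apply: leq_trans (Hk _) _; rewrite ack_le; apply: leq_trans (gk _ _) _.
      by apply: ik; rewrite ?/m ?/y /x; lia.
    - by rewrite /F subnn /s1; upd_lia.
  apply: runs_le (runs_seqA (runs_seq R1 R2)) _ _.
  + by rewrite /F /s1 subn0 -/m -/y; upd_lia; rewrite s0.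
  + by rewrite leq_add // leq_mul2r; apply/orP; right.
Qed.

(** * From counter programs to Turing machines *)

(** [IDec r l] decrements [r], or jumps to [l] if [r] is zero.  [IRead r l] adds
    the next input bit to [r], or jumps to [l] if the input is exhausted. *)
Inductive instr :=
| IInc of nat
| IDec of nat & nat
| IJmp of nat
| IRead of nat & nat.

Definition fconfig := (nat * (nat -> nat) * seq bool)%type.

(** The default [IJmp p] makes every position from [size P] on a fixed point, so reaching one of
    them means halting. *)
Definition fstep (P : seq instr) (c : fconfig) : fconfig :=
  let: (p, s, w) := c in
  match nth (IJmp p) P p with
  | IInc r => (p.+1, upd s r (s r).+1, w)
  | IDec r l => if s r is n.+1 then (p.+1, upd s r n, w) else (l, s, w)
  | IJmp l => (l, s, w)
  | IRead r l => if w is b :: w' then (p.+1, upd s r (s r + b), w') else (l, s, w)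
  end.

Fixpoint flat (c : com) (p : nat) : seq instr :=
  match c with
  | Skip => [::]
  | Inc r => [:: IInc r]
  | Seq c d => flat c p ++ flat d (p + size (flat c p))
  | Loop r c => IDec r (p + size (flat c p.+1)).+2 :: flat c p.+1 ++ [:: IJmp p]
  | If r c d =>
      let fc := flat c p.+1 in
      let q := (p + size fc).+2 in
      IDec r q :: fc ++ IJmp (q + size (flat d q)) :: flat d q
  end.

Fixpoint regs (c : com) : nat :=
  match c with
  | Skip => 0
  | Inc r => r.+1
  | Seq c d => maxn (regs c) (regs d)
  | Loop r c => maxn r.+1 (regs c)
  | If r c d => maxn r.+1 (maxn (regs c) (regs d))
  end.

Definition code_at (P : seq instr) p cs := exists P1 P2, P = P1 ++ cs ++ P2 /\ size P1 = p.

Lemma code_at_catl P p c d : code_at P p (c ++ d) -> code_at P p c.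
Proof. by move=> [P1 [P2 [-> <-]]]; exists P1, (d ++ P2); rewrite -!catA. Qed.

Lemma code_at_catr P p c d : code_at P p (c ++ d) -> code_at P (p + size c) d.
Proof.
by move=> [P1 [P2 [-> <-]]]; exists (P1 ++ c), P2; rewrite -!catA size_cat.
Qed.

Lemma code_at_cons P p i c : code_at P p (i :: c) -> code_at P p.+1 c.
Proof. by rewrite -cat1s => /code_at_catr; rewrite addn1. Qed.

Lemma code_at_nth P p i c d : code_at P p (i :: c) -> nth d P p = i.
Proof. by move=> [P1 [P2 [-> <-]]]; rewrite nth_cat ltnn subnn. Qed.

Section Runs.
Variables (P : seq instr) (m : nat).

Definition tot (s : nat -> nat) := \sum_(i < m) s i.

(** The bound is imposed at every moment of the run and not only at its end, because the reserve of
    the gadget must cover all intermediate contents of the registers. *)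
Definition fruns (c c' : fconfig) N := exists k,
  iter k (fstep P) c = c' /\ forall j, j <= k -> tot (iter j (fstep P) c).1.2 <= N.

Lemma fruns_refl c N : tot c.1.2 <= N -> fruns c c N.
Proof. by exists 0; split=> // j; rewrite leqn0 => /eqP ->. Qed.

Lemma fruns_trans c1 c2 c3 N : fruns c1 c2 N -> fruns c2 c3 N -> fruns c1 c3 N.
Proof.
move=> [k [<- Hk]] [l [<- Hl]]; exists (l + k); split; first by rewrite iterD.
move=> j jlk; case: (leqP j k) => jk; first exact: Hk.
by rewrite -(subnK (ltnW jk)) iterD; apply: Hl; lia.
Qed.

Lemma fruns_le c c' M N : M <= N -> fruns c c' M -> fruns c c' N.
Proof. by move=> MN [k [e H]]; exists k; split=> // j jk; exact: leq_trans (H j jk) MN. Qed.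

Lemma fruns_step c N : tot c.1.2 <= N -> tot (fstep P c).1.2 <= N -> fruns c (fstep P c) N.
Proof. by exists 1; split=> // -[|[|j]]. Qed.

Lemma tot_upd s r v : r < m -> tot (upd s r v) + s r = tot s + v.
Proof.
move=> rm; rewrite /tot (bigD1 (Ordinal rm)) //= [in RHS](bigD1 (Ordinal rm)) //= updE.
rewrite (eq_bigr (fun i : 'I_m => s i)); first by lia.
by move=> i ir; rewrite updN // => e; case/eqP: ir; exact: val_inj.
Qed.

(** The total of the registers grows only by increments, so the initial total plus their number
    bounds it throughout. *)
Lemma exec_fruns c s s' t p w : exec c s s' t -> regs c <= m -> code_at P p (flat c p) ->
  fruns (p, s, w) (p + size (flat c p), s', w) (tot s + t) /\ tot s' <= tot s + t.
Proof.
move=> e; elim: e p => {c s s' t}.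
- by move=> s p _ _; rewrite /= addn0; split; [apply: fruns_refl|]; rewrite addn0.
- move=> r s p /= rm C; have := tot_upd s (s r).+1 rm => T.
  split; last by lia.
  have := @fruns_step (p, s, w) (tot s + 1); rewrite /= (code_at_nth _ C) !addn1 /=.
  by apply; lia.
- move=> c d s1 s2 s3 t u _ IHc _ IHd p; rewrite /= geq_max => /andP[rc rd] C.
  have [R1 T1] := IHc _ rc (code_at_catl C); have [R2 T2] := IHd _ rd (code_at_catr C).
  split; last by lia.
  rewrite size_cat addnA; apply: fruns_trans (fruns_le _ R1) (fruns_le _ R2); lia.
- move=> r c s s0 p _ C; split; last by lia.
  have := @fruns_step (p, s, w) (tot s + 0); rewrite /= (code_at_nth _ C) s0 size_cat /=.
  have -> : p + (size (flat c p.+1) + 1).+1 = (p + size (flat c p.+1)).+2 by lia.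
  by apply; lia.
- move=> r c n s1 s2 s3 t u sr _ IHc _ IHl p /= rl C.
  move: (rl); rewrite geq_max => /andP[rm rc].
  have [R1 T1] := IHc _ rc (code_at_catl (code_at_cons C)).
  have [R2 T2] := IHl p rl C.
  have T0 := tot_upd s1 n rm.
  split; last by lia.
  have H := @fruns_step (p, s1, w) (tot s1 + (t + u)).
  rewrite /= (code_at_nth _ C) sr /= in H.
  apply: fruns_trans (H _ _) _; [lia..|].
  apply: fruns_trans (fruns_le _ R1) _; first by lia.
  have C' := code_at_catr (code_at_cons C).
  have H' := @fruns_step (p.+1 + size (flat c p.+1), s2, w) (tot s1 + (t + u)).
  rewrite /= (code_at_nth _ C') /= in H'.
  apply: fruns_trans (H' _ _) _; [lia..|].
  by apply: fruns_le R2; lia.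
- move=> r c d n s1 s2 t sr _ IHc p /=; rewrite !geq_max => /and3P[rm rc rd] C.
  have [R1 T1] := IHc _ rc (code_at_catl (code_at_cons C)).
  have T0 := tot_upd s1 n rm.
  split; last by lia.
  have H := @fruns_step (p, s1, w) (tot s1 + t).
  rewrite /= (code_at_nth _ C) sr /= in H.
  apply: fruns_trans (H _ _) _; [lia..|].
  apply: fruns_trans (fruns_le _ R1) _; first by lia.
  have C' := code_at_catr (code_at_cons C).
  have H' := @fruns_step (p.+1 + size (flat c p.+1), s2, w) (tot s1 + t).
  rewrite /= (code_at_nth _ C') /= in H'.
  have -> : p + (size (flat c p.+1 ++ IJmp ((p + size (flat c p.+1)).+2 +
     size (flat d (p + size (flat c p.+1)).+2)) :: flat d (p + size (flat c p.+1)).+2)).+1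
     = (p + size (flat c p.+1)).+2 + size (flat d (p + size (flat c p.+1)).+2).
    by rewrite size_cat /=; lia.
  by apply: H'; lia.
- move=> r c d s1 s2 t sr _ IHd p /=; rewrite !geq_max => /and3P[rm rc rd] C.
  have C' := code_at_cons (code_at_catr (code_at_cons C)).
  have E : (p.+1 + size (flat c p.+1)).+1 = (p + size (flat c p.+1)).+2 by lia.
  rewrite E in C'; have [R1 T1] := IHd _ rd C'.
  split; last by lia.
  have H := @fruns_step (p, s1, w) (tot s1 + t).
  rewrite /= (code_at_nth _ C) sr /= in H.
  apply: fruns_trans (H _ _) _; [lia..|].
  have -> : p + (size (flat c p.+1 ++ IJmp ((p + size (flat c p.+1)).+2 +
     size (flat d (p + size (flat c p.+1)).+2)) :: flat d (p + size (flat c p.+1)).+2)).+1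
     = (p + size (flat c p.+1)).+2 + size (flat d (p + size (flat c p.+1)).+2).
    by rewrite size_cat /=; lia.
  by apply: fruns_le R1; lia.
Qed.

End Runs.

Section TuringMachine.
Variables (P : seq instr) (m : nat).

Definition reg_of (i : instr) : nat :=
  match i with IInc r | IDec r _ | IRead r _ => r | IJmp _ => 0 end.

(** Two positions lie beyond the program: the first accepts and the second rejects. The boolean
    provides the intermediate state for a decrement. *)
Definition tm_state : finType := ('I_(size P).+2 * bool)%type.
Definition ucell : finType := cell (unit : finType).
Definition mark : ucell := Some (inr tt).

Definition tm_pc (p : nat) (b : bool) : tm_state := (inord p, b).

Definition tm_verdict (q : tm_state) : option bool :=
  if q.1 < size P then None else Some (q.1 == size P :> nat).

Definition reg_tape (r : nat) : 'I_m.+1 := inord r.+1.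

Definition stay_but (h : {ffun 'I_m.+1 -> ucell}) (i : 'I_m.+1) (a : ucell * move) :=
  fun j => if j == i then a else (h j, Stay).

(** Register [r] is the number of marks to the left of the head on tape
    [r.+1]; the second component of a state is set while [IDec] inspects the
    last mark. *)
Definition tm_delta (q : tm_state) (h : {ffun 'I_m.+1 -> ucell}) :
    tm_state * ('I_m.+1 -> ucell * move) :=
  let p := q.1 : nat in
  match nth (IJmp p) P p with
  | IInc r => (tm_pc p.+1 false, stay_but h (reg_tape r) (mark, MoveRight))
  | IDec r l =>
      if q.2 then
        if h (reg_tape r) == mark then (tm_pc p.+1 false, stay_but h (reg_tape r) (None, Stay))
        else (tm_pc l false, stay_but h (reg_tape r) (None, MoveRight))
      else (tm_pc p true, stay_but h (reg_tape r) (None, MoveLeft))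
  | IJmp l => (tm_pc l false, fun j => (h j, Stay))
  | IRead r l =>
      if h ord0 is Some (inl b) then
        (tm_pc p.+1 false, fun j => if j == ord0 then (h j, MoveRight)
           else if b && (j == reg_tape r) then (mark, MoveRight) else (h j, Stay))
      else (tm_pc l false, fun j => (h j, Stay))
  end.

Definition tm : machine :=
  @Machine tm_state unit m (tm_pc 0 false) tm_verdict tm_delta.

(** The explicit blanks are cells that the head has visited: erased marks to the right, and to the
    left the cell inspected when a register was found to be zero. *)
Definition reg_ok (t : tape unit) (n : nat) :=
  exists a b, t = (nseq n mark ++ nseq a None, None, nseq b None).

Definition in_ok (t : tape unit) (w : seq bool) :=
  exists l, t = (l, head None [seq Some (inl b) | b <- w], behead [seq Some (inl b) | b <- w]).

Definition tm_rel (C : mconfig tm) (c : fconfig) :=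
  [/\ C.1 = tm_pc c.1.1 false, in_ok (C.2 ord0) c.2 &
      forall r, r < m -> reg_ok (C.2 (reg_tape r)) (c.1.2 r)].

Lemma reg_tapeN0 r : r < m -> (reg_tape r == ord0) = false.
Proof. by move=> rm; apply/eqP => /(congr1 val); rewrite /= inordK. Qed.

Lemma reg_tape_eq r r' : r < m -> r' < m -> (reg_tape r == reg_tape r') = (r == r').
Proof.
move=> rm rm'; apply/eqP/eqP => [/(congr1 val)|-> //].
by rewrite /= !inordK // => -[].
Qed.

Lemma reg_ok_inc t n : reg_ok t n -> reg_ok (update_tape t (mark, MoveRight)) n.+1.
Proof. by move=> [a [b ->]]; exists a, b.-1; case: b => [|b]. Qed.

Lemma reg_ok_dec t n : reg_ok t n.+1 ->
  head_cell (update_tape t (None, MoveLeft)) = mark /\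
  reg_ok (update_tape (update_tape t (None, MoveLeft)) (None, Stay)) n.
Proof. by move=> [a [b ->]]; split=> //; exists a, b.+1. Qed.

Lemma reg_ok_dec0 t : reg_ok t 0 ->
  head_cell (update_tape t (None, MoveLeft)) = None /\
  reg_ok (update_tape (update_tape t (None, MoveLeft)) (None, MoveRight)) 0.
Proof.
move=> [a [b ->]]; split; first by case: a.
by exists a.-1.+1, b; case: a.
Qed.

Lemma update_stay (t : tape unit) : update_tape t (head_cell t, Stay) = t.
Proof. by case: t => [[l a] r]. Qed.

Hypothesis regP : forall i, List.In i P -> reg_of i < m.
Hypothesis jumpP : forall p s w, p < size P -> (fstep P (p, s, w)).1.1 <= (size P).+1.

Lemma In_nth (d : instr) p : p < size P -> List.In (nth d P p) P.
Proof.
clear regP jumpP; elim: P p => // i Q IH [|p] /=; first by left.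
by move=> pQ; right; exact: IH.
Qed.

Lemma tm_step C c : c.1.1 < size P -> tm_rel C c ->
  exists k, tm_rel (iter k (@mstep tm) C) (fstep P c).
Proof.
case: c => [[p s] w] /= pP [/= C1 C0 Cr].
have rI := regP (In_nth (IJmp p) pP).
have jI := jumpP s w pP.
have pK : (inord p : 'I_(size P).+2) = p :> nat by rewrite inordK //; lia.
have stepE (D : mconfig tm) b : D.1 = tm_pc p b -> mstep D =
    (let: (q, u) := tm_delta (tm_pc p b) [ffun i => head_cell (D.2 i)] in
     (q, fun i => update_tape (D.2 i) (u i))) :> mconfig tm.
  by move=> D1; rewrite /mstep D1 /= /tm_verdict /= pK pP.
move: jI; rewrite /fstep; move: (stepE) rI; rewrite /tm_delta /= pK.
case: (nth (IJmp p) P p) => [r|r l|l|r l] {}stepE /= rI.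
- move=> jI; exists 1; rewrite /= (stepE C false) //; split=> //=.
    by rewrite /stay_but eq_sym reg_tapeN0 // ffunE update_stay.
  move=> r' rm'; rewrite /stay_but reg_tape_eq //; case: eqP => [->|/eqP rr'].
    by rewrite updE; exact: reg_ok_inc (Cr _ _).
  by rewrite ffunE update_stay updN; [exact: Cr | exact/eqP].
- move=> jI; have N0 : (ord0 == reg_tape r) = false by rewrite eq_sym reg_tapeN0.
  exists 2; rewrite /= (stepE C false) // (stepE _ true) //= ffunE /stay_but eqxx.
  case sr: (s r) jI => [|n] /= jI.
    have := Cr _ rI; rewrite sr => /reg_ok_dec0[hE okE].
    rewrite hE /=; split=> //=.
      by rewrite !(ffunE, N0, update_stay).
    move=> r' rm'; rewrite reg_tape_eq //; case: eqP => [->|/eqP rr'].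
      by rewrite sr.
    by rewrite !(ffunE, reg_tape_eq, negbTE rr', update_stay) //; exact: Cr.
  have := Cr _ rI; rewrite sr => /reg_ok_dec[hE okE].
  rewrite hE /=; split=> //=.
    by rewrite !(ffunE, N0, update_stay).
  move=> r' rm'; rewrite reg_tape_eq //; case: eqP => [->|/eqP rr'].
    by rewrite updE.
  rewrite !(ffunE, reg_tape_eq, negbTE rr', update_stay) // updN; first exact: Cr.
  exact/eqP.
- move=> jI; exists 1; rewrite /= (stepE C false) //; split=> //= [|r' rm']; rewrite ffunE update_stay //.
  exact: Cr.
- move=> jI; exists 1; rewrite /= (stepE C false) //= ffunE.
  case: C0 => L C0; case: w jI C0 => [|b w] jI /= C0; rewrite C0 /=.
    split=> //= [|r' rm']; rewrite ffunE update_stay //; first by exists L.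
    exact: Cr.
  split=> //=.
    by rewrite ffunE C0 /=; exists (Some (inl b) :: L).
  move=> r' rm'; rewrite reg_tapeN0 // reg_tape_eq //; case: eqP => [->|/eqP rr'].
    case: b {C0 jI} => /=; rewrite updE.
      by rewrite addn1; exact: reg_ok_inc (Cr _ _).
    by rewrite ffunE update_stay addn0; exact: Cr.
  by rewrite andbF ffunE update_stay updN; [exact: Cr | exact/eqP].
Qed.

Lemma tm_halts w k p s w' :
  iter k (fstep P) (0, fun=> 0, w) = (p, s, w') ->
  size P <= p <= (size P).+1 ->
  exists t, halts_within tm w t (p == size P).
Proof.
move=> e pP.
have fstep_end c : size P <= c.1.1 -> fstep P c = c.
  by case: c => [[q u] v] /= qP; rewrite nth_default.
have start0 : tm_rel (minit tm w) (0, fun=> 0, w).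
  split=> //=; first by exists [::].
  by move=> r rm; rewrite reg_tapeN0 //; exists 0, 0.
have [t [C1 _ _]] : exists t, tm_rel (iter t (@mstep tm) (minit tm w)) (iter k (fstep P) (0, fun=> 0, w)).
  elim: k {e} => [|k [t IH]]; first by exists 0.
  case: (ltnP (iter k (fstep P) (0, fun=> 0, w)).1.1 (size P)) => pk.
    by have [l H] := tm_step pk IH; exists (l + t); rewrite iterD.
  by exists t; rewrite iterS fstep_end.
exists t; rewrite /halts_within C1 e /= /tm_verdict /= inordK; last by lia.
by case: ltnP => //; lia.
Qed.

End TuringMachine.

Definition jump_of (i : instr) : nat :=
  match i with IInc _ => 0 | IDec _ l | IJmp l | IRead _ l => l end.

Lemma In_cat A (x : A) s t : List.In x (s ++ t) <-> List.In x s \/ List.In x t.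
Proof. by elim: s => [|a s IH] /=; [split=> [|[]]; tauto | rewrite IH; tauto]. Qed.

Lemma In_cons_cat A (a b c x : A) s t : List.In x ((a :: s ++ b :: t) ++ [:: c]) ->
  [\/ x = a, List.In x s, x = b | List.In x t \/ x = c].
Proof.
rewrite In_cat /= In_cat /=; move=> [[->|[H|[->|H]]]|[->|[]]].
- by constructor 1. - by constructor 2. - by constructor 3.
- by constructor 4; left. - by constructor 4; right.
Qed.

Lemma flat_ok c p i : List.In i (flat c p) ->
  reg_of i < maxn 1 (regs c) /\ jump_of i <= p + size (flat c p).
Proof.
elim: c p => [|r|c IHc d IHd|r c IHc|r c IHc d IHd] p //=.
- by case=> // <- /=; lia.
- rewrite In_cat size_cat => -[/IHc|/IHd]; lia.
- by rewrite In_cat size_cat => -[<-|[/IHc|[<-|[]]]] /=; lia.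
- by rewrite In_cat size_cat => -[<-|[/IHc|[<-|/IHd]]] /=; lia.
Qed.

Lemma fstep_jump P p s w B : p < size P -> size P <= B ->
  (forall i, List.In i P -> jump_of i <= B) -> (fstep P (p, s, w)).1.1 <= B.
Proof.
move=> pP PB H; have := H _ (In_nth (IJmp p) pP); rewrite /fstep.
by case: (nth _ _ _) => [r|r l|l|r l] //= jl; [lia|case: (s r) => //=; lia|case: (w) => //=; lia].
Qed.

Lemma fstep_at P p i c s w : code_at P p (i :: c) -> fstep P (p, s, w) =
  match i with
  | IInc r => (p.+1, upd s r (s r).+1, w)
  | IDec r l => if s r is n.+1 then (p.+1, upd s r n, w) else (l, s, w)
  | IJmp l => (l, s, w)
  | IRead r l => if w is b :: w' then (p.+1, upd s r (s r + b), w') else (l, s, w)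
  end.
Proof. by move=> C; rewrite /fstep (code_at_nth _ C). Qed.

Definition term c s s' := exists t, exec c s s' t.

Lemma runs_term c s s' B : runs c s s' B -> term c s s'.
Proof. by case=> t _ e; exists t. Qed.

Lemma term_seq c d s1 s2 s3 : term c s1 s2 -> term d s2 s3 -> term (Seq c d) s1 s3.
Proof. by move=> [t e] [u e']; exists (t + u); exact: exec_seq e e'. Qed.

Lemma term_eq c s s1 s2 : term c s s1 -> s1 =1 s2 -> term c s s2.
Proof. by move=> H /funext <-. Qed.

Definition st0 x : nat -> nat := fun i => if i == 0 then x else 0.

(** [(cp b x).+1] is the code of a list with head [b] and with tail coded by [x], so register 0
    collects the code of the bits read so far, the newest first. *)
Definition read_body := Seq (pair_com 1 0 2 3) (Seq (Inc 1) (Loop 1 (Inc 0))).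

Lemma term_read_body x (b : bool) :
  term read_body (upd (st0 x) 1 b) (st0 (cp b x).+1).
Proof.
apply: term_eq (term_seq (runs_term (runs_pair _ _ _))
  (term_seq (runs_term (runs_inc _ _)) (runs_term (runs_move _ _)))) _ => //.
by move=> z; rewrite /st0; upd_at.
Qed.

(** * Unbounded search by a counter program *)

Section Search.
Variables (F : nat -> nat) (c0 cF cN : com) (B0 BF BN : nat -> nat).
Hypothesis H0 : implements c0 0 5 (fun x => cp x 0) B0.
Hypothesis HF : implements cF 2 5 F BF.
Hypothesis HN : implements cN 0 5 (fun z => cp (unp z).1 (unp z).2.+1) BN.

(** Register 0 holds the pair of the input and the current candidate, register 1 keeps the loop
    alive, register 2 receives the value of [F] and register 3 the verdict; register 4 helps to
    copy. The value 0 means that the search goes on, 1 that it rejects, and a larger value that it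
    accepts. *)
Definition search_body :=
  Seq (Loop 0 (Seq (Inc 2) (Inc 4))) (Seq (Loop 4 (Inc 0)) (Seq cF
    (If 2 (If 2 (Inc 3) Skip) (Seq cN (Inc 1))))).

Definition search_com := Seq c0 (Seq (Inc 1) (Loop 1 search_body)).

Lemma body_found z s : s = upd (st0 z) 1 0 -> F z != 0 ->
  exists s', [/\ term search_body s s', s' 1 = 0 & s' 3 = (1 < F z)].
Proof.
move=> -> Fz.
pose s1 := upd (st0 z) 2 z.
have R1 : term (Seq (Loop 0 (Seq (Inc 2) (Inc 4))) (Loop 4 (Inc 0))) (upd (st0 z) 1 0) s1.
  apply: term_eq (term_seq (runs_term (runs_copy _ _ _ _)) (runs_term (runs_move _ _))) _ => //.
  by move=> y; rewrite /s1 /st0; upd_at.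
have R2 : term cF s1 (upd s1 2 (F z)).
  by apply: runs_term (HF _) => j; rewrite /s1 /st0; upd_at; case: j.
have [s' R3 [s'1 s'3]] : exists2 s', term (If 2 (If 2 (Inc 3) Skip) (Seq cN (Inc 1))) (upd s1 2 (F z)) s' &
    s' 1 = 0 /\ s' 3 = (1 < F z).
  case: (F z) Fz => [|[|k]] // _.
    eexists; first by exists 0; apply: (@exec_ifS _ _ _ 0) => //; apply: exec_if0 => //; exact: exec_skip.
    by [].
  eexists; first by exists 1; apply: (@exec_ifS _ _ _ k.+1) => //; apply: (@exec_ifS _ _ _ k) => //; exact: exec_inc.
  by [].
exists s'; split=> //; have := term_seq R1 (term_seq R2 R3); case=> t H.
have : runs (Seq (Seq (Loop 0 (Seq (Inc 2) (Inc 4))) (Loop 4 (Inc 0))) (Seq cF (If 2 (If 2 (Inc 3) Skip) (Seq cN (Inc 1))))) (upd (st0 z) 1 0) s' t by exists t.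
by move=> /runs_seqA/runs_term.
Qed.

Lemma body_next z s : s = upd (st0 z) 1 0 -> F z = 0 ->
  term search_body s (upd (st0 (cp (unp z).1 (unp z).2.+1)) 1 1).
Proof.
move=> -> Fz.
pose s1 := upd (st0 z) 2 z.
have R1 : term (Seq (Loop 0 (Seq (Inc 2) (Inc 4))) (Loop 4 (Inc 0))) (upd (st0 z) 1 0) s1.
  apply: term_eq (term_seq (runs_term (runs_copy _ _ _ _)) (runs_term (runs_move _ _))) _ => //.
  by move=> y; rewrite /s1 /st0; upd_at.
have R2 : term cF s1 (st0 z).
  apply: term_eq (runs_term (HF _)) _ => [j|y]; first by rewrite /s1 /st0; upd_at; case: j.
  by rewrite {2}/s1 updE Fz /s1 /st0; upd_at.
have R3 : term (Seq cN (Inc 1)) (st0 z) (upd (st0 (cp (unp z).1 (unp z).2.+1)) 1 1).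
  apply: term_eq (term_seq (runs_term (HN _)) (runs_term (runs_inc _ _))) _ => [j|y].
    by rewrite /st0; case: j.
  by rewrite /st0; upd_at.
have [t H] : term (If 2 (If 2 (Inc 3) Skip) (Seq cN (Inc 1))) (st0 z) (upd (st0 (cp (unp z).1 (unp z).2.+1)) 1 1).
  by case: R3 => t e; exists t; apply: exec_if0.
have [u K] := term_seq R1 (term_seq R2 (ex_intro _ t H)).
have : runs (Seq (Seq (Loop 0 (Seq (Inc 2) (Inc 4))) (Loop 4 (Inc 0))) (Seq cF (If 2 (If 2 (Inc 3) Skip) (Seq cN (Inc 1))))) (upd (st0 z) 1 0) (upd (st0 (cp (unp z).1 (unp z).2.+1)) 1 1) u by exists u.
by move=> /runs_seqA/runs_term.
Qed.

Lemma search_loop x N n : n <= N -> F (cp x N) != 0 ->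
  exists n' s, [/\ F (cp x n') != 0, term (Loop 1 search_body) (upd (st0 (cp x n)) 1 1) s &
    s 3 = (1 < F (cp x n'))].
Proof.
have dec z : upd (upd (st0 z) 1 1) 1 0 = upd (st0 z) 1 0 by apply: funext; upd_lia.
move=> nN FN; move E: (N - n) => d; elim: d n nN E => [|d IH] n nN E.
  have nE : n = N by lia.
  rewrite nE; have [s [[t R] s1 s3]] := body_found (dec (cp x N)) FN.
  exists N, s; split=> //; exists (t + 0).
  by apply: (@exec_loopS _ _ 0) R _ => //; exact: exec_loop0.
case: (eqVneq (F (cp x n)) 0) => [F0|Fn].
  have [t R] := body_next (dec (cp x n)) F0.
  move: R; rewrite unp_cp /= => R.
  have [||n' [s [Fn' [u R'] s3]]] := IH n.+1; [by lia..|].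
  exists n', s; split=> //; exists (t + u).
  by apply: (@exec_loopS _ _ 0) R R'.
have [s [[t R] s1 s3]] := body_found (dec (cp x n)) Fn.
exists n, s; split=> //; exists (t + 0).
by apply: (@exec_loopS _ _ 0) R _ => //; exact: exec_loop0.
Qed.

Lemma search_term x N : F (cp x N) != 0 ->
  exists n s, [/\ F (cp x n) != 0, term search_com (st0 x) s & s 3 = (1 < F (cp x n))].
Proof.
move=> FN; have [n [s [Fn R s3]]] := search_loop (leq0n N) FN.
exists n, s; split=> //.
have R0 : term c0 (st0 x) (st0 (cp x 0)).
  apply: term_eq (runs_term (H0 _)) _ => [[|j]//|y].
  by rewrite /st0; upd_at.
apply: term_seq R0 (term_seq _ R).
by apply: term_eq (runs_term (runs_inc _ _)) _.
Qed.

Let fr := flat read_body 1.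
Let e := (size fr).+2.
Let fm := flat search_com e.
Let P0 := IRead 1 e :: fr ++ IJmp 0 :: fm.
(** The last instruction turns the verdict into a halting position: a nonzero register 3 falls
    through to the accepting one, and zero jumps one further to the rejecting one. *)
Definition search_code := P0 ++ [:: IDec 3 (size P0).+2].
Definition search_regs := maxn 5 (maxn (regs read_body) (regs search_com)).

Lemma size_P0 : size P0 = e + size fm.
Proof.
rewrite /P0 (_ : size (_ :: _) = (size (fr ++ IJmp 0 :: fm)).+1) // size_cat /e.
Qed.

Lemma code_read : code_at search_code 0 (IRead 1 e :: fr ++ [:: IJmp 0]).
Proof.
by exists [::], (fm ++ [:: IDec 3 (size P0).+2]); rewrite /search_code /P0 /= -!catA.
Qed.

Lemma code_main : code_at search_code e fm.
Proof.
exists (IRead 1 e :: fr ++ [:: IJmp 0]), [:: IDec 3 (size P0).+2].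
by rewrite /search_code /P0 /= -!catA size_cat /= /e; split; rewrite // addn1.
Qed.

Lemma read_phase w x : exists k, iter k (fstep search_code) (0, st0 x, w) =
  (e, st0 (foldl (fun acc b => (cp (b : bool) acc).+1) x w), [::]).
Proof.
elim: w x => [|b w IH] x.
  by exists 1; rewrite iterS (fstep_at _ _ code_read).
have [k E] := IH (cp b x).+1.
have [t R] := term_read_body x b.
have [[k1 [E1 _]] _] := exec_fruns w R (leqnn _)
  (code_at_catl (code_at_cons code_read)).
exists (k + (1 + (k1 + 1))); rewrite !iterD -[iter 1 _ (0, _, _)]/(fstep _ _) (fstep_at _ _ code_read).
have -> : st0 x 1 + b = b by [].
by rewrite E1 -[iter 1 _ _]/(fstep _ _) (fstep_at _ _ (code_at_catr (code_at_cons code_read))).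
Qed.

Lemma fr_ok i : List.In i fr -> reg_of i < maxn 1 (regs read_body) /\ jump_of i <= 1 + size fr.
Proof. exact: flat_ok. Qed.

Lemma fm_ok i : List.In i fm -> reg_of i < maxn 1 (regs search_com) /\ jump_of i <= e + size fm.
Proof. exact: flat_ok. Qed.

Lemma search_regP i : List.In i search_code -> reg_of i < search_regs.
Proof.
move=> iI; case: (In_cons_cat (iI : List.In i ((IRead 1 e :: fr ++ IJmp 0 :: fm) ++ [:: _])))
  => [->|/fr_ok[H _]|->|[/fm_ok[H _]|->]]; rewrite /search_regs.
- by rewrite leq_max.
- by apply: (leq_trans H); move: (regs search_com) (regs read_body) => a b; lia.
- by rewrite leq_max.
- by apply: (leq_trans H); move: (regs search_com) (regs read_body) => a b; lia.
- by rewrite leq_max.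
Qed.

Lemma search_jumpP p s w : p < size search_code ->
  (fstep search_code (p, s, w)).1.1 <= (size search_code).+1.
Proof.
move=> pP; apply: fstep_jump => // i; rewrite size_cat addn1 -/fr -/fm.
have sP := size_P0.
move=> iI; case: (In_cons_cat (iI : List.In i ((IRead 1 e :: fr ++ IJmp 0 :: fm) ++ [:: _])))
  => [->|/fr_ok[_ H]|->|[/fm_ok[_ H]|->]] //; rewrite ?[jump_of (IRead _ _)]/e sP;
  move: H; rewrite /e; move: (size fr) (size fm) => a b; lia.
Qed.

Lemma search_tm w N :
  let x := foldl (fun acc b => (cp (b : bool) acc).+1) 0 w in
  F (cp x N) != 0 ->
  exists n t, F (cp x n) != 0 /\ halts_within (tm search_code search_regs) w t (1 < F (cp x n)).
Proof.
move=> x FN; have [n [s [Fn [t R] s3]]] := search_term FN.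
exists n.
have [k1 E1] := read_phase w 0.
have [[k2 [E2 _]] _] := exec_fruns [::] R (leqnn _) code_main.
have cE : code_at search_code (size P0) [:: IDec 3 (size P0).+2].
  by exists P0, [::]; rewrite cats0.
have sE : size search_code = (size P0).+1 by rewrite /search_code size_cat addn1.
have E : iter (1 + (k2 + k1)) (fstep search_code) (0, fun=> 0, w) =
    (if 1 < F (cp x n) then (size P0).+1 else (size P0).+2,
     if 1 < F (cp x n) then upd s 3 0 else s, [::]).
  rewrite !iterD; have -> : (fun=> 0) = st0 0 by apply: funext => -[].
  rewrite E1 -/x E2 -/fm -size_P0 -[iter 1 _ _]/(fstep _ _) (fstep_at _ _ cE) s3.
  by case: (1 < _).
have [|t' H] := tm_halts search_regP search_jumpP E.
  by rewrite sE; case: ifP; lia.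
by exists t'; split=> //; move: H; rewrite sE; case: ifP => _; rewrite ?eqxx // gtn_eqF.
Qed.

End Search.

(** A conclusive answer of [chk] is right no matter which number produced it, so it suffices that
    the search meets one of them. *)
Lemma search_decidable (Pb : problem) (chk : seq bool * nat -> nat) :
  prf chk ->
  (forall i : instance Pb, exists n, chk (code i, n) != 0) ->
  (forall (i : instance Pb) n, chk (code i, n) != 0 -> ((1 < chk (code i, n)) <-> holds i)) ->
  decidable_problem Pb.
Proof.
move=> pchk ex ok.
(* Reading leaves the last bit outermost, hence the reversal. *)
have [F pF FE] : prf (fun z : seq bool * nat => chk (rev z.1, z.2)).
  by apply: (prf_comp pchk); apply: prf_pair; [apply: prf_rev|]; repeat prf_base.
have [BF _ HF] := pr_implements pF; have [cF {}HF] := HF 2 5 isT.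
have [B0 _ H0] := pr_implements (pr_pair pr_id pr_zero); have [c0 {}H0] := H0 0 5 isT.
have [BN _ HN] := pr_implements (pr_pair pr_fst (pr_comp pr_succ pr_snd)); have [cN {}HN] := HN 0 5 isT.
exists (tm (search_code c0 cF cN) (search_regs c0 cF cN)) => i.
have xE w : foldl (fun acc b => (cp (b : bool) acc).+1) 0 w = enc (rev w).
  rewrite /rev; have -> : 0 = enc ([::] : seq bool) by [].
  by elim: w [::] => //= b w IH v; rewrite -IH.
have FEi n : F (cp (enc (rev (code i))) n) = chk (code i, n).
  by have := FE (rev (code i), n); rewrite /= revK.
have [N HNi] := ex i.
have [|n [t [Fn H]]] := search_tm H0 HF HN (w := code i) (N := N).
  by rewrite xE FEi.
exists t, (1 < chk (code i, n)); split; first by move: H; rewrite xE FEi.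
by apply: ok; move: Fn; rewrite xE FEi.
Qed.

(** * Primitive recursive simulation of Turing machines *)

(** The index list is fixed outside the coded data, so each entry may come with a function of its
    own and no uniformity in [i] is required. *)
Lemma prf_constlist G (cG : coded G) T (cT : coded T) I (L : seq I) (F : I -> G -> T) :
  (forall i, prf (F i)) -> prf (fun x => [seq F i x | i <- L]).
Proof.
move=> pF; elim: L => [|i L IH] /=; first exact: prf_const.
exact: prf_cons (pF i) IH.
Qed.

Lemma primrec_prf n (f : n.-tuple nat -> nat) :
  primrec f -> prf (fun s : seq nat => f [tuple nth 0 s i | i < n]).
Proof.
elim=> {n f}.
- by move=> n; exact: prf_const.
- apply: (@prf_ext _ _ _ _ (fun s => (nth 0 s 0).+1)); last by prf_auto.
  by move=> s; rewrite /thead tnth_mktuple.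
- move=> n i; apply: (@prf_ext _ _ _ _ (fun s => nth 0 s i)).
    by move=> s; rewrite tnth_mktuple.
  by apply: prf_nth; [exact: prf_id | exact: prf_const].
- move=> m n f g _ pf _ pg.
  apply: (@prf_ext _ _ _ _ (fun s => f [tuple nth 0 [seq g i [tuple nth 0 s j | j < n] | i <- enum 'I_m] k | k < m])).
    move=> s; congr (f _); apply: eq_from_tnth => k.
    by rewrite !tnth_mktuple (nth_map k) ?size_enum_ord // nth_ord_enum.
  apply: (prf_comp pf); apply: prf_constlist => i; exact: pg.
- move=> n f g _ pf _ pg.
  (* Primitive recursion hands the index of the turn to [g], while [iter] does not; the iterated
     pair counts the turns itself. *)
  pose st (s : seq nat) (p : nat * nat) :=
    (p.1.+1, g [tuple nth 0 (p.1 :: p.2 :: behead s) i | i < n.+2]).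
  apply: (@prf_ext _ _ _ _ (fun s => (iter (nth 0 s 0) (st s)
     (0, f [tuple nth 0 (behead s) i | i < n])).2)).
    move=> s; rewrite [thead _]tnth_mktuple.
    have tE : [tuple of behead [tuple nth 0 s i | i < n.+1]] = [tuple nth 0 (behead s) i | i < n].
      apply: eq_from_tnth => i; rewrite tnth_behead !tnth_mktuple nth_behead.
      by rewrite inordK //= ltnS.
    rewrite tE; move: (nth 0 s 0) => m.
    suff -> : iter m (st s) (0, f [tuple nth 0 (behead s) i | i < n]) = (m, iteri m (fun k r : nat =>
        g [tuple of k :: r :: [tuple nth 0 (behead s) i | i < n]]) (f [tuple nth 0 (behead s) i | i < n])) by [].
    elim: m => //= m ->; rewrite /st /=; congr (_, g _); apply: eq_from_tnth => i.
    rewrite tnth_mktuple (tnth_nth 0) /=; case: i => [[|[|i]] //= lti].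
    by have /= -> := nth_mktuple (fun i : 'I_n => nth 0 (behead s) i) 0 (Ordinal (lti : i < n)).
  apply: prf_snd; apply: prf_iter.
  + by apply: prf_nth; [exact: prf_id | exact: prf_const].
  + apply: prf_pair; first by apply: prf_S; repeat prf_base.
    by apply: (prf_comp pg); prf_auto.
  + apply: prf_pair; first exact: prf_const.
    by apply: (prf_comp pf); prf_auto.
Qed.

Lemma primrec1_prf f : primrec1 f -> prf f.
Proof.
move=> [F /primrec_prf pF fE]; apply: (@prf_ext _ _ _ _ (fun n => F [tuple nth 0 [:: n] i | i < 1])).
  move=> n; rewrite fE; congr (F _); apply: eq_from_tnth => i.
  by rewrite tnth_mktuple (tnth_nth 0); case: i => -[].
by apply: (prf_comp pF); prf_auto.
Qed.

Lemma code_natE n : code_nat n =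
  if n is 0 then [:: false] else true :: odd n :: code_nat n./2.
Proof.
rewrite /code_nat; case E: n => [|k] //; rewrite -E.
have H p : code_pos p = true :: odd (nat_of_pos p) ::
    (if bin_of_nat (nat_of_pos p)./2 is Npos q then code_pos q else [:: false]).
  have K q : bin_of_nat (nat_of_pos q) = Npos q by exact: (can_inj nat_of_binK (bin_of_natK _) : _ = _) || exact: nat_of_binK (Npos q).
  case: p => [p|p|] //=; rewrite natTrecE ?doubleK ?oddS ?odd_double ?uphalf_double K //.
have := bin_of_natK n; case: (bin_of_nat n) => [|p] /=; [by rewrite E | move=> <-].
exact: H.
Qed.

Definition code_nat_step (p : nat * seq bool) :=
  if p.1 == 0 then p else (p.1./2, p.2 ++ [:: true; odd p.1]).

Lemma code_nat_iter n : code_nat n = (iter n code_nat_step (n, [::])).2 ++ [:: false].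
Proof.
suff H m k s : k <= m -> (iter m code_nat_step (k, s)).2 ++ [:: false] = s ++ code_nat k.
  by rewrite (H n n [::]).
elim: m k s => [|m IH] k s km.
  by move: km; rewrite leqn0 => /eqP ->.
rewrite iterSr /code_nat_step /=; case: eqP => [->|/eqP k0].
  by rewrite IH.
rewrite IH; last by lia.
by rewrite -catA [in RHS]code_natE; case: k k0 {km}.
Qed.

Lemma prf_code_nat G (cG : coded G) (f : G -> nat) : prf f -> prf (fun x => code_nat (f x)).
Proof.
move=> pf; apply: (@prf_ext _ _ _ _ (fun x => (iter (f x) (fun p => code_nat_step p) (f x, [::])).2 ++ [:: false])).
  by move=> x; rewrite code_nat_iter.
by rewrite /code_nat_step; prf_auto.
Qed.

Section Simulation.
Variable M : machine.
Local Notation n := (ntapes M).+1.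
Local Notation W := (work M).

Definition tapeT := (seq nat * nat * seq nat)%type.
Definition configT := (nat * seq tapeT)%type.

Definition rank_cell (a : cell W) : nat := enum_rank a.
Definition blank : nat := rank_cell None.
Definition rank_state (q : state M) : nat := enum_rank q.

Definition enc_tape (t : tape W) : tapeT :=
  ([seq rank_cell a | a <- t.1.1], rank_cell t.1.2, [seq rank_cell a | a <- t.2]).

Definition enc_config (c : mconfig M) : configT :=
  (rank_state c.1, [seq enc_tape (c.2 i) | i <- enum 'I_n]).

Definition tape0 : tapeT := ([::], blank, [::]).

Definition update_tapeT (a : nat) (m : move) (t : tapeT) : tapeT :=
  match m with
  | MoveLeft => (behead t.1.1, head blank t.1.1, a :: t.2)
  | Stay => (t.1.1, a, t.2)
  | MoveRight => (a :: t.1.1, head blank t.2, behead t.2)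
  end.

Definition key := (state M * {ffun 'I_n -> cell W})%type.

Definition matches (k : key) (c : configT) : bool :=
  (c.1 == rank_state k.1) && ([seq t.1.2 | t <- c.2] == [seq rank_cell (k.2 i) | i <- enum 'I_n]).

Definition result (k : key) (c : configT) : configT :=
  if verdict k.1 is Some _ then c else
  (rank_state (delta k.1 k.2).1,
   [seq update_tapeT (rank_cell ((delta k.1 k.2).2 i).1) ((delta k.1 k.2).2 i).2 (nth tape0 c.2 (i : nat))
      | i <- enum 'I_n]).

(** The machine is fixed, so its transition function is a finite table. The fold is a nest of
    conditionals with one constant row per branch. *)
Definition sim_step (c : configT) : configT :=
  foldr (fun k acc => if matches k c then result k c else acc) c (enum {: key}).

Lemma rank_cell_inj : injective rank_cell.
Proof. by move=> a b /val_inj/enum_rank_inj. Qed.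

Lemma rank_state_inj : injective rank_state.
Proof. by move=> a b /val_inj/enum_rank_inj. Qed.

Lemma nth_tapes (c : mconfig M) (i : 'I_n) :
  nth tape0 [seq enc_tape (c.2 j) | j <- enum 'I_n] i = enc_tape (c.2 i).
Proof. by rewrite (nth_map i) ?size_enum_ord // nth_ord_enum. Qed.

Lemma sim_stepE c : sim_step (enc_config c) = enc_config (mstep c).
Proof.
pose k0 : key := (c.1, [ffun i => head_cell (c.2 i)]).
have mE k : matches k (enc_config c) = (k == k0).
  rewrite /matches /enc_config /= -map_comp; apply/andP/eqP => [[/eqP/rank_state_inj e /eqP h]|->].
    case: k e h => q v /= <- h; congr pair; apply/ffunP => i.
    have /= := congr1 (fun s => nth 0 s i) h.
    by rewrite !(nth_map i 0) ?size_enum_ord // nth_ord_enum ffunE /= => /rank_cell_inj.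
  split=> //; apply/eqP; apply: eq_map => i /=; rewrite ffunE //.
have -> : sim_step (enc_config c) = result k0 (enc_config c).
  rewrite /sim_step; have: k0 \in enum {: key} by rewrite mem_enum.
  by elim: (enum _) => //= k L IH; rewrite inE mE eq_sym; case: eqP => [-> //|_ /IH].
rewrite /result /mstep /=; case: (verdict c.1) => //.
case: (delta _ _) => q u; rewrite /enc_config /=; congr pair; apply: eq_map => i.
rewrite nth_tapes; case: (c.2 i) => [[l a] r]; case: (u i) => b [] //=.
  by case: l. by case: r.
Qed.

Lemma prf_update_tapeT a m : prf (update_tapeT a m).
Proof. by case: m; rewrite /update_tapeT; prf_auto. Qed.

Lemma prf_sim_step : prf sim_step.
Proof.
rewrite /sim_step; elim: (enum _) => [|k L IH] /=; first exact: prf_id.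
apply: prf_if => //; first by rewrite /matches; prf_auto.
rewrite /result; case: (verdict k.1) => [_|]; first exact: prf_id.
apply: prf_pair; first exact: prf_const.
apply: prf_constlist => i; apply: prf_comp; first exact: prf_update_tapeT.
by prf_auto.
Qed.

Definition sim_init (w : seq bool) : configT :=
  let s := [seq if b then rank_cell (Some (inl true)) else rank_cell (Some (inl false)) | b <- w] in
  (rank_state (start M), [seq if i == ord0 then ([::], head blank s, behead s) else tape0 | i <- enum 'I_n]).

Lemma sim_initE w : sim_init w = enc_config (minit M w).
Proof.
rewrite /sim_init /enc_config /=; congr pair; apply: eq_map => i; case: eqP => // _.
have -> : [seq if b then rank_cell (Some (inl true)) else rank_cell (Some (inl false)) | b <- w] =
   [seq rank_cell a | a <- [seq Some (inl b) | b <- w]].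
  by rewrite -map_comp; apply: eq_map => -[].
by rewrite /enc_tape /=; case: (w).
Qed.

Lemma prf_sim_init : prf sim_init.
Proof.
rewrite /sim_init; apply: prf_pair; first exact: prf_const.
by apply: prf_constlist => i; case: (i == ord0); prf_auto.
Qed.

Lemma prf_accepts G (cG : coded G) (w : G -> seq bool) (t : G -> nat) : prf w -> prf t ->
  prf (fun x => verdict (iter (t x) (@mstep M) (minit M (w x))).1 == Some true).
Proof.
move=> pw pt; apply: (@prf_ext _ _ _ _ (fun x => (iter (t x) (fun c => sim_step c) (sim_init (w x))).1
   \in [seq rank_state q | q <- enum (state M) & verdict q == Some true])).
  move=> x; rewrite sim_initE.
  have -> k c : iter k (fun c => sim_step c) (enc_config c) = enc_config (iter k (@mstep M) c).
    by elim: k => //= k ->; rewrite sim_stepE.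
  rewrite /enc_config /= mem_map; last exact: rank_state_inj.
  by rewrite mem_filter mem_enum andbT.
apply: prf_mem; last exact: prf_const.
apply: prf_fst; apply: prf_iter => //; first by apply: (prf_comp prf_sim_step); repeat prf_base.
exact: (prf_comp prf_sim_init).
Qed.

End Simulation.

(** * Counter machines with spurious increments *)

(** The value of the stack with [f i] copies of level [i < j] on top of the
    argument [n]: the Ackermann functions are evaluated from level 0 upwards. *)
Fixpoint VV (f : nat -> nat) (j n : nat) : nat :=
  if j is i.+1 then iter (f i) (ack i) (VV f i n) else n.

Lemma iter_ack_le k c x y : x <= y -> iter c (ack k) x <= iter c (ack k) y.
Proof. by move=> xy; elim: c => //= c IH; rewrite ack_le. Qed.

Lemma iter_ack_gap k c d x e : iter c (ack k) x + (d + e) <= iter (d + c) (ack k) (x + e).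
Proof.
have H1 m y : y + m <= iter m (ack k) y.
  elim: m => [|m IH] /=; first by rewrite addn0.
  by have := ltn_ack k (iter m (ack k) y); lia.
have H2 : iter c (ack k) x + e <= iter c (ack k) (x + e).
  elim: e => [|e IH]; first by rewrite !addn0.
  suff : iter c (ack k) (x + e) < iter c (ack k) (x + e.+1) by lia.
  by rewrite addnS; elim: (c) => //= m; rewrite ack_lt.
rewrite iterD; have := H1 d (iter c (ack k) (x + e)); lia.
Qed.

(** [ack] is strictly increasing and lies above the identity, so every additional copy of a level
    and every additional unit of the argument raises the value by at least one. This is what makes
    spurious tokens visible. *)
Lemma VV_gap f g j n n' : (forall i, i < j -> f i <= g i) -> n <= n' ->
  VV f j n + (\sum_(i < j) (g i - f i) + (n' - n)) <= VV g j n'.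
Proof.
elim: j => [|j IH] fg nn; first by rewrite big_ord0 /=; lia.
rewrite big_ord_recr /=.
have {}IH := IH (fun i ij => fg i (leqW ij)) nn.
set e := \sum_(i < j) _ + _ in IH.
have := iter_ack_gap j (f j) (g j - f j) (VV f j n) e.
rewrite subnK; last exact: fg.
move=> /leq_trans /(_ (iter_ack_le _ _ IH)); rewrite /e.
by rewrite [g j - _ + _]addnA [g j - _ + _]addnC.
Qed.

Lemma VV0 f j n : (forall i, i < j -> f i = 0) -> VV f j n = n.
Proof.
elim: j => //= j IH H; rewrite (H j) //=.
by apply: IH => i ij; apply: H; exact: leqW.
Qed.

(** The levels from [i] on apply the same monotone map on both sides; a rule of the machine has to
    be examined only at the levels that it changes. *)
Lemma VV_tail f g i j n n' : i <= j -> (forall l, i <= l < j -> f l = g l) ->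
  VV f i n <= VV g i n' -> VV f j n <= VV g j n'.
Proof.
move=> ij; rewrite -(subnK ij); elim: (j - i) => [|d IH] fg H //.
rewrite addSn /= (fg (d + i)); last by lia.
by apply: iter_ack_le; apply: IH => // l Hl; apply: fg; lia.
Qed.

Lemma leq_iter_ack1 k m : m < iter m (ack k) 1.
Proof. by elim: m => //= m IH; apply: leq_ltn_trans IH (ltn_ack _ _). Qed.

Section Machine.
Variables (k m x : nat) (P : seq instr).

(** [ca j] counts the copies of level [j] on the stack and [rg j] is a register of the program. [cn]
    is the argument of the stack and, while the program is simulated, the reserve from which
    increments are drawn. *)
Definition counter : finType := option ('I_k.+1 + 'I_m.+1)%type.
Definition cn : counter := None.
Definition ca (j : nat) : counter := Some (inl (inord j)).
Definition rg (j : nat) : counter := Some (inr (inord j)).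

Definition control : finType :=
  ((bool * bool) + ((bool + (bool * 'I_k)) + 'I_(size P).+1))%type.
Definition q_load : control := inl (false, false).
Definition q_clean : control := inl (false, true).
Definition q_unload : control := inl (true, false).
Definition q_end : control := inl (true, true).
Definition q_main (b : bool) : control := inr (inl (inl b)).
Definition q_shift (b : bool) (i : 'I_k) : control := inr (inl (inr (b, i))).
Definition q_sim (p : nat) : control := inr (inr (inord p)).

Definition below (i : nat) : {set counter} :=
  [set c : counter | if (c : option ('I_k.+1 + 'I_m.+1)) is Some (inl j) then j < i else false].

(** In [rule q Z D N q'], the counters in [Z] are tested for zero, then one unit
    of each counter in [D] is removed and one unit of each counter in [N] is
    added.  The rules on [q_main b] and [q_shift b i] evaluate the stack with
    [u (ca i)] copies of level [i] on top of [u cn], forwards and backwards: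
    [q_shift b i] converts between [u cn] and [u (ca i)]. *)
Inductive rule : control -> {set counter} -> {set counter} -> {set counter} -> control -> Prop :=
| r_load : rule q_load finset.set0 finset.set0 [set cn; rg 0] q_load
| r_go : rule q_load finset.set0 finset.set0 [set ca k] (q_main false)
| r_inc b : rule (q_main b) finset.set0 [set ca 0] [set cn] (q_main b)
| r_dec b : rule (q_main b) finset.set0 [set cn] [set ca 0] (q_main b)
| r_enter b (i : 'I_k) : rule (q_main b) (below i.+1) [set ca i.+1] [set cn] (q_shift b i)
| r_unenter b (i : 'I_k) : rule (q_shift b i) (below i.+1) [set cn] [set ca i.+1] (q_main b)
| r_in b (i : 'I_k) : rule (q_shift b i) finset.set0 [set cn] [set ca i] (q_shift b i)
| r_out b (i : 'I_k) : rule (q_shift b i) finset.set0 [set ca i] [set cn] (q_shift b i)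
| r_exit b (i : 'I_k) : rule (q_shift b i) (cn |: below i) finset.set0 [set cn] (q_main b)
| r_unexit b (i : 'I_k) : rule (q_main b) (below i) [set cn] finset.set0 (q_shift b i)
| r_start : rule (q_main false) (below k.+1) finset.set0 finset.set0 (q_sim 0)
| r_siminc p r : p < size P -> nth (IJmp p) P p = IInc r ->
    rule (q_sim p) finset.set0 [set cn] [set rg r] (q_sim p.+1)
| r_simdec p r l : p < size P -> nth (IJmp p) P p = IDec r l ->
    rule (q_sim p) finset.set0 [set rg r] [set cn] (q_sim p.+1)
| r_simzero p r l : p < size P -> nth (IJmp p) P p = IDec r l ->
    rule (q_sim p) [set rg r] finset.set0 finset.set0 (q_sim l)
| r_simjmp p l : p < size P -> nth (IJmp p) P p = IJmp l ->
    rule (q_sim p) finset.set0 finset.set0 finset.set0 (q_sim l)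
| r_accept : rule (q_sim (size P)) finset.set0 [set rg 0] [set cn] q_clean
| r_clean j : rule q_clean finset.set0 [set rg j] [set cn] q_clean
| r_restore : rule q_clean finset.set0 [set cn] [set rg 0] q_clean
| r_done : rule q_clean (below k.+1) finset.set0 finset.set0 (q_main true)
| r_stop : rule (q_main true) finset.set0 [set ca k; cn; rg 0] finset.set0 q_unload
| r_unload : rule q_unload finset.set0 [set cn; rg 0] finset.set0 q_unload
| r_end : rule q_unload finset.setT finset.set0 finset.set0 q_end.

Definition middle (q : control) : bool :=
  (q != q_load) && (q != q_unload) && (q != q_end).

Definition tots (u : counter -> nat) := \sum_(j < m.+1) u (Some (inr j)).

Definition lev (u : counter -> nat) (j : nat) := u (ca j).

(** In [q_shift b i] the conversion [ack i.+1 n = iter n.+1 (ack i) 1] is halfway done: the units of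
    [cn] count as copies of level [i], and the argument of the stack is [1]. Outside the evaluation
    states the potential is the number of tokens. *)
Definition phi (q : control) (u : counter -> nat) : nat :=
  tots u +
  match q with
  | inr (inl (inl _)) => VV (lev u) k.+1 (u cn)
  | inr (inl (inr (_, i))) => VV (fun j => lev u j + (j == i) * u cn) k.+1 1
  | _ => u cn + \sum_(j < k.+1) lev u j
  end.

Lemma ca_eq i j : i <= k -> j <= k -> (ca i == ca j) = (i == j).
Proof.
move=> ik jk; apply/eqP/eqP => [[]|-> //].
by move=> /(congr1 val); rewrite /= !inordK.
Qed.

Lemma rg_eq i j : i <= m -> j <= m -> (rg i == rg j) = (i == j).
Proof.
move=> ik jk; apply/eqP/eqP => [[]|-> //].
by move=> /(congr1 val); rewrite /= !inordK.
Qed.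

Lemma ca_cn i : (ca i == cn) = false. Proof. by []. Qed.
Lemma cn_ca i : (cn == ca i) = false. Proof. by []. Qed.
Lemma rg_cn i : (rg i == cn) = false. Proof. by []. Qed.
Lemma cn_rg i : (cn == rg i) = false. Proof. by []. Qed.
Lemma ca_rg i j : (ca i == rg j) = false. Proof. by []. Qed.
Lemma rg_ca i j : (rg i == ca j) = false. Proof. by []. Qed.
Definition ctE := (ca_cn, cn_ca, rg_cn, cn_rg, ca_rg, rg_ca, eqxx).

Lemma in_below i j : j <= k -> (ca j \in below i) = (j < i).
Proof. by move=> jk; rewrite inE /= inordK. Qed.

Lemma counterP (c : counter) :
  [\/ c = cn, exists2 j, j <= k & c = ca j | exists2 j, j <= m & c = rg j].
Proof.
case: c => [[i|j]|]; last by constructor 1.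
  by constructor 2; exists i; [rewrite -ltnS | rewrite /ca inord_val].
by constructor 3; exists j; [rewrite -ltnS | rewrite /rg inord_val].
Qed.

(** Every counter contributes at least one per token, by [VV_gap] where the stack is evaluated, so
    equal potentials leave no room for a surplus in any counter. *)
Lemma phi_gap q u v : (forall c, u c <= v c) ->
  phi q u <= phi q v /\ (middle q -> phi q v <= phi q u -> u =1 v).
Proof.
move=> uv.
have tE : tots v = tots u + \sum_(j < m.+1) (v (rg j) - u (rg j)).
  rewrite /tots -big_split /=; apply: eq_bigr => j _; rewrite /rg inord_val subnKC //.
have fin (d : nat) : v cn - u cn <= d -> (forall j, j <= k -> v (ca j) - u (ca j) <= d) ->
    \sum_(j < m.+1) (v (rg j) - u (rg j)) + d = 0 -> u =1 v.
  move=> dn da /eqP; rewrite addn_eq0 => /andP[s0 /eqP d0] c.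
  case: (counterP c) => [->|[j jk ->]|[j jm ->]].
  - by have := uv cn; lia.
  - by have := uv (ca j); have := da j jk; lia.
  - move: s0; rewrite sum_nat_eq0 => /forallP/(_ (inord j)); rewrite /= inordK // => /eqP.
    by have := uv (rg j); lia.
have le_sum (f g : nat -> nat) j : j <= k -> g j - f j <= \sum_(i < k.+1) (g i - f i).
  by move=> jk; rewrite (bigD1 (inord j)) //= inordK // leq_addr.
rewrite /phi tE; case: q => [q|[[b|[b i]]|p]].
- have sE : \sum_(j < k.+1) lev v j = \sum_(j < k.+1) lev u j + \sum_(j < k.+1) (lev v j - lev u j).
    by rewrite -big_split /=; apply: eq_bigr => j _; rewrite subnKC //; exact: uv.
  split=> [|_ H]; first by have := uv cn; lia.
  apply: (fin (v cn - u cn + \sum_(j < k.+1) (lev v j - lev u j))); try by have := uv cn; lia.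
  by move=> j jk; have := le_sum (lev u) (lev v) j jk; rewrite /lev; lia.
- have := @VV_gap (lev u) (lev v) k.+1 (u cn) (v cn) (fun i _ => uv _) (uv cn).
  set D := (_ + (v cn - u cn)) => H.
  split=> [|_ H']; first by lia.
  apply: (fin D); try by rewrite /D; lia.
  by move=> j jk; have := le_sum (lev u) (lev v) j jk; rewrite /D /lev; lia.
- set f := fun j => lev u j + _; set g := fun j => lev v j + _.
  have fg j : f j <= g j by rewrite /f /g leq_add ?leq_mul //; exact: uv.
  have := @VV_gap f g k.+1 1 1 (fun i _ => fg i) (leqnn _).
  set D := (_ + (1 - 1)) => H.
  split=> [|_ H']; first by lia.
  apply: (fin D); try by rewrite /D; lia.
    have := le_sum f g i (ltnW (ltn_ord i)); rewrite /D /f /g eqxx /=.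
    by have := uv (ca i); have := uv cn; rewrite /lev; lia.
  move=> j jk; have := le_sum f g j jk; rewrite /D /f /g.
  by have := uv (ca j); have := uv cn; rewrite /lev; case: eqP; lia.
- have sE : \sum_(j < k.+1) lev v j = \sum_(j < k.+1) lev u j + \sum_(j < k.+1) (lev v j - lev u j).
    by rewrite -big_split /=; apply: eq_bigr => j _; rewrite subnKC //; exact: uv.
  split=> [|_ H]; first by have := uv cn; lia.
  apply: (fin (v cn - u cn + \sum_(j < k.+1) (lev v j - lev u j))); try by have := uv cn; lia.
  by move=> j jk; have := le_sum (lev u) (lev v) j jk; rewrite /lev; lia.
Qed.

(** Zero tests are reliable, but tokens may appear from nowhere. In particular a deletion may be
    applied to an empty counter, which [estep] excludes. *)
Definition gstep (Z D N : {set counter}) (u u' : counter -> nat) :=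
  (forall c, c \in Z -> u c = 0) /\ (forall c, u c + (c \in N) <= u' c + (c \in D)).

Definition estep (Z D N : {set counter}) (u u' : counter -> nat) :=
  [/\ forall c, c \in Z -> u c = 0, forall c, c \in D -> 0 < u c &
      forall c, u c + (c \in N) = u' c + (c \in D)].

Definition wr (S : {set counter}) := \sum_(j < m.+1) ((Some (inr j) : counter) \in S).
Definition wa (S : {set counter}) := \sum_(j < k.+1) (ca j \in S).

Lemma wE : [/\ wr finset.set0 = 0, wr [set cn] = 0, forall j, wr [set ca j] = 0 & forall j, wr [set rg j] = 1].
Proof.
split=> [|||j]; rewrite /wr; try by move=> *; apply: big1 => i _; rewrite inE.
rewrite (bigD1 (inord j)) //= inE eqxx big1 // => i /negbTE ij.
rewrite inE; apply/eqP; rewrite eqb0; apply/eqP => -[/eqP]; by rewrite ij.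
Qed.

Lemma waE : [/\ wa finset.set0 = 0, wa [set cn] = 0 & forall j, wa [set rg j] = 0].
Proof. by split=> *; rewrite /wa; apply: big1 => i _; rewrite inE. Qed.

(** Every rule between middle states preserves the potential, with one exception: [r_unexit] at
    [u cn = n] replaces the argument [n] of level [i] by [n.-1] copies of [ack i] on [1], which is
    at least [n] by [leq_iter_ack1]. It reverses [r_exit] when [n = 1]. *)
Lemma phi_rule q Z D N q' u u' : rule q Z D N q' -> middle q -> middle q' ->
  estep Z D N u u' -> phi q u <= phi q' u'.
Proof.
have [w0 wn wa_ wr_] := wE; have [a0 an ar] := waE.
move=> R mq mq' [ZE DE E].
have Er : tots u + wr N = tots u' + wr D.
  by rewrite /tots /wr -!big_split /=; apply: eq_bigr => j _; exact: E.
have Ea : \sum_(j < k.+1) lev u j + wa N = \sum_(j < k.+1) lev u' j + wa D.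
  by rewrite /wa -!big_split /=; apply: eq_bigr => j _; exact: E.
have En := E cn.
have El j : lev u j + (ca j \in N) = lev u' j + (ca j \in D) by exact: E.
have ltW (i : 'I_k) : i <= k by exact: ltnW.
have sums b b' f g n n' : VV f k.+1 n <= VV g k.+1 n' -> tots u = tots u' ->
   b = VV f k.+1 n -> b' = VV g k.+1 n' -> tots u + b <= tots u' + b'.
  by move=> H -> -> ->; rewrite leq_add2l.
clear E; case: R mq mq' ZE DE Er Ea En El => // {q Z D N q'}.
- move=> b _ _ ZE DE Er Ea En El; rewrite !(inE, ctE) /= in En.
  apply: sums _ _ erefl erefl; last by move: Er; rewrite wn wa_; lia.
  apply: (@VV_tail _ _ 1) => [//|l /andP[l0 lk]|] /=.
    by have := El l; rewrite !(inE, ctE) ca_eq //; case: eqP => [e|_] /=; [move: l0; rewrite e | lia].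
  have := El 0; rewrite !(inE, ctE) /=; have iS c n : iter c succn n = c + n by elim: c => //= c ->.
  by rewrite -/ack !iS; lia.
- move=> b _ _ ZE DE Er Ea En El; rewrite !(inE, ctE) /= in En.
  apply: sums _ _ erefl erefl; last by move: Er; rewrite wn wa_; lia.
  apply: (@VV_tail _ _ 1) => [//|l /andP[l0 lk]|] /=.
    by have := El l; rewrite !(inE, ctE) ca_eq //; case: eqP => [e|_] /=; [move: l0; rewrite e | lia].
  have := El 0; rewrite !(inE, ctE) /=; have iS c n : iter c succn n = c + n by elim: c => //= c ->.
  by rewrite -/ack !iS; lia.
- move=> b i _ _ ZE DE Er Ea En El; rewrite !(inE, ctE) /= in En.
  apply: sums _ _ erefl erefl; last by move: Er; rewrite wn wa_; lia.
  have u0 l : l <= i -> lev u l = 0 by move=> li; apply: ZE; rewrite in_below //; have := ltn_ord i; lia.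
  have u'0 l : l <= i -> lev u' l = 0.
    move=> li; have := El l; rewrite u0 // !(inE, ctE) ca_eq; [|by have := ltn_ord i; lia..].
    by have -> : (l == i.+1) = false; [lia | lia].
  apply: (@VV_tail _ _ i.+2) => [|l /andP[il lk]|].
  + by have := ltn_ord i; lia.
  + by have := El l; have := ltn_ord i; rewrite !(inE, ctE) ca_eq; lia.
  + rewrite /= [VV (lev u) i _]VV0; last by move=> l li; apply: u0; lia.
    rewrite VV0 ?(u0 _ (leqnn i)) ?(u'0 _ (leqnn i)) ?eqxx; last first.
      by move=> l li; rewrite u'0; lia.
    have := El i.+1; rewrite !(inE, ctE) /=; have -> : (i.+1 == i :> nat) = false by lia.
    rewrite !addn0 !mul1n add0n => ->; rewrite addn1 iterSr.
    by apply: (@iter_ack_le i.+1); move: En; rewrite addn0 addn1 => <-.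
- move=> b i _ _ ZE DE Er Ea En El; rewrite !(inE, ctE) /= in En.
  apply: sums _ _ erefl erefl; last by move: Er; rewrite wn wa_; lia.
  have u0 l : l <= i -> lev u l = 0 by move=> li; apply: ZE; rewrite in_below //; have := ltn_ord i; lia.
  have u'0 l : l <= i -> lev u' l = 0.
    move=> li; have := El l; rewrite u0 // !(inE, ctE) ca_eq; [|by have := ltn_ord i; lia..].
    by have -> : (l == i.+1) = false; [lia | lia].
  apply: (@VV_tail _ _ i.+2) => [|l /andP[il lk]|].
  + by have := ltn_ord i; lia.
  + by have := El l; have := ltn_ord i; rewrite !(inE, ctE) ca_eq; lia.
  + rewrite /= [VV (lev u') i _]VV0; last by move=> l li; apply: u'0; lia.
    rewrite VV0 ?(u0 _ (leqnn i)) ?(u'0 _ (leqnn i)) ?eqxx; last first.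
      by move=> l li; rewrite u0; lia.
    have := El i.+1; rewrite !(inE, ctE) /=; have -> : (i.+1 == i :> nat) = false by lia.
    rewrite !addn0 !mul1n add0n => <-; rewrite addn1 iterSr.
    by apply: (@iter_ack_le i.+1); move: En; rewrite addn0 addn1 => ->.
- move=> b i _ _ ZE DE Er Ea En El; rewrite !(inE, ctE) /= in En.
  apply: sums _ _ erefl erefl; last by move: Er; rewrite wn wa_; lia.
  apply: (@VV_tail _ _ 0) => [//|l /andP[_ lk]|//].
  have := El l; rewrite !(inE, ctE) ca_eq //=; case: eqP => /=; lia.
- move=> b i _ _ ZE DE Er Ea En El; rewrite !(inE, ctE) /= in En.
  apply: sums _ _ erefl erefl; last by move: Er; rewrite wn wa_; lia.
  apply: (@VV_tail _ _ 0) => [//|l /andP[_ lk]|//].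
  have := El l; rewrite !(inE, ctE) ca_eq //=; case: eqP => /=; lia.
- move=> b i _ _ ZE DE Er Ea En El; rewrite !(inE, ctE) /= in En.
  apply: sums _ _ erefl erefl; last by move: Er; rewrite w0 wn; lia.
  have un : u cn = 0 by apply: ZE; rewrite !(inE, ctE).
  apply: (@VV_tail _ _ 0) => [//|l /andP[_ lk]|] /=; last by lia.
  by have := El l; rewrite !(inE, ctE) un /=; lia.
- move=> b i _ _ ZE DE Er Ea En El; rewrite !(inE, ctE) /= in En.
  apply: sums _ _ erefl erefl; last by move: Er; rewrite w0 wn; lia.
  have un : 0 < u cn by apply: DE; rewrite inE.
  have u0 l : l < i -> lev u l = 0 by move=> li; apply: ZE; rewrite in_below //; have := ltn_ord i; lia.
  have u'E l : lev u' l = lev u l by have := El l; rewrite !(inE, ctE) /=; lia.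
  apply: (@VV_tail _ _ i.+1) => [|l /andP[il lk]|].
  + by have := ltn_ord i; lia.
  + by rewrite u'E; have -> : (l == i) = false; lia.
  + rewrite /= VV0; last by move=> l li; apply: u0; lia.
    rewrite VV0 ?u'E ?eqxx; last first.
      by move=> l li; rewrite u'E u0; [have -> : (l == i) = false; lia | lia].
    rewrite mul1n iterD; apply: iter_ack_le.
    by have := leq_iter_ack1 i (u' cn); lia.
- move=> _ _ ZE DE Er Ea En El; rewrite !(inE, ctE) /= in En.
  rewrite /phi /= -/(VV _ k.+1 _) VV0; last by move=> l lk; apply: ZE; rewrite in_below.
  by move: Er Ea; rewrite w0 a0; lia.
- move=> p r _ _ _ _ ZE DE Er Ea En El; rewrite !(inE, ctE) /= in En.
  by move: Er Ea; rewrite /phi /= wn wr_ an ar; lia.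
- move=> p r l _ _ _ _ ZE DE Er Ea En El; rewrite !(inE, ctE) /= in En.
  by move: Er Ea; rewrite /phi /= wn wr_ an ar; lia.
- move=> p r l _ _ _ _ ZE DE Er Ea En El; rewrite !(inE, ctE) /= in En.
  by move: Er Ea; rewrite /phi /= w0 a0; lia.
- move=> p l _ _ _ _ ZE DE Er Ea En El; rewrite !(inE, ctE) /= in En.
  by move: Er Ea; rewrite /phi /= w0 a0; lia.
- move=> _ _ ZE DE Er Ea En El; rewrite !(inE, ctE) /= in En.
  by move: Er Ea; rewrite /phi /= wn wr_ an ar; lia.
- move=> j _ _ ZE DE Er Ea En El; rewrite !(inE, ctE) /= in En.
  by move: Er Ea; rewrite /phi /= wn wr_ an ar; lia.
- move=> _ _ ZE DE Er Ea En El; rewrite !(inE, ctE) /= in En.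
  by move: Er Ea; rewrite /phi /= wn wr_ an ar; lia.
- move=> _ _ ZE DE Er Ea En El; rewrite !(inE, ctE) /= in En.
  have u0 l : l < k.+1 -> lev u' l = 0.
    by move=> lk; have := El l; rewrite !(inE, ctE) /lev (ZE (ca l)) ?in_below //; lia.
  rewrite /phi /= -/(VV _ k.+1 _) VV0 //.
  rewrite big1; last by move=> j _; apply: ZE; rewrite in_below // -ltnS.
  by move: Er; rewrite w0; lia.
Qed.

Lemma rule_disjoint q Z D N q' c : rule q Z D N q' -> middle q -> c \in Z -> c \notin D.
Proof.
have ltW (i : 'I_k) : i <= k by exact: ltnW.
case=> {q Z D N q'}; intros; match goal with H : is_true (c \in _) |- _ => move: H end;
  case: (counterP c) => [->|[a ak ->]|[a am ->]];
  rewrite !inE ?ctE //= ?ca_eq //= ?inordK //; lia.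
Qed.

Lemma rule_disjointN q Z D N q' c : rule q Z D N q' -> middle q -> c \in D -> c \notin N.
Proof.
have ltW (i : 'I_k) : i <= k by exact: ltnW.
case=> {q Z D N q'}; intros; match goal with H : is_true (c \in _) |- _ => move: H end;
  rewrite !inE // => /eqP ->; rewrite ?ctE //.
Qed.

(** A step with gains is an exact step between two moments of gain, and by [phi_gap] each gain shows
    in the potential. *)
Lemma gain_phi q Z D N q' u u' : rule q Z D N q' -> middle q -> middle q' ->
  gstep Z D N u u' ->
  phi q u <= phi q' u' /\ (phi q' u' <= phi q u -> estep Z D N u u').
Proof.
move=> R mq mq' [ZE E].
(* Gains before the step: exactly the missing tokens that the rule deletes. From [v] the rule
   applies exactly and leads to [w]; the remaining gains lead from [w] to [u']. *)
pose v c := u c + ((c \in D) && (u c == 0)).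
pose w c := v c + (c \in N) - (c \in D).
have vD c : c \in D -> 0 < v c by rewrite /v => ->; case: eqP; lia.
have uv c : u c <= v c by exact: leq_addr.
have vw : estep Z D N v w.
  split=> // c.
    by move=> cZ; rewrite /v ZE // (negbTE (rule_disjoint R mq cZ)).
  by have := vD c; rewrite /w; case: (c \in D) => //= [/(_ isT)|_]; lia.
have wu' c : w c <= u' c.
  have := E c; have := @rule_disjointN _ _ _ _ _ c R mq; rewrite /w /v.
  by case: (c \in D); case: (u c =P 0) => /= [H|H]; try (move=> _; lia); move=> /(_ isT) /negbTE ->; lia.
have [H1 H1'] := phi_gap q uv; have [H2 H2'] := phi_gap q' wu'.
have H3 := phi_rule R mq mq' vw.
split; first by lia.
move=> le.
have /(_ mq) uv' := H1'; have /(_ mq') wu'' := H2'.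
have {}uv' : u =1 v by apply: uv'; lia.
have {}wu'' : w =1 u' by apply: wu''; lia.
have -> : u = v by exact: funext.
by have <- : w = u' by exact: funext.
Qed.

Definition regs0 : nat -> nat := fun j => if j == 0 then x else 0.

Definition accepting := exists t s,
  iter t (fstep P) (0, regs0, [::]) = (size P, s, [::]) /\ 0 < s 0.

(** The meaning of an exact run: until the simulation starts the registers hold the input, during it
    they hold a reachable content of the program, and after it the program has accepted. *)
Definition good (q : control) (u : counter -> nat) : Prop :=
  match q with
  | inr (inr p) => exists t s, iter t (fstep P) (0, regs0, [::]) = (p : nat, s, [::]) /\
      forall j, j <= m -> s j = u (rg j)
  | inr (inl (inl false)) | inr (inl (inr (false, _))) =>
      forall j, j <= m -> u (rg j) = regs0 j
  | _ => accepting
  end.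

Hypothesis regP : forall i, List.In i P -> reg_of i <= m.
Hypothesis jumpP : forall p s w, p < size P -> (fstep P (p, s, w)).1.1 <= size P.

Lemma good_rule q Z D N q' u u' : rule q Z D N q' -> middle q -> middle q' ->
  estep Z D N u u' -> good q u -> good q' u'.
Proof.
move=> R mq mq' [ZE DE E].
have Er j : u (rg j) + (rg j \in N) = u' (rg j) + (rg j \in D) by exact: E.
have keep : (forall j, rg j \notin N) -> (forall j, rg j \notin D) -> forall j, u' (rg j) = u (rg j).
  by move=> HN HD j; have := Er j; rewrite (negbTE (HN j)) (negbTE (HD j)); lia.
clear E; case: R mq mq' ZE DE Er keep => // {q Z D N q'}.
- move=> [] //= _ _ _ _ _ keep G j jm; rewrite keep ?G // => i; by rewrite inE.
- move=> [] //= _ _ _ _ _ keep G j jm; rewrite keep ?G // => i; by rewrite inE.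
- move=> [] // i /= _ _ _ _ _ keep G j jm; rewrite keep ?G // => l; by rewrite inE.
- move=> [] // i /= _ _ _ _ _ keep G j jm; rewrite keep ?G // => l; by rewrite inE.
- move=> [] // i /= _ _ _ _ _ keep G j jm; rewrite keep ?G // => l; by rewrite inE.
- move=> [] // i /= _ _ _ _ _ keep G j jm; rewrite keep ?G // => l; by rewrite inE.
- move=> [] // i /= _ _ _ _ _ keep G j jm; rewrite keep ?G // => l; by rewrite inE.
- move=> [] // i /= _ _ _ _ _ keep G j jm; rewrite keep ?G // => l; by rewrite inE.
- move=> _ _ _ _ _ keep G; exists 0, regs0; split; first by rewrite /= inordK.
  by move=> j jm; rewrite keep ?G // => l; rewrite inE.
- move=> p r pP iE _ _ ZE DE Er keep [t [s [E sE]]].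
  have rm := regP (In_nth (IJmp p) pP); rewrite iE /= in rm.
  exists t.+1, (upd s r (s r).+1); split.
    by rewrite iterS E /= !inordK ?ltnS // ?iE // ltnW.
  move=> j jm; have := Er j; rewrite !(inE, ctE) rg_eq // -sE // /upd.
  by case: eqP => [->|_] /=; lia.
- move=> p r l pP iE _ _ ZE DE Er keep [t [s [E sE]]].
  have rm := regP (In_nth (IJmp p) pP); rewrite iE /= in rm.
  have ur : 0 < s r by rewrite sE //; apply: DE; rewrite inE.
  exists t.+1, (upd s r (s r).-1); split.
    rewrite iterS E /= !inordK ?ltnS // ?iE //; last by rewrite ltnW.
    by case: (s r) ur.
  move=> j jm; have := Er j; rewrite !(inE, ctE) rg_eq // -sE // /upd.
  by case: eqP => [->|_] /=; lia.
- move=> p r l pP iE _ _ ZE DE Er keep [t [s [E sE]]].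
  have rm := regP (In_nth (IJmp p) pP); rewrite iE /= in rm.
  have lP := jumpP s [::] pP; have sr : s r = 0 by rewrite sE // ZE // inE.
  rewrite /= iE sr /= in lP.
  exists t.+1, s; split.
    by rewrite iterS E /= !inordK ?ltnS // ?iE ?sr // ltnW.
  by move=> j jm; rewrite sE // keep // => i; rewrite inE.
- move=> p l pP iE _ _ ZE DE Er keep [t [s [E sE]]].
  have lP := jumpP s [::] pP; rewrite /= iE /= in lP.
  exists t.+1, s; split.
    by rewrite iterS E /= !inordK ?ltnS // ?iE // ltnW.
  by move=> j jm; rewrite sE // keep // => i; rewrite inE.
- move=> _ _ ZE DE Er keep [t [s [E sE]]]; exists t, s; split; first by rewrite E inordK.
  by rewrite sE //; apply: DE; rewrite inE.
Qed.

Definition rule_type : finType :=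
  (control * {set counter} * {set counter} * {set counter} * control)%type.
Definition r_src (d : rule_type) := d.1.1.1.1.
Definition r_zero (d : rule_type) := d.1.1.1.2.
Definition r_del (d : rule_type) := d.1.1.2.
Definition r_new (d : rule_type) := d.1.2.
Definition r_tgt (d : rule_type) := d.2.
Definition is_rule (d : rule_type) := rule (r_src d) (r_zero d) (r_del d) (r_new d) (r_tgt d).

Lemma rule_from_load q Z D N q' : rule q Z D N q' -> q = q_load ->
  q' = q_load /\ N = [set cn; rg 0] /\ D = finset.set0 \/
  q' = q_main false /\ N = [set ca k] /\ D = finset.set0.
Proof. by case=> // _; [left | right]. Qed.

Lemma rule_to_unload q Z D N q' : rule q Z D N q' -> q' = q_unload -> q <> q_unload ->
  q = q_main true /\ D = [set ca k; cn; rg 0].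
Proof. by case. Qed.

Lemma rule_from_unload q Z D N q' : rule q Z D N q' -> q = q_unload ->
  q' = q_unload /\ D = [set cn; rg 0] \/ q' = q_end /\ Z = finset.setT.
Proof. by case=> //; [left | right]. Qed.

Lemma rule_from_middle q Z D N q' : rule q Z D N q' -> middle q ->
  middle q' \/ q' = q_unload.
Proof. by case=> //; auto. Qed.

Lemma rule_to_end q Z D N q' : rule q Z D N q' -> q' = q_end -> q = q_unload.
Proof. by case. Qed.

Lemma rule_end q Z D N q' : rule q Z D N q' -> q <> q_end.
Proof. by case. Qed.

Definition phi0 := ack k x + x.

(** The second part is conditional because gains can occur at any time; it is used only at the end,
    where the potential is known not to have risen. *)
Definition inv (q : control) (u : counter -> nat) :=
  phi0 <= phi q u /\ (phi q u <= phi0 -> good q u).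

Definition u_go (c : counter) : nat := (c == cn) * x + (c == rg 0) * x + (c == ca k).

Lemma phi_go b : phi (q_main b) u_go = phi0.
Proof.
rewrite /phi0 addnC; congr (_ + _).
  have r0 i : ((Some (inr i) : counter) == rg 0) = (i == ord0).
    by rewrite /rg (_ : inord 0 = ord0) //; apply/val_inj; rewrite /= inordK.
  rewrite /tots (bigD1 ord0) //= big1 ?addn0; first by rewrite /u_go r0 /= mul1n addn0.
  by move=> i /negbTE i0; rewrite /u_go r0 i0.
rewrite /= VV0 => [|i ik].
  by rewrite /lev /u_go !ctE /= mul1n !addn0.
by rewrite /lev /u_go !ctE ca_eq ?(ltnW ik) // ltn_eqF.
Qed.

Lemma u_go_rg j : j <= m -> u_go (rg j) = regs0 j.
Proof. by move=> jm; rewrite /u_go !ctE rg_eq // /regs0; case: eqP; rewrite ?mul1n ?addn0. Qed.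

(** At least [x] loads put at least [x] tokens into [cn] and [rg 0], so the potential starts at
    [phi0] or above. A stop after which everything is emptied in time leaves room for the tokens of
    [u_go] only, so the potential ends at [phi0] or below. Being monotone it is constant, every step
    in between is exact, and [good] applies. *)
Lemma gainy_sound (d : nat -> rule_type) (u : nat -> counter -> nat) L :
  (forall i, i <= L -> is_rule (d i)) ->
  (forall i c, i <= L -> c \in r_zero (d i) -> u i c = 0) ->
  (forall i, i < L -> r_tgt (d i) = r_src (d i.+1)) ->
  (forall i c, i < L -> u i c + (c \in r_new (d i)) <= u i.+1 c + (c \in r_del (d i))) ->
  r_src (d 0) = q_load -> r_tgt (d L) = q_end ->
  (forall i, i <= L -> r_src (d i) = q_load -> r_tgt (d i) <> q_load -> x <= i) ->
  (forall i j, i < j <= L -> r_src (d i) <> q_unload -> r_tgt (d i) = q_unload ->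
     r_tgt (d j) = q_end -> j <= i + x) ->
  accepting.
Proof.
move=> H1 H2 H3 H4 H5 H6 H7 H8.
pose stopped i := exists2 l, l < i &
  [/\ r_src (d l) = q_main true, r_tgt (d l) = q_unload, r_del (d l) = [set ca k; cn; rg 0] &
   inv (q_main true) (u l)] /\ forall j, l < j <= i -> r_src (d j) = q_unload.
have fwd i : i <= L ->
    [\/ r_src (d i) = q_load /\ i <= u i cn /\ i <= u i (rg 0),
        middle (r_src (d i)) /\ inv (r_src (d i)) (u i) |
        stopped i].
  elim: i => [|i IH] iL; first by constructor 1; rewrite H5.
  have Ri := H1 i (ltnW iL); have Ti := H3 i iL; have Ui := H4 i ^~ iL.
  case: (IH (ltnW iL)) => [[si [un ur]]|[mi [Il Ir]]|[l li [[sl tl dl Il] Hl]]].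
  - case: (rule_from_load Ri si) => [[t [n e]]|[t [n e]]].
      constructor 1; rewrite -Ti t; split=> //; have := Ui cn; have := Ui (rg 0).
      by rewrite n e !(inE, ctE) /=; lia.
    constructor 2; rewrite -Ti t; split=> //.
    have xi : x <= i by apply: H7 => //; [exact: ltnW | rewrite t].
    have le c : u_go c <= u i.+1 c.
      have := Ui c; rewrite n e !inE /u_go.
      case: (counterP c) => [->|[j jk ->]|[j jm ->]]; rewrite ?ctE ?ca_eq ?rg_eq //; first by lia.
        by lia.
      case: eqP => [->|_]; lia.
    have [G1 G2] := phi_gap (q_main false) le; rewrite phi_go in G1 G2.
    split=> // le'; have E := G2 isT le'.
    by move=> j jm; rewrite -E u_go_rg.
  - case: (rule_from_middle Ri mi) => [mt|tu].
      constructor 2; rewrite -Ti; split=> //.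
      have gs : gstep (r_zero (d i)) (r_del (d i)) (r_new (d i)) (u i) (u i.+1).
        by split=> c; [exact: H2 (ltnW iL) | exact: Ui].
      have [G1 G2] := gain_phi Ri mi mt gs.
      split=> [|le]; first exact: leq_trans Il G1.
      have es : estep (r_zero (d i)) (r_del (d i)) (r_new (d i)) (u i) (u i.+1).
        by apply: G2; exact: leq_trans le Il.
      by apply: good_rule Ri mi mt es (Ir _); exact: leq_trans G1 le.
    constructor 3; have nu : r_src (d i) <> q_unload by move=> e; rewrite e in mi.
    have [sm de] := rule_to_unload Ri tu nu.
    exists i => //; split; first by split=> //; rewrite -sm.
    move=> j ij; have -> : j = i.+1 by lia.
    by rewrite -Ti.
  - constructor 3; exists l; first by lia.
    split=> // j /andP[lj ji]; case: (eqVneq j i.+1) => [->|ne]; last by apply: Hl; lia.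
    have si : r_src (d i) = q_unload by apply: Hl; lia.
    case: (rule_from_unload Ri si) => [[t _]|[t _]]; first by rewrite -Ti t.
    by case: (rule_end (H1 _ iL)); rewrite -Ti.
have sL := rule_to_end (H1 L (leqnn L)) H6.
case: (fwd L (leqnn L)) => [[e _]|[e _]|[l lL [[sl tl dl [_ Il]] Hl]]].
- by rewrite e in sL.
- by rewrite sL in e.
have Lx : L <= l + x by apply: (H8 l L) => //; [rewrite lL leqnn | rewrite sl].
(* Counted from the end, where all counters are zero: a turn of unloading accounts for one token of
   [cn], one of [rg 0] and no others. *)
have bwd i : i < L - l -> u (L - i) cn <= i /\ u (L - i) (rg 0) <= i /\
    forall c, c != cn -> c != rg 0 -> u (L - i) c = 0.
  elim: i => [|i IH] iL.
    have uL c : u L c = 0.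
      apply: H2 => //; case: (rule_from_unload (H1 L (leqnn L)) sL) => [[t _]|[_ ->]].
        by rewrite t in H6.
      by rewrite inE.
    by rewrite subn0 !uL.
  have [|I1 [I2 I3]] := IH; first by lia.
  have E : L - i = (L - i.+1).+1 by lia.
  have iL' : L - i.+1 < L by lia.
  have si : r_src (d (L - i.+1)) = q_unload by apply: Hl; lia.
  have D : r_del (d (L - i.+1)) = [set cn; rg 0].
    case: (rule_from_unload (H1 _ (ltnW iL')) si) => [[_ //]|[t _]].
    by case: (rule_end (H1 _ iL')); rewrite -H3.
  have U c := H4 _ c iL'; rewrite -E D in U.
  split; first by have := U cn; rewrite !inE /=; lia.
  split; first by have := U (rg 0); rewrite !(inE, ctE) /=; lia.
  by move=> c c1 c2; have := U c; rewrite !inE (negbTE c1) (negbTE c2) I3 //; lia.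
have [|B1 [B2 B3]] := bwd (L - l).-1; first by lia.
have E : L - (L - l).-1 = l.+1 by lia.
rewrite E in B1 B2 B3.
have le c : u l c <= u_go c.
  have := H4 l c lL; rewrite dl !inE /u_go.
  case: (counterP c) => [->|[j jk ->]|[j jm ->]]; rewrite ?ctE /=; first by lia.
    by rewrite B3 //; case: eqP; lia.
  case: eqP => [->|/eqP ne]; first by lia.
  by rewrite B3 //; lia.
have [G1 _] := phi_gap (q_main true) le; rewrite phi_go in G1.
exact: Il G1.
Qed.

End Machine.

(** * Exact runs of the counter machine *)

Section ExactRuns.
Variables (k m x : nat) (P : seq instr).
Local Notation counter := (counter k m).
Local Notation control := (control k P).
Local Notation rule_type := (rule_type k m P).
Local Notation cn := (cn k m).
Local Notation ca := (ca k m).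
Local Notation rg := (rg k m).
Local Notation q_load := (q_load k P).
Local Notation q_clean := (q_clean k P).
Local Notation q_unload := (q_unload k P).
Local Notation q_end := (q_end k P).
Local Notation q_main := (q_main k P).
Local Notation q_shift := (@q_shift k P).
Local Notation q_sim := (q_sim k P).
Local Notation rule := (@rule k m P).
Implicit Types (q : control) (u v : counter -> nat) (rs : seq (rule_type * (counter -> nat))).

Definition mk (f : nat -> nat) (n : nat) (s : nat -> nat) : counter -> nat :=
  fun c => match (c : option ('I_k.+1 + 'I_m.+1)) with
    None => n | Some (inl j) => f j | Some (inr j) => s j end.

Fixpoint epath q u rs q' u' : Prop :=
  match rs with
  | [::] => q = q' /\ u = u'
  | (d, v) :: rs' => [/\ is_rule d, r_src d = q, v = u &
      exists2 u1, estep (r_zero d) (r_del d) (r_new d) u u1 & epath (r_tgt d) u1 rs' q' u']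
  end.

Lemma epath_cat q u rs1 q1 u1 rs2 q2 u2 :
  epath q u rs1 q1 u1 -> epath q1 u1 rs2 q2 u2 -> epath q u (rs1 ++ rs2) q2 u2.
Proof.
elim: rs1 q u => [|[d v] rs IH] q u /=; first by move=> [-> ->].
by move=> [R s e [u' E H]] H2; split=> //; exists u' => //; exact: IH H H2.
Qed.

Definition mids rs := all (fun b => middle (r_src b.1) && middle (r_tgt b.1)) rs.

Definition conn q u q' u' := exists2 rs, mids rs & epath q u rs q' u'.

Lemma conn_refl q u : conn q u q u.
Proof. by exists [::]. Qed.

Lemma conn_trans q1 u1 q2 u2 q3 u3 :
  conn q1 u1 q2 u2 -> conn q2 u2 q3 u3 -> conn q1 u1 q3 u3.
Proof.
move=> [r1 m1 p1] [r2 m2 p2]; exists (r1 ++ r2); last exact: epath_cat p1 p2.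
by rewrite /mids all_cat; apply/andP.
Qed.

Lemma conn_rule q Z D N q' u u' : rule q Z D N q' -> middle q -> middle q' ->
  estep Z D N u u' -> conn q u q' u'.
Proof.
move=> R mq mq' E; exists [:: ((q, Z, D, N, q') : rule_type, u)]; first by rewrite /mids /= mq mq'.
by split=> //; exists u'.
Qed.

Definition inst (b : bool) (i : option 'I_k) : control :=
  if i is Some i' then q_shift b i' else q_main b.

(** The rules for the stack come in mutually inverse pairs, so unfolding before the simulation and
    folding after it are obtained by one induction, for either value of the flag. *)
Definition biconn i u i' u' := forall b,
  conn (inst b i) u (inst b i') u' /\ conn (inst b i') u' (inst b i) u.

Lemma biconn_refl i u : biconn i u i u.
Proof. by move=> b; split; exact: conn_refl. Qed.

Lemma biconn_trans i1 u1 i2 u2 i3 u3 :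
  biconn i1 u1 i2 u2 -> biconn i2 u2 i3 u3 -> biconn i1 u1 i3 u3.
Proof.
by move=> H1 H2 b; have [? ?] := H1 b; have [? ?] := H2 b; split; apply: conn_trans; eassumption.
Qed.

Lemma mk_ca f n s j : j <= k -> mk f n s (ca j) = f j.
Proof. by move=> jk; rewrite /= inordK. Qed.

Lemma mk_rg f n s j : j <= m -> mk f n s (rg j) = s j.
Proof. by move=> jm; rewrite /= inordK. Qed.

Ltac mk_step :=
  let c := fresh "c" in
  let j := fresh "a" in
  split=> c; case: (counterP c) => [->|[j ? ->]|[j ? ->]];
  rewrite ?inE ?ctE ?mk_ca ?mk_rg ?ca_eq ?rg_eq /upd //= ?inordK //;
  try (by repeat case: eqP => /= *; subst; lia).

Lemma bi_inc f n s : 0 < f 0 -> biconn None (mk f n s) None (mk (upd f 0 (f 0).-1) n.+1 s).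
Proof.
move=> f0 b; split.
  by apply: conn_rule (r_inc _ _ _ b) isT isT _; mk_step.
by apply: conn_rule (r_dec _ _ _ b) isT isT _; mk_step.
Qed.

Lemma bi_enter (i : 'I_k) f n s : (forall l, l <= i -> f l = 0) -> 0 < f i.+1 ->
  biconn None (mk f n s) (Some i) (mk (upd f i.+1 (f i.+1).-1) n.+1 s).
Proof.
move=> f0 f1 b; have ik := ltn_ord i; split.
  apply: conn_rule (r_enter _ _ b i) isT isT _; mk_step.
  by move=> li; apply: f0; lia.
apply: conn_rule (r_unenter _ _ b i) isT isT _; mk_step.
by move=> li; case: eqP => [e|_]; [lia | apply: f0; lia].
Qed.

Lemma bi_in (i : 'I_k) f n s :
  biconn (Some i) (mk f n.+1 s) (Some i) (mk (upd f i (f i).+1) n s).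
Proof.
move=> b; have ik := ltnW (ltn_ord i); split.
  by apply: conn_rule (r_in _ _ b i) isT isT _; mk_step.
by apply: conn_rule (r_out _ _ b i) isT isT _; mk_step.
Qed.

Lemma bi_exit (i : 'I_k) f s : (forall l, l < i -> f l = 0) ->
  biconn (Some i) (mk f 0 s) None (mk f 1 s).
Proof.
move=> f0 b; have ik := ltnW (ltn_ord i); split.
  by apply: conn_rule (r_exit _ _ b i) isT isT _; mk_step; exact: f0.
by apply: conn_rule (r_unexit _ _ b i) isT isT _; mk_step; exact: f0.
Qed.

Lemma biconn_eq i u i' u' u'' : biconn i u i' u' -> u' = u'' -> biconn i u i' u''.
Proof. by move=> H <-. Qed.

Lemma upd0 f j : f j = 0 -> upd f j 0 = f.
Proof. by move=> f0; apply: funext; upd_lia. Qed.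

(** One copy of level [i.+1] on [n] is exchanged for [n.+1] copies of level [i] on [1]: enter, shift
    all units of [cn] into [ca i], exit. The induction on the level evaluates these copies, the
    inner induction treats the remaining copies of level [i.+1]. *)
Lemma bi_eval j f n s : j <= k -> (forall l, l < j -> f l = 0) ->
  biconn None (mk f n s) None (mk (upd f j 0) (iter (f j) (ack j) n) s).
Proof.
elim: j f n => [|i IHi] f n jk f0.
  move E: (f 0) => c; elim: c f n E f0 => [|c IH] f n E f0.
    by rewrite upd0 //; exact: biconn_refl.
  apply: biconn_trans (bi_inc _ _ _) _; first by rewrite E.
  apply: biconn_eq (IH _ _ _ _) _; rewrite ?updE ?E //.
  by rewrite iterSr; congr (mk _ _ _); apply: funext; upd_lia.
move E: (f i.+1) => c; elim: c f n E f0 => [|c IH] f n E f0.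
  by rewrite upd0 //; exact: biconn_refl.
apply: (biconn_trans (@bi_enter (Ordinal jk) f n s _ _)); [by move=> l li; apply: f0 | by rewrite E|].
rewrite /= E /=.
have bi_ins a g l : biconn (Some (Ordinal jk)) (mk g (a + l) s) (Some (Ordinal jk)) (mk (upd g i (g i + a)) l s).
  elim: a g => [|a IHa] g.
    by rewrite addn0 add0n (_ : upd g i (g i) = g); [exact: biconn_refl | apply: funext; upd_lia].
  rewrite addSn; apply: biconn_trans (bi_in _ _ _ _) _.
  apply: biconn_eq (IHa _) _; congr (mk _ _ _); apply: funext => y /=; rewrite /upd eqxx.
  by case: eqP => // _; lia.
have := bi_ins n.+1 (upd f i.+1 c) 0; rewrite addn0 => H; apply: biconn_trans H _.
apply: biconn_trans (@bi_exit (Ordinal jk) _ _ _) _ => /=.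
  by move=> l li; rewrite /upd; do 2 (case: eqP => [?|_]; first by lia); apply: f0; lia.
have fi : f i = 0 by exact: f0.
apply: biconn_trans (IHi _ _ (ltnW jk) _) _.
  by move=> l li; rewrite /upd; do 2 (case: eqP => [?|_]; first by lia); apply: f0; lia.
have ui : upd f i.+1 c i = 0 by rewrite updN ?fi //; lia.
rewrite ui updE (_ : upd _ i 0 = upd f i.+1 c); last by apply: funext; upd_lia.
apply: biconn_eq (IH _ _ _ _) _; rewrite ?updE //.
  by move=> l li; rewrite updN ?f0 //; lia.
congr (mk _ _ _); first by apply: funext; upd_lia.
exact: (esym (iterSr c (ack i.+1) n)).
Qed.

Definition f_top := upd (fun=> 0) k 1.

Lemma bi_top s : biconn None (mk f_top x s) None (mk (fun=> 0) (ack k x) s).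
Proof.
have ft : f_top k = 1 by rewrite /f_top updE.
have := @bi_eval k f_top x s (leqnn _); rewrite ft => H.
apply: biconn_eq (H _) _; first by move=> l lk; rewrite /f_top updN //; lia.
by congr (mk _ _ _); apply: funext; rewrite /f_top; upd_lia.
Qed.

Hypothesis regP : forall i, List.In i P -> reg_of i <= m.
Hypothesis jumpP : forall p s w, p < size P -> (fstep P (p, s, w)).1.1 <= size P.
Hypothesis noread : forall r l, ~ List.In (IRead r l) P.

Local Notation tot := (tot m.+1).
Local Notation z := (fun=> 0).

(** The reserve is kept at [N - tot s], so the number of tokens is constant and an increment finds a
    unit to draw as long as the registers stay within [N]. *)
Lemma conn_sim p s N c' : p < size P -> tot s <= N ->
  fstep P (p, s, [::]) = c' -> tot c'.1.2 <= N ->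
  conn (q_sim p) (mk z (N - tot s) s) (q_sim c'.1.1) (mk z (N - tot c'.1.2) c'.1.2) /\ c'.2 = [::].
Proof.
move=> pP sN E; have iI := In_nth (IJmp p) pP; move: E; rewrite /fstep.
have := regP iI; have := noread; case iE: (nth _ _ _) iI => [r|r l|l|r l] /= iI nr rm; last by case: (nr _ _ iI).
- move=> <- /= tN; split=> //; apply: conn_rule (r_siminc _ _ pP iE) isT isT _.
  have T := tot_upd s (s r).+1 (rm : r < m.+1).
  have -> : N - tot s = (N - tot (upd s r (s r).+1)).+1 by lia.
  by mk_step.
- case sr: (s r) => [|a] <- /= tN; split=> //.
    apply: conn_rule (r_simzero _ _ pP iE) isT isT _.
    by mk_step; move=> /eqP ->.
  apply: conn_rule (r_simdec _ _ pP iE) isT isT _.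
  have T := tot_upd s a (rm : r < m.+1).
  have -> : N - tot (upd s r a) = (N - tot s).+1 by lia.
  by mk_step.
- move=> <- /= tN; split=> //; apply: conn_rule (r_simjmp _ _ pP iE) isT isT _.
  by mk_step.
Qed.

Lemma conn_clean n s : conn q_clean (mk z n s) q_clean (mk z (n + tot s) z).
Proof.
move E: (tot s) => t; elim: t n s E => [|t IH] n s E.
  rewrite addn0 (_ : mk z n s = mk z n z); first exact: conn_refl.
  apply: funext => -[[j|j]|] //=; move/eqP: E; rewrite sum_nat_eq0 => /forallP/(_ j)/eqP //.
have [j sj] : exists j : 'I_m.+1, 0 < s j.
  apply/existsP; apply: contraTT (_ : t.+1 != 0) => //; rewrite negb_exists => /forallP H.
  by rewrite negbK -E /tot big1 // => j _; apply/eqP; have := H j; rewrite -eqn0Ngt.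
have jm : j <= m by rewrite -ltnS.
have T := tot_upd s (s j).-1 (ltn_ord j).
apply: (@conn_trans _ _ q_clean (mk z n.+1 (upd s j (s j).-1))).
  by apply: conn_rule (r_clean _ _ _ j) isT isT _; mk_step.
by rewrite addnS -addSn; apply: IH; lia.
Qed.

Lemma conn_restore n l : conn q_clean (mk z (l + n) z) q_clean (mk z n (regs0 l)).
Proof.
suff H a : a <= l -> conn q_clean (mk z (l + n) z) q_clean (mk z (l - a + n) (regs0 a)).
  by have := H _ (leqnn l); rewrite subnn.
elim: a => [|a IH] al.
  rewrite subn0 (_ : regs0 0 = z); first exact: conn_refl.
  by apply: funext => j; rewrite /regs0; case: eqP.
apply: conn_trans (IH (ltnW al)) _.
have -> : l - a + n = (l - a.+1 + n).+1 by lia.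
apply: conn_rule (r_restore _ _ _) isT isT _; rewrite /regs0; mk_step.
Qed.

Lemma tot_regs0 : tot (regs0 x) = x.
Proof.
by rewrite /tot (bigD1 ord0) //= big1 ?addn0 // => i /negbTE i0; rewrite /regs0 (_ : (i == 0 :> nat) = (i == ord0)) // i0.
Qed.

Lemma conn_all s : fruns P m.+1 (0, regs0 x, [::]) (size P, s, [::]) (ack k x + x) -> 0 < s 0 ->
  conn (q_main false) (mk f_top x (regs0 x)) (q_main true) (mk f_top x (regs0 x)).
Proof.
set N := ack k x + x; move=> [t [E B]] s0.
have [up _] := bi_top (regs0 x) false; have [_ down] := bi_top (regs0 x) true.
apply: conn_trans up _; apply: conn_trans _ down.
apply: (@conn_trans _ _ (q_sim 0) (mk z (ack k x) (regs0 x))).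
  by apply: conn_rule (r_start _ _ _) isT isT _; mk_step; move=> _; rewrite mk_ca.
have run j : j <= t -> forall c, iter j (fstep P) (0, regs0 x, [::]) = c -> c.2 = [::] /\
    conn (q_sim 0) (mk z (N - tot (regs0 x)) (regs0 x)) (q_sim c.1.1) (mk z (N - tot c.1.2) c.1.2).
  elim: j => [|j IH] jt c <-; first by split=> //; exact: conn_refl.
  have := IH (ltnW jt) _ erefl; have := B j (ltnW jt); have := B j.+1 jt; rewrite iterS.
  case: (iter j _ _) => [[p sp] w] B1 B0 [/= w0 H]; rewrite /= in B0; rewrite {}w0 in B1 *.
  case: (ltnP p (size P)) => pP.
    have [H' ->] := conn_sim pP B0 erefl B1; split=> //; exact: conn_trans H H'.
  by rewrite /= nth_default.
have [_] := run t (leqnn t) _ E; rewrite tot_regs0 addnK /= => H; apply: conn_trans H _.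
have ts : tot s <= N by have := B t (leqnn t); rewrite E.
(* [r_accept] takes a unit out of register 0, which is where the output has to be nonzero. *)
apply: (@conn_trans _ _ q_clean (mk z (N - tot s).+1 (upd s 0 (s 0).-1))).
  by apply: conn_rule (r_accept _ _ _) isT isT _; mk_step; move=> /eqP ->.
apply: conn_trans (conn_clean _ _) _.
have T := tot_upd s (s 0).-1 (ltn0Sn m).
have -> : (N - tot s).+1 + tot (upd s 0 (s 0).-1) = x + ack k x by rewrite /N; lia.
apply: conn_trans (conn_restore _ _) _.
by apply: conn_rule (r_done _ _ _) isT isT _; mk_step; move=> _; rewrite mk_ca.
Qed.

Lemma epath_head q u rs q' u' d0 : epath q u rs q' u' -> 0 < size rs ->
  r_src (nth d0 rs 0).1 = q /\ (nth d0 rs 0).2 = u.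
Proof. by case: rs => [|[d v] rs] //= [_ -> -> _]. Qed.

Lemma epath_nth q u rs q' u' d0 : epath q u rs q' u' -> forall i, i < size rs ->
  let b := nth d0 rs i in
  [/\ is_rule b.1, estep (r_zero b.1) (r_del b.1) (r_new b.1) b.2
       (if i.+1 < size rs then (nth d0 rs i.+1).2 else u') &
      r_tgt b.1 = if i.+1 < size rs then r_src (nth d0 rs i.+1).1 else q'].
Proof.
elim: rs q u => [|[d v] rs IH] q u //= [R sE -> [u1 E H]] [|i] /= ir; last exact: IH H i ir.
split=> //; rewrite ltnS; case: ifP => rs0.
- by have [_ ->] := epath_head d0 H rs0.
- by case: rs rs0 H {IH ir} => //= _ [_ <-].
- by have [-> _] := epath_head d0 H rs0.
- by case: rs rs0 H {IH ir} => //= _ [<- _].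
Qed.

Definition d_load : rule_type := (q_load, finset.set0, finset.set0, [set cn; rg 0], q_load).
Definition d_go : rule_type := (q_load, finset.set0, finset.set0, [set ca k], q_main false).
Definition d_stop : rule_type := (q_main true, finset.set0, [set ca k; cn; rg 0], finset.set0, q_unload).
Definition d_unload : rule_type := (q_unload, finset.set0, [set cn; rg 0], finset.set0, q_unload).
Definition d_end : rule_type := (q_unload, finset.setT, finset.set0, finset.set0, q_end).

Definition lv i := mk z i (regs0 i).

Fixpoint unloads n : seq (rule_type * (counter -> nat)) :=
  if n is n'.+1 then (d_unload, lv n) :: unloads n' else [::].

Lemma epath_loads n i : epath q_load (lv i) [seq (d_load, lv j) | j <- iota i n] q_load (lv (i + n)).
Proof.
elim: n i => [|n IH] i /=; first by rewrite addn0.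
split=> //; first exact: r_load.
by exists (lv i.+1); [rewrite /lv /regs0; mk_step | rewrite addnS -addSn; exact: IH].
Qed.

Lemma epath_unloads n : epath q_unload (lv n) (unloads n) q_unload (lv 0).
Proof.
elim: n => //= n IH; split=> //; first exact: r_unload.
by exists (lv n) => //; rewrite /lv /regs0; mk_step.
Qed.

Lemma size_unloads n : size (unloads n) = n.
Proof. by elim: n => //= n ->. Qed.

Lemma exact_run s : 0 < x ->
  fruns P m.+1 (0, regs0 x, [::]) (size P, s, [::]) (ack k x + x) -> 0 < s 0 ->
  exists (d : nat -> rule_type) (u : nat -> counter -> nat) L,
  [/\ forall i, i <= L -> is_rule (d i),
      forall i, i <= L -> estep (r_zero (d i)) (r_del (d i)) (r_new (d i)) (u i) (u i.+1) &
      forall i, i < L -> r_tgt (d i) = r_src (d i.+1)] /\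
  [/\ r_src (d 0) = q_load, r_tgt (d L) = q_end, forall c, u 0 c = 0,
      (forall i, i <= L -> r_src (d i) = q_load -> r_tgt (d i) <> q_load -> x <= i) &
      (forall i j, i < j <= L -> r_src (d i) <> q_unload -> r_tgt (d i) = q_unload -> j <= i + x)].
Proof.
move=> x0 F s0; have [mid mm pm] := conn_all F s0.
pose A := [seq (d_load, lv j) | j <- iota 0 x] ++ (d_go, lv x) :: mid.
(* [r_stop] removes a unit of [cn] and of [rg 0] itself, so [x.-1] unloads follow and [r_end] comes
   exactly [x] places after [r_stop], the latest moment that is allowed. *)
pose B := (d_stop, mk f_top x (regs0 x)) :: unloads x.-1 ++ [:: (d_end, lv 0)].
have pA : epath q_load (lv 0) A (q_main true) (mk f_top x (regs0 x)).
  apply: epath_cat (epath_loads x 0) _; split=> //; first exact: r_go.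
  exists (mk f_top x (regs0 x)) => //; rewrite /lv /f_top; mk_step.
have pB : epath (q_main true) (mk f_top x (regs0 x)) B q_end (lv 0).
  split=> //; first exact: r_stop.
  exists (lv x.-1); first by rewrite /lv /f_top /regs0; mk_step.
  apply: epath_cat (epath_unloads _) _; split=> //; first exact: r_end.
  exists (lv 0) => //; rewrite /lv /regs0; mk_step.
have p := epath_cat pA pB.
pose d0 : rule_type * (counter -> nat) := (d_end, lv 0).
have sB : size B = x.+1 by rewrite /= size_cat size_unloads /=; lia.
have sR : size (A ++ B) = (size A + x).+1 by rewrite size_cat sB addnS.
exists (fun i => (nth d0 (A ++ B) i).1), (fun i => (nth d0 (A ++ B) i).2), (size A + x).
have H i := epath_nth d0 p (i := i); rewrite sR in H.
split; split.
- by move=> i iL; have [] := H i iL.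
- move=> i iL; have [_ E _] := H i iL; move: E; case: ltnP => // Li.
  by rewrite [nth _ _ i.+1]nth_default // sR.
- by move=> i iL; have [_ _ ->] := H i (ltnW iL); rewrite ltnS iL.
- by have [|-> _] := epath_head d0 p; rewrite ?sR.
- by have [_ _] := H _ (leqnn _); rewrite ltnn.
- move=> c; have [|_ ->] := epath_head d0 p; first by rewrite sR.
  by rewrite /lv /regs0; case: c => [[j|j]|] //=; case: eqP.
- move=> i iL; case: (ltnP i x) => // ix.
  rewrite nth_cat size_cat size_map size_iota ltn_addr // nth_cat size_map size_iota ix.
  by rewrite (nth_map 0) ?size_iota.
- move=> i j /andP[ij jL] si ti; case: (leqP (size A) i) => iA; first by lia.
  move: ti; rewrite nth_cat iA; suff /(all_nthP d0)/(_ i iA)/eqP : all (fun b => r_tgt b.1 != q_unload) A by [].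
  rewrite all_cat /= all_map (@eq_all _ _ predT) ?all_predT //=.
  by apply: sub_all mm => b /andP[_ /andP[/andP[_ ]]].
Qed.

End ExactRuns.

(** * Opacity as an inclusion of languages of delay words *)

Section Stamps.
Import Order.TTheory GRing.Theory Num.Theory.
Local Open Scope ring_scope.
Variables (R : realType) (T : Type).
Implicit Types (t : R) (w : seq (T * R)).

Fixpoint stamps t w : seq (T * R) :=
  if w is (a, d) :: w' then (a, t + d) :: stamps (t + d) w' else [::].

Lemma stamps_inj t : injective (stamps t).
Proof.
move=> w1 w2; elim: w1 w2 t => [|[a d] w IH] [|[a' d'] w'] t //= [-> ed e].
have dd : d = d' by lra.
by rewrite dd in e *; rewrite (IH _ _ e).
Qed.

Lemma stamps_path t w : all (fun p => 0 <= p.2) w ->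
  path <=%R t [seq p.2 | p <- stamps t w].
Proof.
elim: w t => //= -[a d] w IH t /= /andP[d0 nn].
by rewrite lerDl d0 /=; exact: IH.
Qed.

Lemma unstamp t w : path <=%R t [seq p.2 | p <- w] ->
  exists2 dw, stamps t dw = w & all (fun p => 0 <= p.2) dw.
Proof.
elim: w t => [|[a s] w IH] t /=; first by exists [::].
move=> /andP[ts /IH[dw E nn]]; exists ((a, s - t) :: dw) => /=.
  by rewrite addrC subrK E.
by rewrite subr_ge0 ts.
Qed.

Lemma stamps_rcons t w a d : exists s, stamps t (rcons w (a, d)) = rcons (stamps t w) (a, s).
Proof.
elim: w t => [|[b s] w IH] t /=; first by exists (t + d).
by have [s' ->] := IH (t + s); exists s'.
Qed.

End Stamps.

Section OneClock.
Import Order.TTheory GRing.Theory Num.Theory.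
Local Open Scope ring_scope.
Variables (R : realType) (A : timed_automaton).

Definition sat1 (v : R) (g : guard (clock A)) : bool :=
  all (fun k : constraint (clock A) => let: (_, c, d) := k in
    match c with
    | CLt => v < d%:~R | CLe => v <= d%:~R | CEq => v == d%:~R
    | CGe => v >= d%:~R | CGt => v > d%:~R
    end) g.

Definition cst (v : R) : valuation R A := [ffun=> v].

Lemma sat_cst v g : sat (cst v) g = sat1 v g.
Proof. by apply: eq_all => -[[y []] d] /=; rewrite ffunE. Qed.

Lemma delay_cst v d : delay (cst v) d = cst (v + d).
Proof. by apply/ffunP => y; rewrite !ffunE. Qed.

(** Constraints are convex: an invariant that holds at both ends of a delay holds throughout it. *)
Lemma sat1_between u v w g : u <= v <= w -> sat1 u g -> sat1 w g -> sat1 v g.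
Proof.
move=> /andP[uv vw] /allP Hu /allP Hw; apply/allP => k kg.
by move: (Hu k kg) (Hw k kg); case: k {kg} => [[y []] d] /=; lra.
Qed.

(** Words carry delays instead of timestamps, and [b] remembers whether a private location has been
    visited. The invariant is tested at the end of a delay and on entering a location, which
    suffices by convexity. *)
Fixpoint acc (beta : bool) (l : location A) (b : bool) (v : R) (w : seq (action A * R)) : Prop :=
  if w is (a, d) :: w' then
    [/\ l \notin final A, 0 <= d & exists e, [/\ e \in edges A, src e = l, act e = Some a,
      sat1 (v + d) (loc_invariant l) & sat1 (v + d) (grd e)] /\
      let v' := if rst e == finset.set0 then v + d else 0 in
      sat1 v' (loc_invariant (tgt e)) /\ acc beta (tgt e) (b || (tgt e \in priv A)) v' w']
  else l \in final A /\ b = beta.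

Hypothesis clock1 : one_clock A.
Hypothesis eps : epsilon_free A.

Lemma reset_cst v (r : {set clock A}) :
  reset (cst v) r = cst (if r == finset.set0 then v else 0).
Proof.
apply/ffunP => y; rewrite !ffunE; case: eqP => [->|/eqP/set0Pn[z zr]]; first by rewrite inE.
suff -> : y = z by rewrite zr.
by have /card_le1P := eq_leq clock1; move/(_ z isT y); rewrite !inE => /esym/eqP.
Qed.

Lemma run_acc r c t b v : run_from c r -> c.2 = cst v -> sat1 v (loc_invariant c.1) ->
  exists dw, trace_from t r = stamps t dw /\
    acc (b || has (fun s : config R A => s.1 \in priv A) [seq s.2 | s <- r]) c.1 b v dw.
Proof.
move=> H; elim: H t b v => {c r} [c cf|[l mu] d e [l' mu'] r nf [d0 inv_d [eA sl] ge [[tl ml] inv']] _ IH] t b v /=.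
  by move=> _ _; exists [::]; rewrite /= orbF.
move=> muE inv0; subst l' mu'; rewrite muE delay_cst in ge inv' IH; rewrite muE in inv_d.
rewrite reset_cst in inv' IH; rewrite /= sat_cst in inv'.
have [dw [E Ha]] := IH (t + d) (b || (tgt e \in priv A)) _ erefl inv'.
case ae: (act e) => [a|]; last by case: (eps eA).
exists ((a, d) :: dw); rewrite /= E; split=> //; split=> //; exists e; split.
  split=> //; last by rewrite -sat_cst.
  by have := inv_d d; rewrite /= delay_cst sat_cst; apply; rewrite d0 lexx.
by split=> //; rewrite orbA.
Qed.

Lemma acc_run beta l b v dw t : acc beta l b v dw -> sat1 v (loc_invariant l) ->
  exists2 r, run_from (l, cst v) r &
    trace_from t r = stamps t dw /\
    b || has (fun s : config R A => s.1 \in priv A) [seq s.2 | s <- r] = beta.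
Proof.
elim: dw l b v t => [|[a d] dw IH] l b v t /=.
  by move=> [lf <-] _; exists [::]; [exact: run_stop | rewrite orbF].
move=> [nf d0 [e [[eA sl ae iv ge] [iv' H]]]] iv0.
have [r Hr [tr pr]] := IH _ _ _ (t + d) H iv'.
exists ((d, e, (tgt e, cst (if rst e == finset.set0 then v + d else 0))) :: r).
  apply: run_step Hr => //; split=> //=.
  - move=> d' d'd; rewrite delay_cst sat_cst; apply: sat1_between iv0 iv.
    by lra.
  - by rewrite delay_cst sat_cst.
  - by rewrite delay_cst reset_cst sat_cst.
by rewrite /= ae tr; split=> //; rewrite orbA.
Qed.

Definition lang beta : set (seq (action A * R)) := fun dw =>
  sat1 0 (loc_invariant (init A)) /\ acc beta (init A) (init A \in priv A) 0 dw.

Lemma tracesE beta w :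
  (exists r, [/\ is_run r, visits_private r = beta & trace r = w]) <->
  exists2 dw, lang beta dw & stamps 0 dw = w.
Proof.
have i0 : [ffun=> 0] = cst 0 :> valuation R A by apply/ffunP => y; rewrite !ffunE.
split=> [[r [[s0 H] <- <-]]|[dw [s0 H] <-]].
  rewrite /= i0 sat_cst in s0.
  have [dw [E Ha]] := run_acc 0 (init A \in priv A) H i0 s0.
  by exists dw.
have [r Hr [tr pr]] := acc_run 0 H s0.
exists r; split=> //; first by rewrite /is_run /init_config i0 /= sat_cst.
Qed.

Lemma weakly_opaqueE : weakly_opaque R A <-> (forall dw, lang true dw -> lang false dw).
Proof.
have pubE w : PubTr w <-> exists2 dw, lang false dw & stamps 0 dw = w.
  rewrite -tracesE; split=> -[r [? v ?]]; exists r; split=> //; last by rewrite v.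
  exact/negbTE.
split=> H => [dw Ht|w /tracesE[dw Ht <-]].
  have /pubE[dw' Hf /stamps_inj <- //] : PubTr (stamps 0 dw) by apply/H/tracesE; exists dw.
by apply/pubE; exists dw => //; exact: H.
Qed.

Lemma fully_opaqueE : fully_opaque R A <-> (forall dw, lang true dw <-> lang false dw).
Proof.
have pubE w : PubTr w <-> exists2 dw, lang false dw & stamps 0 dw = w.
  rewrite -tracesE; split=> -[r [? v ?]]; exists r; split=> //; last by rewrite v.
  exact/negbTE.
split=> [E dw|H].
  split=> Hl.
    have : PrivTr (stamps 0 dw) by apply/tracesE; exists dw.
    by rewrite E => /pubE[dw' Hf /stamps_inj <-].
  have : PubTr (stamps 0 dw) by apply/pubE; exists dw.
  by rewrite -E => /tracesE[dw' Hf /stamps_inj <-].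
apply/seteqP; split=> w.
  by move=> /tracesE[dw /H Hl e]; apply/pubE; exists dw.
by move=> /pubE[dw /H Hl e]; apply/tracesE; exists dw.
Qed.

End OneClock.

(** * The gadget *)

Inductive gkind := GAny | GLt1 | GEq1 | GGt1 | GEq0 | GGt0 | GLtX | GGtX.

Definition gkinds := [:: GAny; GLt1; GEq1; GGt1; GEq0; GGt0; GLtX; GGtX].

Definition gk_ord (g : gkind) : 'I_8 := inord (match g with
  GAny => 0 | GLt1 => 1 | GEq1 => 2 | GGt1 => 3 | GEq0 => 4 | GGt0 => 5 | GLtX => 6 | GGtX => 7 end).

Lemma gk_ordK : cancel gk_ord (fun i => nth GAny gkinds i).
Proof. by case; rewrite /gk_ord /= inordK. Qed.

HB.instance Definition _ := Finite.copy gkind (can_type gk_ordK).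

Inductive base_loc := BInit | BAny | BSink | BFin | BPriv | BPrivFin | BSame | BAbs | BUnload.

Definition base_locs := [:: BInit; BAny; BSink; BFin; BPriv; BPrivFin; BSame; BAbs; BUnload].

Definition bl_ord (b : base_loc) : 'I_9 := inord (match b with
  BInit => 0 | BAny => 1 | BSink => 2 | BFin => 3 | BPriv => 4 | BPrivFin => 5 | BSame => 6
  | BAbs => 7 | BUnload => 8 end).

Lemma bl_ordK : cancel bl_ord (fun i => nth BInit base_locs i).
Proof. by case; rewrite /bl_ord /= inordK. Qed.

HB.instance Definition _ := Finite.copy base_loc (can_type bl_ordK).

Section Gadget.
Variables (k m : nat) (P : seq instr).
Local Notation counter := (counter k m).
Local Notation rule_type := (rule_type k m P).
Local Notation q_load := (q_load k P).
Local Notation q_unload := (q_unload k P).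
Local Notation q_end := (q_end k P).

Definition letter : finType := option (rule_type + counter * 'I_3)%type.
Definition Mk (d : rule_type) : letter := Some (inl d).
Definition Tok (c : counter) : letter := Some (inr (c, inord 0)).
Definition Del (c : counter) : letter := Some (inr (c, inord 1)).
Definition New (c : counter) : letter := Some (inr (c, inord 2)).
Definition End_ : letter := None.

Definition is_tok (a : letter) : bool := if (a : option (_ + _)) is Some (inr _) then true else false.
Definition is_mk (a : letter) : bool := if (a : option (_ + _)) is Some (inl _) then true else false.

Definition loc : finType := (base_loc + (rule_type + counter * 'I_3))%type.
Definition bl (b : base_loc) : loc := inl b.
Definition LAt (d : rule_type) : loc := inr (inl d).
Definition LDel (c : counter) : loc := inr (inr (c, inord 0)).
Definition LMiss (c : counter) : loc := inr (inr (c, inord 1)).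
Definition LWait (c : counter) : loc := inr (inr (c, inord 2)).

(** The locations in which no defect has been guessed yet. Their clock has not been reset and shows
    the absolute time. *)
Definition wide (l : loc) := l = bl BInit \/ l = bl BAny.

(** With a load marker in front, the marker that ends the loading comes later, and [BAbs], entered
    on the first letter without a reset, can compare its time with [x]. *)
Definition first_ok (a : letter) := exists d, [/\ a = Mk d, is_rule d, r_src d = q_load & r_tgt d = q_load].

(** The public part accepts the words that end in the letter [End_] and do not
    encode a run of the counter machine.  A word encodes a run if the markers
    [Mk d] come one time unit apart, and the block after a marker holds, at
    distinct times, the tokens of the snapshot ([Del c] for the deleted ones,
    [Tok c] for the others) and the created tokens [New c]; the letters [Tok c]
    and [New c] require a token of [c] exactly one time unit later.  Unwanted
    extra tokens cannot be detected by a single clock. *)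
Inductive tr : loc -> gkind -> letter -> bool -> loc -> Prop :=
| t_any l a : wide l -> a <> End_ -> tr l GAny a false (bl BAny)
| t_stop l : wide l -> tr l GAny End_ false (bl BSink)
| t_empty : tr (bl BInit) GAny End_ false (bl BFin)
| t_first a : a <> End_ -> ~ first_ok a -> tr (bl BInit) GAny a false (bl BSink)
| t_time0 a : a <> End_ -> tr (bl BInit) GGt0 a false (bl BSink)
| t_norule l d : wide l -> ~ is_rule d -> tr l GAny (Mk d) false (bl BSink)
| t_at l d : wide l -> tr l GAny (Mk d) true (LAt d)
| t_miss l d c : wide l -> c \in r_new d -> tr l GAny (Mk d) false (LMiss c)
| t_same l a : wide l -> a <> End_ -> tr l GAny a true (bl BSame)
| t_wtok l c : wide l -> tr l GAny (Tok c) true (LWait c)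
| t_wnew l c : wide l -> tr l GAny (New c) true (LWait c)
| t_abs a : a <> End_ -> tr (bl BInit) GAny a false (bl BAbs)
| t_unload l d : wide l -> r_src d <> q_unload -> r_tgt d = q_unload ->
    tr l GAny (Mk d) true (bl BUnload)
| t_atloop d a : is_tok a -> tr (LAt d) GAny a false (LAt d)
| t_atzerot d c : c \in r_zero d -> tr (LAt d) GAny (Tok c) false (bl BSink)
| t_atzerod d c : c \in r_zero d -> tr (LAt d) GAny (Del c) false (bl BSink)
| t_atdel d c : c \notin r_del d -> tr (LAt d) GAny (Del c) false (bl BSink)
| t_atnew d c : c \notin r_new d -> tr (LAt d) GAny (New c) false (bl BSink)
| t_atdel2 d c : tr (LAt d) GAny (Del c) false (LDel c)
| t_atsrc d d' : r_src d' <> r_tgt d -> tr (LAt d) GAny (Mk d') false (bl BSink)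
| t_atlt d d' : tr (LAt d) GLt1 (Mk d') false (bl BSink)
| t_atgt d d' : tr (LAt d) GGt1 (Mk d') false (bl BSink)
| t_atend d : r_tgt d <> q_end -> tr (LAt d) GAny End_ false (bl BFin)
| t_delloop c a : is_tok a -> tr (LDel c) GAny a false (LDel c)
| t_del2 c : tr (LDel c) GAny (Del c) false (bl BSink)
| t_missloop c a : is_tok a -> a <> New c -> tr (LMiss c) GAny a false (LMiss c)
| t_missmk c d : tr (LMiss c) GAny (Mk d) false (bl BSink)
| t_missend c : tr (LMiss c) GAny End_ false (bl BFin)
| t_sameeq a : a <> End_ -> tr (bl BSame) GEq0 a false (bl BSink)
| t_waitlt c a : a <> End_ -> tr (LWait c) GLt1 a false (LWait c)
| t_waiteq c a : a <> End_ -> a <> Tok c -> a <> Del c -> tr (LWait c) GEq1 a false (LWait c)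
| t_waitgt c a : a <> End_ -> tr (LWait c) GGt1 a false (bl BSink)
| t_waitend c : tr (LWait c) GAny End_ false (bl BFin)
| t_absloop a : a <> End_ -> tr (bl BAbs) GAny a false (bl BAbs)
| t_abslt d : r_src d = q_load -> r_tgt d <> q_load -> tr (bl BAbs) GLtX (Mk d) false (bl BSink)
| t_unloop a : a <> End_ -> tr (bl BUnload) GAny a false (bl BUnload)
| t_unend d : r_tgt d = q_end -> tr (bl BUnload) GGtX (Mk d) false (bl BSink)
| t_sink a : tr (bl BSink) GAny a false (bl BSink)
| t_fin : tr (bl BSink) GAny End_ false (bl BFin)
| t_priv0 a : tr (bl BInit) GAny a false (bl BPriv)
| t_priv a : tr (bl BPriv) GAny a false (bl BPriv)
| t_pfin0 : tr (bl BInit) GAny End_ false (bl BPrivFin)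
| t_pfin : tr (bl BPriv) GAny End_ false (bl BPrivFin).

Definition trans_type : finType := (loc * gkind * letter * bool * loc)%type.

Definition transitions : seq trans_type :=
  locked [seq t <- enum trans_type | let: (l, g, a, r, l') := t in `[< tr l g a r l' >]].

Definition guard_of (x : nat) (g : gkind) : guard 'I_1 :=
  match g with
  | GAny => [::]
  | GLt1 => [:: (ord0, CLt, 1%:Z)] | GEq1 => [:: (ord0, CEq, 1%:Z)] | GGt1 => [:: (ord0, CGt, 1%:Z)]
  | GEq0 => [:: (ord0, CEq, 0%:Z)] | GGt0 => [:: (ord0, CGt, 0%:Z)]
  | GLtX => [:: (ord0, CLt, x%:Z)] | GGtX => [:: (ord0, CGt, x%:Z)]
  end%R.

Definition edge_of (x : nat) (t : trans_type) : edge letter loc 'I_1 :=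
  let: (l, g, a, r, l') := t in
  Edge l (guard_of x g) (Some a) (if r then [set ord0] else finset.set0) l'.

Definition gadget (x : nat) : timed_automaton :=
  @TimedAutomaton letter loc (bl BInit) [set bl BPriv; bl BPrivFin]
    [set bl BFin; bl BPrivFin] 'I_1 (fun=> [::]) [seq edge_of x t | t <- transitions].

Lemma gadget_clock x : one_clock (gadget x).
Proof. by rewrite /one_clock card_ord. Qed.

Lemma gadget_eps x : epsilon_free (gadget x).
Proof. by move=> e /mapP[[[[[l g] a] r] l'] _ ->]. Qed.

Import Order.TTheory GRing.Theory Num.Theory.
Local Open Scope ring_scope.

Section Language.
Variables (R : realType) (x : nat).

Definition gsem (g : gkind) (v : R) : bool :=
  match g with
  | GAny => true
  | GLt1 => v < 1 | GEq1 => v == 1 | GGt1 => v > 1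
  | GEq0 => v == 0 | GGt0 => v > 0
  | GLtX => v < x%:R | GGtX => v > x%:R
  end.

Lemma sat1_guard_of g v : @sat1 R (gadget x) v (guard_of x g) = gsem g v.
Proof. by case: g; rewrite /sat1 /= ?andbT -?pmulrn. Qed.

Lemma edgeP e : e \in edges (gadget x) <->
  exists l g a r l', tr l g a r l' /\ e = edge_of x (l, g, a, r, l').
Proof.
split=> [/mapP[[[[[l g] a] r] l']]|[l [g [a [r [l' [H ->]]]]]]].
  by rewrite /transitions -lock mem_filter => /andP[/asboolP H _] ->; exists l, g, a, r, l'.
by apply: map_f; rewrite /transitions -lock mem_filter mem_enum andbT; apply/asboolP.
Qed.

(** Acceptance on absolute timestamps: [tau] is the time of the last reset, so that the clock reads
    [t - tau]. Only the public final location counts. *)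
Fixpoint accA (l : loc) (tau : R) (w : seq (letter * R)) : Prop :=
  if w is (a, t) :: w' then exists g r l', [/\ tr l g a r l', gsem g (t - tau) &
    accA l' (if r then t else tau) w']
  else l = bl BFin.

Lemma tr_fin l g a r l' : tr l g a r l' -> l <> bl BFin /\ l <> bl BPrivFin.
Proof.
case=> *; try match goal with H : wide _ |- _ => case: H => ?; subst end; by split=> e; try subst.
Qed.

Lemma tr_priv l g a r l' : tr l g a r l' -> l = bl BPriv ->
  l' = bl BPriv \/ l' = bl BPrivFin.
Proof.
case=> *; try match goal with H : wide _ |- _ => case: H => ?; subst end; by auto.
Qed.

Lemma edge_in l g a r l' : tr l g a r l' -> edge_of x (l, g, a, r, l') \in edges (gadget x).
Proof. by move=> T; apply: (proj2 (edgeP _)); exists l, g, a, r, l'. Qed.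

Definition acc_step beta l b v a d w := [/\ l \notin final (gadget x), 0 <= d &
  exists g r l', [/\ tr l g a r l', gsem g (v + d) &
    @acc R (gadget x) beta l' (b || (l' \in priv (gadget x))) (if r then 0 else v + d) w]].

Lemma acc_cons beta l b v a d w :
  @acc R (gadget x) beta l b v ((a, d) :: w) <-> acc_step beta l b v a d w.
Proof.
have rE (r : bool) (y z : R) :
    (if (if r then [set ord0] else finset.set0) == finset.set0 :> {set 'I_1} then y else z) = if r then z else y.
  by case: r; rewrite ?eqxx //; case: eqP => // /setP/(_ ord0); rewrite !inE eqxx.
split=> [[nf d0 [e [[/edgeP[l1 [g [c [r [l2 [T ->]]]]]] sl ae _ ge] [_ H]]]]|[nf d0 [g [r [l2 [T ge H]]]]]].
  move: T ge H; rewrite -[l]sl; case: ae => -> T ge H.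
  split; [by rewrite sl | by [] | exists g, r, l2; split=> //].
    by rewrite -sat1_guard_of.
  by move: H; rewrite rE.
split=> //; exists (edge_of x (l, g, a, r, l2)); split.
  by split; [exact: edge_in T | by [] | by [] | by [] | rewrite -[sat1 _ _]/(@sat1 R (gadget x) (v + d) (guard_of x g)) sat1_guard_of].
by split=> //; rewrite -[X in acc _ _ _ X]/(if (if r then [set ord0] else finset.set0) == finset.set0 :> {set 'I_1} then v + d else 0) rE.
Qed.

Lemma finE l : l \in final (gadget x) -> l = bl BFin \/ l = bl BPrivFin.
Proof. by rewrite !inE => /orP[] /eqP ->; auto. Qed.

Lemma nprivE l : l <> bl BPriv -> l <> bl BPrivFin -> (l \in priv (gadget x)) = false.
Proof. by move=> /eqP/negbTE p1 /eqP/negbTE p2; rewrite !inE p1 p2. Qed.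

Lemma acc_private l v dw : @acc R (gadget x) false l true v dw -> False.
Proof.
elim: dw l v => [|[c d] w IH] l v; first by move=> [].
by move=> /acc_cons[_ _ [g [r [l' [_ _ /IH]]]]].
Qed.

Lemma accA_priv w ta l : l = bl BPriv \/ l = bl BPrivFin -> accA l ta w -> False.
Proof.
elim: w ta l => [|[c t] w IH] ta l ll /=; first by case: ll => ->.
move=> [g [r [l' [T _]]]]; apply: IH.
by case: ll => e; [exact: tr_priv T e | have [_ []] := tr_fin T].
Qed.

Lemma acc_accA l tau now dw : all (fun p => 0 <= p.2) dw -> l <> bl BPriv -> l <> bl BPrivFin ->
  @acc R (gadget x) false l false (now - tau) dw <-> accA l tau (stamps now dw).
Proof.
elim: dw l tau now => [|[a d] dw IH] l tau now.
  move=> _ _ lf; split=> [[/finE[]//]|E]; split=> //; by rewrite E !inE eqxx.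
move=> /andP[d0 dw0] l1 l2; rewrite acc_cons.
have vE (r : bool) : (if r then 0 else now - tau + d) = now + d - (if r then now + d else tau).
  by case: r; rewrite ?subrr // addrAC.
split=> [[_ _ [g [r [l' [T ge H]]]]]|[g [r [l' [T ge H]]]]].
  have [p1 p2] : l' <> bl BPriv /\ l' <> bl BPrivFin.
    split=> E; have pr : l' \in priv (gadget x) by rewrite E !inE eqxx ?orbT.
      by move: H; rewrite pr => /acc_private.
    by move: H; rewrite pr => /acc_private.
  exists g, r, l'; split=> //; first by rewrite addrAC.
  by apply/IH => //; move: H; rewrite nprivE // vE.
have [n1 n2] := tr_fin T.
have [p1 p2] : l' <> bl BPriv /\ l' <> bl BPrivFin.
  by split=> E; apply: accA_priv H; auto.
split=> //; first by apply/negP => /finE[].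
exists g, r, l'; split=> //; first by rewrite addrAC.
by rewrite nprivE // vE; apply/IH.
Qed.

End Language.
End Gadget.

(** * The languages of the private and the public part *)

Section GadgetLanguage.
Import Order.TTheory GRing.Theory Num.Theory.
Local Open Scope ring_scope.
Variables (R : realType) (k m x : nat) (P : seq instr).
Local Notation letter := (letter k m P).
Local Notation loc := (loc k m P).
Local Notation gadget := (gadget k m P x).
Local Notation bl := (bl k m P).
Local Notation End_ := (End_ k m P).
Implicit Types (w u : seq (letter * R)) (l : loc).

Definition endsw (dw : seq (letter * R)) :=
  all (fun p => 0 <= p.2) dw /\ exists u d, dw = rcons u (End_, d).

Lemma tr_to_fin l g a r l' : @tr k m P l g a r l' -> l' = bl BFin \/ l' = bl BPrivFin -> a = End_.
Proof. by case=> * //; match goal with H : _ \/ _ |- _ => case: H end. Qed.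

Lemma acc_endsw beta l b v w : @acc R gadget beta l b v w -> l \notin final gadget -> endsw w.
Proof.
elim: w l b v => [|[a d] w IH] l b v; first by move=> [->].
move=> /acc_cons[_ d0 [g [r [l2 [T _ H]]]]] _.
case: w IH H => [|p w] IH H.
  case: H => lf _; split; first by rewrite /= d0.
  by exists [::], d; rewrite (tr_to_fin T) //; exact: finE lf.
have l2f : l2 \notin final gadget by case: p H {IH} => c e /acc_cons[].
have [nn [u [d' E]]] := IH _ _ _ H l2f.
by split; [rewrite [all _ _]/= d0; exact: nn | exists ((a, d) :: u), d'; rewrite E].
Qed.

Lemma init_nonfinal : bl BInit \notin final gadget.
Proof. by rewrite !inE negb_or; apply/andP; split; apply/eqP. Qed.

Lemma lang_trueE dw : @lang R gadget true dw <-> endsw dw.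
Proof.
have pfin : @priv gadget =i [set bl BPriv; bl BPrivFin] by [].
have nf : bl BPriv \notin final gadget.
  by rewrite !inE negb_or; apply/andP; split; apply/eqP.
split=> [[_ H]|[nn [u [d E]]]]; first exact: acc_endsw H init_nonfinal.
split=> //.
have pf : bl BPrivFin \in priv gadget by rewrite !inE eqxx orbT.
have ff : bl BPrivFin \in final gadget by rewrite !inE eqxx orbT.
have fin b v t : 0 <= t -> @acc R gadget true (bl BPriv) b v [:: (End_, t)].
  move=> t0; apply/acc_cons; split=> //; exists GAny, false, (bl BPrivFin).
  by split=> //; [exact: t_pfin | split=> //; rewrite pf orbT].
have loop b v w t : all (fun p => 0 <= p.2) w -> 0 <= t ->
    @acc R gadget true (bl BPriv) b v (rcons w (End_, t)).
  elim: w b v => [|[a s] w IH] b v; first by move=> _; exact: fin.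
  move=> /andP[s0 w0] t0; apply/acc_cons; split=> //; exists GAny, false, (bl BPriv).
  by split=> //; [exact: t_priv | exact: IH].
rewrite E all_rcons /= in nn; case/andP: nn => d0 nn; rewrite E.
case: u nn {E} => [|[a t] u].
  move=> _; apply/acc_cons; split; [exact: init_nonfinal | by [] |].
  exists GAny, false, (bl BPrivFin).
  by split=> //; [exact: t_pfin0 | split=> //; rewrite pf orbT].
move=> /andP[t0 u0]; apply/acc_cons; split; [exact: init_nonfinal | by [] |].
exists GAny, false, (bl BPriv).
by split=> //; [exact: t_priv0 | exact: loop].
Qed.

Lemma lang_falseE dw : @lang R gadget false dw <->
  all (fun p => 0 <= p.2) dw /\ @accA k m P R x (bl BInit) 0 (stamps 0 dw).
Proof.
have i0 : (bl BInit \in priv gadget) = false.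
  by rewrite !inE; apply/negbTE; rewrite negb_or; apply/andP; split; apply/eqP.
split=> [[_ H]|[nn H]].
  have [nn _] := acc_endsw H init_nonfinal.
  by split=> //; apply/acc_accA => //; move: H; rewrite /= i0 subr0.
by split=> //; rewrite /= i0; rewrite -[0](subr0 0); apply/acc_accA.
Qed.

(** Both parts accept only words that end in [End_], and the private part accepts all of these.
    Hence the public language is always contained in the private one, and both notions of opacity
    say that the public part misses none of these words. *)
Lemma gadget_opaque :
  (weakly_opaque R gadget <-> forall dw, endsw dw -> @accA k m P R x (bl BInit) 0 (stamps 0 dw)) /\
  (fully_opaque R gadget <-> forall dw, endsw dw -> @accA k m P R x (bl BInit) 0 (stamps 0 dw)).
Proof.
have c1 := @gadget_clock k m P x; have e1 := @gadget_eps k m P x.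
split; [rewrite weakly_opaqueE // | rewrite fully_opaqueE //].
  split=> H dw => [/lang_trueE/H/lang_falseE[] //|/lang_trueE Hd].
  by apply/lang_falseE; split; [case: Hd | exact: H].
split=> H dw => [/lang_trueE/H/lang_falseE[] //|].
split=> [/lang_trueE Hd|Hf]; first by apply/lang_falseE; split; [case: Hd | exact: H].
apply/lang_trueE; case: Hf => _ Hf; exact: acc_endsw Hf init_nonfinal.
Qed.

Lemma not_opaqueE :
  (forall dw, endsw dw -> @accA k m P R x (bl BInit) 0 (stamps 0 dw)) <->
  (forall u T, path <=%R 0 [seq p.2 | p <- rcons u (End_, T)] ->
     @accA k m P R x (bl BInit) 0 (rcons u (End_, T))).
Proof.
split=> H.
  move=> u T p; have [dw E nn] := unstamp p; rewrite -E; apply: H; split=> //.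
  elim/last_ind: dw E {nn} => [|dw [a d] _]; first by case: u {p}.
  have [T' ->] := stamps_rcons 0 dw a d => /eqP; rewrite eqseq_rcons => /andP[_ /eqP[-> _]].
  by exists dw, d.
move=> dw [nn [u [d E]]]; have := stamps_path 0 nn; rewrite E.
have [T ->] := stamps_rcons 0 u End_ d; exact: H.
Qed.

End GadgetLanguage.

(** * Rejected words encode runs *)

Section WordToRun.
Import Order.TTheory GRing.Theory Num.Theory.
Local Open Scope ring_scope.
Variables (R : realType) (k m x : nat) (P : seq instr).
Local Notation letter := (letter k m P).
Local Notation loc := (loc k m P).
Local Notation bl := (bl k m P).
Local Notation End_ := (End_ k m P).
Local Notation Mk := (@Mk k m P).
Local Notation Tok := (@Tok k m P).
Local Notation Del := (@Del k m P).
Local Notation New := (@New k m P).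
Local Notation accA := (@accA k m P R x).
Local Notation counter := (counter k m).
Local Notation rule_type := (rule_type k m P).
Implicit Types (w v : seq (letter * R)) (l : loc) (d : rule_type) (c : counter).

Lemma sink_acc tau v T : accA (bl BSink) tau (rcons v (End_, T)).
Proof.
elim: v tau => [|[a t] v IH] tau /=.
  by exists GAny, false, (bl BFin); split=> //; exact: t_fin.
by exists GAny, false, (bl BSink); split=> //; exact: t_sink.
Qed.

Lemma wide_acc l v1 v2 : wide l -> all (fun p => p.1 != End_) v1 ->
  (forall l, wide l -> accA l 0 v2) -> accA l 0 (v1 ++ v2).
Proof.
elim: v1 l => [|[a t] v1 IH] l wl /=; first by move=> _; exact.
move=> /andP[/eqP aE nE] H; exists GAny, false, (bl BAny); split=> //; first exact: t_any.
by apply: IH => //; right.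
Qed.

Lemma at_loop d tau ts v : all (fun p => is_tok p.1) ts -> accA (LAt d) tau v ->
  accA (LAt d) tau (ts ++ v).
Proof.
elim: ts => //= -[a t] ts IH /andP[ta tts] H.
by exists GAny, false, (LAt d); split; [exact: t_atloop | by [] | exact: IH].
Qed.

Lemma del_loop c tau ts v : all (fun p => is_tok p.1) ts -> accA (LDel P c) tau v ->
  accA (LDel P c) tau (ts ++ v).
Proof.
elim: ts => //= -[a t] ts IH /andP[ta tts] H.
by exists GAny, false, (LDel P c); split; [exact: t_delloop | by [] | exact: IH].
Qed.

Lemma miss_loop c tau ts v : all (fun p => is_tok p.1 && (p.1 != New c)) ts ->
  accA (LMiss P c) tau v -> accA (LMiss P c) tau (ts ++ v).
Proof.
elim: ts => //= -[a t] ts IH /andP[/andP[ta /eqP an] tts] H.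
by exists GAny, false, (LMiss P c); split; [exact: t_missloop | by [] | exact: IH].
Qed.

Lemma letterP (a : letter) : [\/ a = End_, exists d, a = Mk d | is_tok a].
Proof. by case: a => [[d|b]|]; [constructor 2; exists d | constructor 3 | constructor 1]. Qed.

Variables (u : seq (letter * R)) (T : R).
Local Notation W := (rcons u (End_, T)).
Hypothesis rejected : ~ accA (bl BInit) 0 W.
Hypothesis Wsorted : path <=%R 0 [seq p.2 | p <- W].

Lemma no_end : all (fun p => p.1 != End_) u.
Proof.
apply: contrapT => /negP/allPn H; apply: rejected.
have [v1 [t [v2 [uE nE]]]] : exists v1 t v2, u = v1 ++ (End_, t) :: v2 /\ all (fun p => p.1 != End_) v1.
  elim: (u) H => [|[a t] v IH] [p]; first by [].
  case: (eqVneq a End_) => [->|aE] pv pE; first by exists [::], t, v.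
  have [|v1 [s [v2 [-> nE]]]] := IH.
    by exists p => //; move: pv; rewrite inE => /predU1P[e|//]; rewrite e /= aE in pE.
  by exists ((a, t) :: v1), s, v2; split=> //=; rewrite aE.
rewrite uE rcons_cat; apply: wide_acc => // [|l wl]; first by left.
by exists GAny, false, (bl BSink); split=> //; [exact: t_stop | exact: sink_acc].
Qed.

Lemma split_rejected v1 v2 : u = v1 ++ v2 -> ~ (forall l, wide l -> accA l 0 (rcons v2 (End_, T))).
Proof.
move=> uE H; apply: rejected; rewrite uE rcons_cat; apply: wide_acc => //; first by left.
by have := no_end; rewrite uE all_cat => /andP[].
Qed.

Lemma at_rejected v1 d t ts v2 : u = v1 ++ (Mk d, t) :: ts ++ v2 -> all (fun p => is_tok p.1) ts ->
  ~ accA (LAt d) t (rcons v2 (End_, T)).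
Proof.
move=> uE tts H; apply: (split_rejected uE) => l wl.
exists GAny, true, (LAt d); split=> //; first exact: t_at.
by rewrite rcons_cat; exact: at_loop.
Qed.

Lemma is_rule_mk v1 d t v2 : u = v1 ++ (Mk d, t) :: v2 -> is_rule d.
Proof.
move=> uE; apply: contrapT => nr; apply: (split_rejected uE) => l wl.
by exists GAny, false, (bl BSink); split=> //; [exact: t_norule | exact: sink_acc].
Qed.

Section Block.
Variables (v1 v2 : seq (letter * R)) (d : rule_type) (t : R) (ts : seq (letter * R)).
Hypothesis uE : u = v1 ++ (Mk d, t) :: ts ++ v2.
Hypothesis tts : all (fun p => is_tok p.1) ts.

Lemma mem_split (s : seq (letter * R)) p : p \in s -> exists s1 s2, s = s1 ++ p :: s2.
Proof.
elim: s => //= q s IH; rewrite inE => /predU1P[<-|/IH[s1 [s2 ->]]]; first by exists [::], s.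
by exists (q :: s1), s2.
Qed.

Lemma blk_split a s : (a, s) \in ts -> exists ts1 ts2,
  [/\ ts = ts1 ++ (a, s) :: ts2, u = v1 ++ (Mk d, t) :: ts1 ++ (a, s) :: ts2 ++ v2,
   all (fun p => is_tok p.1) ts1 & all (fun p => is_tok p.1) ts2].
Proof.
move=> /mem_split[ts1 [ts2 E]]; exists ts1, ts2.
move: tts; rewrite uE E all_cat -catA /= => /and3P[H1 _ H2]; split=> //.
Qed.

Lemma blk_zero c s : (Tok c, s) \in ts \/ (Del c, s) \in ts -> c \notin r_zero d.
Proof.
move=> H; apply/negP => cz.
have [a aE /blk_split[ts1 [ts2 [_ E t1 _]]]] : exists2 a, a = Tok c \/ a = Del c & (a, s) \in ts.
  by case: H => H; [exists (Tok c); auto | exists (Del c); auto].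
apply: (at_rejected E t1); exists GAny, false, (bl BSink); split; [|by []|exact: sink_acc].
by case: aE => ->; [exact: t_atzerot | exact: t_atzerod].
Qed.

Lemma blk_del c s : (Del c, s) \in ts -> c \in r_del d.
Proof.
move=> /blk_split[ts1 [ts2 [_ E t1 _]]]; apply: contrapT => /negP cz.
apply: (at_rejected E t1); exists GAny, false, (bl BSink); split; [|by []|exact: sink_acc].
exact: t_atdel.
Qed.

Lemma count_split (p : pred (letter * R)) s : (1 < count p s)%N ->
  exists s1 q s2, [/\ s = s1 ++ q :: s2, p q & has p s2].
Proof.
elim: s => //= q s IH; case: (boolP (p q)) => pq.
  by rewrite add1n ltnS -has_count => ps; exists [::], q, s.
by rewrite add0n => /IH[s1 [q' [s2 [-> ? ?]]]]; exists (q :: s1), q', s2.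
Qed.

Lemma blk_del1 c : (count (fun p => p.1 == Del c) ts <= (c \in r_del d))%N.
Proof.
case: (boolP (c \in r_del d)) => cd; last first.
  rewrite leqNgt -has_count; apply/hasPn => -[a s] ain /=.
  by apply: contraNN cd => /eqP aE; rewrite aE in ain; exact: blk_del ain.
rewrite leqNgt; apply/negP => /count_split[t1 [[a s] [t2 [E /= /eqP aE]]]].
move=> /hasP[[a' s'] /mem_split[t3 [t4 E']] /= /eqP aE'].
move: tts uE; rewrite E E' aE aE' !all_cat /= ?all_cat /= => /and3P[h1 h3 h4].
rewrite -!catA /= => uE'.
apply: (at_rejected uE' h1); exists GAny, false, (LDel P c); split; [exact: t_atdel2|by []|].
rewrite -catA /= rcons_cat; apply: del_loop => //.
by exists GAny, false, (bl BSink); split; [exact: t_del2|by []|exact: sink_acc].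
Qed.

Lemma blk_next d' t' v3 : v2 = (Mk d', t') :: v3 -> r_src d' = r_tgt d /\ t' = t + 1.
Proof.
move=> vE; have H := at_rejected uE tts; rewrite vE in H.
split.
  apply: contrapT => ne; apply: H; exists GAny, false, (bl BSink).
  by split; [exact: t_atsrc|by []|exact: sink_acc].
case: (ltgtP (t' - t) 1) => [lt|gt|]; last by lra.
  case: H; exists GLt1, false, (bl BSink); split; [exact: t_atlt|by []|exact: sink_acc].
case: H; exists GGt1, false, (bl BSink); split; [exact: t_atgt|by []|exact: sink_acc].
Qed.

Lemma blk_last : v2 = [::] -> r_tgt d = q_end k P.
Proof.
move=> vE; have H := at_rejected uE tts; rewrite vE in H.
apply: contrapT => ne; apply: H; exists GAny, false, (bl BFin).
by split; [exact: t_atend|by []|].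
Qed.

Lemma blk_created c : (v2 = [::] \/ exists p v3, v2 = p :: v3 /\ is_mk p.1) -> c \in r_new d ->
  has (fun p => p.1 == New c) ts.
Proof.
move=> vE cn; apply: contrapT => /negP nh; apply: (split_rejected uE) => l wl.
exists GAny, false, (LMiss P c); split; [exact: t_miss | by []|].
rewrite rcons_cat; apply: miss_loop.
  rewrite all_predI tts /=; apply/allP => p pin; apply: contraNN nh => pe.
  by apply/hasP; exists p.
case: vE => [->|[[a s] [v3 [-> /= am]]]].
  by exists GAny, false, (bl BFin); split; [exact: t_missend|by []|].
case: (letterP a) am => [->//|[d' ->] _|at_ am].
  by exists GAny, false, (bl BSink); split; [exact: t_missmk|by []|exact: sink_acc].
by case: a at_ am => [[]|].
Qed.

End Block.

(** Distinct times allow a token to be identified with its timestamp, which is how tokens are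
    counted later. *)
Lemma strict_split v1 a t b t' v2 : u = v1 ++ (a, t) :: (b, t') :: v2 -> t < t'.
Proof.
move=> uE.
have le : t <= t'.
  move: Wsorted; rewrite uE rcons_cat map_cat cat_path /= => /and3P[_ _ /andP[]//].
rewrite lt_neqAle le andbT; apply/eqP => tt; apply: (split_rejected uE) => l wl.
have := no_end; rewrite uE all_cat /= => /and4P[_ /eqP ae /eqP be _].
exists GAny, true, (bl BSame); split=> //; first exact: t_same.
exists GEq0, false, (bl BSink); split; [exact: t_sameeq | by rewrite /= tt subrr |exact: sink_acc].
Qed.

(** The location [LWait] can read every letter before and after the critical moment, and at that
    moment every letter other than the awaited ones. If these are missing, it survives to the end or
    moves to the sink, and the word is accepted. *)
Lemma copied v1 c t v2 a : a = Tok c \/ a = New c -> u = v1 ++ (a, t) :: v2 ->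
  (Tok c, t + 1) \in v2 \/ (Del c, t + 1) \in v2.
Proof.
move=> ac uE; apply: contrapT => nin; apply: (split_rejected uE) => l wl.
exists GAny, true, (LWait P c); split=> //; first by case: ac => ->; [exact: t_wtok | exact: t_wnew].
have : all (fun p => p.1 != End_) v2 by have := no_end; rewrite uE all_cat /= => /and3P[].
elim: v2 nin {uE} => [|[b s] v2 IH] nin.
  by move=> _; exists GAny, false, (bl BFin); split; [exact: t_waitend|by []|].
move=> /= /andP[/eqP be nE].
have nin' : ~ ((Tok c, t + 1) \in v2 \/ (Del c, t + 1) \in v2).
  by move=> H; apply: nin; rewrite !inE; case: H => ->; rewrite orbT; auto.
case: (ltgtP (s - t) 1) => [lt|gt|e].
- by exists GLt1, false, (LWait P c); split; [exact: t_waitlt | exact: lt | exact: IH].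
- by exists GGt1, false, (bl BSink); split; [exact: t_waitgt | exact: gt | exact: sink_acc].
have st : s = t + 1 by lra.
exists GEq1, false, (LWait P c); split; [|by rewrite /= e|exact: IH].
apply: t_waiteq => // bE; apply: nin; rewrite !inE bE st eqxx; auto.
Qed.

Lemma first_letter : exists d v, [/\ u = (Mk d, 0) :: v, is_rule d, r_src d = q_load k P & r_tgt d = q_load k P].
Proof.
case: u rejected no_end Wsorted => [|[a t] v] rej /= nE srt.
  by case: rej; exists GAny, false, (bl BFin); split; [exact: t_empty|by []|].
case/andP: nE => /eqP ae _; case/andP: srt => t0 _.
have tE : t = 0.
  apply/eqP; rewrite eq_le t0 andbT leNgt; apply/negP => tp; apply: rej.
  by exists GGt0, false, (bl BSink); split; [exact: t_time0 | rewrite /= subr0 | exact: sink_acc].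
case: (pselect (first_ok a)) => [[d [-> r s g]]|nf]; first by exists d, v; rewrite tE.
case: rej; exists GAny, false, (bl BSink); split; [exact: t_first|by []|exact: sink_acc].
Qed.

Lemma loads_long d v1 t v2 : u = v1 ++ (Mk d, t) :: v2 -> r_src d = q_load k P ->
  r_tgt d <> q_load k P -> x%:R <= t.
Proof.
move=> uE sd td; have [d0 [v [uE0 r0 s0 t0]]] := first_letter.
case: v1 uE => [|[a s] v1] uE.
  by move: uE; rewrite uE0 => -[dd]; rewrite dd in t0.
rewrite leNgt; apply/negP => lt; apply: rejected; rewrite uE /=.
have := no_end; rewrite uE /= => /andP[/eqP ae nE].
exists GAny, false, (bl BAbs); split=> //; first exact: t_abs.
rewrite rcons_cat; elim: v1 nE {uE} => [|[b r] v1 IH] /= nE.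
  exists GLtX, false, (bl BSink); split; [exact: t_abslt | by rewrite /= subr0 | exact: sink_acc].
by case/andP: nE => /eqP be nE; exists GAny, false, (bl BAbs); split; [exact: t_absloop|by []|exact: IH].
Qed.

Lemma unloads_short d v1 t v2 d' t' v3 : u = v1 ++ (Mk d, t) :: v2 ++ (Mk d', t') :: v3 ->
  r_src d <> q_unload k P -> r_tgt d = q_unload k P -> r_tgt d' = q_end k P -> t' - t <= x%:R.
Proof.
move=> uE sd td td'; rewrite leNgt; apply/negP => gt; apply: (split_rejected uE) => l wl.
exists GAny, true, (bl BUnload); split=> //; first exact: t_unload.
have : all (fun p => p.1 != End_) v2.
  by have := no_end; rewrite uE !all_cat /= !all_cat => /and4P[].
rewrite rcons_cat; elim: v2 {uE} => [|[b r] v2 IH] /= nE.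
  exists GGtX, false, (bl BSink); split; [exact: t_unend | exact: gt | exact: sink_acc].
by case/andP: nE => /eqP be nE; exists GAny, false, (bl BUnload); split; [exact: t_unloop|by []|exact: IH].
Qed.

End WordToRun.

Section Blocks.
Import Order.TTheory GRing.Theory Num.Theory.
Local Open Scope ring_scope.
Variables (R : realType) (k m x : nat) (P : seq instr).
Local Notation letter := (letter k m P).
Local Notation bl := (bl k m P).
Local Notation End_ := (End_ k m P).
Local Notation Mk := (@Mk k m P).
Local Notation Tok := (@Tok k m P).
Local Notation Del := (@Del k m P).
Local Notation New := (@New k m P).
Local Notation accA := (@accA k m P R x).
Local Notation rule_type := (rule_type k m P).

Definition block : Type := (rule_type * R * seq (letter * R))%type.

Definition blocks_word (bs : seq block) : seq (letter * R) :=
  flatten [seq (Mk b.1.1, b.1.2) :: b.2 | b <- bs].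

Lemma parse_blocks (v : seq (letter * R)) : all (fun p => p.1 != End_) v ->
  exists ts bs, [/\ v = ts ++ blocks_word bs, all (fun p => is_tok p.1) ts &
    all (fun b : block => all (fun p => is_tok p.1) b.2) bs].
Proof.
elim: v => [|[a t] v IH] /=; first by exists [::], [::].
move=> /andP[/eqP ae /IH[ts [bs [-> tts tbs]]]].
case: (letterP a) => [//|[d ->]|ta]; last by exists ((a, t) :: ts), bs; rewrite /= ta.
by exists [::], ((d, t, ts) :: bs); rewrite /= tts.
Qed.

Definition lt2 (p q : letter * R) := p.2 < q.2.

Lemma lt2_trans : transitive lt2.
Proof. by move=> p q r; exact: lt_trans. Qed.

Definition holds_c (c : counter k m) (p : letter * R) := (p.1 == Tok c) || (p.1 == Del c).
Definition sends_c (c : counter k m) (p : letter * R) := (p.1 == Tok c) || (p.1 == New c).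

Lemma kinds_neq (c : counter k m) : [/\ Tok c == Del c = false, Tok c == New c = false & Del c == New c = false].
Proof.
by split; apply/eqP => -[/(congr1 (fun i : 'I_3 => val i))]; rewrite /= !inordK.
Qed.

Lemma count_kinds c (ts : seq (letter * R)) :
  count (holds_c c) ts = (count (fun p => p.1 == Tok c) ts + count (fun p => p.1 == Del c) ts)%N /\
  count (sends_c c) ts = (count (fun p => p.1 == Tok c) ts + count (fun p => p.1 == New c) ts)%N.
Proof.
have [n1 n2 n3] := kinds_neq c.
split; elim: ts => //= -[a t] ts ->; rewrite /holds_c /sends_c /=.
  by case: eqP => [->|_] /=; rewrite ?n1 ?add0n; lia.
by case: eqP => [->|_] /=; rewrite ?n2 ?add0n; lia.
Qed.

(** The counters of the extracted run are the numbers of tokens in the blocks, where a deleted token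
    still counts in its block and a created one counts from the next block on. *)
Lemma rejected_accepting (u : seq (letter * R)) T :
  (forall i, List.In i P -> (reg_of i <= m)%N) ->
  (forall p s w, (p < size P)%N -> ((fstep P (p, s, w)).1.1 <= size P)%N) ->
  ~ accA (bl BInit) 0 (rcons u (End_, T)) ->
  path <=%R 0 [seq p.2 | p <- rcons u (End_, T)] -> accepting x P.
Proof.
move=> regP jumpP rej srt.
have nE := no_end rej.
have [ts0 [bs [uE tts0 tbs]]] := parse_blocks nE.
have [d0 [v0 [uE0 r0 sd0 td0]]] := first_letter rej srt.
have {ts0 tts0} uE : u = blocks_word bs.
  by case: ts0 uE tts0 => // -[a t] ts; rewrite uE0 => -[<-].
pose b0 : block := (d0, 0, [::]).
pose b i := nth b0 bs i.
have spl i : (i < size bs)%N -> u = blocks_word (take i bs) ++ (Mk (b i).1.1, (b i).1.2) :: (b i).2 ++ blocks_word (drop i.+1 bs).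
  move=> ib; rewrite uE -{1}(cat_take_drop i bs) (drop_nth b0) //.
  by rewrite /blocks_word map_cat flatten_cat /= -/(b i).
have tok i : (i < size bs)%N -> all (fun p => is_tok p.1) (b i).2.
  by move=> ib; have /(all_nthP b0)/(_ i ib) := tbs.
have bs0 : (0 < size bs)%N by case: bs uE {tbs b spl tok} => //; rewrite uE0.
have nxt i : (i.+1 < size bs)%N -> blocks_word (drop i.+1 bs) =
    (Mk (b i.+1).1.1, (b i.+1).1.2) :: (b i.+1).2 ++ blocks_word (drop i.+2 bs).
  by move=> ib; rewrite (drop_nth b0) // /blocks_word /= -/(b i.+1).
have bnext i : (i.+1 < size bs)%N -> r_src (b i.+1).1.1 = r_tgt (b i).1.1 /\ (b i.+1).1.2 = (b i).1.2 + 1.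
  by move=> ib; apply: (blk_next rej (spl i (ltnW ib)) (tok i (ltnW ib)) (nxt i ib)).
have b00 : (b 0).1.1 = d0 /\ (b 0).1.2 = 0.
  have := spl 0%N bs0; rewrite uE0 take0 /= => -[e1 e2 _]; split; last by rewrite e2.
  by rewrite e1.
have time i : (i < size bs)%N -> (b i).1.2 = i%:R.
  elim: i => [|i IH] ib; first by case: b00.
  by have [_ ->] := bnext i ib; rewrite IH ?(ltnW ib) // -natr1.
have srt2 : pairwise lt2 u.
  rewrite -sorted_pairwise; last exact: lt2_trans.
  apply/(sortedP (Mk d0, 0)) => i iu.
  have E : u = take i u ++ nth (Mk d0, 0) u i :: nth (Mk d0, 0) u i.+1 :: drop i.+2 u.
    by rewrite -!drop_nth // ?cat_take_drop //; exact: ltnW.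
  by move: E; case: (nth _ u i) => a t; case: (nth _ u i.+1) => c s E; apply: (strict_split rej srt E).
have inb i p : (i < size bs)%N -> p \in (b i).2 -> i%:R < p.2 /\ ((i.+1 < size bs)%N -> p.2 < i.+1%:R).
  move=> ib pin; move: srt2; rewrite (spl i ib) pairwise_cat /= => /and3P[_ _ /andP[H1 H2]].
  split; first by have := allP H1 p; rewrite mem_cat pin /lt2 /= time // => /(_ isT).
  move=> ib'; move: H2; rewrite nxt // pairwise_cat => /and3P[/allrelP H3 _ _].
  by have := H3 p (Mk (b i.+1).1.1, (b i.+1).1.2) pin (mem_head _ _); rewrite /lt2 /= time.
have uniq_u : uniq [seq p.2 | p <- u].
  apply: (sorted_uniq lt_trans ltxx); rewrite sorted_map.
  by rewrite (sorted_pairwise lt2_trans).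
have inu p : p \in u -> is_tok p.1 -> exists2 j, (j < size bs)%N & p \in (b j).2.
  rewrite uE /blocks_word => /flattenP[s /mapP[c cbs ->]]; rewrite inE => /predU1P[->//|pin] _.
  by exists (index c bs); rewrite ?index_mem // /b nth_index.
have leLb i : (i <= (size bs).-1)%N = (i < size bs)%N by rewrite -ltnS prednK.
apply: (@gainy_sound k m x P regP jumpP (fun i => (b i).1.1) (fun i c => count (holds_c c) (b i).2) (size bs).-1).
- by move=> i; rewrite leLb => iL; apply: (is_rule_mk rej (spl i _)).
- move=> i c; rewrite leLb => ib cz; apply/eqP; rewrite -leqn0 leqNgt -has_count; apply/hasPn => -[a s] pin.
  apply/negP => /orP[] /eqP /= aE; rewrite aE in pin.
    by have /negP := blk_zero rej (spl i ib) (tok i ib) (or_introl pin).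
  by have /negP := blk_zero rej (spl i ib) (tok i ib) (or_intror pin).
- by move=> i; rewrite ltn_predRL => ib; have [<- _] := bnext i ib.
- move=> i c; rewrite ltn_predRL => ib'; have ib := ltnW ib'.
  have [c1 c2] := count_kinds c (b i).2.
  have D1 := blk_del1 rej (spl i ib) (tok i ib) c.
  have N1 : ((c \in r_new (b i).1.1) <= count (fun p => p.1 == New c) (b i).2)%N.
    case: (boolP (c \in _)) => // cn; rewrite -has_count.
    apply: (blk_created rej (spl i ib) (tok i ib)) => //; right.
    by eexists; eexists; split; first exact: nxt.
  (* All times in the word are distinct, so the shift by one time unit embeds the surviving and
     created tokens of a block into the tokens of the next. It need not be onto, whence the
     inequality. *)
  suff : (count (sends_c c) (b i).2 <= count (holds_c c) (b i.+1).2)%N.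
    by move: D1 N1 c1 c2 (count_kinds c (b i.+1).2) => D1 N1 -> -> _; clear -D1 N1; lia.
  rewrite -!size_filter -(size_map (fun p => p.2 + 1) (seq.filter (sends_c c) _)) -(size_map snd (seq.filter (holds_c c) _)).
  apply: uniq_leq_size.
    have -> : [seq p.2 + 1 | p <- seq.filter (sends_c c) (b i).2] = [seq t + 1 | t <- [seq p.2 | p <- seq.filter (sends_c c) (b i).2]].
      by rewrite -map_comp.
    rewrite map_inj_uniq; last exact: addIr.
    apply: (subseq_uniq _ uniq_u); apply: map_subseq; apply: subseq_trans (filter_subseq _ _) _.
    rewrite (spl i ib); apply: subseq_trans (suffix_subseq _ _).
    by apply: subseq_trans (subseq_cons _ _); exact: prefix_subseq.
  move=> t /mapP[[a s]]; rewrite mem_filter => /andP[/= ac pin] ->.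
  have [v1 [v2 E]] := mem_split pin.
  have uE' : u = (blocks_word (take i bs) ++ (Mk (b i).1.1, (b i).1.2) :: v1) ++ (a, s) :: (v2 ++ blocks_word (drop i.+1 bs)).
    by rewrite (spl i ib) E -!catA /=.
  have ac' : a = Tok c \/ a = New c by case/orP: ac => /eqP /= ->; auto.
  have [a' a'E a'in] : exists2 a', holds_c c (a', s + 1) & (a', s + 1) \in u.
    have H := copied rej ac' uE'; rewrite uE'.
    by case: H => H; [exists (Tok c) | exists (Del c)];
      rewrite /holds_c /= ?eqxx ?orbT // mem_cat inE H !orbT.
  have ta' : is_tok a' by case/orP: a'E => /eqP /= ->.
  have [j jb jin] := inu _ a'in ta'.
  have [i1 /(_ ib') i2] := inb i _ ib pin; have [j1 j2] := inb j _ jb jin.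
  rewrite /= in i1 i2 j1 j2.
  (* Block [j] lies strictly between the times [j] and [j.+1], apart from the last block, for which
     [inb] gives no upper end. *)
  suff jE : j = i.+1.
    by apply/mapP; exists (a', s + 1) => //; rewrite mem_filter a'E -jE.
  apply/eqP; rewrite eqn_leq; apply/andP; split.
    rewrite -ltnS -(ltr_nat R) (lt_trans j1) // -[X in _ < X]natr1.
    by rewrite ltrD2r.
  rewrite leqNgt; apply/negP => ji.
  have : s + 1 < i.+1%:R.
    by apply: lt_le_trans (j2 (leq_ltn_trans ji ib')) _; rewrite ler_nat.
  by rewrite -natr1 ltrD2r ltNge (ltW i1).
- by case: b00 => -> _.
- have := blk_last rej (spl (size bs).-1 _) (tok (size bs).-1 _); apply; rewrite -?leLb //.
  by rewrite prednK // drop_size.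
- move=> i; rewrite leLb => ib sl tl.
  by have := loads_long rej srt (spl i ib) sl tl; rewrite time // ler_nat.
- move=> i j; rewrite leLb => /andP[ij jb] si ti tj; have ib := ltn_trans ij jb.
  have E : exists v2 v3, u = blocks_word (take i bs) ++ (Mk (b i).1.1, (b i).1.2) :: v2 ++ (Mk (b j).1.1, (b j).1.2) :: v3.
    exists ((b i).2 ++ blocks_word (take (j - i.+1) (drop i.+1 bs))), ((b j).2 ++ blocks_word (drop j.+1 bs)).
    rewrite {1}(spl i ib); congr (_ ++ _ :: _); rewrite -catA; congr (_ ++ _).
    rewrite -{1}(cat_take_drop (j - i.+1) (drop i.+1 bs)) /blocks_word map_cat flatten_cat; congr (_ ++ _).
    rewrite drop_drop subnK // (drop_nth b0) //= -/(b j) //.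
  have [v2 [v3 E']] := E.
  have := unloads_short rej E' si ti tj; rewrite !time // lerBlDr -natrD ler_nat addnC //.
Qed.

End Blocks.

(** * Runs give rejected words *)

Lemma count_filterD T (a b : pred T) s :
  (count a [seq y <- s | ~~ b y] + count (fun y => a y && b y) s = count a s)%N.
Proof. by elim: s => //= y s <-; case: (b y) => /=; case: (a y) => /=; lia. Qed.

Section Tokens.
Variables (C : finType).
Implicit Types (s : seq (nat * C)) (p : nat * C).

(** Tokens are pairs of an identity and a counter; [sel D s p] selects, for
    each counter of [D], the first token of [s]. *)
Definition sel (D : {set C}) s p :=
  (p.2 \in D) && (p == head p [seq q <- s | q.2 == p.2]).

Definition fresh_tokens (f : nat) (N : {set C}) : seq (nat * C) := zip (iota f #|N|) (enum N).

Lemma unzip1_fresh f N : [seq p.1 | p <- fresh_tokens f N] = iota f #|N|.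
Proof. by rewrite -/(unzip1 _) unzip1_zip // size_iota cardE. Qed.

Lemma unzip2_fresh f N : [seq p.2 | p <- fresh_tokens f N] = enum N.
Proof. by rewrite -/(unzip2 _) unzip2_zip // size_iota cardE. Qed.

Lemma fresh_id f N p : p \in fresh_tokens f N -> f <= p.1 < f + #|N|.
Proof. by move=> /(map_f fst); rewrite unzip1_fresh mem_iota. Qed.

Lemma fresh_mem f N p : p \in fresh_tokens f N -> p.2 \in N.
Proof. by move=> /(map_f snd); rewrite unzip2_fresh mem_enum. Qed.

Lemma count_fresh f N c : count (fun p => p.2 == c) (fresh_tokens f N) = (c \in N).
Proof.
rewrite -(mem_enum N) -(unzip2_fresh f) -(count_uniq_mem c); last by rewrite unzip2_fresh enum_uniq.
by rewrite count_map.
Qed.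

Lemma count_sel D s c : uniq s ->
  count (fun p => (p.2 == c) && sel D s p) s = (c \in D) && (0 < count (fun p => p.2 == c) s).
Proof.
move=> us; case: (boolP (c \in D)) => cD /=; last first.
  rewrite (@eq_count _ _ pred0) ?count_pred0 // => p /=.
  by apply/negbTE/negP => /andP[/eqP e /andP[]]; rewrite e (negbTE cD).
rewrite -has_count; case: hasP => [[p ps /eqP pc]|np]; last first.
  rewrite (@eq_in_count _ _ pred0) ?count_pred0 // => p ps /=.
  by apply/negbTE/negP => /andP[pc _]; apply: np; exists p.
have : [seq q <- s | q.2 == c] <> [::].
  by move=> e; have : p \in [seq q <- s | q.2 == c]; [rewrite mem_filter pc eqxx | rewrite e].
case E : [seq q <- s | q.2 == c] => [//|h t] _.
have : h \in [seq q <- s | q.2 == c] by rewrite E mem_head.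
rewrite mem_filter => /andP[/eqP hc hs].
rewrite (@eq_in_count _ _ (pred1 h)) ?count_uniq_mem ?hs // => q qs /=.
rewrite /sel; case: (eqVneq q.2 c) => [qc|qc] /=; last by apply/esym/eqP => qh; rewrite qh hc eqxx in qc.
by rewrite qc cD E.
Qed.

End Tokens.

Section RunToWord.
Import Order.TTheory GRing.Theory Num.Theory.
Variables (R : realType) (k m x : nat) (P : seq instr).
Local Notation letter := (letter k m P).
Local Notation loc := (loc k m P).
Local Notation bl := (bl k m P).
Local Notation End_ := (End_ k m P).
Local Notation Mk := (@Mk k m P).
Local Notation Tok := (@Tok k m P).
Local Notation Del := (@Del k m P).
Local Notation New := (@New k m P).
Local Notation accA := (@accA k m P R x).
Local Notation rule_type := (rule_type k m P).
Local Notation counter := (counter k m).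

Variables (d : nat -> rule_type) (u : nat -> counter -> nat) (L : nat).
Hypothesis ruleP : forall i, i <= L -> is_rule (d i).
Hypothesis stepP : forall i, i <= L -> estep (r_zero (d i)) (r_del (d i)) (r_new (d i)) (u i) (u i.+1).
Hypothesis chainP : forall i, i < L -> r_tgt (d i) = r_src (d i.+1).
Hypothesis src0 : r_src (d 0) = q_load k P.
Hypothesis tgtL : r_tgt (d L) = q_end k P.
Hypothesis u0 : forall c, u 0 c = 0.
Hypothesis loadP : forall i, i <= L -> r_src (d i) = q_load k P -> r_tgt (d i) <> q_load k P -> x <= i.
Hypothesis unloadP : forall i j, i < j <= L -> r_src (d i) <> q_unload k P ->
  r_tgt (d i) = q_unload k P -> j <= i + x.
Hypothesis x0 : 0 < x.

Fixpoint toks (i : nat) : seq (nat * counter) * nat :=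
  if i is i'.+1 then
    ([seq p <- (toks i').1 | ~~ sel (r_del (d i')) (toks i').1 p] ++ fresh_tokens (toks i').2 (r_new (d i')),
     (toks i').2 + #|r_new (d i')|)
  else ([::], 0).

Definition kept i := (toks i).1.
Definition created i := fresh_tokens (toks i).2 (r_new (d i)).
Definition deleted i := sel (r_del (d i)) (kept i).

Lemma ids_sorted i : pairwise ltn [seq p.1 | p <- kept i ++ created i] /\
  all (fun p => p.1 < (toks i).2) (kept i).
Proof.
have app i' : pairwise ltn [seq p.1 | p <- kept i'] -> all (fun p => p.1 < (toks i').2) (kept i') ->
    pairwise ltn [seq p.1 | p <- kept i' ++ created i'].
  move=> Hp Ha; rewrite map_cat pairwise_cat Hp unzip1_fresh.
  rewrite -[X in _ && X](sorted_pairwise ltn_trans) iota_ltn_sorted andbT /=.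
  apply/allrelP => a b /mapP[p ps ->]; rewrite mem_iota => /andP[fb _].
  exact: leq_trans (allP Ha _ ps) fb.
suff [Hp Ha] : pairwise ltn [seq p.1 | p <- kept i] /\ all (fun p => p.1 < (toks i).2) (kept i).
  by split=> //; exact: app.
elim: i => [|i [Hp Ha]] //.
have /and3P[H1 H2 H3] : [&& allrel ltn [seq p.1 | p <- kept i] [seq p.1 | p <- created i],
    pairwise ltn [seq p.1 | p <- kept i] & pairwise ltn [seq p.1 | p <- created i]].
  by have := app i Hp Ha; rewrite map_cat pairwise_cat.
split.
  rewrite [kept i.+1]/(_ ++ _) map_cat pairwise_cat; apply/and3P; split=> //.
    apply/allrelP => a b /mapP[p]; rewrite mem_filter => /andP[_ ps] -> bs.
    by move/allrelP: H1; apply=> //; apply: map_f.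
  by apply: subseq_pairwise H2; apply: map_subseq; exact: filter_subseq.
rewrite [kept i.+1]/(_ ++ _) all_cat; apply/andP; split.
  apply/allP => p; rewrite mem_filter => /andP[_ ps] /=.
  by rewrite ltn_addr // (allP Ha).
by apply/allP => p /fresh_id/andP[_].
Qed.

Lemma uniq_kept i : uniq (kept i).
Proof.
have [H _] := ids_sorted i.
have : uniq [seq p.1 | p <- kept i].
  apply: (sorted_uniq ltn_trans ltnn); rewrite (sorted_pairwise ltn_trans).
  by move: H; rewrite map_cat pairwise_cat => /and3P[].
exact: map_uniq.
Qed.

Lemma count_kept i c : i <= L.+1 -> count (fun p => p.2 == c) (kept i) = u i c.
Proof.
elim: i c => [|i IH] c iL; first by rewrite u0.
have [Z D E] := stepP (iL : i <= L).
have cS := count_sel (r_del (d i)) c (uniq_kept i).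
rewrite [kept i.+1]/(_ ++ _) count_cat count_fresh.
have cF : count (fun p => p.2 == c) [seq p <- kept i | ~~ deleted i p] +
    count (fun p => (p.2 == c) && deleted i p) (kept i) = u i c.
  by rewrite -(IH c (ltnW iL)) count_filterD.
rewrite cS (IH c (ltnW iL)) in cF; have Ec := E c; have := D c; move: cF Ec.
move: (count _ _) (u i c) (u i.+1 c) => a b e; clear.
case: (c \in r_del (d i)) => /=; last by lia.
by move=> H1 H2 /(_ isT) u_pos; rewrite u_pos in H1; lia.
Qed.

Local Open Scope ring_scope.
Implicit Types (v : seq (letter * R)).

(** A strictly increasing sequence inside the open unit interval: a block must have room for any
    number of identities, in their order. *)
Definition fr (j : nat) : R := 1 - j.+2%:R^-1.

Lemma fr01 j : 0 < fr j < 1.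
Proof.
have h : (0 : R) < j.+2%:R by rewrite ltr0n.
by rewrite /fr subr_gt0 invf_lt1 // ltr1n /= ltrBlDr ltrDl invr_gt0.
Qed.

Lemma fr_lt i j : (i < j)%N -> fr i < fr j.
Proof. by move=> ij; rewrite /fr ltrD2l ltrN2 ltf_pV2 ?posrE ?ltr0n // ltr_nat. Qed.

Definition kind i (p : nat * counter) : letter := if deleted i p then Del p.2 else Tok p.2.

Definition tokens_at i : seq (letter * R) :=
  [seq (kind i p, i%:R + fr p.1) | p <- kept i] ++ [seq (New p.2, i%:R + fr p.1) | p <- created i].

Definition word_from a n : seq (letter * R) :=
  flatten [seq (Mk (d i), i%:R) :: tokens_at i | i <- iota a n].

Definition word := word_from 0 L.+1.

Definition depicts (q : letter * R) i :=
  [\/ q = (Mk (d i), i%:R),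
      exists p, [/\ p \in kept i, ~~ deleted i p & q = (Tok p.2, i%:R + fr p.1)],
      exists p, [/\ p \in kept i, deleted i p & q = (Del p.2, i%:R + fr p.1)] |
      exists p, p \in created i /\ q = (New p.2, i%:R + fr p.1)].

Lemma tokens_atP q i : q \in (Mk (d i), i%:R) :: tokens_at i <-> depicts q i.
Proof.
rewrite inE mem_cat; split.
  move=> /predU1P[->|/orP[/mapP[p ps ->]|/mapP[p ps ->]]]; first by constructor 1.
    rewrite /kind; case: (boolP (deleted i p)) => dp; [constructor 3|constructor 2]; by exists p.
  by constructor 4; exists p.
case=> [->|[p [ps dp ->]]|[p [ps dp ->]]|[p [ps ->]]]; first by rewrite eqxx.
- by apply/orP; right; apply/orP; left; apply/mapP; exists p => //; rewrite /kind (negbTE dp).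
- by apply/orP; right; apply/orP; left; apply/mapP; exists p => //; rewrite /kind dp.
- by apply/orP; right; apply/orP; right; apply/mapP; exists p.
Qed.

Lemma word_fromP a n q : q \in word_from a n <-> exists2 i, (a <= i < a + n)%N & depicts q i.
Proof.
split=> [/flattenP[s /mapP[i]]|[i ian /tokens_atP qi]].
  by rewrite mem_iota => ian -> /tokens_atP; exists i.
apply/flattenP; exists ((Mk (d i), i%:R) :: tokens_at i) => //.
by apply/mapP; exists i; rewrite ?mem_iota.
Qed.

Lemma wordP q : q \in word <-> exists2 i, (i <= L)%N & depicts q i.
Proof. by rewrite /word word_fromP; split=> -[i iL H]; exists i. Qed.

Lemma depicts_time q i : depicts q i -> i%:R <= q.2 < i.+1%:R /\ (i%:R < q.2 -> is_tok q.1).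
Proof.
have H p : i%:R <= i%:R + fr p < i.+1%:R.
  by have /andP[h1 h2] := fr01 p; rewrite lerDl (ltW h1) -natr1 ltrD2l.
case=> [->|[p [_ _ ->]]|[p [_ _ ->]]|[p [_ ->]]] /=; try by split.
by rewrite lexx ltr_nat ltnSn ltxx.
Qed.

Lemma word_sorted : pairwise (@lt2 R k m P) word.
Proof.
rewrite /word; move: {1}0%N => a; elim: (L.+1) a => // n IH a.
rewrite /word_from [iota _ _]/= [flatten _]/= -/(word_from a.+1 n) -cat_cons pairwise_cat IH andbT; apply/andP; split.
  apply/allrelP => q q' /tokens_atP/depicts_time[/andP[_ h] _].
  move=> /word_fromP[i /andP[ai _] /depicts_time[/andP[h' _] _]].
  by apply: lt_le_trans h _; apply: le_trans h'; rewrite ler_nat.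
rewrite [pairwise _ _]/= -[X in _ && X]/(pairwise _ (tokens_at a)).
have tm : pairwise (@lt2 R k m P) (tokens_at a).
  have [H _] := ids_sorted a.
  have : pairwise (fun s t : R => s < t) [seq a%:R + fr j | j <- [seq p.1 | p <- kept a ++ created a]].
    by rewrite pairwise_map; apply: sub_pairwise H => i j ij /=; rewrite ltrD2l fr_lt.
  have -> : [seq a%:R + fr j | j <- [seq p.1 | p <- kept a ++ created a]] = [seq q.2 | q <- tokens_at a].
    by rewrite /tokens_at !map_cat -!map_comp.
  by rewrite pairwise_map.
rewrite tm andbT; apply/allP => q; rewrite mem_cat => qa.
have : q \in (Mk (d a), a%:R) :: tokens_at a by rewrite inE mem_cat qa orbT.
case: q qa => e t qa _; rewrite /lt2 /=.
by case/orP: qa => /mapP[p _ [_ ->]]; rewrite ltrDl; case/andP: (fr01 p.1).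
Qed.

Lemma word_between v1 q v2 q' v3 q0 : word = v1 ++ q :: v2 ++ q' :: v3 -> q0 \in word ->
  q.2 < q0.2 < q'.2 -> q0 \in v2.
Proof.
move=> E; have := word_sorted; rewrite E pairwise_cat pairwise_cons pairwise_cat pairwise_cons.
move=> /and4P[/allrelP S1 _ _ /and4P[_ _ S4 _]].
rewrite mem_cat inE mem_cat inE => /or4P[H|/eqP->|H|H] /andP[h1 h2] //; rewrite ?ltxx // in h1.
  by have := lt_trans h1 (S1 _ _ H (mem_head _ _)); rewrite ltxx.
case/predU1P: H => [e|H]; first by rewrite e ltxx in h2.
by have := lt_trans h2 (allP S4 _ H); rewrite ltxx.
Qed.

Lemma mk_in_word i : (i <= L)%N -> (Mk (d i), i%:R) \in word.
Proof. by move=> iL; apply/wordP; exists i => //; constructor 1. Qed.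

Lemma depicts_mk e t i : depicts (Mk e, t) i -> e = d i /\ t = i%:R.
Proof.
case=> [[-> ->]//|[p [_ _ []]]|[p [_ _ []]]|[p [_ []]]] //.
Qed.

Lemma kind_letter_inj (c c' : counter) i j :
  Some (inr (c, inord i)) = Some (inr (c', inord j)) :> letter ->
  (i < 3)%N -> (j < 3)%N -> c = c' /\ i = j.
Proof. by move=> + i3 j3; move=> [-> /(congr1 val)]; rewrite /= !inordK. Qed.

Lemma depicts_tok c t i : depicts (Tok c, t) i ->
  exists p, [/\ p \in kept i, ~~ deleted i p, p.2 = c & t = i%:R + fr p.1].
Proof.
case=> [[]//|[p [ps dp e]]|[p [ps dp e]]|[p [ps e]]];
  case: (kind_letter_inj (congr1 fst e) isT isT) => // cp _.
by have /= tp := congr1 snd e; exists p.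
Qed.

Lemma depicts_del c t i : depicts (Del c, t) i ->
  exists p, [/\ p \in kept i, deleted i p, p.2 = c & t = i%:R + fr p.1].
Proof.
case=> [[]//|[p [ps dp e]]|[p [ps dp e]]|[p [ps e]]];
  case: (kind_letter_inj (congr1 fst e) isT isT) => // cp _.
by have /= tp := congr1 snd e; exists p.
Qed.

Lemma depicts_new c t i : depicts (New c, t) i ->
  exists p, [/\ p \in created i, p.2 = c & t = i%:R + fr p.1].
Proof.
case=> [[]//|[p [ps dp e]]|[p [ps dp e]]|[p [ps e]]];
  case: (kind_letter_inj (congr1 fst e) isT isT) => // cp _.
by have /= tp := congr1 snd e; exists p.
Qed.

Lemma block_index v1 e t ts q v3 : word = v1 ++ (Mk e, t) :: ts ++ q :: v3 ->
  all (fun p => is_tok p.1) ts -> exists2 i, (i <= L)%N & [/\ e = d i, t = i%:R &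
    if is_tok q.1 then depicts q i else (i < L)%N /\ q = (Mk (d i.+1), i.+1%:R)].
Proof.
move=> E tts.
have /wordP[i iL /depicts_mk[ei ti]] : (Mk e, t) \in word by rewrite E mem_cat mem_head orbT.
exists i => //; split=> //.
have qW : q \in word by rewrite E mem_cat inE mem_cat mem_head !orbT.
have /wordP[j jL Dj] := qW.
have [/andP[j1 j2] jt] := depicts_time Dj.
have tq : t < q.2.
  have := word_sorted; rewrite E pairwise_cat pairwise_cons => /and4P[_ _ H _].
  by apply: (allP H q); rewrite mem_cat mem_head orbT.
have ij : (i <= j)%N.
  by rewrite -ltnS -(ltr_nat R) -ti (lt_trans tq).
have nomk l : (i < l <= L)%N -> l%:R < q.2 -> False.
  move=> /andP[il lL] lq.
  have : (Mk (d l), l%:R) \in ts.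
    by apply: (word_between E (mk_in_word lL)); rewrite ti ltr_nat il.
  by move=> /(allP tts).
case: ifP => qt.
  case: (ltngtP i j) ij => // [ij _|-> _ //].
  exfalso; apply: (nomk j); first by rewrite ij.
  rewrite lt_neqAle j1 andbT; apply/eqP => jq.
  case: Dj jq qt => [-> //|[p [_ _ ->]]|[p [_ _ ->]]|[p [_ ->]]] /= /esym/eqP;
    by rewrite addrC -subr_eq0 addrK gt_eqF //; case/andP: (fr01 p.1).
have qE : q = (Mk (d j), j%:R).
  by case: Dj qt => [-> //|[p [_ _ ->]]|[p [_ _ ->]]|[p [_ ->]]].
have ij' : (i < j)%N by rewrite -(ltr_nat R) -ti; move: tq; rewrite qE.
have jE : j = i.+1.
  apply/eqP; rewrite eqn_leq ij' andbT leqNgt; apply/negP => ji.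
  apply: (nomk i.+1); first by rewrite ltnSn (leq_trans (ltnW ji)).
  by rewrite qE /= ltr_nat.
by rewrite -jE; split=> //; exact: leq_trans ij' jL.
Qed.

Lemma block_last v1 e t ts : word = v1 ++ (Mk e, t) :: ts ->
  all (fun p => is_tok p.1) ts -> e = d L.
Proof.
move=> E tts.
have /wordP[i iL /depicts_mk[ei ti]] : (Mk e, t) \in word by rewrite E mem_cat mem_head orbT.
case: (ltngtP i L) iL => // [iL _|iL _]; last by rewrite ei iL.
have : (Mk (d L), L%:R) \in word by exact: mk_in_word.
have := word_sorted; rewrite E pairwise_cat => /and3P[/allrelP S _ _].
rewrite mem_cat inE => /or3P[H|/eqP[_ eq]|/(allP tts)//].
  by have := S _ _ H (mem_head _ _); rewrite /lt2 /= ti ltr_nat ltnNge (ltnW iL).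
by move: iL; rewrite -(ltr_nat R) eq ti ltxx.
Qed.

Lemma token_zero p i : (i <= L)%N -> p \in kept i -> p.2 \notin r_zero (d i).
Proof.
move=> iL ps; apply/negP => pz; have [Z _ _] := stepP iL; have := Z _ pz.
have := count_kept p.2 (leqW iL) => <- /eqP; rewrite -leqn0 leqNgt -has_count => /hasPn/(_ p ps).
by rewrite eqxx.
Qed.

Lemma wide_at e : ~ wide (LAt e : loc).
Proof. by case. Qed.

Lemma tr_at e g a r l' : @tr k m P (LAt e) g a r l' ->
  [\/ [/\ is_tok a, l' = LAt e & r = false],
      exists2 c, a = Tok c \/ a = Del c & c \in r_zero e,
      (exists2 c, a = Del c & c \notin r_del e) \/ (exists2 c, a = New c & c \notin r_new e) |
      [\/ exists2 c, a = Del c & l' = LDel P c /\ r = false,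
          exists2 e', a = Mk e' & [\/ r_src e' <> r_tgt e, g = GLt1 | g = GGt1] |
          a = End_ /\ r_tgt e <> q_end k P]].
Proof.
move E: (LAt e) => l T; case: T E => //.
all: intros; subst.
all: try match goal with H : wide _ |- _ => by case: (wide_at H) end.
all: match goal with H : LAt _ = LAt _ |- _ => case: H => ?; subst end.
- by constructor 1.
- by constructor 2; exists c; auto.
- by constructor 2; exists c; auto.
- by constructor 3; left; exists c.
- by constructor 3; right; exists c.
- by constructor 4; constructor 1; exists c.
- by constructor 4; constructor 2; exists d'; auto; constructor 1.
- by constructor 4; constructor 2; exists d'; auto; constructor 2.
- by constructor 4; constructor 2; exists d'; auto; constructor 3.
- by constructor 4; constructor 3.
Qed.

Lemma wait_loc_inj c c' i j :
  inr (inr (c, inord i)) = inr (inr (c', inord j)) :> loc ->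
  (i < 3)%N -> (j < 3)%N -> c = c' /\ i = j.
Proof. by move=> + i3 j3; move=> [-> /(congr1 val)]; rewrite /= !inordK. Qed.

Ltac tr_inv T E := move: E; case: T => //; intros; subst;
  try match goal with
  | H : wide ?l |- _ => by case: H => ?; subst
  | H : wide ?l, E : ?l = _ |- _ => by case: H => ?; subst
  end;
  try match goal with H : _ = _ |- _ =>
    case: (wait_loc_inj H isT isT) => ? // _; subst end.

Lemma tr_del c g a r l' : @tr k m P (LDel P c) g a r l' ->
  is_tok a /\ l' = LDel P c /\ r = false \/ a = Del c.
Proof.
move E: (LDel P c) => l T; tr_inv T E.
  by left.
by right.
Qed.

Lemma tr_miss c g a r l' : @tr k m P (LMiss P c) g a r l' ->
  [\/ [/\ is_tok a, a <> New c, l' = LMiss P c & r = false], exists e, a = Mk e | a = End_].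
Proof.
move E: (LMiss P c) => l T; tr_inv T E; first by constructor 1.
  by constructor 2; exists d0.
by constructor 3.
Qed.

Lemma tr_wait c g a r l' : @tr k m P (LWait P c) g a r l' ->
  [\/ [/\ g = GLt1, l' = LWait P c & r = false],
      [/\ g = GEq1, a <> Tok c & a <> Del c], g = GGt1 | a = End_].
Proof.
move E: (LWait P c) => l T; tr_inv T E.
- by constructor 1. - by constructor 2. - by constructor 3. - by constructor 4.
Qed.

Lemma tr_same g a r l' : @tr k m P (bl BSame) g a r l' -> g = GEq0 /\ a <> End_.
Proof. by move E: (bl BSame) => l T; tr_inv T E. Qed.

Lemma tr_abs g a r l' : @tr k m P (bl BAbs) g a r l' ->
  [/\ a <> End_, l' = bl BAbs & r = false] \/
  g = GLtX /\ exists e, [/\ a = Mk e, r_src e = q_load k P & r_tgt e <> q_load k P].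
Proof.
move E: (bl BAbs) => l T; tr_inv T E; first by left.
by right; split=> //; exists d0.
Qed.

Lemma tr_unload g a r l' : @tr k m P (bl BUnload) g a r l' ->
  [/\ a <> End_, l' = bl BUnload & r = false] \/
  g = GGtX /\ exists e, [/\ a = Mk e & r_tgt e = q_end k P].
Proof.
move E: (bl BUnload) => l T; tr_inv T E; first by left.
by right; split=> //; exists d0.
Qed.

Lemma no_End q : q \in word -> q.1 <> End_.
Proof. by move=> /wordP[i _ [->|[p [_ _ ->]]|[p [_ _ ->]]|[p [_ ->]]]]. Qed.

Lemma suffix_lt v1 q v2 q' : word = v1 ++ q :: v2 -> q' \in v2 -> q.2 < q'.2.
Proof.
move=> E qin; have := word_sorted; rewrite E pairwise_cat pairwise_cons => /and4P[_ _ H _].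
exact: (allP H q' qin).
Qed.

(** Times increase strictly, so no letter with a later time is read before the awaited one; and when
    that letter comes, the clock is exactly 1 and no transition of [LWait] reads it. *)
Lemma wait_rej c s v1 v2 b : word = v1 ++ v2 -> b = Tok c \/ b = Del c -> (b, s + 1) \in v2 ->
  ~ accA (LWait P c) s (rcons v2 (End_, L.+1%:R)).
Proof.
move=> E bc; elim: v2 v1 E => [|[a t] v2 IH] v1 E //= bin [g [r [l' [T ge H]]]].
have tl : (b, s + 1) \in v2 -> t < s + 1 by exact: suffix_lt E.
have aE := no_End (_ : (a, t) \in word); rewrite E mem_cat mem_head orbT in aE.
case: (tr_wait T) => [[gE lE rE]|[gE n1 n2]|gE|e]; last by have := aE isT; rewrite /= e.
- subst g l' r; rewrite /= in ge.
  have bt : (b, s + 1) \in v2.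
    by move: bin; rewrite inE => /predU1P[[_ e]|//]; move: ge; rewrite -e; lra.
  by apply: (IH (rcons v1 (a, t))) bt H; rewrite cat_rcons.
- subst g; move: ge => /= /eqP ge.
  move: bin; rewrite inE => /predU1P[[e _]|/tl]; last by lra.
  by case: bc => bc; rewrite -e bc in n1 n2.
- subst g; rewrite /= in ge.
  move: bin; rewrite inE => /predU1P[[_ e]|/tl h].
    by move: ge; rewrite -e addrAC subrr add0r ltxx.
  by move: ge; rewrite ltrBrDl => /(lt_trans h); rewrite ltxx.
Qed.

Lemma same_rej v1 a t v2 : word = v1 ++ (a, t) :: v2 ->
  ~ accA (bl BSame) t (rcons v2 (End_, L.+1%:R)).
Proof.
move=> E; case: v2 E => [|[b t'] v2] E /= [g [r [l' [T ge _]]]]; have [gE aE] := tr_same T => //.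
have := suffix_lt E (mem_head _ _); move: ge; rewrite gE /= => /eqP; lra.
Qed.

Lemma abs_rej v1 v2 : word = v1 ++ v2 -> ~ accA (bl BAbs) 0 (rcons v2 (End_, L.+1%:R)).
Proof.
elim: v2 v1 => [|[a t] v2 IH] v1 E /= [g [r [l' [T ge H]]]].
  by case: (tr_abs T) => [[//]|[_ [e [//]]]].
case: (tr_abs T) => [[_ lE rE]|[gE [e [ae se te]]]].
  by subst l' r; apply: (IH (rcons v1 (a, t))) H; rewrite cat_rcons.
have : (a, t) \in word by rewrite E mem_cat mem_head orbT.
rewrite ae => /wordP[i iL /depicts_mk[ei ti]]; subst e t g.
by move: ge; rewrite /= subr0 ltr_nat ltnNge (loadP iL).
Qed.

Lemma unload_rej i v1 v2 : (i <= L)%N -> r_src (d i) <> q_unload k P -> r_tgt (d i) = q_unload k P ->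
  word = v1 ++ v2 -> (forall q, q \in v2 -> i%:R < q.2) ->
  ~ accA (bl BUnload) i%:R (rcons v2 (End_, L.+1%:R)).
Proof.
move=> iL si ti; elim: v2 v1 => [|[a t] v2 IH] v1 E later /= [g [r [l' [T ge H]]]].
  by case: (tr_unload T) => [[//]|[_ [e [//]]]].
case: (tr_unload T) => [[_ lE rE]|[gE [e [ae te]]]].
  subst l' r; apply: (IH (rcons v1 (a, t))) H; first by rewrite cat_rcons.
  by move=> q qin; apply: later; rewrite inE qin orbT.
have : (a, t) \in word by rewrite E mem_cat mem_head orbT.
have := later _ (mem_head _ _).
rewrite ae => it /wordP[j jL /depicts_mk[ej tj]]; subst e t g.
rewrite /= ltr_nat in it; have := unloadP (i := i) (j := j); rewrite it jL => /(_ isT si ti).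
by move: ge; rewrite /= ltrBrDl -natrD ltr_nat addnC ltnNge addnC => /negP H' /H'.
Qed.

Section BlockRejections.
Variables (i : nat) (v1 : seq (letter * R)).
Hypothesis iL : (i <= L)%N.

Lemma here ts q v2 : word = v1 ++ (Mk (d i), i%:R) :: ts ++ q :: v2 ->
  all (fun p => is_tok p.1) ts ->
  if is_tok q.1 then depicts q i else (i < L)%N /\ q = (Mk (d i.+1), i.+1%:R).
Proof.
move=> E tts; have [j jL [dj /eqP]] := block_index E tts.
by rewrite eqr_nat => /eqP <-.
Qed.

Lemma del_rej c s tau ts v2 : word = v1 ++ (Mk (d i), i%:R) :: ts ++ v2 ->
  all (fun p => is_tok p.1) ts -> (Del c, s) \in ts ->
  ~ accA (LDel P c) tau (rcons v2 (End_, L.+1%:R)).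
Proof.
elim: v2 ts => [|[a t] v2 IH] ts E tts sin /= [g [r [l' [T _ H]]]].
  by case: (tr_del T) => [[]|].
have Dq := here E tts.
case: (tr_del T) => [[ta [lE rE]]|ae].
  subst l' r; apply: (IH (rcons ts (a, t))) H; first by rewrite cat_rcons.
    by rewrite all_rcons /= ta.
  by rewrite mem_rcons inE sin orbT.
have [t1 [t2 tE]] := mem_split sin.
have E' : word = v1 ++ (Mk (d i), i%:R) :: t1 ++ (Del c, s) :: t2 ++ (a, t) :: v2.
  by rewrite E tE -catA.
have t1t : all (fun p => is_tok p.1) t1 by move: tts; rewrite tE all_cat => /andP[].
have /= := here E' t1t; rewrite ae /= in Dq E' *.
case/depicts_del: Dq => p [pk dp cp tp].
case/depicts_del => p' [_ dp' cp' sp].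
(* [sel] picks the first token of a counter, so two deleted tokens of one counter in the same block
   are the same token. *)
have pp : p = p'.
  move: dp dp' => /andP[_ /eqP e1] /andP[_ /eqP e2].
  have : p \in [seq q <- kept i | q.2 == c] by rewrite mem_filter cp eqxx.
  by rewrite e1 e2 cp cp'; case: [seq q <- _ | _].
have : (Del c, s).2 < (Del c, t).2.
  apply: (@suffix_lt (v1 ++ (Mk (d i), i%:R) :: t1) (Del c, s) (t2 ++ (Del c, t) :: v2)).
    by rewrite E' -catA.
  by rewrite mem_cat mem_head orbT.
by rewrite /= sp tp pp ltxx.
Qed.

Lemma miss_rej c tau ts v2 : word = v1 ++ (Mk (d i), i%:R) :: ts ++ v2 ->
  all (fun p => is_tok p.1) ts -> c \in r_new (d i) -> ~~ has (fun p => p.1 == New c) ts ->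
  ~ accA (LMiss P c) tau (rcons v2 (End_, L.+1%:R)).
Proof.
move=> E tts cn; have [p pc pin] : exists2 p, p.2 = c & p \in created i.
  have : has (fun p => p.2 == c) (created i) by rewrite has_count count_fresh cn.
  by move=> /hasP[p pin /eqP]; exists p.
have qW : (New c, i%:R + fr p.1) \in word.
  by apply/wordP; exists i => //; constructor 4; exists p; rewrite pc.
have /andP[f0 f1] := fr01 p.1.
elim: v2 ts E tts => [|[a t] v2 IH] ts E tts nn /= [g [r [l' [T _ H]]]].
  move: qW; rewrite E cats0 mem_cat inE => /or3P[H1|/eqP[]//|H3].
    have := word_sorted; rewrite E pairwise_cat => /and3P[/allrelP S _ _].
    by have := S _ _ H1 (mem_head _ _); rewrite /lt2 /= gtrDl ltNge (ltW f0).
  by case/negP: nn; apply/hasP; exists (New c, i%:R + fr p.1) => //=.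
have Dq := here E tts.
have aE : a <> End_ by apply: (no_End (q := (a, t))); rewrite E mem_cat inE mem_cat mem_head !orbT.
case: (tr_miss T) => [[ta /eqP an lE rE]|[e ae]|//].
  subst l' r; apply: (IH (rcons ts (a, t))) H; first by rewrite cat_rcons.
    by rewrite all_rcons /= ta.
  by rewrite has_rcons /= negb_or an.
rewrite ae /= in Dq; case: Dq => _ [_ tE].
case/negP: nn; apply/hasP; exists (New c, i%:R + fr p.1) => //=.
apply: word_between E qW _; rewrite /= tE.
by rewrite ltrDl f0 -natr1 ltrD2l.
Qed.

Lemma at_rej ts v2 : word = v1 ++ (Mk (d i), i%:R) :: ts ++ v2 ->
  all (fun p => is_tok p.1) ts -> ~ accA (LAt (d i)) i%:R (rcons v2 (End_, L.+1%:R)).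
Proof.
elim: v2 ts => [|[a t] v2 IH] ts E tts /= [g [r [l' [T ge H]]]].
  have dL : d i = d L by rewrite cats0 in E; exact: block_last E tts.
  case: (tr_at T) => [[//]|[c []//]|[[c //]|[c //]]|[[c //]|[e //]|[_]]].
  by rewrite dL tgtL.
have Dq := here E tts.
have aE : a <> End_ by apply: (no_End (q := (a, t))); rewrite E mem_cat inE mem_cat mem_head !orbT.
case: (tr_at T) => [[ta lE rE]|[c ac cz]|[[c ac cd]|[c ac cn]]|[[c ac [lE rE]]|[e ae]|[//]]].
- subst l' r; apply: (IH (rcons ts (a, t))) H; first by rewrite cat_rcons.
  by rewrite all_rcons /= ta.
- have ta : is_tok a by case: ac => ->.
  rewrite /= ta in Dq.
  have [p pin pc] : exists2 p, p \in kept i & p.2 = c.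
    by case: ac => ac; rewrite ac in Dq;
      [case/depicts_tok: Dq => p [pin _ pc _] | case/depicts_del: Dq => p [pin _ pc _]]; exists p.
  by have /negP := token_zero iL pin; rewrite pc.
- by rewrite ac /= in Dq; case/depicts_del: Dq => p [_ /andP[pd _] cp _]; rewrite -cp pd in cd.
- by rewrite ac /= in Dq; case/depicts_new: Dq => p [/fresh_mem pn cp _]; rewrite -cp pn in cn.
- subst l' r; apply: (del_rej (ts := rcons ts (a, t))) H; first by rewrite cat_rcons.
    by rewrite all_rcons /= tts ac.
  by rewrite ac mem_rcons; exact: mem_head.
- rewrite ae /= in Dq; case: Dq => iL' [ei tE].
  case=> [ne|gE|gE]; first by apply: ne; rewrite ei chainP.
    by move: ge; rewrite gE tE /= -natr1 addrAC subrr add0r ltxx.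
  by move: ge; rewrite gE tE /= -natr1 addrAC subrr add0r ltxx.
Qed.

End BlockRejections.

Lemma end_rule q Z D N q' : @rule k m P q Z D N q' -> q' = q_end k P ->
  [/\ Z = finset.setT, D = finset.set0 & N = finset.set0].
Proof. by case. Qed.

Lemma wait_rej_at i c t a v1 v2 : (i <= L)%N -> word = v1 ++ (a, t) :: v2 ->
  (exists p, [/\ p \in kept i.+1, p.2 = c & t = i%:R + fr p.1]) ->
  ~ accA (LWait P c) t (rcons v2 (End_, L.+1%:R)).
Proof.
move=> iL E [p [pk pc tp]].
(* A token that leaves the last block would be counted after [r_end], which requires all counters to
   be zero and creates nothing. *)
have iL' : (i < L)%N.
  rewrite ltn_neqAle iL andbT; apply/eqP => iE; subst i.
  have /(_ tgtL) [Z0 D0 N0] := end_rule (ruleP (leqnn L)).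
  have [Z D N] := stepP (leqnn L).
  have : (0 < count (fun q => q.2 == c) (kept L.+1))%N.
    by rewrite -has_count; apply/hasP; exists p; rewrite //= pc.
  rewrite count_kept //; have := N c; rewrite N0 D0 Z; last by rewrite Z0 finset.in_setT.
  by rewrite !finset.in_set0 !addn0 => <-.
have qW : (kind i.+1 p, t + 1) \in word.
  apply/wordP; exists i.+1 => //; apply/tokens_atP; rewrite inE mem_cat; apply/orP; right.
  by apply/orP; left; apply/mapP; exists p => //; rewrite tp -natr1 addrAC.
apply: (@wait_rej c t (rcons v1 (a, t)) v2 (kind i.+1 p)); first by rewrite cat_rcons.
  by rewrite /kind pc; case: ifP; auto.
have := word_sorted; rewrite E pairwise_cat pairwise_cons => /and4P[/allrelP S _ _ _].
move: qW; rewrite E mem_cat inE => /or3P[h|/eqP[_ h]|//].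
  by have := S _ _ h (mem_head _ _); rewrite /lt2 /= gtrDl ltNge ler01.
by move/eqP: h; rewrite -subr_eq0 addrAC subrr add0r oner_eq0.
Qed.

Lemma word_head : exists v, word = (Mk (d 0), 0%:R) :: v.
Proof. by eexists. Qed.

(** Each way of leaving the wide locations asserts one particular defect, and the word of an exact
    run has none of them. *)
Lemma wide_rej l v1 v2 : wide l -> word = v1 ++ v2 -> (l = bl BInit -> v1 = [::]) ->
  ~ accA l 0 (rcons v2 (End_, L.+1%:R)).
Proof.
elim: v2 v1 l => [|[a t] v2 IH] v1 l wl E l0 /= [g [r [l' [T ge H]]]].
  have [v wE] := word_head; rewrite wE cats0 in E.
  have nl : l <> bl BInit by move=> /l0 v1E; rewrite v1E in E.
  case: wl nl T H => -> // _ T H.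
  by move El: (bl BAny : loc) T => l1 T; case: T El H.
have aW : (a, t) \in word by rewrite E mem_cat mem_head orbT.
have aE : a <> End_ by exact: (no_End aW).
have first : l = bl BInit -> a = Mk (d 0) /\ t = 0.
  by move=> /l0 v1E; have [v wE] := word_head; move: E; rewrite v1E wE => -[<- <- _].
have blk e : a = Mk e -> exists2 i, (i <= L)%N & e = d i /\ t = i%:R.
  by move=> aM; rewrite aM in aW; have /wordP[i iL /depicts_mk ?] := aW; exists i.
have wn : wide (bl BAny : loc) by right.
move: first blk aE aW ge H l0 E wl; case: T => {l g a r l'}.
all: intros.
all: try by case: wl.
- by apply: (IH (rcons v1 (a, t)) (bl BAny)) H; rewrite ?cat_rcons.
(* The first rule is a load, because leaving [q_load] at index 0 would require [x <= 0]. *)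
- case: (first erefl) => aM _; case: n0; exists (d 0); split=> //; first exact: ruleP.
  by apply/eqP/negPn/negP => /eqP /(loadP (leq0n L) src0); rewrite leqNgt x0.
- by case: (first erefl) => _ t0; move: ge; rewrite t0 /= subrr ltxx.
- by have [j jL [dE _]] := blk _ erefl; case: n; rewrite dE; exact: ruleP.
- have [j jL [dE tE]] := blk _ erefl; subst.
  exact: (at_rej jL (ts := [::]) E) H.
- have [j jL [dE tE]] := blk _ erefl; subst.
  exact: (miss_rej jL (ts := [::]) E) H.
- exact: same_rej E H.
- have /wordP[j jL /depicts_tok[p [pk dp pc tp]]] := aW.
  apply: (wait_rej_at jL E) H; exists p; split=> //.
  by rewrite mem_cat mem_filter dp pk.
- have /wordP[j jL /depicts_new[p [pk pc tp]]] := aW.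
  apply: (wait_rej_at jL E) H; exists p; split=> //.
  by rewrite mem_cat pk orbT.
- by apply: (abs_rej (v1 := rcons v1 (a, t))) H; rewrite cat_rcons.
- have [j jL [dE tE]] := blk _ erefl; subst.
  apply: (unload_rej (v1 := rcons v1 (Mk (d j), j%:R)) jL) H => //; first by rewrite cat_rcons.
  by move=> q qin; exact: suffix_lt E qin.
- by apply: (accA_priv _ H); left.
Qed.

Lemma run_rejected : exists v T, path <=%R 0 [seq q.2 | q <- rcons v (End_, T)] /\
  ~ accA (bl BInit) 0 (rcons v (End_, T)).
Proof.
exists word, L.+1%:R; split; last by apply: (@wide_rej _ [::]) => //; left.
have tW q : q \in word -> 0 <= q.2 < L.+1%:R.
  move=> /wordP[i iL /depicts_time[/andP[h1 h2] _]].
  by rewrite (le_trans (ler0n _ i) h1) (lt_le_trans h2) // ler_nat.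
rewrite path_sortedE; last exact: le_trans.
rewrite all_map; apply/andP; split.
  rewrite all_rcons; apply/andP; split; first exact: ler0n.
  by apply/allP => q /tW /andP[].
rewrite sorted_map; apply: pairwise_sorted.
rewrite pairwise_rcons; apply/andP; split.
  by apply/allP => q /tW /andP[_ /ltW].
by apply: sub_pairwise word_sorted => q q' /ltW.
Qed.

End RunToWord.

(** * Opacity of a gadget and acceptance by its program *)

Section Opacity.
Variables (R : realType) (k m x : nat) (P : seq instr).
Hypothesis regP : forall i, List.In i P -> reg_of i <= m.
Hypothesis jumpP : forall p s w, p < size P -> (fstep P (p, s, w)).1.1 <= size P.
Hypothesis noread : forall r l, ~ List.In (IRead r l) P.
Hypothesis x0 : 0 < x.
Hypothesis bounded : exists s,
  fruns P m.+1 (0, regs0 x, [::]) (size P, s, [::]) (ack k x + x).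

Lemma gadget_opacity :
  (weakly_opaque R (gadget k m P x) <-> ~ accepting x P) /\
  (fully_opaque R (gadget k m P x) <-> ~ accepting x P).
Proof.
have H : (forall dw, endsw dw -> @accA k m P R x (bl k m P BInit) 0%R (stamps 0%R dw)) <-> ~ accepting x P.
  rewrite not_opaqueE; split=> [Acc [t [s [it s0]]]|nacc u T pth].
    have [s1 [t1 [it1 H1]]] := bounded.
    have halt n s' : iter n (fstep P) (size P, s', [::]) = (size P, s', [::]).
      by elim: n => //= n ->; rewrite /fstep nth_default.
    (* The accepting run and the bounded run both reach a fixed point of the same deterministic
       program, so they end in the same registers, and the bound carries over. *)
    have F : fruns P m.+1 (0, regs0 x, [::]) (size P, s, [::]) (ack k x + x).
      have [tt1|t1t] := leqP t t1.
        by exists t1; split=> //; rewrite -(subnK tt1) iterD it halt.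
      exists t1; split=> //; move: it; rewrite -(subnK (ltnW t1t)) iterD it1 halt => -[<-].
      by [].
    have [d [u [L [[h1 h2 h3] [h4 h5 h6 h7 h8]]]]] := exact_run regP noread x0 F s0.
    have [v [T [pth]]] := @run_rejected R _ _ _ _ _ _ _ h1 h2 h3 h4 h5 h6 h7 h8 x0.
    by apply; exact: Acc.
  by apply: contrapT => rej; apply: nacc; exact: rejected_accepting regP jumpP rej pth.
by have [-> ->] := @gadget_opaque R k m x P.
Qed.

End Opacity.

(** * The lower bound *)

Section Templates.

(** In a template, [0] and [1] stand for bits and every other number for a
    place to be filled with the code of a parameter [x]. *)
Definition fill (t : seq nat) (x : nat) : seq bool :=
  flatten [seq if b == 0 then [:: false] else if b == 1 then [:: true] else code_nat x | b <- t].

Definition templ (f : nat -> seq bool) := exists t, forall x, f x = fill t x.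

Lemma templ_cat f g : templ f -> templ g -> templ (fun x => f x ++ g x).
Proof.
move=> [t Ht] [u Hu]; exists (t ++ u) => x.
by rewrite Ht Hu /fill map_cat flatten_cat.
Qed.

Lemma templ_const w : templ (fun=> w).
Proof.
exists [seq nat_of_bool b | b <- w] => x; rewrite /fill.
by elim: w => //= -[] w /= <-.
Qed.

Lemma templ_hole : templ (fun x => code_nat x).
Proof. by exists [:: 2] => x; rewrite /fill /= cats0. Qed.

Lemma templ_flatten T (f : T -> nat -> seq bool) s :
  (forall a, templ (f a)) -> templ (fun x => flatten [seq f a x | a <- s]).
Proof.
by move=> H; elim: s => [|a s IH]; [exact: templ_const | exact: templ_cat].
Qed.

(** The parameter occurs only as a constant in the guards [GLtX] and [GGtX]; letters, locations and
    transitions are the same for all [x]. *)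
Lemma templ_gadget k m P : templ (fun x => code_ta (gadget k m P x)).
Proof.
pose A := gadget k m P 0.
have -> : (fun x => code_ta (gadget k m P x)) = (fun x => code_nat #|action A| ++
    code_nat #|location A| ++ code_nat #|clock A| ++ code_fin (init A) ++ code_set (priv A) ++
    code_set (final A) ++ flatten [seq code_guard (loc_invariant l) | l <- enum (location A)] ++
    (code_nat (size (transitions k m P)) ++
     flatten [seq code_edge (edge_of x t) | t <- transitions k m P])).
  apply/funext => x.
  have <- : code_seq (@code_edge _ _ _) (edges (gadget k m P x)) =
      code_nat (size (transitions k m P)) ++ flatten [seq code_edge (edge_of x t) | t <- transitions k m P].
    by rewrite /code_seq [edges _]/edges size_map -map_comp.
  by [].
do 7![apply: templ_cat; first exact: templ_const].
apply: templ_cat; first exact: templ_const.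
apply: templ_flatten => -[[[[l g] a] r] l'].
rewrite (_ : (fun x => _) = (fun x => code_fin l ++ (code_guard (guard_of x g) ++
  (code_action (Some a) ++ code_set (if r then [set ord0] else finset.set0 : {set 'I_1}) ++
   code_fin l')))) //.
apply: templ_cat; first exact: templ_const.
apply: templ_cat; last exact: templ_const.
have H c : templ (fun x => code_guard [:: (ord0 : 'I_1, c, x%:Z%R)]).
  rewrite (_ : (fun x => _) = (fun x => (code_nat 1 ++ code_fin (ord0 : 'I_1) ++
    code_nat (nat_of_cmp c) ++ [:: false]) ++ code_nat x)).
    exact: templ_cat (templ_const _) templ_hole.
  by apply/funext => x; rewrite /code_guard /code_seq [flatten _]/= cats0 /code_int -!catA.
case: g; rewrite /guard_of; try exact: templ_const.
  exact: H.
exact: H.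
Qed.

End Templates.

Lemma prf_fill T (cT : coded T) (t : T -> seq nat) (x : T -> nat) :
  prf t -> prf x -> prf (fun y => fill (t y) (x y)).
Proof.
move=> pt px; rewrite /fill; apply: prf_flatten.
apply: (@prf_map _ _ _ _ _ _ t (fun y b => if b == 0 then [:: false] else
  if b == 1 then [:: true] else code_nat (x y))) => //.
have px1 : prf (fun p : T * nat => x p.1) by apply: prf_comp px _; exact: prf_fst prf_id.
have pc := prf_code_nat px1.
by apply: prf_if; [|exact: prf_const|apply: prf_if => //; [|exact: prf_const]]; prf_auto.
Qed.

Lemma noread_flat c p r l : ~ List.In (IRead r l) (flat c p).
Proof.
elim: c p => [|r'|c IHc d IHd|r' c IHc|r' c IHc d IHd] p //=.
- by case.
- by rewrite In_cat => -[/IHc|/IHd].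
- by rewrite In_cat => -[|[/IHc|[|[]]]].
- by rewrite In_cat /= => -[|[/IHc|[|/IHd]]].
Qed.

(** The level [k] is taken from the majorant of the cost, so [ack k x] covers all increments on
    input [x] and the further [x] covers the input itself. *)
Lemma compile (F : nat -> nat) : pr F -> exists k m P,
  [/\ forall i, List.In i P -> reg_of i <= m,
      forall p s w, p < size P -> (fstep P (p, s, w)).1.1 <= size P,
      forall r l, ~ List.In (IRead r l) P,
      forall x, exists s, fruns P m.+1 (0, regs0 x, [::]) (size P, s, [::]) (ack k x + x) &
      forall x, accepting x P <-> 0 < F x].
Proof.
move=> /pr_implements[B [k Bk] /(_ 0 1 isT)[c Hc]].
pose P := flat c 0; pose m := maxn 1 (regs c).
have cP : code_at P 0 (flat c 0) by exists [::], [::]; rewrite cats0.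
have run x : exists s, fruns P m.+1 (0, regs0 x, [::]) (size P, s, [::]) (ack k x + x) /\ s 0 = F x.
  have [j|t tB ex] := Hc (regs0 x); first by case: j.
  have [H _] := @exec_fruns P m.+1 _ _ _ _ 0 [::] ex (leq_trans (leq_maxr _ _) (leqnSn _)) cP.
  exists (upd (regs0 x) 0 (F (regs0 x 0))); split; last by rewrite updE.
  apply: fruns_le H; rewrite /tot big_ord_recl big1 // addn0 addnC leq_add2r.
  by apply: leq_trans tB (leq_trans _ (Bk x)); rewrite leq_addr.
exists k, m, P; split.
- by move=> i /flat_ok[H _]; rewrite ltnW.
- move=> p s w pP; apply: fstep_jump => // i /flat_ok[_]; by rewrite add0n.
- by move=> r l; exact: noread_flat.
- by move=> x; have [s [H _]] := run x; exists s.
- move=> x; have [s [[t [it _]] sF]] := run x; split; last by move=> F0; exists t, s; rewrite sF.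
  move=> [t' [s' [it' s0]]]; rewrite -sF.
  have halt n s1 : iter n (fstep P) (size P, s1, [::]) = (size P, s1, [::]).
    by elim: n => //= n ->; rewrite /fstep nth_default.
  have [tt|tt] := leqP t t'.
    by move: it'; rewrite -(subnK tt) iterD it halt => -[->].
  by move: it; rewrite -(subnK (ltnW tt)) iterD it' halt => -[<-].
Qed.

Definition index_of (t : seq nat) : nat := enc t.

(** Diagonalisation: the machine that decides the opacity of the gadgets is
    run on the gadget of its own simulation. *)
Lemma gadget_lower (R : realType) (H : timed_automaton -> Prop) :
  (forall A, H A <-> weakly_opaque R A) \/ (forall A, H A <-> fully_opaque R A) ->
  ~ exists (M : machine) (f : nat -> nat), primrec1 f /\
    forall A, one_clock A -> epsilon_free A ->
      exists b, halts_within M (code_ta A) (f (size (code_ta A))) b /\ (b <-> H A).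
Proof.
move=> HE [M [f [pf dec]]].
(* The diagonal: a template filled with its own index. *)
pose w t := fill t (index_of t).
pose h (t : seq nat) := verdict (iter (f (size (w t))) (@mstep M) (minit M (w t))).1 == Some true.
have pw : prf w by apply: prf_fill; [exact: prf_id | exists id; [exact: pr_id|]].
have ph : prf h.
  apply: prf_accepts => //; apply: (prf_comp (primrec1_prf pf)); exact: prf_size.
have [F pF FE] := ph.
(* [P] decides whether [M] accepts a diagonal word. The gadgets of [P] have a template [t], and for
   [x] the index of [t] the code of the gadget is [w t] itself: the gadget is opaque exactly if [M]
   does not accept its code. *)
have [k [m [P [regP jumpP noread bounded acc]]]] := compile pF.
have [t tE] := templ_gadget k m P.
(* A code starts with the code of a number, which is never empty; hence the template is not empty
   and its index is positive. *)
pose x := index_of t; have x0 : 0 < x.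
  rewrite /x; case: (t) tE => [/(_ 0)|a u _] //; rewrite /code_ta => /(congr1 size).
  by rewrite size_cat /code_nat; case: bin_of_nat => //= -[].
have [b [run bH]] := dec _ (gadget_clock k m P x) (gadget_eps (k:=k) (m:=m) (P:=P) (x:=x)).
have [wo fo] := @gadget_opacity R k m x P regP jumpP noread x0 (bounded x).
have HA : H (gadget k m P x) <-> ~ accepting x P by case: HE => ->.
have hb : h t = b by move: run; rewrite /halts_within tE /h /w => ->; case: (b).
have : accepting x P <-> b by rewrite acc /x FE hb; case: (b).
case: b bH {run hb} => [[H1 H2] A|[H1 H2] A].
  by case: (proj1 HA (H1 isT)); apply/A.
by have : false by apply/H2/HA => /A.
Qed.

(** * Higman's lemma *)

Lemma infinite_pigeonhole (A : finType) (f : nat -> A) :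
  exists a, forall N, exists2 n, N <= n & f n = a.
Proof.
apply: contrapT => H.
have /choice[N HN] : forall a, exists N, forall n, N <= n -> f n <> a.
  move=> a; apply: contrapT => Ha; apply: H; exists a => N; apply: contrapT => HN.
  by apply: Ha; exists N => n Nn fn; apply: HN; exists n.
by apply: (HN (f (\max_a N a)) _ _ erefl); exact: leq_bigmax.
Qed.

Section Higman.
Variable A : finType.
Implicit Types (s : seq (seq A)) (f : nat -> seq A).

Definition bad_seq f := forall i j, i < j -> ~~ subseq (f i) (f j).

Definition extendable s := exists2 f, bad_seq f & forall i, i < size s -> f i = nth [::] s i.

(** The greedy choice behind a minimal bad sequence. The condition stands inside the existential so
    that [choice] yields a total function. *)
Lemma extend_min s : exists w, extendable s -> extendable (rcons s w) /\
  forall v, size v < size w -> ~ extendable (rcons s v).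
Proof.
case: (pselect (extendable s)) => [[f bf fs]|ns]; last by exists [::].
pose Q n := `[< exists2 w, extendable (rcons s w) & size w = n >].
have exQ : exists n, Q n.
  exists (size (f (size s))); apply/asboolP; exists (f (size s)) => //.
  exists f => // i; rewrite size_rcons ltnS leq_eqVlt => /predU1P[->|il].
    by rewrite nth_rcons ltnn eqxx.
  by rewrite nth_rcons il fs.
case: (ex_minnP exQ) => n /asboolP[w Ew wn] min; exists w => _; split=> // v vw Ev.
have := min (size v); rewrite -wn leqNgt vw => /implyP; rewrite implybF => /negP; apply.
by apply/asboolP; exists v.
Qed.

(** Nash-Williams' minimal bad sequence. *)
Theorem higman f : exists i j, i < j /\ subseq (f i) (f j).
Proof.
apply: contrapT => nf.
have bf : bad_seq f.
  by move=> i j ij; apply/negP => s; apply: nf; exists i, j.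
have [next nextP] := choice extend_min.
pose pre n := iter n (fun s => rcons s (next s)) [::].
have szp n : size (pre n) = n by elim: n => //= n IH; rewrite size_rcons IH.
have ext n : extendable (pre n).
  elim: n => [|n IH]; first by exists f.
  by have [] := nextP _ IH.
pose m n := next (pre n).
have pre_nth n i : i < n -> nth [::] (pre n) i = m i.
  elim: n => // n IH; rewrite ltnS leq_eqVlt /= nth_rcons szp => /predU1P[->|il].
    by rewrite ltnn eqxx.
  by rewrite il IH.
have minm n v : size v < size (m n) -> ~ extendable (rcons (pre n) v).
  by have [_] := nextP _ (ext n); apply.
have badm : bad_seq m.
  move=> i j ij; have [g bg gE] := ext j.+1; rewrite szp in gE.
  by rewrite -!(@pre_nth j.+1) ?ltnS ?(ltnW ij) // -!gE ?ltnS ?(ltnW ij) //; exact: bg.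
have nonnil n : m n != [::].
  by apply/eqP => mn; have := badm n n.+1 (leqnn _); rewrite mn sub0seq.
have [a Ha] : exists a, forall N, exists2 n, N <= n & exists v, m n = a :: v.
  have [a0 _] : exists a0 : A, True by have := nonnil 0; case: (m 0) => // a0; exists a0.
  have [a Ha] := infinite_pigeonhole (fun n => head a0 (m n)).
  exists a => N; have [n Nn e] := Ha N; exists n => //; exists (behead (m n)).
  by move: (nonnil n) e; case: (m n) => //= b v _ ->.
have /choice[nx nxP] : forall N, exists n, N <= n /\ exists v, m n = a :: v.
  by move=> N; have [n] := Ha N; exists n.
pose idx i := iter i (fun n => nx n.+1) (nx 0).
have idxE i : m (idx i) = a :: behead (m (idx i)).
  by case: i => [|i] /=; [have [_ [v ->]] := nxP 0 | have [_ [v ->]] := nxP (idx i).+1].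
have idx_lt i j : i < j -> idx i < idx j.
  elim: j => // j IH; rewrite ltnS leq_eqVlt => ij.
  have [h _] := nxP (idx j).+1; apply: leq_trans h.
  by case/predU1P: ij => [->|/IH/ltnW].
have idx0 i : idx 0 <= idx i by case: i => // i; exact/ltnW/idx_lt.
pose n0 := idx 0.
(* The minimal sequence up to [n0], followed by the tails of its words that begin with [a]. It is
   still bad, because embedding one tail into another would embed the words, and its word at [n0] is
   shorter than the minimal one. *)
pose g i := if i < n0 then m i else behead (m (idx (i - n0))).
apply: (minm n0 (behead (m n0))); first by rewrite /n0 {2}idxE.
exists g; last first.
  move=> i; rewrite size_rcons szp ltnS leq_eqVlt nth_rcons szp => /predU1P[->|il].
    by rewrite /g ltnn subnn eqxx.
  by rewrite /g il pre_nth.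
move=> i j ij; rewrite /g; have [jn|nj] := ltnP j n0.
  by rewrite (ltn_trans ij jn) badm.
have [in0|ni] := ltnP i n0.
  apply: contra (badm i (idx (j - n0)) (leq_trans in0 (idx0 _))) => H.
  by rewrite idxE; exact: subseq_trans H (subseq_cons _ _).
have lt : idx (i - n0) < idx (j - n0).
  by apply: idx_lt; rewrite ltn_sub2r // (leq_ltn_trans ni ij).
apply: contra (badm _ _ lt) => H.
by rewrite idxE [X in subseq _ X]idxE /= eqxx.
Qed.

End Higman.

(** * Timed automata over numbers *)

(** Timed automata over numbers.  A constraint is [(clock, (cmp, z))] where [z]
    stands for [- z./2] if [z] is odd and for [z./2] otherwise; an edge is
    [(source, (guard, (action, (resets, target))))]. *)
Definition rawC := (nat * (nat * nat))%type.
Definition rawG := seq rawC.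
Definition rawE := (nat * (rawG * (nat * (seq nat * nat))))%type.
Definition raw := ((nat * (nat * nat)) * ((nat * (seq nat * seq nat)) * (seq rawG * seq rawE)))%type.

Definition e_src (e : rawE) := e.1.
Definition e_grd (e : rawE) := e.2.1.
Definition e_act (e : rawE) := e.2.2.1.
Definition e_rst (e : rawE) := e.2.2.2.1.
Definition e_tgt (e : rawE) := e.2.2.2.2.
Definition r_nloc (r : raw) := r.1.2.1.
Definition r_init (r : raw) := r.2.1.1.
Definition r_priv (r : raw) := r.2.1.2.1.
Definition r_fin (r : raw) := r.2.1.2.2.
Definition r_invs (r : raw) := r.2.2.1.
Definition r_edges (r : raw) := r.2.2.2.

Definition codeC (c : rawC) := code_nat c.1 ++ code_nat c.2.1 ++ odd c.2.2 :: code_nat c.2.2./2.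
Definition codeG (g : rawG) := code_seq codeC g.
Definition codeN (s : seq nat) := code_seq code_nat s.
Definition codeE (e : rawE) :=
  code_nat e.1 ++ codeG e.2.1 ++ code_nat e.2.2.1 ++ codeN e.2.2.2.1 ++ code_nat e.2.2.2.2.
(** A certificate contains the numerical automaton, and its verifier encodes this again and compares
    with the input. Only injectivity of the code is needed, and no parser. *)
Definition codeR (r : raw) :=
  code_nat r.1.1 ++ code_nat r.1.2.1 ++ code_nat r.1.2.2 ++
  code_nat r.2.1.1 ++ codeN r.2.1.2.1 ++ codeN r.2.1.2.2 ++
  flatten [seq codeG g | g <- r.2.2.1] ++ code_seq codeE r.2.2.2.

Definition self_delimiting T (f : T -> seq bool) :=
  forall x y u v, f x ++ u = f y ++ v -> x = y /\ u = v.

Lemma code_pos_sd : self_delimiting code_pos.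
Proof.
elim=> [p IH|p IH|] [q|q|] u v //= [].
- by move=> /IH[-> ->].
- by case: p {IH}.
- by move=> /IH[-> ->].
- by case: q.
- by move=> ->.
Qed.

Lemma code_nat_sd : self_delimiting code_nat.
Proof.
move=> x y u v; rewrite /code_nat -{2}(bin_of_natK x) -{2}(bin_of_natK y).
case: (bin_of_nat x) (bin_of_nat y) => [|p] [|q] /=.
- by case.
- by case: q.
- by case: p.
- by move=> /code_pos_sd[-> ->].
Qed.

Lemma flatten_sd T (f : T -> seq bool) s t u v : self_delimiting f -> size s = size t ->
  flatten [seq f x | x <- s] ++ u = flatten [seq f x | x <- t] ++ v -> s = t /\ u = v.
Proof.
move=> sd; elim: s t => [|x s IH] [|y t] //= [st]; rewrite -!catA.
by move=> /sd[-> /IH[]// -> ->].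
Qed.

Lemma code_seq_sd T (f : T -> seq bool) : self_delimiting f -> self_delimiting (code_seq f).
Proof.
move=> sd s t u v; rewrite /code_seq -!catA => /code_nat_sd[st].
exact: flatten_sd.
Qed.

Lemma cat_sd T U (f : T -> seq bool) (g : U -> seq bool) :
  self_delimiting f -> self_delimiting g -> self_delimiting (fun p => f p.1 ++ g p.2).
Proof. by move=> sf sg [x y] [x' y'] u v /=; rewrite -!catA => /sf[-> /sg[-> ->]]. Qed.

Lemma codeG_sd : self_delimiting codeG.
Proof.
pose codeZ n := odd n :: code_nat n./2.
suff sZ : self_delimiting codeZ.
  exact: code_seq_sd (cat_sd code_nat_sd (cat_sd code_nat_sd sZ)).
move=> n m u v /= [o e]; have [h ->] := code_nat_sd e; split=> //.
by rewrite -(odd_double_half n) o h odd_double_half.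
Qed.

Lemma codeE_sd : self_delimiting codeE.
Proof.
exact: cat_sd code_nat_sd (cat_sd codeG_sd (cat_sd code_nat_sd
  (cat_sd (code_seq_sd code_nat_sd) code_nat_sd))).
Qed.

(** The invariants are written without the length of their list, which has to be recovered from the
    number of locations; the two hypotheses provide this. *)
Lemma codeR_inj (r s : raw) : size (r_invs r) = r_nloc r -> size (r_invs s) = r_nloc s ->
  codeR r = codeR s -> r = s.
Proof.
case: r => -[n1 [n2 n3]] [[i [p f]] [iv es]]; case: s => -[n1' [n2' n3']] [[i' [p' f']] [iv' es']].
rewrite /r_invs /r_nloc /codeR /= => s1 s2.
move=> /code_nat_sd[-> /code_nat_sd[e2 /code_nat_sd[-> /code_nat_sd[->]]]].
move=> /(code_seq_sd code_nat_sd)[-> /(code_seq_sd code_nat_sd)[->]].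
have /(flatten_sd codeG_sd) h : size iv = size iv' by rewrite s1 s2.
move=> /h[->]; rewrite -[X in X = _ -> _]cats0 -[X in _ = X -> _]cats0 => /(code_seq_sd codeE_sd)[-> _].
by rewrite e2.
Qed.

Section OfAutomaton.
Variable A : timed_automaton.

Definition rk (T : finType) (x : T) : nat := enum_rank x.

Lemma rk_inj (T : finType) : injective (@rk T).
Proof. by move=> x y /ord_inj/enum_rank_inj. Qed.

Definition zcode (d : int) : nat := `|d|%N.*2 + (d < 0)%R.
Definition rawC_of (c : constraint (clock A)) : rawC :=
  (rk c.1.1, (nat_of_cmp c.1.2, zcode c.2)).
Definition rawG_of (g : guard (clock A)) : rawG := [seq rawC_of c | c <- g].
Definition act_of (a : option (action A)) : nat := if a is Some b then (rk b).+1 else 0.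
Definition rawE_of (e : aedge A) : rawE :=
  (rk (src e), (rawG_of (grd e), (act_of (act e), ([seq rk x | x <- enum (rst e)], rk (tgt e))))).
Definition raw_of : raw :=
  ((#|action A|, (#|location A|, #|clock A|)),
   ((rk (init A), ([seq rk x | x <- enum (priv A)], [seq rk x | x <- enum (final A)])),
    ([seq rawG_of (loc_invariant l) | l <- enum (location A)], [seq rawE_of e | e <- edges A]))).

Lemma code_seq_map T U (f : U -> seq bool) (h : T -> U) s :
  code_seq f (map h s) = code_seq (fun x => f (h x)) s.
Proof. by rewrite /code_seq size_map -map_comp. Qed.

Lemma eq_code_seq T (f g : T -> seq bool) : f =1 g -> code_seq f =1 code_seq g.
Proof. by move=> fg s; rewrite /code_seq (eq_map fg). Qed.

Lemma zcode_half d : (zcode d)./2 = `|d|%N.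
Proof. by rewrite /zcode addnC half_bit_double. Qed.

Lemma zcode_odd d : odd (zcode d) = (d < 0)%R.
Proof. by rewrite /zcode oddD odd_double; case: (d < 0)%R. Qed.

Lemma codeG_of g : codeG (rawG_of g) = code_guard g.
Proof.
rewrite /codeG code_seq_map; apply: eq_code_seq => -[[x c] d].
by rewrite /codeC /= zcode_half zcode_odd.
Qed.

Lemma codeE_of e : codeE (rawE_of e) = code_edge e.
Proof.
rewrite /codeE /rawE_of /= codeG_of /codeN code_seq_map.
by rewrite /code_edge /code_action; case: (act e).
Qed.

Lemma codeR_of : codeR raw_of = code_ta A.
Proof.
rewrite /codeR /= /codeN !code_seq_map (eq_code_seq codeE_of) -map_comp.
by rewrite (eq_map (fun l => codeG_of (loc_invariant l))).
Qed.

Lemma size_invs_of : size (r_invs raw_of) = r_nloc raw_of.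
Proof. by rewrite /r_invs size_map -cardE. Qed.

End OfAutomaton.

(** * Languages of numerical automata *)

Section RawSemantics.
Import Order.TTheory GRing.Theory Num.Theory.
Local Open Scope ring_scope.
Variables (R : realType) (r : raw).

Definition zval (z : nat) : R := if odd z then - z./2%:R else z./2%:R.

Definition satc (v : R) (c : rawC) : bool :=
  match c.2.1 with
  | 0%N => v < zval c.2.2 | 1%N => v <= zval c.2.2 | 2%N => v == zval c.2.2
  | 3%N => v >= zval c.2.2 | _ => v > zval c.2.2
  end.

Definition satr v (g : rawG) := all (satc v) g.

Definition inv_of (l : nat) : rawG := nth [::] (r_invs r) l.

Definition move_flag (b : nat) (e : rawE) : nat := if e_tgt e \in r_priv r then 1%N else b.

Definition move_clock (v : R) (e : rawE) : R := if e_rst e == [::] then v else 0.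

Definition enabled (l : nat) (v : R) (e : rawE) : bool :=
  [&& e_src e == l, l \notin r_fin r, satr v (inv_of l), satr v (e_grd e) &
      satr (move_clock v e) (inv_of (e_tgt e))].

Fixpoint racc (beta l b : nat) (v : R) (w : seq (nat * R)) : Prop :=
  if w is (a, d) :: w' then
    0 <= d /\ exists e, [/\ e \in r_edges r, e_act e = a, enabled l (v + d) e &
      racc beta (e_tgt e) (move_flag b e) (move_clock (v + d) e) w']
  else l \in r_fin r /\ b = beta.

Definition rflag l : nat := l \in r_priv r.

Definition rlang beta w := satr 0 (inv_of (r_init r)) /\ racc beta (r_init r) (rflag (r_init r)) 0 w.

End RawSemantics.

Section Link.
Import Order.TTheory GRing.Theory Num.Theory.
Local Open Scope ring_scope.
Variables (R : realType) (A : timed_automaton).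
Hypothesis eps : epsilon_free A.
Local Notation r := (raw_of A).

Lemma zval_zcode d : zval R (zcode d) = d%:~R.
Proof.
rewrite /zval zcode_half zcode_odd; case: ltrP => d0.
  by rewrite pmulrn -mulrNz abszE ltr0_norm // opprK.
by rewrite pmulrn abszE ger0_norm.
Qed.

Lemma satr_of (v : R) (g : guard (clock A)) : satr v (rawG_of g) = sat1 v g.
Proof.
rewrite /satr all_map; apply: eq_all => -[[x c] d].
by rewrite /satc /= zval_zcode; case: c.
Qed.

Lemma inv_of_rk (l : location A) : inv_of r (rk l) = @rawG_of A (loc_invariant l).
Proof.
rewrite /inv_of /r_invs /= (nth_map l) ?nth_enum_rank //.
by rewrite -cardE ltn_ord.
Qed.

Lemma mem_rk (T : finType) (B : {set T}) x : (rk x \in [seq rk y | y <- enum B]) = (x \in B).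
Proof. by rewrite (mem_map (@rk_inj T)) mem_enum. Qed.

Lemma nil_rst (B : {set clock A}) : ([seq rk x | x <- enum B] == [::]) = (B == finset.set0).
Proof. by rewrite -size_eq0 size_map -cardE cards_eq0. Qed.

Lemma enabled_of (l : location A) (v : R) (e : aedge A) : enabled r (rk l) v (rawE_of e) =
  [&& src e == l, l \notin final A, sat1 v (loc_invariant l), sat1 v (grd e) &
      sat1 (if rst e == finset.set0 then v else 0) (loc_invariant (tgt e))].
Proof.
rewrite /enabled !inv_of_rk !satr_of /= (inj_eq (@rk_inj _)) mem_rk; do 4!congr (_ && _).
by rewrite /move_clock /e_rst /= nil_rst.
Qed.

Lemma racc_of (beta : bool) (l : location A) (b : bool) (v : R) (w : seq (action A * R)) :
  racc r beta (rk l) b v [seq (act_of (Some p.1), p.2) | p <- w] <-> acc beta l b v w.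
Proof.
elim: w l b v => [|[a d] w IH] l b v /=.
  rewrite mem_rk; split=> -[lf]; first by case: (b) (beta) => -[].
  by move=> ->.
have move_of e : racc r beta (rk (tgt e)) (move_flag r b (rawE_of e))
    (move_clock (v + d) (rawE_of e)) [seq (act_of (Some p.1), p.2) | p <- w] <->
    acc beta (tgt e) (b || (tgt e \in priv A)) (if rst e == finset.set0 then v + d else 0) w.
  rewrite -IH /move_flag mem_rk /move_clock /e_rst /= nil_rst.
  by case: (tgt e \in _); case: (b).
split=> [[d0 [_ [/mapP[e eA ->] ae]]]|[lf d0 [e [[eA sl ae iv ge] [iv' H]]]]].
  rewrite enabled_of => /and5P[/eqP sl lf iv ge iv'] /move_of H; split=> //.
  exists e; split=> //; split=> //.
  by move: ae; rewrite /e_act /=; case: (act e) => // a' [h]; rewrite (rk_inj h).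
split=> //; exists (rawE_of e); split; [exact: map_f|by rewrite /e_act /= ae| |exact/move_of].
by rewrite enabled_of sl eqxx lf iv ge iv'.
Qed.

Lemma rlang_of (beta : bool) (w : seq (action A * R)) :
  rlang r beta [seq (act_of (Some p.1), p.2) | p <- w] <-> lang beta w.
Proof.
rewrite /rlang inv_of_rk satr_of /rflag mem_rk /lang.
by split=> -[? H]; split=> //; apply/racc_of.
Qed.

Lemma rlang_words (beta : nat) w : rlang r beta w ->
  exists u : seq (action A * R), w = [seq (act_of (Some p.1), p.2) | p <- u].
Proof.
move=> [_]; move: (r_init r) (rflag r _) 0; elim: w => [|[a d] w IH] l b v /=; first by exists [::].
move=> [_ [_ [/mapP[e eA ->] ae _ /IH[u ->]]]]; rewrite -ae /e_act /=.
case E: (act e) => [a'|]; last by case: (eps eA E).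
by exists ((a', d) :: u).
Qed.

End Link.

(** * The region abstraction *)

(** An item [((tag, (location, flag)), k)] stands for a configuration whose
    clock has integer part [k], capped above the constants; the tag is [1] for
    the run that is to be matched and [0] for the runs that may match it.  A
    configuration lists the classes of items by increasing fractional part, the
    first class being that of the integers. *)
Definition ident := (nat * (nat * nat))%type.
Definition item := (ident * nat)%type.
Definition class := seq item.
Definition cfg := seq class.

Section Abstract.
Variable r : raw.

(** A number that occurs in a list or a pair is at most the code of the latter. *)
Definition cap : nat := enc r.2.2.

Definition satk (z : bool) (k : nat) (c : rawC) : bool :=
  if odd c.2.2 && (0 < c.2.2./2) then 3 <= c.2.1
  else if c.2.1 == 0 then k < c.2.2./2
  else if c.2.1 == 1 then (k < c.2.2./2) || ((k == c.2.2./2) && z)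
  else if c.2.1 == 2 then (k == c.2.2./2) && z
  else if c.2.1 == 3 then c.2.2./2 <= k
  else (c.2.2./2 < k) || ((k == c.2.2./2) && ~~ z).

Definition after (z : bool) (k : nat) (e : rawE) : bool * nat :=
  if e_rst e == [::] then (z, k) else (true, 0).

Definition enk (z : bool) (p : item) (e : rawE) : bool :=
  [&& e_src e == p.1.2.1, p.1.2.1 \notin r_fin r,
      all (fun c => satk z p.2 c) (inv_of r p.1.2.1), all (fun c => satk z p.2 c) (e_grd e) &
      all (fun c => satk (after z p.2 e).1 (after z p.2 e).2 c) (inv_of r (e_tgt e))].

(** The run to be matched takes the edge [e] itself; a matching run may take any edge with the same
    action. *)
Definition moves (e : rawE) (q : ident) : seq rawE :=
  if q.1 == 1 then [:: e] else [seq e' <- r_edges r | e_act e' == e_act e].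

Definition new_id (q : ident) (e : rawE) : ident := (q.1, (e_tgt e, move_flag r q.2.2 e)).

(** The images of the items of a class that are reset ([b]) or kept. *)
Definition images (e : rawE) (z b : bool) (c : class) : class :=
  flatten [seq [seq (new_id p.1 e', if b then 0 else p.2) |
    e' <- [seq e' <- moves e p.1 | enk z p e' && ((e_rst e' != [::]) == b)]] | p <- c].

(** Items that are reset join the class of the integers, and the others keep their places, so the
    order of the fractional parts is undisturbed. Items without an enabled edge vanish, and emptied
    classes remain. *)
Definition act_cfg (e : rawE) (J : cfg) : cfg :=
  (images e true false (head [::] J) ++ images e true true (head [::] J) ++
     flatten [seq images e false true c | c <- behead J]) ::
  [seq images e false false c | c <- behead J].

Definition bump (c : class) : class :=
  [seq (p.1, if p.2 < cap.+1 then p.2.+1 else p.2) | p <- c].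

Definition wrap (J : cfg) : cfg := bump (last [::] J) :: rev (behead (rev J)).

(** Time passes in two ways: a little, so that no clock is an integer any more, or up to the moment
    when the largest fractional part reaches the next integer. *)
Definition succs (J : cfg) : seq cfg :=
  [:: [::] :: J, wrap J & [seq act_cfg e J | e <- r_edges r]].

Definition init_cfg : cfg :=
  [:: if all (fun c => satk true 0 c) (inv_of r (r_init r)) then
        [:: ((1, (r_init r, rflag r (r_init r))), 0); ((0, (r_init r, rflag r (r_init r))), 0)]
      else [::]].

(** For [beta = 1] a private run is unmatched by public ones. Full opacity also uses [beta = 0],
    with the roles exchanged. *)
Definition bad (beta : nat) (J : cfg) : bool :=
  has (fun c => has (fun p : item => [&& p.1.1 == 1, p.1.2.1 \in r_fin r & p.1.2.2 == beta]) c) J &&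
  ~~ has (fun c => has (fun p : item => [&& p.1.1 == 0, p.1.2.1 \in r_fin r & p.1.2.2 == 1 - beta]) c) J.

Inductive reach : cfg -> Prop :=
| reach0 : reach init_cfg
| reach_step J J' : reach J -> J' \in succs J -> reach J'.

Lemma wrap_rcons J c : wrap (rcons J c) = bump c :: J.
Proof. by rewrite /wrap last_rcons rev_rcons /= revK. Qed.

Lemma enc_mem (T : eqType) {cT : coded T} (x : T) s : x \in s -> enc x <= enc s.
Proof.
elim: s => // y s IH; rewrite inE /= => /predU1P[->|/IH {}IH].
  by apply: leqW; apply: leq_trans (leq_cp _ _); rewrite leq_addr.
by apply: leqW; apply: leq_trans (leq_cp _ _); apply: leq_trans IH _; rewrite leq_addl.
Qed.

Lemma enc_pair T U {cT : coded T} {cU : coded U} (p : T * U) :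
  enc p.1 <= enc p /\ enc p.2 <= enc p.
Proof.
by split; apply: leq_trans (leq_cp _ _); [exact: leq_addr | exact: leq_addl].
Qed.

Definition small (g : rawG) := all (fun c => c.2.2./2 <= cap) g.

Lemma half_enc (c : rawC) : c.2.2./2 <= enc c.
Proof.
assert (h1 : enc c.2 <= enc c) by exact (proj2 (enc_pair c)).
assert (h2 : enc c.2.2 <= enc c.2) by exact (proj2 (enc_pair c.2)).
apply: leq_trans (leq_trans h2 h1).
by rewrite /= -{2}(odd_double_half c.2.2) -addnn; lia.
Qed.

Lemma small_enc (g : rawG) : enc g <= cap -> small g.
Proof.
move=> gc; apply/allP => c cg.
assert (h : enc c <= enc g) by (exact: enc_mem cg).
exact: leq_trans (half_enc c) (leq_trans h gc).
Qed.

Lemma small_inv l : small (inv_of r l).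
Proof.
rewrite /inv_of; case: (ltnP l (size (r_invs r))) => H; last by rewrite nth_default.
assert (h1 : enc (nth [::] (r_invs r) l) <= enc (r_invs r)) by (exact/enc_mem/mem_nth).
assert (h2 : enc (r_invs r) <= cap) by exact (proj1 (enc_pair r.2.2)).
exact: small_enc (leq_trans h1 h2).
Qed.

Lemma small_grd e : e \in r_edges r -> small (e_grd e).
Proof.
move=> er; assert (h1 : enc e <= enc (r_edges r)) by (exact: enc_mem).
assert (h2 : enc (r_edges r) <= cap) by exact (proj2 (enc_pair r.2.2)).
assert (h3 : enc e.2 <= enc e) by exact (proj2 (enc_pair e)).
assert (h4 : enc (e_grd e) <= enc e.2) by exact (proj1 (enc_pair e.2)).
exact: small_enc (leq_trans h4 (leq_trans h3 (leq_trans h1 h2))).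
Qed.

Lemma satk_cap z N c : c.2.2./2 <= cap -> satk z (minn N cap.+1) c = satk z N c.
Proof.
rewrite /satk => mc; have l1 : (minn N cap.+1 < c.2.2./2) = (N < c.2.2./2) by lia.
have l2 : (minn N cap.+1 == c.2.2./2) = (N == c.2.2./2) by lia.
have l3 : (c.2.2./2 <= minn N cap.+1) = (c.2.2./2 <= N) by lia.
have l4 : (c.2.2./2 < minn N cap.+1) = (c.2.2./2 < N) by lia.
by rewrite l1 l2 l3 l4.
Qed.

Lemma bump_minn N K : (if minn N K < K then (minn N K).+1 else minn N K) = minn N.+1 K.
Proof. by rewrite gtn_min ltnn orbF; case: (ltnP N K) => NK; lia. Qed.

Section Concrete.
Import Order.TTheory GRing.Theory Num.Theory.
Local Open Scope ring_scope.
Variable R : realType.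
Implicit Types (X : ident -> R -> Prop) (Z : seq (class * R)) (d phi : R).

Lemma satcE (N : nat) phi c : 0 <= phi < 1 -> satc (N%:R + phi) c = satk (phi == 0) N c.
Proof.
move=> /andP[f0 f1]; rewrite /satc /satk /zval; move: (c.2.1) (c.2.2) => cm z.
have v0 : 0 <= N%:R + phi by rewrite addr_ge0 ?ler0n.
have ltE (m : nat) : (N%:R + phi < m%:R) = (N < m)%N.
  case: ltnP => Nm; last first.
    by apply/negbTE; rewrite -leNgt; apply: (@le_trans _ _ N%:R); rewrite ?ler_nat ?lerDl.
  have N1 : N%:R + 1 <= m%:R :> R by rewrite natr1 ler_nat.
  by apply: lt_le_trans N1; rewrite ltrD2l.
have eqE (m : nat) : (N%:R + phi == m%:R) = (N == m) && (phi == 0).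
  apply/eqP/andP => [e|[/eqP -> /eqP ->]]; last by rewrite addr0.
  have Nm : N = m.
    apply/eqP; rewrite eqn_leq; apply/andP; split; first by rewrite -ltnS -ltE e ltr_nat.
    by rewrite leqNgt -ltE e ltxx.
  by split; [exact/eqP | move: e; rewrite -Nm -[X in _ = X]addr0 => /addrI ->].
have leE (m : nat) : (N%:R + phi <= m%:R) = (N < m)%N || ((N == m) && (phi == 0)).
  by rewrite le_eqVlt eqE ltE orbC.
have gtE (m : nat) : (m%:R < N%:R + phi) = (m < N)%N || ((N == m) && (phi != 0)).
  by rewrite ltNge leE negb_or -leqNgt leq_eqVlt; case: (ltngtP m N) => //= _; rewrite ?andbT.
have [m0|m0] := posnP z./2.
  have -> : (if odd z then - z./2%:R else z./2%:R) = z./2%:R :> R by rewrite m0 mulr0n oppr0 if_same.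
  rewrite andbF.
  by case: cm => [|[|[|[|cm]]]] /=; rewrite ?ltE ?leE ?eqE ?gtE // leNgt ltE -leqNgt.
rewrite andbT; case: (odd z); last first.
  by case: cm => [|[|[|[|cm]]]] /=; rewrite ?ltE ?leE ?eqE ?gtE // leNgt ltE -leqNgt.
have neg : - z./2%:R < N%:R + phi by apply: lt_le_trans v0; rewrite oppr_lt0 ltr0n.
case: cm => [|[|[|[|cm]]]] /=; rewrite ?neg ?(ltW neg) //.
- by rewrite ltNge (ltW neg).
- by rewrite leNgt neg.
- by rewrite gt_eqF.
Qed.

Lemma satrE (N : nat) phi g : 0 <= phi < 1 -> small g ->
  satr (N%:R + phi) g = all (fun c => satk (phi == 0) (minn N cap.+1) c) g.
Proof.
move=> f01 sg; apply: eq_in_all => c cg.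
by rewrite satcE // satk_cap //; exact: (allP sg).
Qed.

Definition xdel d X : ident -> R -> Prop := fun q v => exists2 u, X q u & v = u + d.

Definition xact e X : ident -> R -> Prop := fun q v => exists q0 u e',
  [/\ X q0 u, e' \in moves e q0, enabled r q0.2.1 u e', q = new_id q0 e' & v = move_clock u e'].

(** [Z] is an abstract configuration annotated with the actual fractional parts. Concrete
    configurations that differ only in integer parts above the cap share an item, so the
    correspondence is stated in two directions instead of as a bijection. *)
Definition describes Z X :=
  [/\ exists c Z', Z = (c, 0) :: Z', pairwise <%R [seq c.2 | c <- Z], all (fun c => c.2 < 1) Z,
      forall q v, X q v -> exists c phi (N : nat),
        [/\ (c, phi) \in Z, (q, minn N cap.+1) \in c & v = N%:R + phi] &
      forall c phi p, (c, phi) \in Z -> p \in c -> exists2 N : nat,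
        X p.1 (N%:R + phi) & p.2 = minn N cap.+1].

Lemma describes_range Z X c phi : describes Z X -> (c, phi) \in Z -> 0 <= phi < 1.
Proof.
move=> [[c0 [Z0 ->]] srt lt1 _ _] cZ; rewrite (allP lt1 _ cZ) andbT.
case/predU1P: cZ => [[_ ->] //|cZ]; move: srt => /= /andP[/allP H _].
by apply/ltW/(H phi)/mapP; exists (c, phi).
Qed.

Lemma describes_tail c0 Z X c phi : describes ((c0, 0) :: Z) X -> (c, phi) \in Z -> 0 < phi.
Proof.
move=> [_ /= /andP[/allP H _] _ _ _] cZ.
by apply/(H phi)/mapP; exists (c, phi).
Qed.

Definition shift d Z := [seq (c.1, c.2 + d) | c <- Z].

Lemma shift_fst d Z : [seq c.1 | c <- shift d Z] = [seq c.1 | c <- Z].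
Proof. by rewrite -map_comp. Qed.

Lemma shift_pairwise d Z : pairwise <%R [seq c.2 | c <- shift d Z] = pairwise <%R [seq c.2 | c <- Z].
Proof.
rewrite -map_comp !pairwise_map; apply: eq_pairwise => x y /=.
by rewrite ltrD2r.
Qed.

Lemma describes_push d Z X : describes Z X -> 0 < d -> all (fun c => c.2 + d < 1) Z ->
  describes (([::], 0) :: shift d Z) (xdel d X).
Proof.
move=> D d0 lt1; have rng := describes_range D; case: D => _ srt _ H1 H2; split.
- by exists [::], (shift d Z).
- rewrite map_cons pairwise_cons shift_pairwise srt andbT; apply/allP => _ /mapP[_ /mapP[[c f] cZ ->] ->] /=.
  by rewrite ltr_wpDl //; case/andP: (rng _ _ cZ).
- by rewrite /= ltr01 all_map.
- move=> q v [u /H1[c [f [N [cZ qc ->]]]] ->]; exists c, (f + d), N; rewrite addrA; split=> //.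
  by rewrite inE; apply/orP; right; apply/mapP; exists (c, f).
- move=> c f p; rewrite inE => /predU1P[[-> _] //|/mapP[[c' f'] cZ [-> ->]] /(H2 _ _ _ cZ)[N XN pN]].
  by exists N => //; exists (N%:R + f'); rewrite ?addrA.
Qed.

Lemma describes_wrap c phi Z X : describes (rcons Z (c, phi)) X ->
  describes ((bump c, 0) :: shift (1 - phi) Z) (xdel (1 - phi) X).
Proof.
move=> D; have rng := describes_range D; case: D => _ srt _ H1 H2.
have fl c' f : (c', f) \in Z -> f < phi.
  move: srt; rewrite map_rcons pairwise_rcons => /andP[/allP H _] cZ.
  by apply: (H f); apply/mapP; exists (c', f).
have /andP[p0 p1] : 0 <= phi < 1 by apply: (rng c); rewrite mem_rcons mem_head.
have inZ x : x \in Z -> x \in rcons Z (c, phi) by move=> xZ; rewrite mem_rcons inE xZ orbT.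
split.
- by exists (bump c), (shift (1 - phi) Z).
- rewrite map_cons pairwise_cons shift_pairwise; move: srt; rewrite map_rcons pairwise_rcons => /andP[_ ->].
  rewrite andbT; apply/allP => _ /mapP[_ /mapP[[c' f] cZ ->] ->] /=.
  have /andP[f0 _] := rng _ _ (inZ _ cZ); rewrite ltr_wpDl // subr_gt0 //.
- rewrite /= ltr01; apply/allP => _ /mapP[[c' f] cZ ->] /=.
  by have := fl _ _ cZ; lra.
- move=> q v [u /H1[c' [f [N [cZ qc ->]]]] ->]; move: cZ; rewrite mem_rcons inE => /predU1P[[e1 e2]|cZ].
    subst c' f; exists (bump c), 0, N.+1; split; first exact: mem_head.
      by apply/mapP; exists (q, minn N cap.+1); rewrite //= bump_minn.
    by rewrite -natr1; ring.
  exists c', (f + (1 - phi)), N; split=> //; last by rewrite -[LHS]addrA.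
  by rewrite inE; apply/orP; right; apply/mapP; exists (c', f).
- move=> c' f p; rewrite inE => /predU1P[[-> ->]|/mapP[[c2 f'] cZ [-> ->]] pc].
    move=> /mapP[p' p'c ->] /=.
    have [|N XN pN] := H2 c phi p' _ p'c; first by rewrite mem_rcons mem_head.
    exists N.+1; first by exists (N%:R + phi) => //; rewrite -natr1; ring.
    by rewrite pN bump_minn.
  have [N XN pN] := H2 _ _ _ (inZ _ cZ) pc.
  by exists N => //; exists (N%:R + f'); rewrite // -[RHS]addrA.
Qed.

End Concrete.
End Abstract.

(** * Exactness of the region abstraction *)

Section Simulation.
Import Order.TTheory GRing.Theory Num.Theory.
Local Open Scope ring_scope.
Variables (r : raw) (R : realType).
Local Notation cap := (cap r).
Implicit Types (X : ident -> R -> Prop) (Z : seq (class * R)) (d phi : R) (e : rawE).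

Lemma mem_images e z b (c : class) (p' : item) : reflect
  (exists p e', [/\ p \in c, e' \in moves r e p.1, enk r z p e', (e_rst e' != [::]) = b &
     p' = (new_id r p.1 e', if b then 0%N else p.2)]) (p' \in images r e z b c).
Proof.
apply: (iffP flattenP) => [[s /mapP[p pc ->] /mapP[e']]|[p [e' [pc em en rb ->]]]].
  by rewrite mem_filter => /andP[/andP[en /eqP rb] em] ->; exists p, e'.
eexists; first by apply/mapP; exists p; first exact: pc.
by apply/mapP; exists e' => //; rewrite mem_filter en rb eqxx.
Qed.

Lemma moves_edges e q e' : e \in r_edges r -> e' \in moves r e q -> e' \in r_edges r.
Proof.
rewrite /moves => er; case: ifP => _; first by rewrite inE => /eqP ->.
by rewrite mem_filter => /andP[].
Qed.

Lemma enkE phi (q : ident) (N : nat) e : 0 <= phi < 1 -> e \in r_edges r ->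
  enk r (phi == 0) (q, minn N cap.+1) e = enabled r q.2.1 (N%:R + phi) e.
Proof.
move=> f01 er; rewrite /enk /enabled /= -!satrE ?small_inv ?small_grd //; do 4!congr (_ && _).
rewrite /after /move_clock; case: ifP => _ /=; first by rewrite -satrE ?small_inv.
have := @satrE r R 0 0 (inv_of r (e_tgt e)); rewrite eqxx min0n addr0 => -> //.
  by rewrite lexx ltr01.
exact: small_inv.
Qed.

Lemma describes_act e Z X : e \in r_edges r -> describes r Z X ->
  exists2 Z', [seq c.1 | c <- Z'] = act_cfg r e [seq c.1 | c <- Z] & describes r Z' (xact r e X).
Proof.
move=> er D; have rng := describes_range D; have ZE := D; case: ZE => -[c0 [Z0 ZE]] srt lt1 H1 H2.
have tl c phi : (c, phi) \in Z0 -> (phi == 0) = false.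
  by move=> cZ; apply/gt_eqF/(@describes_tail r R c0 Z0 X c) => //; rewrite -ZE.
have fwd c phi b p' : (c, phi) \in Z -> p' \in images r e (phi == 0) b c ->
    if b then xact r e X p'.1 0 /\ p'.2 = 0%N else
    exists2 N : nat, xact r e X p'.1 (N%:R + phi) & p'.2 = minn N cap.+1.
  move=> cZ /mem_images[[q k] [e' [pc em en rb ->]]].
  have [N XN /= kN] := H2 _ _ _ cZ pc; subst k.
  rewrite enkE ?(rng c) ?(moves_edges er em) // in en.
  have act : xact r e X (new_id r q e') (move_clock (N%:R + phi) e').
    by exists q, (N%:R + phi), e'.
  by move: act rb; rewrite /move_clock; case: eqP => _ act <- //=; exists N.
have fwdF c phi p' : (c, phi) \in Z -> p' \in images r e (phi == 0) false c ->
    exists2 N : nat, xact r e X p'.1 (N%:R + phi) & p'.2 = minn N cap.+1.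
  exact: fwd.
have fwdT c phi p' : (c, phi) \in Z -> p' \in images r e (phi == 0) true c ->
    xact r e X p'.1 0 /\ p'.2 = 0%N.
  exact: fwd.
have bwd q v : xact r e X q v -> exists c phi (N : nat) b,
    [/\ (c, phi) \in Z, (q, if b then 0%N else minn N cap.+1) \in images r e (phi == 0) b c &
      v = if b then 0 else N%:R + phi].
  move=> [q0 [u [e' [/H1[c [phi [N [cZ pc uE]]]] em en -> ->]]]].
  exists c, phi, N, (e_rst e' != [::]); split=> //; last by rewrite /move_clock uE; case: eqP.
  apply/mem_images; exists (q0, minn N cap.+1), e'; split=> //.
  by rewrite enkE ?(rng c) ?(moves_edges er em) // -uE.
pose h := head [::] (act_cfg r e [seq c.1 | c <- Z]).
have memh p' : reflect ((p' \in images r e true false c0) \/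
    exists c phi, (c, phi) \in Z /\ p' \in images r e (phi == 0) true c) (p' \in h).
  rewrite /h ZE /act_cfg /= !mem_cat; apply: (iffP or3P) => [[H|H|/flattenP[s /mapP[c /mapP[[c' phi] cZ ->] ->]] H]|[H|[c [phi [cZ H]]]]].
  - by left.
  - by right; exists c0, 0; rewrite mem_head eqxx.
  - by right; exists c', phi; rewrite inE cZ orbT (tl c').
  - by constructor 1.
  - move: cZ H; rewrite inE => /predU1P[[-> ->]|cZ]; first by rewrite eqxx; constructor 2.
    rewrite (tl c) // => H; constructor 3; apply/flattenP; exists (images r e false true c) => //.
    by apply/mapP; exists c => //; apply/mapP; exists (c, phi).
exists ((h, 0) :: [seq (images r e false false c.1, c.2) | c <- Z0]).
  rewrite map_cons /h ZE /act_cfg [head _ (_ :: _)]/= [behead _]/=; congr (_ :: _).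
  by rewrite -!map_comp.
have sndE : [seq c.2 | c <- (h, 0) :: [seq (images r e false false c.1, c.2) | c <- Z0]] = [seq c.2 | c <- Z].
  by rewrite ZE /= -map_comp.
split.
- by exists h, [seq (images r e false false c.1, c.2) | c <- Z0].
- by rewrite sndE.
- by move: lt1; rewrite ZE /= all_map.
- move=> q v /bwd[c [phi [N [b [cZ qin ->]]]]]; case: b qin => qin.
    exists h, 0, 0%N; rewrite mem_head addr0; split=> //; rewrite min0n.
    by apply/memh; right; exists c, phi.
  move: cZ qin; rewrite ZE inE => /predU1P[[-> ->]|cZ].
    rewrite eqxx => qin; exists h, 0, N; rewrite mem_head; split=> //.
    by apply/memh; left.
  rewrite (tl c) // => qin; exists (images r e false false c), phi, N; split=> //.
  by rewrite inE; apply/orP; right; apply/mapP; exists (c, phi).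
- move=> c phi p; rewrite inE => /predU1P[[-> ->]|/mapP[[c' f] cZ [-> ->]]].
    move=> /memh[H|[c' [f [cZ /(fwdT _ _ _ cZ)[H1' H2']]]]].
      apply: (fwdF c0 0); first by rewrite ZE mem_head.
      by rewrite eqxx.
    by exists 0%N; rewrite ?addr0 // H2' min0n.
  move=> H; apply: (fwdF c' f); last by rewrite (tl _ _ cZ).
  by rewrite ZE inE cZ orbT.
Qed.

Lemma xdelD d d' X : xdel d (xdel d' X) = xdel (d' + d) X.
Proof.
apply/funext => q; apply/funext => v; apply/propext; split=> [[_ [u Xu ->] ->]|[u Xu ->]].
  by exists u => //; rewrite addrA.
by exists (u + d'); [exists u | rewrite addrA].
Qed.

Lemma xdel0 X : xdel 0 X = X.
Proof.
apply/funext => q; apply/funext => v; apply/propext; split=> [[u Xu ->]|Xv]; first by rewrite addr0.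
by exists v => //; rewrite addr0.
Qed.

Lemma succs_push J : [::] :: J \in succs r J. Proof. exact: mem_head. Qed.
Lemma succs_wrap J : wrap r J \in succs r J. Proof. by rewrite !inE eqxx orbT. Qed.
Lemma succs_act e J : e \in r_edges r -> act_cfg r e J \in succs r J.
Proof. by move=> er; rewrite !inE; apply/or3P; constructor 3; apply/mapP; exists e. Qed.

(** By induction on the number of integers that clocks cross. *)
Lemma describes_delay d Z X : 0 <= d -> describes r Z X -> reach r [seq c.1 | c <- Z] ->
  exists2 Z', reach r [seq c.1 | c <- Z'] & describes r Z' (xdel d X).
Proof.
have [n] := ubnP (\sum_(c <- Z) Num.truncn (c.2 + d)).
elim: n d Z X => // n IH d Z X; rewrite ltnS => sn d0 D rZ.
have [->|dn0] := eqVneq d 0; first by exists Z; rewrite ?xdel0.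
have dp : 0 < d by rewrite lt_neqAle eq_sym dn0.
case/lastP: Z D rZ sn => [[[c [Z' //]]]|Z [c phi] D rZ sn].
have /andP[p0 p1] : 0 <= phi < 1 by apply: (describes_range D (c := c)); rewrite mem_rcons mem_head.
have [fd|fd] := ltP (phi + d) 1.
  exists (([::], 0) :: shift d (rcons Z (c, phi))).
    by rewrite map_cons shift_fst; apply: reach_step rZ (succs_push _).
  apply: describes_push => //; rewrite all_rcons /= fd; apply/allP => -[c' f] cZ /=.
  case: D => _ + _ _ _; rewrite map_rcons pairwise_rcons => /andP[/allP H _].
  have fl : f < phi by apply: (H f); apply/mapP; exists (c', f).
  by apply: lt_trans fd; rewrite ltrD2r.
(* The delay is cut at the moment when the last class reaches an integer. In the measure the term of
   this class falls, and the terms of the other classes do not change. *)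
have d1 : 0 <= d - (1 - phi) by lra.
have D' := describes_wrap D.
have := IH _ _ _ _ d1 D'; rewrite xdelD [1 - phi + _]addrC subrK; apply.
  apply: leq_trans sn; rewrite -cats1 big_cat big_seq1 big_cons /= big_map addnC.
  have -> : \sum_(j <- Z) Num.truncn ((j.1, j.2 + (1 - phi)).2 + (d - (1 - phi))) =
      \sum_(j <- Z) Num.truncn (j.2 + d).
    by apply: eq_bigr => j _ /=; congr Num.truncn; ring.
  rewrite ltn_add2l add0r.
  rewrite truncn_gt_nat -natr1; have := truncn_le (d - (1 - phi)); rewrite d1.
  by set t := _%:R; move: d1; move: (t) => y h1 h2; lra.
rewrite map_cons shift_fst -/(map _ _).
have -> : bump r c :: [seq c0.1 | c0 <- Z] = wrap r [seq c0.1 | c0 <- rcons Z (c, phi)].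
  by rewrite map_rcons wrap_rcons.
exact: reach_step rZ (succs_wrap _).
Qed.

Definition xbad (beta : nat) X :=
  (exists l v, X (1%N, (l, beta)) v /\ l \in r_fin r) /\
  ~ (exists l v, X (0%N, (l, 1 - beta)%N) v /\ l \in r_fin r).

Lemma describes_has Z X (t beta : nat) : describes r Z X ->
  has (fun c => has (fun p : item => [&& p.1.1 == t, p.1.2.1 \in r_fin r & p.1.2.2 == beta]) c)
    [seq c.1 | c <- Z] <-> exists l v, X (t, (l, beta)) v /\ l \in r_fin r.
Proof.
move=> [_ _ _ H1 H2]; split.
  move=> /hasP[_ /mapP[[c phi] cZ ->] /hasP[[[t' [l b]] k] pc /= /and3P[/eqP et lf /eqP eb]]].
  by have [N XN _] := H2 _ _ _ cZ pc; subst t' b; exists l, (N%:R + phi).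
move=> [l [v [/H1[c [phi [N [cZ pc _]]]] lf]]].
apply/hasP; exists c; first by apply/mapP; exists (c, phi).
by apply/hasP; exists ((t, (l, beta)), minn N cap.+1); rewrite //= lf !eqxx.
Qed.

Lemma describes_bad beta Z X : describes r Z X -> xbad beta X <-> bad r beta [seq c.1 | c <- Z].
Proof.
move=> D; rewrite /xbad /bad -!(describes_has _ _ D); split=> [[-> /negP] //|/andP[-> /negP] //].
Qed.

Lemma xbad_del beta d X : xbad beta (xdel d X) <-> xbad beta X.
Proof.
have E t b : (exists l v, xdel d X (t, (l, b)) v /\ l \in r_fin r) <->
    (exists l v, X (t, (l, b)) v /\ l \in r_fin r).
  split=> [[l [_ [[u Xu _] lf]]]|[l [v [Xv lf]]]]; first by exists l, u.
  by exists l, (v + d); split=> //; exists v.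
by rewrite /xbad !E.
Qed.

Definition xinit : ident -> R -> Prop := fun q v =>
  [/\ satr (0 : R) (inv_of r (r_init r)), v = 0 & exists t, (t == 0%N) || (t == 1%N) /\
     q = (t, (r_init r, rflag r (r_init r)))].

Definition xstep X (m : R * rawE) := xact r m.2 (xdel m.1 X).
Definition xrun X (w : seq (R * rawE)) := foldl xstep X w.
Definition legal (w : seq (R * rawE)) := all (fun m => (0 <= m.1) && (m.2 \in r_edges r)) w.

Lemma describes_init : exists2 Z, [seq c.1 | c <- Z] = init_cfg r & describes r Z xinit.
Proof.
have sE := @satrE r R 0 0 (inv_of r (r_init r)).
rewrite eqxx min0n addr0 in sE.
have s0 : satr (0 : R) (inv_of r (r_init r)) = all (fun c => satk true 0 c) (inv_of r (r_init r)).
  by apply: sE; [rewrite lexx ltr01 | exact: small_inv].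
exists [:: (head [::] (init_cfg r), 0)] => //; split=> //=.
- by exists (head [::] (init_cfg r)), [::].
- by rewrite ltr01.
- move=> q v [si -> [t [tE ->]]]; exists (head [::] (init_cfg r)), 0, 0%N.
  rewrite mem_head addr0 min0n; split=> //=; rewrite -s0 si.
  by case/orP: tE => /eqP ->; rewrite !inE eqxx ?orbT.
- move=> c phi p; rewrite inE => /eqP[-> ->] /=; rewrite -s0; case: ifP => // si.
  by rewrite !inE => /orP[] /eqP ->; exists 0%N; rewrite ?min0n // addr0; split=> //; [exists 1%N|exists 0%N].
Qed.

Lemma run_reach w : legal w -> exists2 Z, reach r [seq c.1 | c <- Z] & describes r Z (xrun xinit w).
Proof.
elim/last_ind: w => [_|w [d e] IH].
  by have [Z ZE D] := describes_init; exists Z => //; rewrite ZE; constructor.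
rewrite /legal all_rcons => /andP[/andP[/= d0 er] /IH[Z rZ D]].
have [Z1 r1 D1] := describes_delay d0 D rZ.
have [Z2 E2 D2] := describes_act er D1.
exists Z2; first by rewrite E2; apply: reach_step r1 (succs_act _ er).
by rewrite /xrun foldl_rcons.
Qed.

(** An abstract path may stop between two actions, so the concrete run is followed by a pending
    delay [d], to which further time steps are added. *)
Lemma reach_run J : reach r J -> exists w d Z,
  [/\ legal w, 0 <= d, [seq c.1 | c <- Z] = J & describes r Z (xdel d (xrun xinit w))].
Proof.
elim=> {J} [|J J' _ [w [d [Z [lw d0 <- D]]]]].
  by have [Z ZE D] := describes_init; exists [::], 0, Z; rewrite xdel0.
rewrite !inE => /or3P[/eqP ->|/eqP ->|/mapP[e er ->]].
(* A delay so short that no clock reaches an integer: half of the smallest distance to one will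
   do. *)
- have [de [de0 lt1]] : exists de, 0 < de /\ all (fun c => c.2 + de < 1) Z.
    case: D => _ _ + _ _; elim: Z => [|[c f] Z IH] /=; first by exists 1.
    move=> /andP[f1 /IH[de [de0 H]]]; exists (Num.min de ((1 - f) / 2)); split.
      by rewrite lt_min de0 divr_gt0 // subr_gt0.
    apply/andP; split; first by case: (leP de ((1 - f) / 2)); lra.
    by apply: sub_all H => -[c' f'] /=; case: (leP de ((1 - f) / 2)); lra.
  exists w, (d + de), (([::], 0) :: shift de Z); split=> //; first by rewrite addr_ge0 // ltW.
    by rewrite map_cons shift_fst.
  by rewrite -xdelD; exact: describes_push.
- case/lastP: Z D => [[[c [Z' //]]]|Z [c phi] D].
  have /andP[p0 p1] : 0 <= phi < 1 by apply: (describes_range D (c := c)); rewrite mem_rcons mem_head.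
  exists w, (d + (1 - phi)), ((bump r c, 0) :: shift (1 - phi) Z); split=> //; first lra.
    by rewrite map_cons shift_fst map_rcons wrap_rcons.
  by rewrite -xdelD; exact: describes_wrap.
- have [Z' E' D'] := describes_act er D.
  exists (rcons w (d, e)), 0, Z'; split=> //; first by rewrite /legal all_rcons /= d0 er.
  by rewrite xdel0 /xrun foldl_rcons.
Qed.

Lemma run_bad beta : (exists w, legal w /\ xbad beta (xrun xinit w)) <->
  (exists J, reach r J /\ bad r beta J).
Proof.
split=> [[w [/run_reach[Z rZ D] /(describes_bad _ D) b]]|[J [/reach_run[w [d [Z [lw _ <- D]]]] b]]].
  by exists [seq c.1 | c <- Z].
by exists w; split=> //; apply/xbad_del/(describes_bad _ D).
Qed.

End Simulation.

(** * Words, and the matching of runs *)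

Section Words.
Import Order.TTheory GRing.Theory Num.Theory.
Local Open Scope ring_scope.
Variables (r : raw) (R : realType).
Implicit Types (X : ident -> R -> Prop) (w : seq (R * rawE)).

(** The list [w] of delays and edges plays two roles: for tag 1 it is the run itself, for tag 0 only
    its labels matter. *)
Fixpoint follows (t beta l b : nat) (v : R) w : Prop :=
  if w is (d, e) :: w' then
    exists e', [/\ e' \in moves r e (t, (l, b)), enabled r l (v + d) e' &
      follows t beta (e_tgt e') (move_flag r b e') (move_clock (v + d) e') w']
  else l \in r_fin r /\ b = beta.

Lemma xrunE t beta w X : (exists l v, xrun r X w (t, (l, beta)) v /\ l \in r_fin r) <->
  exists l b v, X (t, (l, b)) v /\ follows t beta l b v w.
Proof.
elim: w X => [|[d e] w IH] X /=.
  by split=> [[l [v [Xv lf]]]|[l [b [v [Xv [lf <-]]]]]]; [exists l, beta, v | exists l, v].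
rewrite IH /xstep; split.
  move=> [l [b [v [[[t0 [l0 b0]] [_ [e' [[u Xu ->] em en [-> -> ->] ->]]]] F]]]].
  by exists l0, b0, u; split=> //; exists e'.
move=> [l [b [v [Xv [e' [em en F]]]]]].
exists (e_tgt e'), (move_flag r b e'), (move_clock (v + d) e'); split=> //.
by exists (t, (l, b)), (v + d), e'; split=> //; exists v.
Qed.

Definition labels w := [seq (e_act m.2, m.1) | m <- w].

Lemma follows0 beta l b v w : legal r w -> follows 0 beta l b v w <-> racc r beta l b v (labels w).
Proof.
elim: w l b v => [|[d e] w IH] l b v //= /andP[/andP[d0 _] lw]; split.
  move=> [e' []]; rewrite /moves mem_filter => /andP[/eqP ae er] en /(IH _ _ _ lw) F.
  by split=> //; exists e'.
move=> [_ [e' [er ae en /(IH _ _ _ lw) F]]].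
by exists e'; split=> //; rewrite /moves mem_filter ae eqxx er.
Qed.

Lemma follows1 beta l b v dw : racc r beta l b v dw <->
  exists w, [/\ legal r w, follows 1 beta l b v w & labels w = dw].
Proof.
split.
  elim: dw l b v => [|[a d] dw IH] l b v /=; first by exists [::].
  move=> [d0 [e [er <- en /IH[w [lw F <-]]]]]; exists ((d, e) :: w); split=> //.
    by rewrite /= d0 er.
  by exists e; split=> //; rewrite /moves mem_head.
move=> [w [lw F <-]]; elim: w l b v lw F => [|[d e] w IH] l b v //= /andP[/andP[d0 er] lw].
move=> [e' []]; rewrite /moves inE => /eqP -> en /(IH _ _ _ lw) F.
by split=> //; exists e.
Qed.

(** The tagged item follows one chosen run, while the untagged items explore all runs over the same
    labels; that none of them is final with the opposite flag means that the word is not in the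
    other language. *)
Lemma run_words beta : (exists w, legal r w /\ xbad r beta (xrun r (@xinit r R) w)) <->
  exists dw : seq (nat * R), rlang r beta dw /\ ~ rlang r (1 - beta) dw.
Proof.
have init t b w : (t == 0%N) || (t == 1%N) ->
    (exists l b' v, @xinit r R (t, (l, b')) v /\ follows t b l b' v w) <->
    satr (0 : R) (inv_of r (r_init r)) /\ follows t b (r_init r) (rflag r (r_init r)) 0 w.
  move=> t01; split=> [[l [b' [v [[si -> [t' [_ [-> -> ->]]]] F]]]]|[si F]]; first by [].
  exists (r_init r), (rflag r (r_init r)), 0; split=> //; split=> //.
  by exists t.
split.
  move=> [w [lw []]]; rewrite !xrunE !init // => -[si F1] F0.
  exists (labels w); split; first by split=> //; apply/follows1; exists w.
  by move=> [_ F]; apply: F0; split=> //; apply/follows0.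
move=> [dw [[si /follows1[w [lw F <-]]] nF]]; exists w; split=> //.
rewrite /xbad !xrunE !init //; split=> // -[_ /follows0 F0].
by apply: nF; split=> //; apply: F0.
Qed.

End Words.

Section Safety.
Variables (R : realType) (A : timed_automaton).
Hypothesis clock1 : one_clock A.
Hypothesis eps : epsilon_free A.
Local Notation r := (raw_of A).

Definition safe (bs : seq nat) (r0 : raw) := forall J b, reach r0 J -> b \in bs -> ~~ bad r0 b J.

Lemma lang_safe (b : bool) : (forall dw, @lang R A b dw -> @lang R A (~~ b) dw) <->
  forall J, reach r J -> ~~ bad r b J.
Proof.
have [H1 H2] : (exists J, reach r J /\ bad r b J) <->
    exists dw : seq (nat * R), rlang r b dw /\ ~ rlang r (1 - b) dw.
  by rewrite -run_words run_bad.
have nb : (1 - b = ~~ b)%N by case: (b).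
rewrite nb in H1 H2; split=> [H J rJ|H dw ldw].
  apply/negP => bJ; have [|dw [ldw ndw]] := H1; first by exists J.
  have [u uE] := rlang_words eps ldw; rewrite uE in ldw ndw.
  by apply: ndw; apply/rlang_of/H/rlang_of.
apply: contrapT => ndw; have [|J [rJ bJ]] := H2; last by have := H _ rJ; rewrite bJ.
by exists [seq (act_of (Some p.1), p.2) | p <- dw]; split; [exact/rlang_of | move/rlang_of].
Qed.

Lemma weakly_opaque_safe : weakly_opaque R A <-> safe [:: 1] r.
Proof.
rewrite weakly_opaqueE //; have -> := lang_safe true.
split=> [H J b rJ|H J rJ]; last exact: H.
by rewrite inE => /eqP ->; exact: H.
Qed.

Lemma fully_opaque_safe : fully_opaque R A <-> safe [:: 1; 0] r.
Proof.
rewrite fully_opaqueE //; have [T1 T2] := lang_safe true; have [F1 F2] := lang_safe false.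
split=> [H J b rJ|H dw].
  rewrite !inE => /orP[] /eqP ->; first by apply: T1 => // dw /H.
  by apply: F1 => // dw /H.
split; first by apply: T2 => J rJ; apply: (H J 1).
by apply: F2 => J rJ; apply: (H J 0).
Qed.

End Safety.

(** * Well-quasi-ordering of abstract configurations *)

Definition tagged (p : item) := p.1.1 == 1.

Definition tg (c : class) := has tagged c.

(** Agreement on tagged items, inclusion on the others: a smaller class has fewer runs that could
    match. *)
Definition le_class (c c' : class) :=
  all (fun p => p \in c') c && all (fun p => ~~ tagged p || (p \in c)) c'.

(** A Higman embedding in which a class of [t] may be skipped only if it contains no tagged item,
    since the run to be matched must not get lost. *)
Fixpoint emb (s t : seq class) : bool :=
  if t is c' :: t' then
    (~~ tg c' && emb s t') || (if s is c :: s' then le_class c c' && emb s' t' else false)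
  else nilp s.

(** Fewer untagged items make a bad configuration more likely, so the safe
    configurations are closed upwards. *)
Definition le_cfg (J J' : cfg) :=
  le_class (head [::] J) (head [::] J') && emb (behead J) (behead J').

Lemma le_classP c c' : reflect ((forall p, p \in c -> p \in c') /\
  (forall p, tagged p -> p \in c' -> p \in c)) (le_class c c').
Proof.
apply: (iffP andP) => [[/allP H1 /allP H2]|[H1 H2]]; split=> //.
- by move=> p tp /H2; rewrite tp.
- exact/allP.
- by apply/allP => p pc'; case: (boolP (tagged p)) => //= tp; exact: H2.
Qed.

Lemma le_class_trans c2 c1 c3 : le_class c1 c2 -> le_class c2 c3 -> le_class c1 c3.
Proof.
move=> /le_classP[a1 b1] /le_classP[a2 b2]; apply/le_classP; split=> [p /a1/a2 //|p tp /b2 h].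
by apply: b1 => //; exact: h.
Qed.

Lemma le_class_tg c c' : le_class c c' -> tg c' = tg c.
Proof.
move=> /le_classP[H1 H2]; apply/hasP/hasP => -[p pc tp]; exists p => //; first exact: H2.
exact: H1.
Qed.

Lemma le_class_cat a a' b b' : le_class a a' -> le_class b b' -> le_class (a ++ b) (a' ++ b').
Proof.
move=> /le_classP[a1 a2] /le_classP[b1 b2]; apply/le_classP; split=> p.
  by rewrite !mem_cat => /orP[/a1 ->|/b1 ->]; rewrite ?orbT.
by move=> tp; rewrite !mem_cat => /orP[/(a2 _ tp) ->|/(b2 _ tp) ->]; rewrite ?orbT.
Qed.

Lemma le_nil_class c : ~~ tg c -> le_class [::] c.
Proof. by move=> /hasPn H; apply/le_classP; split=> // p tp /H; rewrite tp. Qed.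

Lemma emb_trans u s t : emb s t -> emb t u -> emb s u.
Proof.
elim: u s t => [|c u IH] s t /=; first by move=> + /nilP tE; rewrite tE.
move=> st /orP[/andP[nc tu]|]; first by rewrite nc (IH _ _ st tu).
case: t st => // d t st /andP[dc tu]; move: st => /= /orP[/andP[nd st]|].
  by rewrite (le_class_tg dc) nd (IH _ _ st tu).
case: s => // x s /andP[xd st].
by rewrite (le_class_trans xd dc) (IH _ _ st tu) orbT.
Qed.

Lemma le_cfg_trans J2 J1 J3 : le_cfg J1 J2 -> le_cfg J2 J3 -> le_cfg J1 J3.
Proof.
move=> /andP[h1 e1] /andP[h2 e2].
by rewrite /le_cfg (le_class_trans h1 h2) (emb_trans e1 e2).
Qed.

Lemma emb_rcons s t d : emb s (rcons t d) ->
  ~~ tg d && emb s t \/ exists s0 x, [/\ s = rcons s0 x, le_class x d & emb s0 t].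
Proof.
elim: t s => [|c t IH] s /=.
  case: s => [|x s]; first by rewrite orbF => ->; left.
  by rewrite /= andbF /= => /andP[xd /nilP ->]; right; exists [::], x.
move=> /orP[/andP[nc /IH[/andP[nd st]|[s0 [x [-> xd st]]]]]|].
- by left; rewrite nd nc st.
- by right; exists s0, x; split=> //; rewrite nc st.
case: s => // y s /andP[yc /IH[/andP[nd st]|[s0 [x [-> xd st]]]]].
  by left; rewrite nd yc st orbT.
by right; exists (y :: s0), x; split=> //; rewrite yc st orbT.
Qed.

Lemma emb_flatten (f : class -> class) s t :
  (forall c c', le_class c c' -> le_class (f c) (f c')) -> (forall c, tg (f c) -> tg c) ->
  emb s t -> le_class (flatten [seq f c | c <- s]) (flatten [seq f c | c <- t]).
Proof.
move=> fm ft; elim: t s => [|c' t IH] s /=; first by move/nilP->.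
move=> /orP[/andP[nc /IH]|].
  by apply: (@le_class_cat [::]); apply: le_nil_class; apply: contra nc; exact: ft.
by case: s => // c s /andP[/fm cc' /IH]; exact: le_class_cat.
Qed.

Lemma emb_map (f : class -> class) s t :
  (forall c c', le_class c c' -> le_class (f c) (f c')) -> (forall c, tg (f c) -> tg c) ->
  emb s t -> emb [seq f c | c <- s] [seq f c | c <- t].
Proof.
move=> fm ft; elim: t s => [|c' t IH] s /=; first by move/nilP->.
move=> /orP[/andP[nc /IH ->]|]; first by rewrite (contra (ft c') nc).
by case: s => // c s /andP[/fm /= -> /IH ->]; rewrite orbT.
Qed.

Section Monotone.
Variable r : raw.

Lemma images_mono e z b c c' : le_class c c' -> le_class (images r e z b c) (images r e z b c').
Proof.
move=> /le_classP[H1 H2]; apply/le_classP; split=> p.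
  move=> /mem_images[q [e' [qc em en rb pE]]]; apply/mem_images; exists q, e'; split=> //.
  exact: H1.
move=> tp /mem_images[q [e' [qc em en rb pE]]]; apply/mem_images; exists q, e'; split=> //.
by apply: H2 => //; move: tp; rewrite pE.
Qed.

Lemma images_tg e z b c : tg (images r e z b c) -> tg c.
Proof.
move=> /hasP[p /mem_images[q [e' [qc _ _ _ pE]]] tp].
by apply/hasP; exists q => //; move: tp; rewrite pE.
Qed.

Lemma bump_mono c c' : le_class c c' -> le_class (bump r c) (bump r c').
Proof.
move=> /le_classP[H1 H2]; apply/le_classP; split=> p.
  by move=> /mapP[q qc ->]; apply: map_f; exact: H1.
by move=> tp /mapP[q qc pE]; rewrite pE; apply: map_f; apply: H2 => //; move: tp; rewrite pE.
Qed.

Lemma bump_tg c : tg (bump r c) = tg c.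
Proof. by rewrite /tg has_map. Qed.

(** A smaller configuration can imitate every step of a larger one, so closure under successors
    needs to be tested only on generators of an upward closed set. *)
Lemma le_cfg_simulation w J J' : w != [::] -> J != [::] -> le_cfg w J -> J' \in succs r J ->
  exists2 w', w' \in succs r w & le_cfg w' J'.
Proof.
case: w J => // c s [//|c' t] _ _ /andP[/= cc' st].
rewrite !inE => /or3P[/eqP ->|/eqP ->|/mapP[e er ->]].
- exists ([::] :: c :: s); first exact: succs_push.
  by rewrite /le_cfg /= cc' st orbT.
- case/lastP: t st => [/nilP ->|t d /emb_rcons[/andP[nd st]|[s0 [x [-> xd st]]]]].
  + exists (wrap r [:: c]); first exact: succs_wrap.
    by rewrite /le_cfg /wrap /= (bump_mono cc').
  (* The class that wraps in the larger configuration has no counterpart in the smaller one. No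
     clock of the latter reaches an integer at that moment, so it answers by a short delay. *)
  + exists ([::] :: c :: s); first exact: succs_push.
    rewrite -rcons_cons wrap_rcons /le_cfg /= cc' st orbT andbT.
    by apply: le_nil_class; rewrite bump_tg.
  + exists (wrap r (c :: rcons s0 x)); first exact: succs_wrap.
    by rewrite -!rcons_cons !wrap_rcons /le_cfg /= (bump_mono xd) cc' st orbT.
- exists (act_cfg r e (c :: s)); first exact: succs_act.
  rewrite /le_cfg /act_cfg /=; apply/andP; split; last first.
    by apply: emb_map st => [*|*]; [exact: images_mono | apply: images_tg; eassumption].
  apply: le_class_cat; first exact: images_mono.
  apply: le_class_cat; first exact: images_mono.
  by apply: emb_flatten st => [*|*]; [exact: images_mono | apply: images_tg; eassumption].
Qed.

Lemma le_cfg_flatten w J : w != [::] -> J != [::] -> le_cfg w J -> le_class (flatten w) (flatten J).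
Proof.
case: w J => // c s [//|c' t] _ _ /andP[/= cc' st]; apply: le_class_cat => //.
by have := @emb_flatten id s t (fun _ _ => id) (fun _ => id) st; rewrite !map_id.
Qed.

Lemma has_flatten_pred (P : pred item) (J : cfg) : has (fun c => has P c) J = has P (flatten J).
Proof. by elim: J => //= c J ->; rewrite has_cat. Qed.

Lemma le_cfg_bad b w J : w != [::] -> J != [::] -> le_cfg w J -> bad r b J -> bad r b w.
Proof.
move=> w0 J0 /(le_cfg_flatten w0 J0)/le_classP[H1 H2].
rewrite /bad !has_flatten_pred => /andP[/hasP[p pJ /and3P[tp lf fb]] /hasPn nJ].
apply/andP; split; first by apply/hasP; exists p; rewrite ?tp ?lf ?fb //; exact: H2.
by apply/hasPn => q /H1/nJ.
Qed.

(** The upward closure of [W] is an inductive invariant without bad configurations. All four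
    conditions are finite checks on [W]. *)
Definition certified (bs : seq nat) (W : seq cfg) :=
  [&& has (fun w => le_cfg w (init_cfg r)) W, all (fun w : cfg => w != [::]) W,
      all (fun w => all (fun J => has (fun w' => le_cfg w' J) W) (succs r w)) W &
      all (fun w => all (fun b => ~~ bad r b w) bs) W].

Lemma reach_nonnil J : reach r J -> J != [::].
Proof.
by case=> // J0 J' _; rewrite !inE => /or3P[/eqP ->|/eqP ->|/mapP[e _ ->]].
Qed.

Lemma certified_safe bs W : certified bs W -> safe bs r.
Proof.
move=> /and4P[/hasP[w0 w0W i0] /allP nn /allP cl /allP nb].
have cover J : reach r J -> exists2 w, w \in W & le_cfg w J.
  elim=> {J} [|J J' rJ [w wW wJ] J'J]; first by exists w0.
  have [w1 w1s w1J] := le_cfg_simulation (nn _ wW) (reach_nonnil rJ) wJ J'J.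
  have /hasP[w2 w2W w21] := allP (cl _ wW) _ w1s.
  by exists w2 => //; exact: le_cfg_trans w21 w1J.
move=> J b rJ bbs; have [w wW wJ] := cover J rJ; apply/negP => bJ.
by have := allP (nb _ wW) _ bbs; rewrite (le_cfg_bad (nn _ wW) (reach_nonnil rJ) wJ bJ).
Qed.

Definition bound := (enc (r_init r :: [seq e_tgt e | e <- r_edges r])).+1.

Definition bounded_item (p : item) :=
  [&& p.1.1 < 2, p.1.2.1 < bound, p.1.2.2 < 2 & p.2 < (cap r).+2].

(** Bounded items leave finitely many classes up to order and repetition, which gives the alphabet
    for Higman's lemma. The bound on tagged items controls the classes that an embedding may not
    skip. *)
Definition tame (J : cfg) := all bounded_item (flatten J) && (count tagged (flatten J) <= 1).

Lemma loc_bound l : l \in r_init r :: [seq e_tgt e | e <- r_edges r] -> l < bound.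
Proof. by move=> lL; rewrite ltnS; exact: (enc_mem lL). Qed.

Lemma count_images e z c :
  count tagged (images r e z false c) + count tagged (images r e z true c) <= count tagged c.
Proof.
elim: c => // p c; rewrite /images /= !count_cat => IH.
rewrite addnACA; apply: leq_add IH; rewrite !count_map !count_filter.
rewrite (eq_count (a2 := fun e' => tagged p && (enk r z p e' && ((e_rst e' != [::]) == false)))) //.
rewrite [X in _ + X <= _](eq_count (a2 := fun e' => tagged p && (enk r z p e' && ((e_rst e' != [::]) == true)))) //.
rewrite /moves -/(tagged p); case: (tagged p) => /=; last by rewrite !count_pred0.
by case: (enk r z p e) => //=; case: (e_rst e == [::]).
Qed.

Lemma images_bounded e z b c : e \in r_edges r -> all bounded_item c -> all bounded_item (images r e z b c).
Proof.
move=> er /allP H; apply/allP => p /mem_images[q [e' [qc em _ _ ->]]].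
have /and4P[h1 h2 h3 h4] := H q qc; apply/and4P; split=> //=.
- by apply: loc_bound; rewrite inE (map_f e_tgt (moves_edges er em)) orbT.
- by rewrite /move_flag; case: ifP.
- by case: b.
Qed.

Lemma tame_succs J J' : J != [::] -> tame J -> J' \in succs r J -> tame J'.
Proof.
rewrite /tame => J0 /andP[bJ cJ]; rewrite !inE => /or3P[/eqP ->|/eqP ->|/mapP[e er ->]].
- by rewrite /= bJ.
- case/lastP: J J0 bJ cJ => // J c _; rewrite wrap_rcons -cats1 flatten_cat /= cats0.
  rewrite !all_cat !count_cat => /andP[-> bc] cc; rewrite andbT; apply/andP; split.
    rewrite all_map; apply: sub_all bc => p /and4P[h1 h2 h3 h4]; apply/and4P; split=> //=.
    by case: ifP.
  by rewrite count_map addnC.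
- case: J J0 bJ cJ => // c s _; rewrite /act_cfg /= !all_cat !count_cat => /andP[bc bs] cs.
  have bi z b c0 := @images_bounded e z b c0 er.
  rewrite !bi //=; apply/andP; split.
    have fl b : all bounded_item (flatten [seq images r e false b c0 | c0 <- s]).
      by elim: s bs {cs} => //= c1 s IH; rewrite !all_cat => /andP[h1 h2]; rewrite bi // IH.
    by rewrite !fl.
  apply: leq_trans cs; rewrite -!addnA addnA; apply: leq_add; first exact: count_images.
  elim: s {bs} => //= c1 s IH; rewrite !count_cat.
  by rewrite addnACA; apply: leq_add IH; rewrite addnC; exact: count_images.
Qed.

Lemma tame_reach J : reach r J -> tame J.
Proof.
elim=> {J} [|J J' rJ tJ]; last exact: tame_succs (reach_nonnil rJ) tJ.
have ib : r_init r < bound by apply: loc_bound; exact: mem_head.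
have fb : rflag r (r_init r) < 2 by rewrite /rflag; case: (_ \in _).
by rewrite /init_cfg /tame; case: ifP => _ //=; rewrite /bounded_item /= ib fb.
Qed.

(** A subsequence could skip a tagged class of [t]; but then the rest of [t] would have too few
    tagged classes to accommodate those of [s]. *)
Lemma emb_subseq (L : eqType) (psi : class -> L) (T : pred L) s t :
  (forall c c', c \in s -> c' \in t -> psi c = psi c' -> le_class c c') ->
  (forall c, c \in s ++ t -> tg c = T (psi c)) ->
  count tg s = count tg t -> subseq [seq psi c | c <- s] [seq psi c | c <- t] -> emb s t.
Proof.
elim: t s => [|c' t IH] s psi_le psi_tg; first by case: s {psi_le psi_tg}.
have cT u : {subset u <= s ++ c' :: t} -> count tg u = count T [seq psi c | c <- u].
  by move=> us; rewrite count_map; apply: eq_in_count => c /us; exact: psi_tg.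
case: s psi_le psi_tg cT => [|c s] psi_le psi_tg cT.
  move=> c0 _; have : all (predC tg) (c' :: t) by rewrite all_predC has_count -c0.
  by elim: (c' :: t) => //= d u IH' /andP[/negbTE -> /IH' ->].
rewrite /= => cst; case: eqP => [e sub|ne sub].
  have cc' : le_class c c' by apply: psi_le; rewrite ?mem_head.
  rewrite cc' (IH s) ?orbT //.
  - by move=> d d' ds dt; apply: psi_le; rewrite inE ?ds ?dt orbT.
  - by move=> d ds; apply: psi_tg; move: ds; rewrite !(mem_cat, inE) => /orP[] ->; rewrite ?orbT.
  - by move: cst; rewrite (le_class_tg cc'); apply: addnI.
have nc' : ~~ tg c'.
  apply/negP => tc'; have es : count tg (c :: s) = count T (map psi (c :: s)).
    by apply: cT => d ds; rewrite mem_cat ds.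
  have et : count tg t = count T (map psi t).
    by apply: cT => d dt; rewrite mem_cat [d \in c' :: t]inE dt !orbT.
  have := leq_count_subseq T sub; rewrite -[count T (psi c :: _)]es -et.
  by rewrite [count tg (c :: s)]/= cst tc' add1n ltnn.
rewrite nc' (IH (c :: s)) //.
- by move=> d d' ds dt; apply: psi_le; rewrite // inE dt orbT.
- move=> d ds; apply: psi_tg; move: ds; rewrite !mem_cat => /orP[->|dt] //.
  by rewrite [d \in c' :: t]inE dt !orbT.
- by rewrite /= cst (negbTE nc').
Qed.

Definition box := ('I_2 * 'I_bound * 'I_2 * 'I_(cap r).+2)%type.

Definition box_item (f : box) : item :=
  ((f.1.1.1 : nat, (f.1.1.2 : nat, f.1.2 : nat)), f.2 : nat).

Definition content (c : class) : {set box} := [set f | box_item f \in c].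

Lemma content_le c c' : all bounded_item c -> all bounded_item c' ->
  content c = content c' -> le_class c c'.
Proof.
have sub a b : all bounded_item a -> content a = content b -> {subset a <= b}.
  move=> /allP ba ab [[t [l f]] k] pa; have /and4P[/= h1 h2 h3 h4] := ba _ pa.
  have : ((Ordinal h1, Ordinal h2, Ordinal h3, Ordinal h4) : box) \in content b.
    by rewrite -ab inE.
  by rewrite inE.
move=> bc bc' e; apply/le_classP; split=> [p|p _]; first exact: sub bc e p.
exact: sub bc' (esym e) p.
Qed.

Lemma content_tg c : all bounded_item c -> tg c = [exists f in content c, tagged (box_item f)].
Proof.
move=> /allP bc; apply/hasP/exists_inP => [[p pc tp]|[f]]; last by rewrite inE; exists (box_item f).
case: p pc tp => -[t [l f]] k pc tp; have /and4P[/= h1 h2 h3 h4] := bc _ pc.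
by exists (Ordinal h1, Ordinal h2, Ordinal h3, Ordinal h4); rewrite ?inE.
Qed.

Lemma count_tg s : count tg s <= count tagged (flatten s).
Proof.
elim: s => //= c s IH; rewrite count_cat; apply: leq_add IH.
by rewrite /tg has_count; case: (count _ _).
Qed.

Lemma good_pair (J : nat -> cfg) : (forall i, reach r (J i)) ->
  exists i j, i < j /\ le_cfg (J i) (J j).
Proof.
move=> rJ; have t i := tame_reach (rJ i).
pose psi (c : class) : {set box} * bool + {set box} := inr (content c).
(* The first class becomes a letter of a different kind, so that a subsequence has to match first
   classes with each other. Its flag tells whether a later class is tagged; as there is at most one
   such class, equal flags give the equal counts that [emb_subseq] requires. *)
pose f i : seq ({set box} * bool + {set box})%type :=
  inl (content (head [::] (J i)), has tg (behead (J i))) :: [seq psi c | c <- behead (J i)].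
have [i [j [ij sub]]] := higman f; exists i, j; split=> //.
have bJ l c : c \in J l -> all bounded_item c.
  have /andP[/allP b _] := t l; move=> cJ; apply/allP => p pc; apply: b.
  by apply/flattenP; exists c.
have bh l : all bounded_item (head [::] (J l)).
  by have := bJ l; case: (J l) => //= c s H; apply: H; exact: mem_head.
have bb l c : c \in behead (J l) -> all bounded_item c.
  by move=> cJ; apply: (bJ l); exact: mem_behead.
have cb l : count tg (behead (J l)) = has tg (behead (J l)).
  have /andP[_] := t l; have := count_tg (behead (J l)).
  rewrite has_count; case: (J l) => //= c s; rewrite count_cat.
  by case: (count tg s) => [|[|n]] // ? ?; lia.
move: sub; rewrite /f /=; case: eqP => [[hE cE] sub|_ /mem_subseq sub].
  rewrite /le_cfg content_le //=.
  apply: (emb_subseq (psi := psi)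
    (T := fun l => if l is inr C then [exists f in C, tagged (box_item f)] else false)) sub.
  - by move=> c c' cs ct [e]; apply: content_le e; [exact: bb cs | exact: bb ct].
  - by move=> c; rewrite mem_cat => /orP[] /bb; exact: content_tg.
  - by rewrite !cb cE.
by have := sub _ (mem_head _ _) => /mapP[].
Qed.

(** Otherwise reachable configurations could be chosen one after another, none of them above an
    earlier one, against [good_pair]. Mere existence is enough, because the machine searches for
    [W]. *)
Lemma finite_basis : exists2 W : seq cfg, (forall w, w \in W -> reach r w) &
  forall J, reach r J -> exists2 w, w \in W & le_cfg w J.
Proof.
apply: contrapT => nW.
have /choice[f fP] : forall W : seq cfg, exists J, (forall w, w \in W -> reach r w) ->
    reach r J /\ forall w, w \in W -> ~~ le_cfg w J.
  move=> W; apply: contrapT => nJ; apply: nW; exists W.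
    by apply: contrapT => h; apply: nJ; exists [::] => /h.
  move=> J rJ; apply: contrapT => nw; apply: nJ; exists J => _; split=> // w wW.
  by apply/negP => wJ; apply: nw; exists w.
pose pre n := iter n (fun W => f W :: W) [::].
have prer n w : w \in pre n -> reach r w.
  elim: n w => // n IH w; rewrite inE => /predU1P[->|/IH //].
  by have [] := fP _ IH.
have [i [j [ij le]]] := good_pair (fun i => proj1 (fP _ (prer i))).
have fin : f (pre i) \in pre j.
  elim: j ij {le} => // j IH; rewrite ltnS leq_eqVlt inE => /predU1P[->|/IH ->].
    by rewrite eqxx.
  by rewrite orbT.
by have := proj2 (fP _ (prer j)) _ fin; rewrite le.
Qed.

Lemma safe_certified bs : safe bs r -> exists W, certified bs W.
Proof.
move=> sf; have [W rW cW] := finite_basis; exists W; apply/and4P; split.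
- by have [w wW wi] := cW _ (reach0 r); apply/hasP; exists w.
- by apply/allP => w /rW/reach_nonnil.
- apply/allP => w /rW rw; apply/allP => J Jw.
  by have [w' w'W w'J] := cW _ (reach_step rw Jw); apply/hasP; exists w'.
- by apply/allP => w /rW rw; apply/allP => b; exact: sf.
Qed.

Definition counterexample (bs : seq nat) (P : seq cfg) :=
  [&& last [::] P == init_cfg r, all (fun q => q.1 \in succs r q.2) (zip P (behead P)) &
      has (fun b => bad r b (head [::] P)) bs].

Lemma counterexampleP bs : (exists P, counterexample bs P) <-> ~ safe bs r.
Proof.
split=> [[P /and3P[/eqP Pi Ps /hasP[b bbs bP]]] sf|nsf].
  have : reach r (head [::] P).
    elim: P Pi Ps {bP} => [|J P IH] /=; first by move=> -> _; exact: reach0.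
    case: P IH => [|J' P] IH /=; first by move=> -> _; exact: reach0.
    by move=> Pi /andP[JJ' Ps]; apply: reach_step JJ'; apply: IH.
  by move=> rP; have := sf _ _ rP bbs; rewrite bP.
have [J [b [rJ bbs bJ]]] : exists J b, [/\ reach r J, b \in bs & bad r b J].
  apply: contrapT => H; apply: nsf => J b rJ bbs; apply/negP => bJ.
  by apply: H; exists J, b.
suff [P [P1 P2 P3]] : exists P, [/\ last [::] P == init_cfg r,
    all (fun q => q.1 \in succs r q.2) (zip P (behead P)) & P = J :: behead P].
  by exists P; apply/and3P; split=> //; apply/hasP; exists b => //; rewrite P3.
elim: rJ {bJ} => {J} [|J J' _ [P [P1 P2 P3]] JJ']; first by exists [:: init_cfg r] => /=.
exists (J' :: P); rewrite P3 /= in P1 P2 *; split=> //.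
by rewrite JJ'.
Qed.

End Monotone.

(** * Primitive recursive verification of certificates *)

Section Checkers.
Context {G : Type} {cG : coded G}.

Lemma prf_enc T (cT : coded T) (f : G -> T) : prf f -> prf (fun x => enc (f x)).
Proof. by move=> [F pF FE]; exists F. Qed.

Lemma prf_code_seq T (cT : coded T) (f : G -> T -> seq bool) (l : G -> seq T) :
  prf (fun p => f p.1 p.2) -> prf l -> prf (fun x => code_seq (f x) (l x)).
Proof.
move=> pf pl; rewrite /code_seq; apply: prf_cat; first exact/prf_code_nat/prf_size.
exact/prf_flatten/prf_map.
Qed.

End Checkers.

Ltac prf_extra ::= lazymatch goal with
  | |- prf (fun x => code_nat (@?f x)) => apply: (@prf_code_nat _ _ f)
  end.

Lemma prf_codeN G (cG : coded G) (f : G -> seq nat) : prf f -> prf (fun x => codeN (f x)).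
Proof. by move=> pf; apply: (@prf_code_seq _ _ _ _ (fun _ n => code_nat n) f); prf_auto. Qed.

Lemma prf_codeG G (cG : coded G) (f : G -> rawG) : prf f -> prf (fun x => codeG (f x)).
Proof.
by move=> pf; apply: (@prf_code_seq _ _ _ _ (fun _ c => codeC c) f) => //; rewrite /codeC; prf_auto.
Qed.

Ltac prf_extra ::= lazymatch goal with
  | |- prf (fun x => code_nat (@?f x)) => apply: (@prf_code_nat _ _ f)
  | |- prf (fun x => codeN (@?f x)) => apply: (@prf_codeN _ _ f)
  | |- prf (fun x => codeG (@?f x)) => apply: (@prf_codeG _ _ f)
  end.

Lemma prf_codeEs G (cG : coded G) (f : G -> seq rawE) : prf f -> prf (fun x => code_seq codeE (f x)).
Proof.
by move=> pf; apply: (@prf_code_seq _ _ _ _ (fun _ e => codeE e) f) => //; rewrite /codeE; prf_auto.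
Qed.

Lemma prf_codeGs G (cG : coded G) (f : G -> seq rawG) :
  prf f -> prf (fun x => flatten [seq codeG g | g <- f x]).
Proof.
by move=> pf; apply: prf_flatten; apply: (@prf_map _ _ _ _ _ _ f (fun _ g => codeG g)) => //; prf_auto.
Qed.

Ltac prf_extra ::= lazymatch goal with
  | |- prf (fun x => code_nat (@?f x)) => apply: (@prf_code_nat _ _ f)
  | |- prf (fun x => codeN (@?f x)) => apply: (@prf_codeN _ _ f)
  | |- prf (fun x => code_seq codeE (@?f x)) => apply: (@prf_codeEs _ _ f)
  | |- prf (fun x => flatten [seq codeG g | g <- @?f x]) => apply: (@prf_codeGs _ _ f)
  end.

Lemma prf_codeR G (cG : coded G) (f : G -> raw) : prf f -> prf (fun x => codeR (f x)).
Proof. by move=> pf; rewrite /codeR; prf_auto. Qed.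

Section System.
Context {G : Type} {cG : coded G}.

Lemma prf_satk (z : G -> bool) (k : G -> nat) (c : G -> rawC) : prf z -> prf k -> prf c ->
  prf (fun x => satk (z x) (k x) (c x)).
Proof. by move=> pz pk pc; rewrite /satk; prf_auto. Qed.

Lemma prf_after (z : G -> bool) (k : G -> nat) (e : G -> rawE) : prf z -> prf k -> prf e ->
  prf (fun x => after (z x) (k x) (e x)).
Proof. by move=> pz pk pe; rewrite /after /e_rst; prf_auto. Qed.

Lemma prf_inv_of (r : G -> raw) (l : G -> nat) : prf r -> prf l -> prf (fun x => inv_of (r x) (l x)).
Proof. by move=> pr pl; rewrite /inv_of /r_invs; prf_auto. Qed.

Lemma prf_e_grd (e : G -> rawE) : prf e -> prf (fun x => e_grd (e x)).
Proof. by move=> pe; rewrite /e_grd; prf_auto. Qed.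

End System.

Ltac prf_extra ::= lazymatch goal with
  | |- prf (fun x => satk (@?z x) (@?k x) (@?c x)) => apply: (@prf_satk _ _ z k c)
  | |- prf (fun x => after (@?z x) (@?k x) (@?e x)) => apply: (@prf_after _ _ z k e)
  | |- prf (fun x => inv_of (@?r x) (@?l x)) => apply: (@prf_inv_of _ _ r l)
  | |- prf (fun x => e_grd (@?e x)) => apply: (@prf_e_grd _ _ e)
  end.

Lemma prf_enk G (cG : coded G) (r : G -> raw) (z : G -> bool) (p : G -> item) (e : G -> rawE) :
  prf r -> prf z -> prf p -> prf e -> prf (fun x => enk (r x) (z x) (p x) (e x)).
Proof. by move=> pr pz pp pe; rewrite /enk /e_src /r_fin /e_tgt; prf_auto. Qed.

Lemma prf_moves G (cG : coded G) (r : G -> raw) (e : G -> rawE) (q : G -> ident) :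
  prf r -> prf e -> prf q -> prf (fun x => moves (r x) (e x) (q x)).
Proof. by move=> pr pe pq; rewrite /moves /e_act /r_edges; prf_auto. Qed.

Lemma prf_new_id G (cG : coded G) (r : G -> raw) (q : G -> ident) (e : G -> rawE) :
  prf r -> prf q -> prf e -> prf (fun x => new_id (r x) (q x) (e x)).
Proof. by move=> pr pq pe; rewrite /new_id /move_flag /e_tgt /r_priv; prf_auto. Qed.

Ltac prf_extra ::= lazymatch goal with
  | |- prf (fun x => satk (@?z x) (@?k x) (@?c x)) => apply: (@prf_satk _ _ z k c)
  | |- prf (fun x => inv_of (@?r x) (@?l x)) => apply: (@prf_inv_of _ _ r l)
  | |- prf (fun x => enk (@?r x) (@?z x) (@?p x) (@?e x)) => apply: (@prf_enk _ _ r z p e)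
  | |- prf (fun x => moves (@?r x) (@?e x) (@?q x)) => apply: (@prf_moves _ _ r e q)
  | |- prf (fun x => new_id (@?r x) (@?q x) (@?e x)) => apply: (@prf_new_id _ _ r q e)
  | |- prf (fun x => enc (@?f x)) => apply: (@prf_enc _ _ _ _ f)
  end.

Lemma prf_images G (cG : coded G) (r : G -> raw) (e : G -> rawE) (z b : bool) (c : G -> class) :
  prf r -> prf e -> prf c -> prf (fun x => images (r x) (e x) z b (c x)).
Proof. by move=> pr pe pc; rewrite /images /e_rst; prf_auto. Qed.

Lemma prf_bump G (cG : coded G) (r : G -> raw) (c : G -> class) :
  prf r -> prf c -> prf (fun x => bump (r x) (c x)).
Proof. by move=> pr pc; rewrite /bump /cap; prf_auto. Qed.

Lemma prf_le_class G (cG : coded G) (c d : G -> class) :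
  prf c -> prf d -> prf (fun x => le_class (c x) (d x)).
Proof. by move=> pc pd; rewrite /le_class /tagged; prf_auto. Qed.

Lemma prf_tg G (cG : coded G) (c : G -> class) : prf c -> prf (fun x => tg (c x)).
Proof. by move=> pc; apply: (@prf_has _ _ _ _ c (fun _ p => tagged p)) => //; rewrite /tagged; prf_auto. Qed.

Definition thinnings (t : seq class) : seq (seq class) :=
  foldr (fun c acc => (if tg c then [::] else acc) ++ [seq c :: u | u <- acc]) [:: [::]] t.

(** [emb] recurses on two lists; this form is visibly primitive recursive. *)
Lemma embE s t : emb s t =
  has (fun u => (size u == size s) && all (fun q => le_class q.1 q.2) (zip s u)) (thinnings t).
Proof.
elim: t s => [|c t IH] s /=; first by rewrite orbF; case: s.
rewrite has_cat; congr (_ || _); first by rewrite IH; case: (tg c).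
rewrite has_map; case: s => [|x s].
  by apply/esym/negbTE/hasPn => u _.
rewrite IH; case xc: (le_class x c) => /=; first by apply: eq_has => u /=; rewrite eqSS xc.
by apply/esym/negbTE/hasPn => u _ /=; rewrite xc andbF.
Qed.

Ltac prf_extra ::= lazymatch goal with
  | |- prf (fun x => images (@?r x) (@?e x) ?z ?b (@?c x)) => apply: (@prf_images _ _ r e z b c)
  | |- prf (fun x => bump (@?r x) (@?c x)) => apply: (@prf_bump _ _ r c)
  | |- prf (fun x => le_class (@?c x) (@?d x)) => apply: (@prf_le_class _ _ c d)
  | |- prf (fun x => tg (@?c x)) => apply: (@prf_tg _ _ c)
  | |- prf (fun x => inv_of (@?r x) (@?l x)) => apply: (@prf_inv_of _ _ r l)
  | |- prf (fun x => satk (@?z x) (@?k x) (@?c x)) => apply: (@prf_satk _ _ z k c)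
  end.

Lemma prf_emb G (cG : coded G) (s t : G -> seq class) :
  prf s -> prf t -> prf (fun x => emb (s x) (t x)).
Proof.
move=> ps pt; apply: (prf_ext (fun x => esym (embE (s x) (t x)))).
by rewrite /thinnings; prf_auto.
Qed.

Lemma prf_act_cfg G (cG : coded G) (r : G -> raw) (e : G -> rawE) (J : G -> cfg) :
  prf r -> prf e -> prf J -> prf (fun x => act_cfg (r x) (e x) (J x)).
Proof. by move=> pr pe pJ; rewrite /act_cfg; prf_auto. Qed.

Lemma prf_wrap G (cG : coded G) (r : G -> raw) (J : G -> cfg) :
  prf r -> prf J -> prf (fun x => wrap (r x) (J x)).
Proof. by move=> pr pJ; rewrite /wrap; prf_auto. Qed.

Lemma prf_init_cfg G (cG : coded G) (r : G -> raw) : prf r -> prf (fun x => init_cfg (r x)).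
Proof. by move=> pr; rewrite /init_cfg /rflag /r_init /r_priv; prf_auto. Qed.

Lemma prf_bad G (cG : coded G) (r : G -> raw) (b : G -> nat) (J : G -> cfg) :
  prf r -> prf b -> prf J -> prf (fun x => bad (r x) (b x) (J x)).
Proof. by move=> pr pb pJ; rewrite /bad /r_fin; prf_auto. Qed.

Ltac prf_extra ::= lazymatch goal with
  | |- prf (fun x => emb (@?s x) (@?t x)) => apply: (@prf_emb _ _ s t)
  | |- prf (fun x => le_class (@?c x) (@?d x)) => apply: (@prf_le_class _ _ c d)
  | |- prf (fun x => act_cfg (@?r x) (@?e x) (@?J x)) => apply: (@prf_act_cfg _ _ r e J)
  | |- prf (fun x => wrap (@?r x) (@?J x)) => apply: (@prf_wrap _ _ r J)
  | |- prf (fun x => init_cfg (@?r x)) => apply: (@prf_init_cfg _ _ r)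
  | |- prf (fun x => bad (@?r x) (@?b x) (@?J x)) => apply: (@prf_bad _ _ r b J)
  | |- prf (fun x => codeR (@?f x)) => apply: (@prf_codeR _ _ f)
  end.

Lemma prf_succs G (cG : coded G) (r : G -> raw) (J : G -> cfg) :
  prf r -> prf J -> prf (fun x => succs (r x) (J x)).
Proof. by move=> pr pJ; rewrite /succs /r_edges; prf_auto. Qed.

Lemma prf_le_cfg G (cG : coded G) (I J : G -> cfg) :
  prf I -> prf J -> prf (fun x => le_cfg (I x) (J x)).
Proof. by move=> pI pJ; rewrite /le_cfg; prf_auto. Qed.

Ltac prf_extra ::= lazymatch goal with
  | |- prf (fun x => succs (@?r x) (@?J x)) => apply: (@prf_succs _ _ r J)
  | |- prf (fun x => le_cfg (@?I x) (@?J x)) => apply: (@prf_le_cfg _ _ I J)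
  | |- prf (fun x => init_cfg (@?r x)) => apply: (@prf_init_cfg _ _ r)
  | |- prf (fun x => bad (@?r x) (@?b x) (@?J x)) => apply: (@prf_bad _ _ r b J)
  | |- prf (fun x => codeR (@?f x)) => apply: (@prf_codeR _ _ f)
  end.

Lemma prf_certified G (cG : coded G) bs (r : G -> raw) (W : G -> seq cfg) :
  prf r -> prf W -> prf (fun x => certified (r x) bs (W x)).
Proof. by move=> pr pW; rewrite /certified; prf_auto. Qed.

Lemma prf_counterexample G (cG : coded G) bs (r : G -> raw) (P : G -> seq cfg) :
  prf r -> prf P -> prf (fun x => counterexample (r x) bs (P x)).
Proof. by move=> pr pP; rewrite /counterexample; prf_auto. Qed.

Definition certificate := (raw * (seq cfg * seq cfg))%type.

Lemma certificate_surj : exists dec : nat -> certificate, cancel enc dec /\ cancel dec enc.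
Proof.
have sN := surj_nat; have sL := surj_seq sN.
have s : @surj_code certificate _.
  do ?[exact: surj_nat | apply: surj_seq | apply: surj_prod].
have [dec decK] := choice s; exists dec; split=> // c.
by apply: enc_inj; rewrite decK.
Qed.

(** If the automaton is safe, some finite invariant certifies it, and otherwise some finite path
    refutes it; both kinds of evidence are checked by one primitive recursive function, so the
    search always ends. *)
Lemma safe_decidable bs (Pb : problem) (A : instance Pb -> timed_automaton) :
  (forall i, code i = code_ta (A i)) -> (forall i, holds i <-> safe bs (raw_of (A i))) ->
  decidable_problem Pb.
Proof.
move=> codeE holdsE; have [dec [encK decK]] := certificate_surj.
(* The test on the size of the list of invariants makes [codeR] injective, so that the automaton in
   the certificate is the one given as input. *)
pose verify (c : certificate) (w : seq bool) : nat :=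
  if (codeR c.1 == w) && (size c.1.2.2.1 == c.1.1.2.1) then
    if counterexample c.1 bs c.2.1 then 1 else if certified c.1 bs c.2.2 then 2 else 0
  else 0.
pose chk (p : seq bool * nat) := verify (dec p.2) p.1.
have raw_eq i (c : certificate) : codeR c.1 == code i -> size c.1.2.2.1 == c.1.1.2.1 ->
    c.1 = raw_of (A i).
  move=> /eqP e /eqP s; apply: codeR_inj => //; first exact: size_invs_of.
  by rewrite (codeR_of (A i)) -codeE.
apply: (search_decidable (chk := chk)).
- have pdec : prf (fun p : seq bool * nat => dec p.2).
    by exists (fun x => (unp x).2); [exact: pr_snd | move=> p; rewrite decK /= unp_cp].
  rewrite /chk /verify; prf_auto.
    by apply: (@prf_counterexample _ _ bs (fun x => (dec x.2).1) (fun x => (dec x.2).2.1)); prf_auto.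
  by apply: (@prf_certified _ _ bs (fun x => (dec x.2).1) (fun x => (dec x.2).2.2)); prf_auto.
- have verifyE i P W : chk (code i, enc ((raw_of (A i), (P, W)) : certificate)) =
      if counterexample (raw_of (A i)) bs P then 1 else if certified (raw_of (A i)) bs W then 2 else 0.
    rewrite -[chk _]/(verify (dec (enc _)) (code i)) encK /verify; have sz := size_invs_of (A i).
    by rewrite [codeR _](codeR_of (A i)) -codeE eqxx (introT eqP sz).
  move=> i; case: (pselect (safe bs (raw_of (A i)))) => [sf|nsf].
    have [W cW] := safe_certified sf; exists (enc ((raw_of (A i), ([::], W)) : certificate)).
    by rewrite verifyE cW; case: (counterexample _ _ _).
  have [P cP] := (counterexampleP _ _).2 nsf; exists (enc ((raw_of (A i), (P, [::])) : certificate)).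
  by rewrite verifyE cP.
move=> i n; rewrite /chk /verify /= holdsE; case: ifP => // /andP[e s].
rewrite (raw_eq _ _ e s); case: ifP => [cP _|_].
  split=> // sf; have /counterexampleP// : exists P, counterexample (raw_of (A i)) bs P by eexists; exact: cP.
case: ifP => // cW _; split=> // _; exact: certified_safe cW.
Qed.

Theorem theorem5p5 (R : realType) :
  decidable_non_primrec
    (subproblem (full_opacity_problem R)
       (fun A : timed_automaton => one_clock A /\ epsilon_free A)) /\
  decidable_non_primrec
    (subproblem (weak_opacity_problem R)
       (fun A : timed_automaton => one_clock A /\ epsilon_free A)).
Proof.
split; split.
- apply: (@safe_decidable [:: 1; 0] (subproblem (full_opacity_problem R) _) (fun i => sval i)) => //.
  move=> -[A [clock1 eps]] /=.
  exact: fully_opaque_safe.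
- move=> [M [f [pf dec]]]; apply: (@gadget_lower R (fully_opaque R)); first by right.
  by exists M, f; split=> // A clock1 eps; exact: dec (exist _ A (conj clock1 eps)).
- apply: (@safe_decidable [:: 1] (subproblem (weak_opacity_problem R) _) (fun i => sval i)) => //.
  move=> -[A [clock1 eps]] /=.
  exact: weakly_opaque_safe.
- move=> [M [f [pf dec]]]; apply: (@gadget_lower R (weakly_opaque R)); first by left.
  by exists M, f; split=> // A clock1 eps; exact: dec (exist _ A (conj clock1 eps)).
Qed.
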